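(* Choose $\varpi\in\mathbb C_p$ with $0<|\varpi|<1$. Let $\mathbb T^2_n=\mathrm{Spa}\,\mathbb C_p\langle T_1^{\pm1/p^n},T_2^{\pm1/p^n}\rangle$ for $n\ge0$, $\mathbb T^2=\mathbb T^2_0$, with maps $\mathbb T^2_n\to\mathbb T^2$ given by $T_i\mapsto(T_i^{1/p^n})^{p^n}$ and transition maps given by $T_i^{1/p^n}\mapsto(T_i^{1/p^{n+1}})^p$. Let $Y=\{|T_1-1|\le|\varpi|,\ |T_2-1|\le|\varpi|\}\subset\mathbb T^2$, identified with $\mathrm{Spa}\,\mathbb C_p\langle u,v\rangle$ by $T_1=1+\varpi u$, $T_2=1+\varpi v$, and let $Y_n=Y\times_{\mathbb T^2}\mathbb T^2_n$. Let $X=\mathrm{Spa}\,\mathbb C_p\langle t\rangle$, let $f:X\to Y$ be the morphism given by $u\mapsto t^2$, $v\mapsto t^3$, and put $X_n=X\times_YY_n$. A choice of compatible primitive $p^n$-th roots of unity in $\mathbb C_p$ makes $(X_n)_{n\ge0}$ a profinite étale torsor $\pi_X:\widetilde X\to X$ under $\varprojlim_n\mu_{p^n}(\mathbb C_p)^2\simeq\mathbb Z_p^2$. Then the $\mathbb Z_p^2$-torsor $\pi_X:\widetilde X\to X$ is affinoid perfectoid, but its geometric Sen map $$\theta_{\widetilde X}:\widehat{\mathcal O}_X\otimes_{\mathbb Q_p}\mathfrak g_{\pi_X}^\vee\longrightarrow\widehat{\mathcal O}_X\otimes_{\mathcal O_X}\Omega^1_{X/\mathbb C_p}(-1)$$ is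 not surjective at $t=0$.
   Context: Conventions. $p$ is a prime. Rigid analytic spaces are separated adic spaces over $\mathbb C_p$, locally of the form $\mathrm{Spa}(A,A^\circ)$ with $A$ a rigid affinoid algebra; $\mathrm{Spa}\,A$ means $\mathrm{Spa}(A,A^\circ)$. $X_{\text{pro-ét}}$ is Scholze's pro-étale site, $\widehat{\mathcal O}_X^+=\varprojlim_m\mathcal O_X^+/p^m$ and $\widehat{\mathcal O}_X=\widehat{\mathcal O}_X^+[1/p]$. Affinoid perfectoid. Writing $X_n=\mathrm{Spa}(B_n,B_n^\circ)$, $B^+=\varprojlim_{m\ge1}(\varinjlim_nB_n^\circ)/p^m$, the tower is affinoid perfectoid if $(B^+[1/p],B^+)$ is a perfectoid affinoid $\mathbb C_p$-algebra. Geometric Sen map. Let $X/\mathbb C_p$ be smooth, $\pi:\widetilde X\to X$ a profinite étale torsor under a compact $p$-adic Lie group $G$, $\mathfrak g=\mathrm{Lie}\,G$, and $\mathfrak g_\pi^\vee$ the $\mathbb Q_p$-local system on $X_{\text{pro-ét}}$ associated via $\pi$ with the coadjoint representation; $(-1)$ is a Tate twist. The geometric Sen map (Rodríguez Camargo) is the $\widehat{\mathcal O}_X$-linear map $\theta_{\widetilde X}:\widehat{\mathcal O}_X\otimes_{\mathbb Q_p}\mathfrak g_\pi^\vee\to\widehat{\mathcal O}_X\otimes_{\mathcal O_X}\Omega^1_{X/\mathbb C_p}(-1)$ determined as follows. (i) Every finite locally free $\widehat{\mathcal O}_X$-module $\mathcal F$ on $X_{\text{pro-ét}}$ has a canonical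 Higgs field $\theta_{\mathcal F}:\mathcal F\to\mathcal F\otimes_{\mathcal O_X}\Omega^1_{X/\mathbb C_p}(-1)$, functorial in $\mathcal F$ and compatible with pullback along morphisms of smooth rigid spaces. Locally, let $X=\mathrm{Spa}(A,A^\circ)$ have dimension $d$ and a chart $X\to\mathbb T^d=\mathrm{Spa}\,\mathbb C_p\langle T_1^{\pm1},\dots,T_d^{\pm1}\rangle$ that is a composition of rational localizations and finite étale maps. Let $X_n=X\times_{\mathbb T^d}\mathbb T^d_n$ with $\mathbb T^d_n$ the torus in the coordinates $T_i^{1/p^n}$, $A_n=\mathcal O(X_n)$, $A_{\mathrm{tor}}=\widehat{\varinjlim_n A_n}$, and let $X_\infty$ be the resulting toric tower, with group $\Gamma=\mathbb Z_p^d$ after fixing compatible $p$-power roots of unity; let $\eta_1,\dots,\eta_d$ be the standard basis of $\mathrm{Lie}\,\Gamma$. Put $M=\mathcal F(X_\infty)$. After a finite étale refinement there are $n$ and a finite projective $\Gamma$-stable $A_n$-submodule $P_n\subset M$ with $A_{\mathrm{tor}}\otimes_{A_n}P_n\simeq M$ and $M^{\Gamma\text{-}\mathrm{la}}=\varinjlim_{m\ge n}A_m\otimes_{A_n}P_n$. The derived actions $\nabla_j$ of $\eta_j$ on $P_n$ are commuting $A_n$-linear endomorphisms, and $\theta_{\mathcal F}(a\otimes v)=\sum_j(a\otimes\nabla_jv)\otimes\omega_j$, where $\omega_1,\dots,\omega_d$ is the basis of $A_{\mathrm{tor}}\otimes_A\Omega^1_{A/\mathbb C_p}(-1)$ given by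 $dT_j/T_j$ twisted by the chosen generator (standard normalization). (ii) For every finite-dimensional locally analytic representation $\rho:G\to\mathrm{GL}(V)$, with $\mathcal V=\widehat{\mathcal O}_X\otimes_{\mathbb Q_p}V_\pi$ and the differentiated action viewed as $d\rho:\mathcal V\to\mathcal V\otimes_{\mathbb Q_p}\mathfrak g_\pi^\vee$, one has $\theta_{\mathcal V}=(\mathrm{id}_{\mathcal V}\otimes\theta_{\widetilde X})\circ d\rho$. These identities determine $\theta_{\widetilde X}$ uniquely. Pointwise surjectivity. $\theta_{\widetilde X}$ is surjective at $x\in X$ if for geometric points $\mathrm{Spa}(C,C^+)\to X$ above $x$ the induced fibre map $C\otimes_{\mathbb Q_p}\mathfrak g^\vee\to C\otimes\Omega^1_{X/\mathbb C_p}(-1)$ is surjective. *)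

(* Defs.v *)
From HB Require Import structures.
From mathcomp Require Import all_boot all_order all_algebra generic_quotient ring_quotient qpoly.
From mathcomp Require Import boolp classical_sets reals.

Set Implicit Arguments.
Unset Strict Implicit.
Unset Printing Implicit Defensive.

Import Order.TTheory GRing.Theory Num.Theory.
Local Open Scope ring_scope.
Local Open Scope classical_set_scope.
Local Open Scope quotient_scope.

Record absval (R : realType) (K : fieldType) := AbsVal {
  av :> K -> R;
  av_ge0 : forall x, 0 <= av x;
  av_eq0 : forall x, av x = 0 <-> x = 0;
  avM : forall x y, av (x * y) = av x * av y;
  avD : forall x y, av (x + y) <= Num.max (av x) (av y) }.

Definition av_complete (R : realType) (K : fieldType) (v : absval R K) :=
  forall u : nat -> K,
    (forall e : R, 0 < e -> exists N, forall i j, (N <= i)%N -> (N <= j)%N ->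
       v (u i - u j) < e) ->
    exists l, forall e : R, 0 < e -> exists N, forall i, (N <= i)%N ->
       v (u i - l) < e.

(* Closures of Q and of N in K; when v p = 1/p and K is complete, they are
   (copies of) Q_p and Z_p. *)
Definition Qp (R : realType) (K : fieldType) (v : absval R K) : set K :=
  [set x | forall e : R, 0 < e -> exists q : rat, v (x - ratr q) < e].

Definition Zp (R : realType) (K : fieldType) (v : absval R K) : set K :=
  [set x | forall e : R, 0 < e -> exists m : nat, v (x - m%:R) < e].

(* C is the completion of an algebraic closure of Q_p, with |p| = 1/p. *)
Definition is_Cp (R : realType) (p : nat) (C : closedFieldType)
    (v : absval R C) :=
  [/\ v p%:R = p%:R^-1,
      av_complete v &
      forall (x : C) (e : R), 0 < e -> exists y,
        v (x - y) < e /\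
        exists q : {poly C}, [/\ q != 0, forall i, Qp v q`_i & root q y]].

Section AbsValTheory.
Variables (R : realType) (K : fieldType) (v : absval R K).

Lemma av0 : v 0 = 0. Proof. exact/av_eq0. Qed.

Lemma av1 : v 1 = 1.
Proof.
have /eqP : v 1 * v 1 = v 1 * 1 by rewrite -avM !mulr1.
rewrite -subr_eq0 -mulrBr mulf_eq0 => /orP[/eqP/av_eq0/eqP|].
  by rewrite oner_eq0.
by rewrite subr_eq0 => /eqP.
Qed.

Lemma avN x : v (- x) = v x.
Proof.
have h : v (-1) = 1.
  have : v (-1) ^+ 2 = 1 by rewrite expr2 -avM mulrNN mulr1 av1.
  move/eqP; rewrite sqrf_eq1 => /orP[/eqP//|/eqP h].
  by have := av_ge0 v (-1); rewrite h oppr_ge0 ler10.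
by rewrite -mulN1r avM h mul1r.
Qed.

Lemma av_sum_le (I : Type) (r : seq I) (P : pred I) (F : I -> K) (e : R) :
  0 <= e -> (forall i, P i -> v (F i) <= e) -> v (\sum_(i <- r | P i) F i) <= e.
Proof.
move=> e0 h; elim/big_ind: _ => //; first by rewrite av0.
by move=> x y hx hy; apply: le_trans (avD v x y) _; rewrite ge_max hx.
Qed.

End AbsValTheory.

Definition tends0 (R : realType) (K : fieldType) (v : absval R K)
    (f : nat -> K) :=
  forall e : R, 0 < e -> exists N, forall n, (N <= n)%N -> v (f n) < e.

Record tate (R : realType) (K : fieldType) (v : absval R K) := Tate {
  tcoef :> nat -> K;
  tcoefP : tends0 v tcoef }.

Section Tate.
Variables (R : realType) (K : fieldType) (v : absval R K).
Local Notation A := (tate v).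
Implicit Types f g h : A.

HB.instance Definition _ := gen_eqMixin A.
HB.instance Definition _ := gen_choiceMixin A.

Lemma tateP f g : (forall n, f n = g n) -> f = g.
Proof.
case: f g => f fP [g gP] /= /funext fg; move: gP; rewrite -fg => gP.
by rewrite (Prop_irrelevance fP gP).
Qed.

Lemma tbounded f : exists2 M : R, 0 < M & forall n, v (f n) <= M.
Proof.
have [N hN] := tcoefP f ltr01.
have [M M0 hM] : exists2 M : R, 0 < M & forall n, (n < N)%N -> v (f n) <= M.
  elim: N {hN} => [|N [M M0 IH]]; first by exists 1.
  exists (Num.max M (v (f N))) => [|n]; first by rewrite lt_max M0.
  rewrite ltnS leq_eqVlt le_max => /orP[/eqP->|/IH->//].
  by rewrite lexx orbT.
exists (Num.max M 1) => [|n]; first by rewrite lt_max M0.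
rewrite le_max; case: (ltnP n N) => [/hM->//|/hN/ltW->].
by rewrite orbT.
Qed.

Lemma tzeroP : tends0 v (fun=> 0).
Proof. by move=> e e0; exists 0%N => n _; rewrite av0. Qed.
Lemma tconstP (c : K) : tends0 v (fun n => if n == 0%N then c else 0).
Proof. by move=> e e0; exists 1%N => -[|n] //= _; rewrite av0. Qed.
Lemma tvarP : tends0 v (fun n => (n == 1%N)%:R).
Proof. by move=> e e0; exists 2%N => -[|[|n]] //= _; rewrite av0. Qed.
Lemma taddP f g : tends0 v (fun n => f n + g n).
Proof.
move=> e e0; have [N hN] := tcoefP f e0; have [M hM] := tcoefP g e0.
exists (maxn N M) => n; rewrite geq_max => /andP[/hN hf /hM hg].
by apply: le_lt_trans (avD _ _ _) _; rewrite gt_max hf.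
Qed.
Lemma toppP f : tends0 v (fun n => - f n).
Proof.
by move=> e /(tcoefP f)[N hN]; exists N => n /hN; rewrite avN.
Qed.
Lemma tmulP f g : tends0 v (fun n => \sum_(i < n.+1) f i * g (n - i)%N).
Proof.
move=> e e0; have [F F0 hF] := tbounded f; have [G G0 hG] := tbounded g.
have e2 : 0 < e / 2 by rewrite divr_gt0.
have [N hN] := tcoefP f (divr_gt0 e2 G0).
have [M hM] := tcoefP g (divr_gt0 e2 F0).
exists (N + M)%N => n nNM; have : e / 2 < e.
  by rewrite ltr_pdivrMr // ltr_pMr // ltr1n.
apply: le_lt_trans; apply: av_sum_le; first exact: ltW.
move=> i _; rewrite avM; case: (leqP N i) => [/hN hf|iN].
  rewrite -[e / 2](divfK (lt0r_neq0 G0)).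
  by apply: ler_pM; rewrite ?av_ge0 // ltW.
rewrite -[e / 2](divfK (lt0r_neq0 F0)) mulrC.
apply: ler_pM; rewrite ?av_ge0 // ltW // hM //.
rewrite leq_subRL; first by apply: leq_trans nNM; rewrite leq_add2r ltnW.
by rewrite -ltnS.
Qed.

Definition tzero : A := Tate tzeroP.
Definition tconst (c : K) : A := Tate (tconstP c).
Definition tvar : A := Tate tvarP.
Definition tadd f g : A := Tate (taddP f g).
Definition topp f : A := Tate (toppP f).
Definition tmul f g : A := Tate (tmulP f g).

Lemma taddA : associative tadd.
Proof. by move=> f g h; apply: tateP => n /=; rewrite addrA. Qed.
Lemma taddC : commutative tadd.
Proof. by move=> f g; apply: tateP => n /=; rewrite addrC. Qed.
Lemma tadd0 : left_id tzero tadd.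
Proof. by move=> f; apply: tateP => n /=; rewrite add0r. Qed.
Lemma taddN : left_inverse tzero topp tadd.
Proof. by move=> f; apply: tateP => n /=; rewrite addNr. Qed.
HB.instance Definition _ := GRing.isZmodule.Build A taddA taddC tadd0 taddN.

Let trunc (n : nat) f : {poly K} := \poly_(i < n.+1) f i.
Let truncE n f i : (i <= n)%N -> (trunc n f)`_i = f i.
Proof. by rewrite coef_poly ltnS => ->. Qed.
Let trunc_mul n f g i : (i <= n)%N ->
  (trunc n f * trunc n g)`_i = (tmul f g) i.
Proof.
move=> i_n; rewrite coefM; apply: eq_bigr => j _.
by rewrite !truncE // ?(leq_trans (leq_subr _ _)) // (leq_trans _ i_n) // -ltnS.
Qed.

Lemma tmulA : associative tmul.
Proof.
move=> f g h; apply: tateP => n.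
transitivity ((trunc n f * (trunc n g * trunc n h))`_n).
  rewrite coefM; apply: eq_bigr => i _.
  by rewrite truncE -1?ltnS // trunc_mul ?leq_subr.
rewrite mulrA coefM; apply: eq_bigr => i _.
by rewrite trunc_mul -1?ltnS // truncE ?leq_subr.
Qed.
Lemma tmulC : commutative tmul.
Proof.
by move=> f g; apply: tateP => n; rewrite -!(trunc_mul _ _ (leqnn n)) mulrC.
Qed.
Lemma tmul1 : left_id (tconst 1) tmul.
Proof.
move=> f; apply: tateP => n /=.
by rewrite big_ord_recl subn0 mul1r big1 ?addr0 // => i _; rewrite mul0r.
Qed.
Lemma tmulDl : left_distributive tmul +%R.
Proof.
move=> f g h; apply: tateP => n /=; rewrite -big_split.
by apply: eq_bigr => i _; rewrite mulrDl.
Qed.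
Lemma tate1_neq0 : tconst 1 != 0 :> A.
Proof.
apply/eqP => /(congr1 (fun f : A => f 0%N))/eqP /=.
by rewrite oner_eq0.
Qed.
HB.instance Definition _ := GRing.Zmodule_isComNzRing.Build A
  tmulA tmulC tmul1 tmulDl tate1_neq0.

(* K<t>^o, the unit ball of the Gauss norm *)
Definition tball : set A := [set f | forall n, v (f n) <= 1].

Lemma tball1 : tball 1.
Proof. by case=> [|n] /=; rewrite ?av1 ?av0. Qed.
Lemma tballD f g : tball f -> tball g -> tball (f + g).
Proof.
by move=> hf hg n; apply: le_trans (avD _ _ _) _; rewrite ge_max hf hg.
Qed.
Lemma tballN f : tball f -> tball (- f).
Proof. by move=> hf n /=; rewrite avN. Qed.
Lemma tballM f g : tball f -> tball g -> tball (f * g).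
Proof.
move=> hf hg n; apply: av_sum_le => // i _.
by rewrite avM mulr_ile1 ?av_ge0.
Qed.
Lemma tball0 : tball 0.
Proof. by move=> n /=; rewrite av0. Qed.
End Tate.

(* For the canonical Banach topology of a finite K<t>-algebra S, a subset is
   bounded iff it lies in a finitely generated K<t>^o-submodule of S. *)
Section PowerBounded.
Variables (R : realType) (K : fieldType) (v : absval R K).
Local Notation A := (tate v).

Definition in_lattice (S : comNzRingType) (j : A -> S) (s : seq S) (x : S) :=
  exists c : nat -> A, (forall i, tball (c i)) /\
    x = \sum_(i < size s) j (c i) * s`_i.

Definition power_bounded (S : comNzRingType) (j : A -> S) : set S :=
  [set b | exists s : seq S, forall k, in_lattice j s (b ^+ k)].

Section Theory.
Variables (S : comNzRingType) (j : {rmorphism A -> S}).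
Implicit Types (s : seq S) (x y b : S).

Lemma lattice_mem s x : x \in s -> in_lattice j s x.
Proof.
move=> xs; exists (fun i => (i == index x s)%:R); split=> [i|].
  by case: eqP => _; [exact: tball1 | exact: tball0].
have lt : (index x s < size s)%N by rewrite index_mem.
rewrite (bigD1 (Ordinal lt)) //= eqxx rmorph1 mul1r nth_index // big1 ?addr0 //.
move=> i; rewrite -val_eqE /= => /negPf->.
by rewrite rmorph0 mul0r.
Qed.

Lemma lattice0 s : in_lattice j s 0.
Proof.
exists (fun=> 0); split=> [i|]; first exact: tball0.
by rewrite big1 // => i _; rewrite rmorph0 mul0r.
Qed.

Lemma latticeD s x y : in_lattice j s x -> in_lattice j s y ->
  in_lattice j s (x + y).
Proof.
move=> [c [hc ->]] [d [hd ->]]; exists (fun i => c i + d i); split=> [i|].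
  exact: tballD.
by rewrite -big_split; apply: eq_bigr => i _ /=; rewrite rmorphD mulrDl.
Qed.

Lemma latticeZ s (a : A) x : tball a -> in_lattice j s x ->
  in_lattice j s (j a * x).
Proof.
move=> ha [c [hc ->]]; exists (fun i => a * c i); split=> [i|].
  exact: tballM.
by rewrite mulr_sumr; apply: eq_bigr => i _ /=; rewrite rmorphM mulrA.
Qed.

Lemma lattice_sum s (I : Type) (r : seq I) (F : I -> S) :
  (forall i, in_lattice j s (F i)) -> in_lattice j s (\sum_(i <- r) F i).
Proof.
move=> h; elim: r => [|i r IH]; first by rewrite big_nil; exact: lattice0.
by rewrite big_cons; apply: latticeD.
Qed.

Lemma latticeMn s x n : in_lattice j s x -> in_lattice j s (x *+ n).
Proof.
move=> h; elim: n => [|n IH]; first by rewrite mulr0n; exact: lattice0.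
by rewrite mulrS; apply: latticeD.
Qed.

Lemma latticeM s1 s2 x y : in_lattice j s1 x -> in_lattice j s2 y ->
  in_lattice j [seq a * b | a <- s1, b <- s2] (x * y).
Proof.
move=> [c [hc ->]] [d [hd ->]]; rewrite mulr_suml; apply: lattice_sum => i.
rewrite mulr_sumr; apply: lattice_sum => k.
rewrite mulrACA -rmorphM; apply: latticeZ; first exact: tballM.
by apply/lattice_mem/allpairs_f; exact: mem_nth.
Qed.

Lemma pb0 : power_bounded j 0.
Proof.
exists [:: 1] => -[|k]; last by rewrite exprS mul0r; exact: lattice0.
by rewrite expr0; apply: lattice_mem; rewrite inE.
Qed.

Lemma pbM x y :
  power_bounded j x -> power_bounded j y -> power_bounded j (x * y).
Proof.
move=> [s1 h1] [s2 h2]; exists [seq a * b | a <- s1, b <- s2] => k.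
by rewrite exprMn; apply: latticeM.
Qed.

Lemma pbD x y :
  power_bounded j x -> power_bounded j y -> power_bounded j (x + y).
Proof.
move=> [s1 h1] [s2 h2]; exists [seq a * b | a <- s1, b <- s2] => k.
rewrite exprDn; apply: lattice_sum => i.
by apply: latticeMn; apply: latticeM.
Qed.

Lemma pbN x : power_bounded j x -> power_bounded j (- x).
Proof.
move=> [s h]; exists s => k; rewrite exprNn.
rewrite -[(-1) ^+ k](rmorph_sign j).
apply: latticeZ; last exact: h.
by rewrite -signr_odd; case: odd; rewrite ?expr1 ?expr0;
   do ?apply: tballN; exact: tball1.
Qed.

Lemma pb_nat n : power_bounded j n%:R.
Proof.
exists [:: 1] => k; rewrite -natrX; apply: latticeMn.
by apply: lattice_mem; rewrite inE.
Qed.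

End Theory.

Lemma pb_morph (S T : comNzRingType) (j : {rmorphism A -> S})
    (j' : {rmorphism A -> T}) (f : {rmorphism S -> T}) (x : S) :
  (forall a, f (j a) = j' a) -> power_bounded j x -> power_bounded j' (f x).
Proof.
move=> fj [s h]; exists (map f s) => k; have [c [hc xk]] := h k.
exists c; split=> //; rewrite -rmorphXn xk rmorph_sum size_map.
by apply: eq_bigr => i _; rewrite rmorphM fj (nth_map 0).
Qed.

End PowerBounded.

Section Qlift.
Variables (S T : comNzRingType) (h : {poly S}).

(* The S-algebra morphism S[X]/(h) -> T with X |-> y, along psi : S -> T. *)
Definition qlift (psi : S -> T) (y : T) (q : {poly %/ h}) : T :=
  (map_poly psi (q : {poly S})).[y].

Lemma qlift_morph (psi : {rmorphism S -> T}) (y : T) :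
    (1 < size h)%N -> h \is monic -> (map_poly psi h).[y] = 0 ->
  zmod_morphism (qlift psi y) /\ monoid_morphism (qlift psi y).
Proof.
move=> sh hm hy; split=> [a b|]; first by rewrite /qlift /= rmorphB hornerD hornerN.
split=> [|a b]; rewrite /qlift /=; first by rewrite rmorph1 hornerC.
suff H (f g : {poly S}) : (map_poly psi (Pdiv.CommonRing.rmodp (f * g)
    (mk_monic h))).[y] = (map_poly psi f).[y] * (map_poly psi g).[y] by exact: H.
rewrite /mk_monic sh hm /= -hornerM -rmorphM; set q := f * g.
have := Pdiv.RingMonic.rdivp_eq hm q => {2}->.
by rewrite rmorphD rmorphM hornerD hornerM hy mulr0 add0r.
Qed.
End Qlift.

(* A sequence of R-algebras lev 0 -> lev 1 -> lev 2 -> ... *)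
Record tower (B : comNzRingType) := Tower {
  lev :> nat -> comNzRingType;
  str : forall n, {rmorphism B -> lev n};
  tr : forall n, {rmorphism lev n -> lev n.+1};
  trstr : forall n a, tr n (str n a) = str n.+1 a }.

Definition const_tower (B : comNzRingType) : tower B :=
  @Tower B (fun=> B) (fun=> idfun) (fun=> idfun) (fun _ _ => erefl).

Section Adjoin.
Variables (p : nat) (p_pr : prime p) (B : comNzRingType).

Definition kumpol (tw : tower B) (a : B) n : {poly tw n} :=
  'X^(p ^ n) - (str tw n a)%:P.

(* The class of X in tw_n[X]/(X^(p^n) - a), i.e. a^(1/p^n). *)
Definition kumX (tw : tower B) (a : B) n : {poly %/ kumpol tw a n} :=
  in_qpoly (kumpol tw a n) 'X.

Definition adj_tr (tw : tower B) (a : B) n :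
    {poly %/ kumpol tw a n} -> {poly %/ kumpol tw a n.+1} :=
  qlift (qpolyC (kumpol tw a n.+1) \o tr tw n) (kumX tw a n.+1 ^+ p).

Lemma pn_gt0 n : (0 < p ^ n)%N. Proof. by rewrite expn_gt0 prime_gt0. Qed.

Lemma kumpol_size tw a n : (1 < size (kumpol tw a n))%N.
Proof. by rewrite size_XnsubC ?pn_gt0 // ltnS pn_gt0. Qed.

Lemma kumpol_monic tw a n : kumpol tw a n \is monic.
Proof. exact/monicXnsubC/pn_gt0. Qed.

Lemma kumXE tw a n : kumX tw a n ^+ (p ^ n) = qpolyC _ (str tw n a).
Proof.
have mh : mk_monic (kumpol tw a n) = kumpol tw a n.
  by rewrite /mk_monic kumpol_size kumpol_monic.
rewrite /kumX -rmorphXn; apply: val_inj => /=; rewrite mh.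
have -> : 'X^(p ^ n) = 1 * kumpol tw a n + (str tw n a)%:P.
  by rewrite mul1r addrNK.
rewrite Pdiv.RingMonic.rmodp_addl_mul_small ?kumpol_monic //.
by rewrite (leq_ltn_trans (size_polyC_leq1 _)) // kumpol_size.
Qed.

Lemma adj_tr_morph tw a n :
  zmod_morphism (@adj_tr tw a n) /\ monoid_morphism (@adj_tr tw a n).
Proof.
apply: qlift_morph; rewrite ?kumpol_size ?kumpol_monic //.
rewrite /kumpol rmorphB /= map_polyXn map_polyC /= hornerD hornerN hornerXn hornerC.
by rewrite -exprM -expnS kumXE trstr subrr.
Qed.

HB.instance Definition _ tw a n := GRing.isZmodMorphism.Build
  _ _ (@adj_tr tw a n) (adj_tr_morph tw a n).1.
HB.instance Definition _ tw a n := GRing.isMonoidMorphism.Build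
  _ _ (@adj_tr tw a n) (adj_tr_morph tw a n).2.

Lemma adj_trstr tw a n (b : B) :
  adj_tr (qpolyC (kumpol tw a n) (str tw n b)) = qpolyC _ (str tw n.+1 b).
Proof. by rewrite /adj_tr /qlift /= map_polyC hornerC /= trstr. Qed.

(* The tower n |-> tw_n[a^(1/p^n)]. *)
Definition adjoin (tw : tower B) (a : B) : tower B :=
  @Tower B (fun n => {poly %/ kumpol tw a n})
    (fun n => qpolyC (kumpol tw a n) \o str tw n)
    (fun n => @adj_tr tw a n) (adj_trstr tw a).

(* n |-> B[a^(1/p^n) : a in s]; the head of s is adjoined last. *)
Fixpoint kummer (s : seq B) : tower B :=
  if s is a :: s' then adjoin (kummer s') a else const_tower B.
End Adjoin.

Section Completion.
Variables (R : realType) (K : fieldType) (v : absval R K) (p : nat).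
Variables (B : comNzRingType) (phi : {rmorphism tate v -> B}) (tw : tower B).

(* B_n^o *)
Definition levO n : set (tw n) := power_bounded (str tw n \o phi).

Definition pO n m : set (tw n) := [set p%:R ^+ m * y | y in @levO n].

(* Cauchy sequences x_n in B_n, for the p-adic topology of colim B_n^o
   (comparing consecutive terms suffices; the first clause is automatic when
   the B_n are finite over K<t>). *)
Definition cauchy (x : forall n, tw n) :=
  (exists k N, forall n, (N <= n)%N -> @levO n (p%:R ^+ k * x n)) /\
  (forall m, exists N, forall n, (N <= n)%N ->
     @pO n.+1 m (x n.+1 - tr tw n (x n))).

Definition null (x : forall n, tw n) :=
  forall m, exists N, forall n, (N <= n)%N -> @pO n m (x n).

Lemma levO_tr n x : @levO n x -> @levO n.+1 (tr tw n x).
Proof. by apply: pb_morph => a /=; rewrite trstr. Qed.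

Lemma levO_nat n k : @levO n k%:R. Proof. exact: pb_nat. Qed.
Lemma levO_natX n k : @levO n (p%:R ^+ k).
Proof. by rewrite -natrX; exact: levO_nat. Qed.

Lemma pO0 n m : @pO n m 0.
Proof. by exists 0; [exact: pb0 | rewrite mulr0]. Qed.
Lemma pOD n m x y : @pO n m x -> @pO n m y -> @pO n m (x + y).
Proof.
by move=> [a ha <-] [b hb <-]; exists (a + b); [exact: pbD | rewrite mulrDr].
Qed.
Lemma pON n m x : @pO n m x -> @pO n m (- x).
Proof. by move=> [a ha <-]; exists (- a); [exact: pbN | rewrite mulrN]. Qed.
Lemma pO_tr n m x : @pO n m x -> @pO n.+1 m (tr tw n x).
Proof.
move=> [a ha <-]; exists (tr tw n a); first exact: levO_tr.
by rewrite rmorphM rmorphXn rmorph_nat.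
Qed.
Lemma pOM n m k (x y : tw n) : @levO n (p%:R ^+ k * x) -> @pO n (m + k) y ->
  @pO n m (x * y).
Proof.
move=> hx [b hb <-]; exists ((p%:R ^+ k * x) * b); first exact: pbM.
by rewrite exprD -!mulrA [RHS]mulrCA; congr (_ * _); rewrite mulrCA.
Qed.

Lemma cauchy_levO_tr k n (x : tw n) : @levO n (p%:R ^+ k * x) ->
  @levO n.+1 (p%:R ^+ k * tr tw n x).
Proof. by move/levO_tr; rewrite rmorphM rmorphXn rmorph_nat. Qed.

Lemma cauchy_str (b : B) k : @levO 0 (p%:R ^+ k * str tw 0 b) ->
  cauchy (fun n => str tw n b).
Proof.
move=> h; split; last first.
  by move=> m; exists 0%N => n _; rewrite trstr subrr; exact: pO0.
exists k, 0%N => n _; elim: n => // n IH.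
by rewrite -trstr; apply: cauchy_levO_tr.
Qed.
Lemma cauchy_nat c : cauchy (fun n => c%:R).
Proof.
split; first by exists 0%N, 0%N => n _; rewrite expr0 mul1r; exact: levO_nat.
by move=> m; exists 0%N => n _; rewrite rmorph_nat subrr; exact: pO0.
Qed.
Lemma cauchyD x y : cauchy x -> cauchy y -> cauchy (fun n => x n + y n).
Proof.
move=> [[k [N hx]] cx] [[l [M hy]] cy]; split; last first.
  move=> m; have [N' h] := cx m; have [M' h'] := cy m.
  exists (maxn N' M') => n; rewrite geq_max => /andP[/h h1 /h' h2].
  by rewrite rmorphD opprD addrACA; apply: pOD.
exists (k + l)%N, (maxn N M) => n; rewrite geq_max => /andP[/hx h1 /hy h2].
rewrite mulrDr; apply: pbD.
  by rewrite addnC exprD -mulrA; apply: pbM => //; exact: levO_natX.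
by rewrite exprD -mulrA; apply: pbM => //; exact: levO_natX.
Qed.
Lemma cauchyN x : cauchy x -> cauchy (fun n => - x n).
Proof.
move=> [[k [N hx]] cx]; split.
  by exists k, N => n /hx h; rewrite mulrN; apply: pbN.
move=> m; have [M h] := cx m; exists M => n /h {}h.
by rewrite rmorphN -opprD; apply: pON.
Qed.
Lemma cauchyM x y : cauchy x -> cauchy y -> cauchy (fun n => x n * y n).
Proof.
move=> [[k [N hx]] cx] [[l [M hy]] cy]; split.
  exists (k + l)%N, (maxn N M) => n; rewrite geq_max => /andP[/hx h1 /hy h2].
  by rewrite exprD mulrACA; apply: pbM.
move=> m; have [N' h] := cx (m + l)%N; have [M' h'] := cy (m + k)%N.
exists (maxn (maxn N M) (maxn N' M')) => n.
rewrite !geq_max => /andP[/andP[hN hM] /andP[hN' hM']].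
rewrite rmorphM.
have -> : x n.+1 * y n.+1 - tr tw n (x n) * tr tw n (y n) =
  y n.+1 * (x n.+1 - tr tw n (x n)) + tr tw n (x n) * (y n.+1 - tr tw n (y n)).
  by rewrite !mulrBr [y _ * x _]mulrC [y _ * tr _ _ _]mulrC addrA addrNK.
apply: pOD.
  by apply: pOM; [apply: hy; exact: leqW | exact: h].
by apply: pOM; [apply: cauchy_levO_tr; exact: hx | exact: h'].
Qed.

Record cseq := CSeq { cs :> forall n, tw n; csP : cauchy cs }.
HB.instance Definition _ := gen_eqMixin cseq.
HB.instance Definition _ := gen_choiceMixin cseq.

Lemma cseqP (x y : cseq) : (forall n, x n = y n) -> x = y.
Proof.
case: x y => x xP [y yP] /= h.
have e : x = y by apply: functional_extensionality_dep.
by move: yP; rewrite -e => yP; rewrite (Prop_irrelevance xP yP).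
Qed.

Definition cs0 := CSeq (cauchy_nat 0).
Definition cs1 := CSeq (cauchy_nat 1).
Definition csD (x y : cseq) := CSeq (cauchyD (csP x) (csP y)).
Definition csN (x : cseq) := CSeq (cauchyN (csP x)).
Definition csM (x y : cseq) := CSeq (cauchyM (csP x) (csP y)).

Lemma csDA : associative csD.
Proof. by move=> x y z; apply: cseqP => n /=; rewrite addrA. Qed.
Lemma csDC : commutative csD.
Proof. by move=> x y; apply: cseqP => n /=; rewrite addrC. Qed.
Lemma csD0 : left_id cs0 csD.
Proof. by move=> x; apply: cseqP => n /=; rewrite add0r. Qed.
Lemma csDN : left_inverse cs0 csN csD.
Proof. by move=> x; apply: cseqP => n /=; rewrite addNr. Qed.
HB.instance Definition _ := GRing.isZmodule.Build cseq csDA csDC csD0 csDN.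
Lemma csMA : associative csM.
Proof. by move=> x y z; apply: cseqP => n /=; rewrite mulrA. Qed.
Lemma csMC : commutative csM.
Proof. by move=> x y; apply: cseqP => n /=; rewrite mulrC. Qed.
Lemma csM1 : left_id cs1 csM.
Proof. by move=> x; apply: cseqP => n /=; rewrite mul1r. Qed.
Lemma csMDl : left_distributive csM +%R.
Proof. by move=> x y z; apply: cseqP => n /=; rewrite mulrDl. Qed.
HB.instance Definition _ :=
  GRing.Zmodule_isComPzRing.Build cseq csMA csMC csM1 csMDl.

Definition nullb : {pred cseq} := fun x => `[< null x >].

Lemma nullb_zmod : zmod_closed nullb.
Proof.
split; first by apply/asboolP => m; exists 0%N => n _; exact: pO0.
move=> x y /asboolP hx /asboolP hy; apply/asboolP => m.
have [N h] := hx m; have [M h'] := hy m; exists (maxn N M) => n.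
rewrite geq_max => /andP[/h h1 /h' h2].
by apply: pOD => //; apply: pON.
Qed.
HB.instance Definition _ := GRing.isZmodClosed.Build cseq nullb nullb_zmod.

Lemma nullbM (x y : cseq) : y \in nullb -> x * y \in nullb.
Proof.
move=> /asboolP hy; apply/asboolP => m.
have [[k [N hx]] _] := csP x; have [M h] := hy (m + k)%N.
exists (maxn N M) => n; rewrite geq_max => /andP[/hx h1 /h h2].
exact: pOM h1 h2.
Qed.

(* B^+[1/p] for B^+ = lim_m (colim_n B_n^o)/p^m *)
Definition compl := Quotient.quot nullb.
HB.instance Definition _ := GRing.Zmodule.on compl.

Definition compl_pi (x : cseq) : compl := \pi_(Quotient.quot nullb) x.
Definition compl1 : compl := compl_pi 1.
Definition complM (x y : compl) : compl := compl_pi (repr x * repr y).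

Lemma compl_piP (x y : cseq) : x - y \in nullb -> compl_pi x = compl_pi y.
Proof. by rewrite Quotient.idealrBE => /eqP. Qed.
Lemma repr_compl (x : cseq) : repr (compl_pi x) - x \in nullb.
Proof. by rewrite Quotient.idealrBE reprK. Qed.
Lemma compl_piM (x y : cseq) :
  complM (compl_pi x) (compl_pi y) = compl_pi (x * y).
Proof.
apply: compl_piP; set x' := repr _; set y' := repr _.
have -> : x' * y' - x * y = y' * (x' - x) + x * (y' - y).
  by rewrite !mulrBr [y' * x']mulrC [y' * x]mulrC addrA addrNK.
by apply: rpredD; apply: nullbM; exact: repr_compl.
Qed.
Lemma compl_piK (x : compl) : compl_pi (repr x) = x. Proof. exact: reprK. Qed.
Lemma compl_piD (x y : cseq) : compl_pi x + compl_pi y = compl_pi (x + y).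
Proof. by rewrite /compl_pi piE. Qed.

Lemma complMA : associative complM.
Proof.
move=> x y z; rewrite -(compl_piK x) -(compl_piK y) -(compl_piK z).
by rewrite !compl_piM mulrA.
Qed.
Lemma complMC : commutative complM.
Proof.
by move=> x y; rewrite -(compl_piK x) -(compl_piK y) !compl_piM mulrC.
Qed.
Lemma complM1 : left_id compl1 complM.
Proof. by move=> x; rewrite -(compl_piK x) compl_piM mul1r. Qed.
Lemma complMDl : left_distributive complM +%R.
Proof.
move=> x y z; rewrite -(compl_piK x) -(compl_piK y) -(compl_piK z).
by rewrite compl_piD !compl_piM compl_piD mulrDl.
Qed.
HB.instance Definition _ :=
  GRing.Zmodule_isComPzRing.Build compl complMA complMC complM1 complMDl.

(* The limit of a sequence x_n in B_n, with the junk value 0 if it is not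
   Cauchy; all the sequences to which this is applied below are Cauchy. *)
Definition clim (x : forall n, tw n) : compl :=
  if pselect (cauchy x) is left h then compl_pi (CSeq h) else 0.

(* B^+ *)
Definition cplus : set compl :=
  [set x | exists y : cseq, (forall n, @levO n (y n)) /\ x = compl_pi y].

Definition cst (b : B) : compl := clim (fun n => str tw n b).

Fixpoint trk n k : tw n -> tw (k + n)%N :=
  if k is k'.+1 then tr tw (k' + n) \o @trk n k' else id.

Definition trmax n (x : tw n) m : tw m :=
  if @idP (n <= m)%N is ReflectT h
  then ecast i (tw i) (subnK h) (trk (m - n) x) else 0.

(* B_n -> B^+[1/p] *)
Definition lev_emb n (x : tw n) : compl := clim (trmax x).

End Completion.

(* (E, Ep) is a perfectoid affinoid algebra over the perfectoid field
   (C, O_C); the topology of E is the one with basis p^m Ep of neighbourhoods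
   of 0, so that Ep is open by construction. *)
Section Perfectoid.
Variables (R : realType) (C : closedFieldType) (v : absval R C) (p : nat).
Variables (E : comPzRingType) (emb : C -> E) (Ep : set E).

Definition padic_nbhs (m : nat) : set E := [set p%:R ^+ m * y | y in Ep].

Definition powerbdd : set E :=
  [set x | exists m, forall k, Ep (p%:R ^+ m * x ^+ k)].

Record perfectoid_affinoid : Prop := PerfectoidAffinoid {
  pa_emb : zmod_morphism emb /\ monoid_morphism emb;
  pa_emb_int : forall c, v c <= 1 -> Ep (emb c);
  pa_subring : [/\ Ep 1, forall x y, Ep x -> Ep y -> Ep (x - y) &
                forall x y, Ep x -> Ep y -> Ep (x * y)];
  pa_loc : forall x, exists m, Ep (p%:R ^+ m * x);
  pa_separated : forall x, (forall m, padic_nbhs m x) -> x = 0;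
  pa_complete : forall u : nat -> E,
    (forall m, exists N, forall i j, (N <= i)%N -> (N <= j)%N ->
       padic_nbhs m (u i - u j)) ->
    exists l, forall m, exists N, forall i, (N <= i)%N ->
       padic_nbhs m (u i - l);
  pa_uniform : exists m, forall x, powerbdd x -> Ep (p%:R ^+ m * x);
  pa_frobenius : forall x, powerbdd x ->
    exists y z, [/\ powerbdd y, powerbdd z & x = y ^+ p + p%:R * z];
  pa_int_closed : forall x d (c : nat -> E), (forall i, Ep (c i)) ->
    x ^+ d = \sum_(i < d) c i * x ^+ i -> Ep x }.
End Perfectoid.

Section LocallyAnalytic.
Variables (R : realType) (C : closedFieldType) (v : absval R C) (p : nat).
Variables (E : comPzRingType) (emb : C -> E) (nb : nat -> set E).
Variables (a b : nat).

Definition mx_nbhs m : set 'M[E]_(a, b) := [set M | forall i j, nb m (M i j)].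

Definition Zpd d : set 'rV[C]_d := [set x | forall i, Zp v (x 0 i)].

(* F : Z_p^d -> Mat(E) is given around each point x0 by a power series
   converging on x0 + p^k Z_p^d. *)
Definition locally_analytic d (F : 'rV[C]_d -> 'M[E]_(a, b)) :=
  forall x0, Zpd x0 -> exists k, exists c : ('I_d -> nat) -> 'M[E]_(a, b),
    (forall m, exists N, forall i : 'I_d -> nat, (N <= \sum_l i l)%N ->
       mx_nbhs m (emb (p%:R ^+ (k * \sum_l i l)) *: c i)) /\
    forall x, Zpd x -> forall m, exists N, forall N', (N <= N')%N ->
      mx_nbhs m (F (x0 + p%:R ^+ k *: x) -
        \sum_(i : {ffun 'I_d -> 'I_N'})
           emb (\prod_l (p%:R ^+ k * x 0 l) ^+ i l) *: c (fun l => i l)).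

(* w is the derivative at 0 of F : Z_p -> Mat(E). *)
Definition is_deriv0 (F : C -> 'M[E]_(a, b)) (w : 'M[E]_(a, b)) :=
  forall m, exists k, forall x, Zp v x -> x != 0 -> v x <= v (p%:R ^+ k) ->
    mx_nbhs m (emb x^-1 *: (F x - F 0) - w).
End LocallyAnalytic.

Section FiniteEtale.
Variables (A B : comNzRingType) (phi : {rmorphism A -> B}).

Definition alinear (f : B -> A) :=
  forall a x y, f (phi a * x + y) = a * f x + f y.

(* B is a finite projective A-module (with dual bases f_i, y_i) whose trace
   form is perfect. *)
Definition finite_etale :=
  exists k (y : 'I_k -> B) (f : 'I_k -> B -> A),
  [/\ forall i, alinear (f i),
      forall b, b = \sum_i phi (f i b) * y i &
      forall g, alinear g ->
        exists! x, forall b, g b = \sum_i f i (x * b * y i)].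
End FiniteEtale.

Section KummerMaps.
Variables (R : realType) (C : closedFieldType) (v : absval R C).
Variables (p : nat) (p_pr : prime p) (zeta : nat -> C).
Local Notation A := (tate v).

(* a natural number congruent to x in Z_p modulo p^n *)
Definition zres n (x : C) : nat :=
  xget 0%N [set m : nat | v (x - m%:R) <= v (p%:R ^+ n)].

Section Action.
Variables (B : comNzRingType) (phi : {rmorphism A -> B}).

(* g = (g_1, ..., g_k) in Z_p^k acts by a_i^(1/p^n) |-> zeta_n^(g_i) a_i^(1/p^n) *)
Fixpoint kact (s : seq B) (g : seq C) n {struct s} :
    kummer p_pr s n -> kummer p_pr s n :=
  match s return kummer p_pr s n -> kummer p_pr s n with
  | [::] => id
  | a :: s' =>
      qlift (qpolyC (kumpol p (kummer p_pr s') a n) \o @kact s' (behead g) n)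
        (str (kummer p_pr (a :: s')) n
           (phi (tconst v (zeta n ^+ zres n (head 0 g))))
         * kumX p (kummer p_pr s') a n)
  end.

Definition cact (s : seq B) (g : seq C) (x : compl p phi (kummer p_pr s)) :
    compl p phi (kummer p_pr s) :=
  clim p phi (fun n => kact g (repr x n)).
End Action.

Section BaseChange.
Variables (B B' : comNzRingType) (phi : {rmorphism A -> B})
  (phi' : {rmorphism A -> B'}) (psi : {rmorphism B -> B'}).

Fixpoint kbc (s : seq B) n {struct s} :
    kummer p_pr s n -> kummer p_pr (map psi s) n :=
  match s return kummer p_pr s n -> kummer p_pr (map psi s) n with
  | [::] => psi
  | a :: s' =>
      qlift (qpolyC (kumpol p (kummer p_pr (map psi s')) (psi a) n)
               \o @kbc s' n)
        (kumX p (kummer p_pr (map psi s')) (psi a) n)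
  end.

Definition cbc (s : seq B) (x : compl p phi (kummer p_pr s)) :
    compl p phi' (kummer p_pr (map psi s)) :=
  clim p phi' (fun n => kbc (repr x n)).
End BaseChange.
End KummerMaps.

Section KummerTorsor.
Variables (R : realType) (C : closedFieldType) (v : absval R C).
Variables (p : nat) (p_pr : prime p) (zeta : nat -> C) (a1 a2 : tate v).
Local Notation B := (kummer p_pr [:: a1; a2]).

Definition root1 n : B n := kumX p (kummer p_pr [:: a2]) a1 n.
Definition root2 n : B n := qpolyC _ (kumX p (const_tower (tate v)) a2 n).

Definition actB (g h : C) n : B n -> B n := @kact R C v p p_pr zeta _ idfun
  [:: a1; a2] [:: g; h] n.

(* O(X_n x_X X_n), as the base change of O(X_n) to O(X_n) *)
Definition selfprod n : comNzRingType :=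
  kummer p_pr [:: str B n a1; str B n a2] n.

(* b (x) b' |-> b . (g, h)(b') *)
Definition selfprod_act (g h : C) n : selfprod n -> B n :=
  qlift (qlift idfun (actB g h (root2 n))) (actB g h (root1 n)).

(* X_n -> X is a finite etale torsor under (Z/p^n)^2, i.e.
   (Z/p^n)^2 x X_n -> X_n x_X X_n is an isomorphism, and the actions are
   compatible for varying n. *)
Definition profinite_etale_torsor :=
  forall n, [/\ finite_etale (str B n),
    forall b : 'I_(p ^ n) -> 'I_(p ^ n) -> B n, exists! f : selfprod n,
      forall g h : 'I_(p ^ n), selfprod_act (g : nat)%:R (h : nat)%:R f = b g h &
    forall g h, Zp v g -> Zp v h -> forall x : B n,
      actB g h (tr B n x) = tr B n (actB g h x)].
End KummerTorsor.

(* X = Spa C<t>, with the map (a1, a2) : X -> T^2, whose tower X_n is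
   n |-> C<t>[a1^(1/p^n), a2^(1/p^n)] and has group G = Z_p^2, and with a toric
   chart T : X -> T^1, whose tower is n |-> C<t>[T^(1/p^n)] =: A_n and has group
   Gamma = Z_p.  The product of the two towers is affinoid perfectoid, and
   sheaves on X_proet are described by their sections on that product, with
   their action of G x Gamma.  As G is commutative the coadjoint representation
   is trivial, so the geometric Sen map is given by a row (theta_1, theta_2):
   the image of the l-th dual basis vector of Lie G = Q_p^2 is
   theta_l (x) omega, where omega is dT/T twisted by (zeta_n)_n. *)
Section GeometricSen.
Variables (R : realType) (C : closedFieldType) (v : absval R C).
Variables (p : nat) (p_pr : prime p) (zeta : nat -> C).
Local Notation A := (tate v).
Variables (a1 a2 T : A).

Section Refinement.
(* a finite etale X' -> X, or X' = X *)
Variables (A' : comNzRingType) (phi : {rmorphism A -> A'}).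

(* O^ on the product of the two towers over X', and its integral subring *)
Definition OU : comPzRingType :=
  compl p phi (kummer p_pr (map phi [:: a1; a2; T])).

Definition OUplus : set OU := @cplus _ _ _ _ _ _ _.

Definition OUcst (c : C) : OU := cst p phi (kummer p_pr _) (phi (tconst v c)).

Definition OUnbhs (m : nat) : set OU := padic_nbhs p OUplus m.

Definition actG (g : 'rV[C]_2) : OU -> OU :=
  cact zeta [:: g 0 0; g 0 1; 0].

Definition actGamma (x : C) : OU -> OU := cact zeta [:: 0; 0; x].

Definition torA : nat -> comNzRingType := kummer p_pr [:: phi T].

Definition torA_lev n (x : torA n) : kummer p_pr (map phi [:: a1; a2; T]) n :=
  qpolyC _ (qpolyC _ x).

Definition torA_emb n (x : torA n) : OU := lev_emb p phi (torA_lev x).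

(* A_tor, the completion of colim_n A_n *)
Definition Ator : set OU :=
  [set x | exists s : forall n, torA n,
     cauchy p phi (tw := kummer p_pr [:: phi T]) s /\
     x = clim p phi (fun n => torA_lev (s n))].

Section Representation.
Variables (r : nat) (rho : 'rV[C]_2 -> 'M[C]_r).

(* Sections over the toric tower of the O^-module attached to rho *)
Definition secM : set 'cV[OU]_r :=
  [set w | forall g, Zpd v g ->
     map_mx OUcst (rho g) *m map_mx (actG g) w = w].

Definition orbit (w : 'cV[OU]_r) (x : C) : 'cV[OU]_r :=
  map_mx (actGamma x) w.

(* P is a finite projective Gamma-stable A_n-submodule of M = secM (with dual
   bases f_i, g_i), A_tor (x)_{A_n} P -> M is bijective, and the Gamma-locally
   analytic vectors of M are the union of the A_m P. *)
Record decompletion n (P : set 'cV[OU]_r) : Prop := Decompletion {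
  dc_sub : P `<=` secM;
  dc_zero : P 0;
  dc_lin : forall (a : torA n) w w', P w -> P w' -> P (torA_emb a *: w + w');
  dc_stable : forall x w, Zp v x -> P w -> P (orbit w x);
  dc_tensor : exists k (g : 'I_k -> 'cV[OU]_r) (f : 'I_k -> 'cV[OU]_r -> torA n),
    [/\ (forall i, P (g i)),
        (forall i a w w', P w -> P w' ->
           f i (torA_emb a *: w + w') = a * f i w + f i w'),
        (forall w, P w -> w = \sum_i torA_emb (f i w) *: g i),
        (forall w, secM w -> exists a : 'I_k -> OU,
           (forall i, Ator (a i)) /\ w = \sum_i a i *: g i) &
        (forall a : 'I_k -> OU, (forall i, Ator (a i)) ->
           \sum_i a i *: g i = 0 ->
           forall j, \sum_i a i * torA_emb (f j (g i)) = 0)];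
  dc_la : forall w, secM w ->
    (locally_analytic v p OUcst OUnbhs
       (fun x : 'rV[C]_1 => orbit w (x 0 0)) <->
     exists m, (n <= m)%N /\
       exists k (b : 'I_k -> torA m) (u : 'I_k -> 'cV[OU]_r),
         (forall i, P (u i)) /\ w = \sum_i torA_emb (b i) *: u i) }.

(* The Higgs field of the module, as the coefficient of omega: the O^-linear
   extension of the derived action of Gamma on P. *)
Definition is_higgs (P : set 'cV[OU]_r) (Theta : 'M[OU]_r) :=
  forall w, P w -> is_deriv0 v p OUcst OUnbhs (orbit w) (Theta *m w).
End Representation.
End Refinement.

Record la_rep r (rho : 'rV[C]_2 -> 'M[C]_r) : Prop := LaRep {
  lr_Qp : forall g, Zpd v g -> forall i j, Qp v (rho g i j);
  lr_one : rho 0 = 1%:M;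
  lr_mul : forall g h, Zpd v g -> Zpd v h -> rho (g + h) = rho g *m rho h;
  lr_la : locally_analytic v p idfun
    (fun m => [set x : C | v x <= v (p%:R ^+ m)]) rho }.

(* N l is the derived action of the l-th basis vector of Lie G. *)
Definition is_drho r (rho : 'rV[C]_2 -> 'M[C]_r) (N : 'I_2 -> 'M[C]_r) :=
  forall l, is_deriv0 v p idfun (fun m => [set x : C | v x <= v (p%:R ^+ m)])
    (fun x => rho (x *: delta_mx 0 l)) (N l).

Definition OX := OU idfun.

Record geometric_sen_map (theta : 'rV[OX]_2) : Prop := GeometricSenMap {
  gs_equivariant : forall g x, Zpd v g -> Zp v x ->
    map_mx (actG g) theta = theta /\ map_mx (actGamma x) theta = theta;
  gs_higgs : forall r (rho : 'rV[C]_2 -> 'M[C]_r) (N : 'I_2 -> 'M[C]_r),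
    la_rep rho -> is_drho rho N ->
    forall (A' : comNzRingType) (phi : {rmorphism A -> A'}), finite_etale phi ->
    forall n (P : set 'cV[OU phi]_r) (Theta : 'M[OU phi]_r),
      decompletion rho n P -> is_higgs P Theta ->
      Theta = \sum_l (cbc phi phi (theta 0 l) : OU phi)
                       *: map_mx (OUcst phi) (N l) }.

(* A geometric point Spa(C', C'^+) -> X above the point t = x0, together with
   a lift to the product of the two towers. *)
Record geometric_point (x0 : C) (C' : closedFieldType) (v' : absval R C')
    (y : {rmorphism OX -> C'}) : Prop := GeometricPoint {
  gp_complete : av_complete v';
  gp_cst : forall c, v' (y (OUcst idfun c)) = v c;
  gp_cont : forall x, OUplus x -> v' (y x) <= 1;
  gp_above : y (cst p idfun (kummer p_pr _) (tvar v)) = y (OUcst idfun x0) }.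

Definition surjective_at (theta : 'rV[OX]_2) (x0 : C) :=
  forall (C' : closedFieldType) (v' : absval R C') (y : {rmorphism OX -> C'}),
    geometric_point x0 v' y ->
    forall b : C', exists l : 'I_2 -> C', \sum_i l i * y (theta 0 i) = b.
End GeometricSen.

(* The tower n |-> O(X_n) = C<t>[a1^(1/p^n), a2^(1/p^n)] over X = Spa C<t>. *)
Definition affinoid_perfectoid (R : realType) (C : closedFieldType)
    (v : absval R C) (p : nat) (p_pr : prime p) (a1 a2 : tate v) :=
  perfectoid_affinoid v p
    (fun c => cst p idfun (kummer p_pr [:: a1; a2]) (tconst v c))
    (@cplus R C v p (tate v) idfun (kummer p_pr [:: a1; a2])).

(* Main.v *)
(* A point of the tower of s = (s_i) over the disc is a point z of the closed unit
   disc with compatible p-power roots of the s_i(z).  The completed tower is the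
   algebra of those functions of such points that are uniform limits of functions
   of finite level, and its integral subring is given by |f| <= 1; everything is
   therefore proved for algebras of functions.

   Torsor: Lagrange interpolation at the p^n-th roots of unity.

   Perfectoidness: the closed algebra D generated by all p-power roots of
   1 + varpi t^2 and 1 + varpi t^3 satisfies the Frobenius condition, and contains
   u = t^2 and t^3.  It contains t: for |gamma| <= 1, u is congruent modulo p to an
   element U with a compatible system of p-power roots, t^3/gamma is almost
   integral over the ball of D extended by the (U/gamma)^(1/p^k), and successive
   approximation makes t a limit of elements of D.  So the tower is D.

   Sen map: for l = 1, 2 put k = l + 1, x = 1 + varpi t^k and s = 1 + c t.  The
   element [c^k][x] - [c^k] - [varpi]([s] - 1)^k of A_inf vanishes under theta;
   dividing it by xi gives a function L with g L = L - g_l for g in G, and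
   gamma L = L + b for the generator gamma of Gamma, where
   b = varpi k s (c t)^(k-1) / (c^k x).  For the representation
   g |-> [[1, g_l], [0, 1]] this makes P = A e_1 + A (L, 1) a decompletion: the
   G-invariants of O^ are A_tor, since trace-one elements allow one to descend
   invariants along a perfectoid tower with bounded loss, and the Gamma-analytic
   elements of A_tor have finite level, since the normalized Tate traces are
   bounded.  Hence theta_l = b, which vanishes at t = 0 because k >= 2. *)
Require Import Defs.
From HB Require Import structures.
From mathcomp Require Import all_boot all_order all_algebra.
From mathcomp Require Import rat generic_quotient ring_quotient qpoly cyclic separable cyclotomic.
From mathcomp Require Import ring lra zify.
From mathcomp Require Import boolp classical_sets reals.

Set Implicit Arguments.
Unset Strict Implicit.
Unset Printing Implicit Defensive.

Import Order.TTheory GRing.Theory Num.Theory.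
Local Open Scope ring_scope.

(** * Absolute values, roots and limits in C_p *)

(** The obstacle for perfectoidness is one missing coefficient: at finite level the functions of the
    point of the disc are polynomials in [t] without linear term. Two facts overcome it. Every
    [t ^+ k] with [k != 1] is a power of [t ^+ 2] times 1 or [t ^+ 3]. And the expansion of [y ^+ Q]
    in powers of [t] has coefficients bounded by Cauchy's inequality on any disc |t| <= |tau| with a
    loss independent of Q. The uniformity in Q gives all powers of suitable quotients of [y] one
    common denominator, and closedness under p-th roots reduces this denominator to p. For the Sen
    map no period ring is constructed: an element x of A_inf is represented by the sequence of the
    values of theta(phi^(-n)(x)) in C, integrality by the boundedness of all iterates of the
    delta-operator, and division by xi by a convergent Teichmuller expansion. It then makes sense
    pointwise and stays in every uniformly closed algebra. Throughout, the losses (traces, averages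
    over roots of unity, interpolation) have to be bounded independently of the level; this shapes
    most of the estimates. *)

Section AbsVal.
Variables (R : realType) (C : fieldType) (v : absval R C).
Implicit Types (x y : C) (e : R).

Lemma avX x n : v (x ^+ n) = v x ^+ n.
Proof. by elim: n => [|n IH]; rewrite ?expr0 ?av1 // !exprS avM IH. Qed.

Lemma avV x : v x^-1 = (v x)^-1.
Proof.
case: (eqVneq x 0) => [->|x0]; first by rewrite invr0 av0 invr0.
have h : v x * v x^-1 = 1 by rewrite -avM mulfV // av1.
have vx : v x != 0 by apply/eqP => /av_eq0/eqP; rewrite (negPf x0).
by apply: (mulfI vx); rewrite h mulfV.
Qed.

Lemma avf x y : v (x / y) = v x / v y.
Proof. by rewrite avM avV. Qed.

Lemma av_neq0 x : (v x != 0) = (x != 0).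
Proof. by apply/idP/idP; apply: contra_neq; [move->; exact: av0|move/av_eq0]. Qed.

Lemma av_gt0 x : (0 < v x) = (x != 0).
Proof. by rewrite lt0r av_ge0 andbT av_neq0. Qed.

Lemma avDle x y e : v x <= e -> v y <= e -> v (x + y) <= e.
Proof. by move=> hx hy; apply: le_trans (avD v x y) _; rewrite ge_max hx. Qed.

Lemma avBle x y e : v x <= e -> v y <= e -> v (x - y) <= e.
Proof. by move=> hx hy; apply: avDle => //; rewrite avN. Qed.

Lemma avBC x y : v (x - y) = v (y - x).
Proof. by rewrite -opprB avN. Qed.

Lemma avBtrans x y z e : v (x - y) <= e -> v (y - z) <= e -> v (x - z) <= e.
Proof. by move=> hx hy; rewrite -(subrKA y x); apply: avDle. Qed.

Lemma av_near x y e : v (x - y) <= e -> v y <= e -> v x <= e.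
Proof. by move=> h hy; rewrite -(subrK y x); apply: avDle. Qed.

Lemma av_eq_lt x y : v (x - y) < v y -> v x = v y.
Proof.
move=> h; apply/eqP; rewrite eq_le; apply/andP; split.
  by apply: av_near (ltW h) _.
rewrite leNgt; apply/negP => hx.
have := avD v x (y - x); rewrite addrC subrK => /le_lt_trans - /(_ (v y)).
by rewrite gt_max hx avBC h ltxx => /(_ isT).
Qed.

Lemma av_nat n : v n%:R <= 1.
Proof.
elim: n => [|n IH]; first by rewrite av0.
by rewrite -natr1; apply: avDle; rewrite // av1.
Qed.

Lemma avMn x n : v (x *+ n) <= v x.
Proof. by rewrite -mulr_natl avM ler_piMl ?av_ge0 ?av_nat. Qed.

Lemma avM_le x y (a b : R) : v x <= a -> v y <= b -> v (x * y) <= a * b.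
Proof. by move=> hx hy; rewrite avM ler_pM ?av_ge0. Qed.

Lemma avM1 x y : v x <= 1 -> v y <= 1 -> v (x * y) <= 1.
Proof. by move=> hx hy; rewrite avM mulr_ile1 ?av_ge0. Qed.

Lemma avX1 x n : v x <= 1 -> v (x ^+ n) <= 1.
Proof. by move=> hx; rewrite avX exprn_ile1 ?av_ge0. Qed.

Lemma avX_root x n : (0 < n)%N -> v (x ^+ n) = 1 -> v x = 1.
Proof.
by move=> n0; rewrite avX => /eqP; rewrite pexpr_eq1 ?av_ge0 // => /eqP.
Qed.

Lemma avX_le x n (a : R) : (0 < n)%N -> 0 <= a -> v (x ^+ n) <= a ^+ n -> v x <= a.
Proof. by move=> n0 a0; rewrite avX ler_pXn2r // nnegrE ?av_ge0. Qed.

Lemma avX_lt1 x n : (0 < n)%N -> v (x ^+ n) < 1 -> v x < 1.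
Proof.
move=> n0; rewrite avX; case: (ltP (v x) 1) => // h1.
by rewrite ltNge exprn_ege1.
Qed.

Lemma avX_le1 x n : (0 < n)%N -> v (x ^+ n) <= 1 -> v x <= 1.
Proof. by move=> n0 h; apply: (avX_le n0) => //; rewrite expr1n. Qed.

(** By Bernoulli's inequality the powers of |x| would grow at least linearly if |x| > 1. *)
Lemma av_pow_bounded x (M : R) : (forall k, v x ^+ k <= M) -> v x <= 1.
Proof.
move=> h; rewrite leNgt; apply/negP => x1.
have d0 : 0 < v x - 1 by rewrite subr_gt0.
have bern k : 1 + k%:R * (v x - 1) <= v x ^+ k.
  elim: k => [|k IH]; first by rewrite mul0r addr0 expr0.
  rewrite exprS; apply: le_trans (_ : v x * (1 + k%:R * (v x - 1)) <= _).
    have hk : 0 <= k%:R :> R by [].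
    have hd : 0 <= k%:R * (v x - 1) * (v x - 1) by rewrite !mulr_ge0 ?ler0n //; exact: ltW.
    rewrite -natr1; set d := v x - 1 in hd d0 *; set kk := k%:R in hk hd *.
    have -> : v x = 1 + d by rewrite /d; ring.
    have -> : (1 + d) * (1 + kk * d) = 1 + (kk + 1) * d + kk * d * d by ring.
    by rewrite lerDl.
  by apply: ler_wpM2l (IH); apply: av_ge0.
have [k hk] : exists k : nat, M / (v x - 1) < k%:R.
  exists (Num.truncn (Num.max 0 (M / (v x - 1)))).+1.
  apply: le_lt_trans (truncnS_gt _); by rewrite le_max lexx orbT.
have := le_trans (bern k) (h k).
rewrite ltr_pdivrMr // in hk; lra.
Qed.

End AbsVal.

(* [ccross p x y] = ((x + y)^p - x^p - y^p) / p *)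
Definition ccross (R : nzRingType) (p : nat) (x y : R) : R :=
  \sum_(i < p.-1) x ^+ (p - i.+1) * y ^+ i.+1 *+ ('C(p, i.+1) %/ p).

Lemma ccrossE (K : comNzRingType) p (x y : K) : prime p ->
  (x + y) ^+ p = x ^+ p + y ^+ p + p%:R * ccross p x y.
Proof.
move=> pr; rewrite exprDn; case: p pr => [//|[//|n]] pr.
rewrite big_ord_recl big_ord_recr /= !subn0 bin0 mulr1n expr0 mulr1.
rewrite [X in _ + X = _]addrC addrA; congr (_ + _ + _).
  by rewrite /bump /= add1n subnn expr0 mul1r binn mulr1n.
rewrite /ccross mulr_sumr; apply: eq_bigr => i _ /=.
rewrite /bump /= add1n mulr_natl -mulrnA divnK //.
by apply: prime_dvd_bin => //=; rewrite ltnS.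
Qed.

Section CrossBound.
Variables (R : realType) (C : fieldType) (v : absval R C).

(** Every term is an integer times a monomial of total degree p, hence at most max(|x|, |y|)^p. *)
Lemma ccross_le p (x y : C) (e : R) : prime p -> 0 <= e ->
  v (x ^+ p) <= e -> v (y ^+ p) <= e -> v (ccross p x y) <= e.
Proof.
move=> pr e0 hx hy; apply: av_sum_le => // i _.
apply: le_trans (avMn _ _ _) _; rewrite avM !avX.
have ip : (i.+1 <= p)%N.
  by apply: leq_trans (ltn_ord i) (leq_pred _).
have [xy|yx] := leP (v x) (v y).
  apply: le_trans hy; rewrite avX -[in leRHS](subnK ip) exprD.
  by rewrite ler_wpM2r ?exprn_ge0 ?av_ge0 // lerXn2r // nnegrE av_ge0.
apply: le_trans hx; rewrite avX -[in leRHS](subnK ip) exprD.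
rewrite ler_wpM2l ?exprn_ge0 ?av_ge0 // lerXn2r ?nnegrE ?av_ge0 //; exact: ltW.
Qed.

End CrossBound.

(** Bundles the prime, the field and the roots of unity, so that all later sections and structures
    depend on a single parameter. *)
Record cpdata := CpData {
  cpR : realType;
  cpp : nat;
  cpp_pr : prime cpp;
  cpC : closedFieldType;
  cpv : absval cpR cpC;
  cphC : is_Cp cpp cpv;
  cpz : nat -> cpC;
  cpz_prim : forall n, (cpp ^ n).-primitive_root (cpz n);
  cpz_compat : forall n, cpz n.+1 ^+ cpp = cpz n }.

Section Cp.
Variable K : cpdata.
Local Notation R := (cpR K).
Local Notation p := (cpp K).
Local Notation p_pr := (cpp_pr K).
Local Notation C := (cpC K).
Local Notation v := (cpv K).
Local Notation hC := (cphC K).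

Lemma p_gt1 : (1 < p)%N. Proof. exact: prime_gt1 (cpp_pr K). Qed.
Lemma p_gt0 : (0 < p)%N. Proof. exact: prime_gt0 (cpp_pr K). Qed.

Lemma Cp_q : v p%:R = p%:R^-1. Proof. by case: hC. Qed.
Lemma q_gt0 : 0 < v p%:R.
Proof. by rewrite Cp_q invr_gt0 ltr0n p_gt0. Qed.
Lemma q_ge0 : 0 <= v p%:R. Proof. exact: av_ge0. Qed.
Lemma q_lt1 : v p%:R < 1.
Proof. by rewrite Cp_q invf_lt1 ?ltr0n ?ltr1n ?p_gt0 ?p_gt1. Qed.
Lemma q_le1 : v p%:R <= 1. Proof. exact/ltW/q_lt1. Qed.
Lemma pC_neq0 : p%:R != 0 :> C. Proof. by rewrite -(av_gt0 v) q_gt0. Qed.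

Lemma q_arch (e : R) : 0 < e -> exists m, v p%:R ^+ m < e.
Proof.
move=> e0; have [k hk] : exists k : nat, e^-1 < k%:R.
  by exists (Num.truncn e^-1).+1; exact: truncnS_gt.
exists k; rewrite Cp_q exprVn invf_plt ?posrE ?exprn_gt0 ?ltr0n ?p_gt0 //.
apply: lt_le_trans hk _; rewrite -natrX ler_nat ltnW //.
by apply: ltn_expl; exact: p_gt1.
Qed.

Lemma q_big (M : R) : exists m, M <= (v p%:R ^+ m)^-1.
Proof.
have M0 : 0 < (Num.max M 1)^-1 by rewrite invr_gt0 lt_max ltr01 orbT.
have [m hm] := q_arch M0; exists m.
rewrite -[M]invrK in M0 *.
apply: le_trans (_ : Num.max M 1 <= _); first by rewrite invrK le_max lexx.
rewrite -[leLHS]invrK lef_pV2 ?posrE ?exprn_gt0 ?q_gt0 //; last first.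
  by rewrite invrK in M0.
exact: ltW.
Qed.

Lemma le_max_q (a b : R) : 0 <= b -> (forall m, a <= Num.max b (v p%:R ^+ m)) -> a <= b.
Proof.
move=> b0 h; rewrite leNgt; apply/negP => ba.
have a0 : 0 < a by apply: le_lt_trans ba.
have [m hm] := q_arch a0; have := h m.
by rewrite le_max leNgt ba /= leNgt hm.
Qed.

Lemma q_anti m n : (m <= n)%N -> v p%:R ^+ n <= v p%:R ^+ m.
Proof. by move=> mn; rewrite ler_wiXn2l ?q_ge0 ?q_le1. Qed.

Lemma av_eq0_q (x : C) : (forall m, v x <= v p%:R ^+ m) -> x = 0.
Proof.
move=> h; apply/(av_eq0 v)/eqP; rewrite eq_le av_ge0 andbT.
by apply: le_max_q => // m; rewrite le_max h orbT.
Qed.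

Lemma av_coprime n : coprime n p -> v n%:R = 1.
Proof.
move=> np; have n0 : (0 < n)%N.
  by case: n np => //; rewrite /coprime gcd0n => /eqP pe; move: p_pr; rewrite pe.
case: (egcdnP p n0) => a b e _; rewrite (eqP np) in e.
have h : v (a * n)%:R = 1.
  rewrite e natrD -[RHS](av1 v); apply: av_eq_lt.
  rewrite addrK natrM avM av1; apply: le_lt_trans q_lt1.
  by rewrite ler_piMl ?av_nat ?q_ge0.
apply/eqP; rewrite eq_le av_nat /= -h natrM avM.
by rewrite ler_piMl ?av_nat ?av_ge0.
Qed.

Lemma natC_neq0 n : (0 < n)%N -> n%:R != 0 :> C.
Proof.
move=> n0; have [m pm ->] := pfactor_coprime p_pr n0.
rewrite natrM mulf_neq0 ?natrX ?expf_neq0 ?pC_neq0 //.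
by rewrite -(av_gt0 v) av_coprime ?ltr01 // coprime_sym.
Qed.

Lemma av_nat_dvd n m : v n%:R <= v p%:R ^+ m -> (0 < n)%N -> (p ^ m %| n)%N.
Proof.
move=> h n0; have [k pk e] := pfactor_coprime p_pr n0.
rewrite {}e in h *; apply: dvdn_mull; apply: dvdn_exp2l.
move: h; rewrite natrM avM av_coprime 1?coprime_sym // mul1r natrX avX.
rewrite leNgt => h; rewrite leqNgt; apply: contra h => h.
by rewrite ltr_iXn2l ?q_gt0 ?q_lt1.
Qed.

Lemma nroot_ex (x : C) n : exists y, (0 < n)%N -> y ^+ n = x.
Proof.
case: n => [|n]; first by exists 0.
have /closed_rootP[y /rootP] : size ('X^(n.+1) - x%:P : {poly C}) != 1%N.
  by rewrite size_XnsubC.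
rewrite !hornerE => /eqP; rewrite subr_eq0 => /eqP e; by exists y.
Qed.

Definition nroot n x := sval (cid (nroot_ex x n)).
Lemma nrootK n x : (0 < n)%N -> nroot n x ^+ n = x.
Proof. exact: (svalP (cid (nroot_ex x n))). Qed.

Definition psys (x : C) n := iter n (nroot p) x.
Lemma psys0 x : psys x 0 = x. Proof. by []. Qed.
Lemma psysS x n : psys x n.+1 ^+ p = psys x n.
Proof. by rewrite /psys iterS nrootK ?p_gt0. Qed.

Lemma psys_pow (r : nat -> C) n : (forall n, r n.+1 ^+ p = r n) ->
  r n ^+ (p ^ n) = r 0%N.
Proof. by move=> h; elim: n => [|n IH]; rewrite ?expn0 ?expr1 // expnS exprM h. Qed.

Lemma psys_powD (r : nat -> C) m n : (forall n, r n.+1 ^+ p = r n) ->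
  r (m + n)%N ^+ (p ^ m) = r n.
Proof.
by move=> h; elim: m => [|m IH]; rewrite ?expn0 ?expr1 // expnS exprM addSn h.
Qed.

Lemma prim_root_ex n : (0 < n)%N -> exists z : C, n.-primitive_root z.
Proof.
move=> n0.
have [rs e] := closed_field_poly_normal ('X^n - 1%:P : {poly C}).
rewrite (monicP (monicXnsubC 1 n0)) scale1r in e.
have u : uniq rs.
  by rewrite -separable_prod_XsubC -e separable_Xn_sub_1 // natC_neq0.
have s : size rs = n.
  have := size_XnsubC (1 : C) n0; rewrite e size_prod_XsubC => -[].
  by [].
have : has n.-primitive_root rs.
  apply: has_prim_root; rewrite ?s //; apply/allP => z zr.
  by rewrite /root_of_unity e root_prod_XsubC.
by case/hasP => z _; exists z.
Qed.

Lemma sum_prim_root n (z : C) k : n.-primitive_root z ->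
  \sum_(i < n) z ^+ (k * i) = if (n %| k)%N then n%:R else 0.
Proof.
move=> zn; have n0 := prim_order_gt0 zn.
case: ifPn => nk.
  rewrite (eq_bigr (fun=> 1)) ?sumr_const ?card_ord //.
  move=> i _; have /eqP zk1 : z ^+ k == 1 by rewrite -(prim_order_dvd zn).
  by rewrite exprM zk1 expr1n.
have zk : z ^+ k - 1 != 0 by rewrite subr_eq0 -(prim_order_dvd zn).
apply: (mulfI zk); rewrite mulr0.
rewrite (eq_bigr (fun i : 'I_n => (z ^+ k) ^+ i)) => [|i _]; last by rewrite exprM.
by rewrite -subrX1 -exprM mulnC exprM (prim_expr_order zn) expr1n subrr.
Qed.

Lemma av_prim_root n (z : C) : n.-primitive_root z -> v z = 1.
Proof.
move=> zn; apply: (avX_root (prim_order_gt0 zn)).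
by rewrite prim_expr_order // av1.
Qed.

(** Cauchy's inequality: the coefficient is an average of values on the circle of radius |tau|,
    taken over roots of unity of an order that is a unit, so that averaging loses nothing. *)
Lemma poly_cauchy (P : {poly C}) (tau : C) (B : R) : 0 <= B ->
  (forall z, v z <= v tau -> v P.[z] <= B) ->
  forall k, v P`_k * v tau ^+ k <= B.
Proof.
move=> B0 h k; case: (ltnP k (size P)) => [kP|kP]; last first.
  by rewrite nth_default // av0 mul0r.
(* N is prime to p and exceeds the degree, so that the average isolates one coefficient. *)
pose N := (p * size P).+1.
have cN : coprime N p.
  by rewrite /N coprime_sym /coprime -addn1 mulnC gcdnMDl gcdn1.
have [z zN] := prim_root_ex (ltn0Sn (p * size P) : (0 < N)%N).
have sP : (size P < N)%N by rewrite ltnS leq_pmull ?p_gt0.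
pose Nk := (N - k)%N.
have key : \sum_(i < N) z ^+ (Nk * i) * P.[z ^+ i * tau] = N%:R * (P`_k * tau ^+ k).
  rewrite (eq_bigr (fun i : 'I_N => \sum_(l < size P) P`_l * tau ^+ l * z ^+ ((Nk + l) * i))).
    rewrite exchange_big /= (bigD1 (Ordinal kP)) //= [X in _ + X]big1 ?addr0.
      rewrite -mulr_sumr sum_prim_root // /Nk subnK ?dvdnn 1?mulrC //.
      by apply: ltnW; apply: leq_trans kP (ltnW sP).
    move=> l lk; rewrite -mulr_sumr sum_prim_root // ifF ?mulr0 //.
    apply/negbTE; apply: contra lk => /dvdnP[c hc]; apply/eqP/val_inj => /=.
    rewrite /Nk in hc; move: kP sP (ltn_ord l) hc; clearbody N.
    move: (size P) (nat_of_ord l) => S l' kS SN lS.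
    by case: c => [|[|c]]; rewrite ?mulSn; nia.
  move=> i _; rewrite horner_coef mulr_sumr; apply: eq_bigr => l _.
  rewrite exprMn -exprM mulnDl exprD; rewrite [(l * i)%N]mulnC; ring.
have : v (N%:R * (P`_k * tau ^+ k)) <= B.
  rewrite -key; apply: av_sum_le => // i _.
  rewrite avM avX (av_prim_root zN) expr1n mul1r; apply: h.
  by rewrite avM avX (av_prim_root zN) expr1n mul1r.
by rewrite avM av_coprime // mul1r avM avX.
Qed.

End Cp.

Section Limits.
Variable K : cpdata.
Local Notation R := (cpR K).
Local Notation p := (cpp K).
Local Notation C := (cpC K).
Local Notation v := (cpv K).
Local Notation q := (v p%:R).

Definition cvgC (u : nat -> C) (l : C) :=
  forall m, exists N, forall n, (N <= n)%N -> v (u n - l) <= q ^+ m.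

Definition limC (u : nat -> C) : C := xget 0 [set l | cvgC u l].

(** Consecutive differences control all differences, by the ultrametric inequality ([step_le]). *)
Definition cauchyC (u : nat -> C) :=
  forall m, exists N, forall n, (N <= n)%N -> v (u n.+1 - u n) <= q ^+ m.

Lemma step_le (u : nat -> C) (e : R) N : (forall n, (N <= n)%N -> v (u n.+1 - u n) <= e) ->
  forall i j, (N <= i)%N -> (N <= j)%N -> v (u i - u j) <= e.
Proof.
move=> h; have e0 : 0 <= e by apply: le_trans (h N (leqnn N)); exact: av_ge0.
have H i k : (N <= i)%N -> v (u (k + i)%N - u i) <= e.
  move=> Ni; elim: k => [|k IH]; first by rewrite subrr av0.
  by apply: avBtrans IH; apply: h; apply: leq_trans Ni _; rewrite leq_addl.
move=> i j Ni Nj; case: (leqP i j) => [ij|/ltnW ij].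
  by rewrite avBC -(subnK ij); apply: H.
by rewrite -(subnK ij); apply: H.
Qed.

Lemma limP u : cauchyC u -> cvgC u (limC u).
Proof.
move=> hu; have [_ cmp _] := cphC K.
have [e e0|l hl] := cmp u.
  have [m hm] := q_arch e0; have [N hN] := hu m; exists N => i j Ni Nj.
  by apply: le_lt_trans hm; exact: step_le hN _ _ Ni Nj.
have : cvgC u l.
  move=> m; have [N hN] := hl (q ^+ m) (exprn_gt0 _ (q_gt0 K)).
  by exists N => n /hN/ltW.
rewrite /limC; case: xgetP => [y _ //|h] hl'.
by have := h l.
Qed.

Lemma cvg_near u l (a : C) (e : R) : 0 <= e -> cvgC u l ->
  (exists N, forall n, (N <= n)%N -> v (u n - a) <= e) -> v (l - a) <= e.
Proof.
move=> e0 hl [N hN]; apply: (@le_max_q K) => // m.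
have [M hM] := hl m; pose n := maxn N M.
rewrite -[l - a](subrKA (u n)); apply: le_trans (avD _ _ _) _.
rewrite ge_max !le_max avBC hM ?leq_maxr // hN ?leq_maxl //.
by rewrite orbT.
Qed.

Lemma cvg_unique u l l' : cvgC u l -> cvgC u l' -> l = l'.
Proof.
move=> h h'; apply/eqP; rewrite -subr_eq0; apply/eqP/(@av_eq0_q K) => m.
apply: cvg_near h _; first by rewrite exprn_ge0 ?q_ge0.
exact: h'.
Qed.

Lemma cvg_const (a : C) : cvgC (fun=> a) a.
Proof. by move=> m; exists 0%N => n _; rewrite subrr av0 exprn_ge0 ?q_ge0. Qed.

Lemma cvg_ext u u' l : (exists N, forall n, (N <= n)%N -> u n = u' n) -> cvgC u l -> cvgC u' l.
Proof.
move=> [N hN] h m; have [M hM] := h m; exists (maxn N M) => n.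
by rewrite geq_max => /andP[/hN<- /hM].
Qed.

Lemma cvgD u u' l l' : cvgC u l -> cvgC u' l' -> cvgC (fun n => u n + u' n) (l + l').
Proof.
move=> h h' m; have [N hN] := h m; have [M hM] := h' m; exists (maxn N M) => n.
rewrite geq_max => /andP[/hN h1 /hM h2].
by rewrite opprD addrACA; apply: avDle.
Qed.

Lemma cvgM u u' l l' : cvgC u l -> cvgC u' l' -> cvgC (fun n => u n * u' n) (l * l').
Proof.
move=> h h' m.
have [a ha] := q_big (Num.max (v l) 1); have [b hb] := q_big (v l').
have [N hN] := h (m + b)%N; have [M hM] := h' (m + a)%N; have [M' hM'] := h 0%N.
exists (maxn (maxn N M') M) => n; rewrite !geq_max => /andP[/andP[/hN h1 /hM' h3] /hM h2].
have -> : u n * u' n - l * l' = u n * (u' n - l') + (u n - l) * l' by ring.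
have un : v (u n) <= (q ^+ a)^-1.
  apply: le_trans ha; rewrite -(subrK l (u _)); apply: le_trans (avD _ _ _) _.
  by rewrite ge_max !le_max lexx andbT h3 orbT.
have qn k : q ^+ k != 0 by rewrite expf_neq0 // gt_eqF ?q_gt0.
apply: avDle.
  by apply: le_trans (avM_le un h2) _; rewrite exprD mulrCA mulVf // mulr1.
by apply: le_trans (avM_le h1 hb) _; rewrite exprD -mulrA mulfV // mulr1.
Qed.

Lemma cvgX u l n : cvgC u l -> cvgC (fun k => u k ^+ n) (l ^+ n).
Proof.
move=> h; elim: n => [|n IH]; first exact: cvg_const.
rewrite exprS; apply: cvg_ext (cvgM h IH).
by exists 0%N => k _; rewrite exprS.
Qed.

Lemma cvg_le u l (e : R) : 0 <= e -> cvgC u l ->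
  (exists N, forall n, (N <= n)%N -> v (u n) <= e) -> v l <= e.
Proof.
move=> e0 h [N hN]; rewrite -(subr0 l); apply: cvg_near h _ => //.
by exists N => n /hN; rewrite subr0.
Qed.

Lemma cvg_shift u l k : cvgC u l -> cvgC (fun n => u (n + k)%N) l.
Proof.
move=> h m; have [N hN] := h m; exists N => n Nn; apply: hN.
exact: leq_trans Nn (leq_addr _ _).
Qed.
End Limits.

(** * Evaluation of Tate series on the closed unit disc *)

Section TateEval.
Variable K : cpdata.
Local Notation R := (cpR K).
Local Notation p := (cpp K).
Local Notation C := (cpC K).
Local Notation v := (cpv K).
Local Notation q := (v p%:R).
Local Notation A := (tate v).
Implicit Types (f g : A) (z : C).

Definition gle f (B : R) := forall n, v (f n) <= B.

Lemma tpolyP (P : {poly C}) : tends0 v (fun n => P`_n).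
Proof. by move=> e e0; exists (size P) => n h; rewrite nth_default // av0. Qed.
Definition tpoly P : A := Tate (tpolyP P).

Lemma tpolyD P Q : tpoly (P + Q) = tpoly P + tpoly Q.
Proof. by apply: tateP => n /=; rewrite coefD. Qed.
Lemma tpolyM P Q : tpoly (P * Q) = tpoly P * tpoly Q.
Proof. by apply: tateP => n /=; rewrite coefM. Qed.
Lemma tpolyC c : tpoly c%:P = tconst v c.
Proof. by apply: tateP => n /=; rewrite coefC. Qed.
Lemma tpolyX : tpoly 'X = tvar v.
Proof. by apply: tateP => n /=; rewrite coefX. Qed.

Lemma tpoly_zmod : zmod_morphism tpoly.
Proof. by move=> P Q; apply: tateP => n /=; rewrite coefB. Qed.
Lemma tpoly_monoid : monoid_morphism tpoly.
Proof. by split; [exact: tpolyC|exact: tpolyM]. Qed.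
HB.instance Definition _ := GRing.isZmodMorphism.Build {poly C} A tpoly tpoly_zmod.
HB.instance Definition _ := GRing.isMonoidMorphism.Build {poly C} A tpoly tpoly_monoid.

Definition ttrunc f n : {poly C} := \poly_(i < n) f i.

Definition tev z f : C := limC (fun n => (ttrunc f n).[z]).

Lemma ttrunc_gle f n (B : R) : 0 <= B -> gle f B -> forall k, v (ttrunc f n)`_k <= B.
Proof. by move=> B0 h k; rewrite coef_poly; case: ifP => // _; rewrite av0. Qed.

Lemma horner_gle (P : {poly C}) z (B : R) : 0 <= B -> v z <= 1 ->
  (forall k, v P`_k <= B) -> v P.[z] <= B.
Proof.
move=> B0 hz h; rewrite horner_coef; apply: av_sum_le => // i _.
by rewrite avM -[B]mulr1; apply: ler_pM; rewrite ?av_ge0 ?avX1.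
Qed.

Lemma ttruncP f m : exists N, forall n, (N <= n)%N -> gle (f - tpoly (ttrunc f n)) (q ^+ m).
Proof.
have [N hN] := tcoefP f (exprn_gt0 m (q_gt0 K)); exists N => n Nn k /=.
rewrite coef_poly; case: ltnP => kn; first by rewrite subrr av0 exprn_ge0 ?q_ge0.
by rewrite subr0; apply/ltW/hN/(leq_trans Nn kn).
Qed.

Lemma tev_cvg z f : v z <= 1 -> cvgC (fun n => (ttrunc f n).[z]) (tev z f).
Proof.
move=> hz; apply: limP => m; have [N hN] := ttruncP f m; exists N => n Nn.
rewrite -hornerN -hornerD; apply: horner_gle => // [|k]; first by rewrite exprn_ge0 ?q_ge0.
have -> : (ttrunc f n.+1 - ttrunc f n)`_k =
  (f k - (ttrunc f n)`_k) - (f k - (ttrunc f n.+1)`_k) by rewrite coefB; ring.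
by apply: avBle; [apply: hN|apply: hN (leqW Nn) k].
Qed.

Lemma tev_near z f (P : {poly C}) (e : R) : v z <= 1 -> 0 <= e -> gle (f - tpoly P) e ->
  v (tev z f - P.[z]) <= e.
Proof.
move=> hz e0 h; apply: cvg_near (tev_cvg f hz) _ => //.
exists (size P) => n nP; rewrite -hornerN -hornerD; apply: horner_gle => // k.
rewrite coefB coef_poly; case: ltnP => kn; first exact: h.
by rewrite [P`__]nth_default ?subrr ?av0 // (leq_trans nP).
Qed.

(** A value is pinned down by approximating polynomials; additivity and multiplicativity of
    evaluation are obtained by approximating the arguments. *)
Lemma tev_unique z f l : v z <= 1 ->
  (forall m, exists P, gle (f - tpoly P) (q ^+ m) /\ v (l - P.[z]) <= q ^+ m) ->
  tev z f = l.
Proof.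
move=> hz h; apply/eqP; rewrite -subr_eq0; apply/eqP/(@av_eq0_q K) => m.
have [P [h1 h2]] := h m; apply: avBtrans (_ : v (P.[z] - l) <= _).
  by apply: tev_near => //; rewrite exprn_ge0 ?q_ge0.
by rewrite avBC.
Qed.

Lemma gleD f g B : gle f B -> gle g B -> gle (f + g) B.
Proof. by move=> hf hg n; apply: avDle; [apply: hf|apply: hg]. Qed.
Lemma gleM f g B B' : gle f B -> gle g B' -> gle (f * g) (B * B').
Proof.
move=> hf hg n /=; apply: av_sum_le => [|i _]; last exact: avM_le.
by apply: mulr_ge0; [apply: le_trans (hf 0%N)|apply: le_trans (hg 0%N)]; exact: av_ge0.
Qed.

Lemma gle_big f : exists m, gle f (q ^+ m)^-1.
Proof.
have [M _ hM] := tbounded f; have [m hm] := q_big M; exists m => n.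
exact: le_trans (hM n) hm.
Qed.

Lemma tev_poly z P : v z <= 1 -> tev z (tpoly P) = P.[z].
Proof.
move=> hz; apply: tev_unique => // m; exists P; rewrite !subrr av0; split.
  by move=> n /=; rewrite av0 exprn_ge0 ?q_ge0.
by rewrite exprn_ge0 ?q_ge0.
Qed.

Lemma tevD z f g : v z <= 1 -> tev z (f + g) = tev z f + tev z g.
Proof.
move=> hz; apply: tev_unique => // m.
have [N hN] := ttruncP f m; have [M hM] := ttruncP g m.
exists (ttrunc f N + ttrunc g M).
rewrite tpolyD hornerD !opprD !(addrACA _ _ (- _)).
have hf := hN N (leqnn _); have hg := hM M (leqnn _); have q0 := exprn_ge0 m (q_ge0 K).
by split; [apply: gleD|apply: avDle; apply: tev_near].
Qed.

Lemma tevM z f g : v z <= 1 -> tev z (f * g) = tev z f * tev z g.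
Proof.
move=> hz; apply: tev_unique => // m.
have [a ha] := gle_big f; have [b hb] := gle_big g.
have [N hN] := ttruncP f (m + b + a)%N; have [M hM] := ttruncP g (m + a)%N.
have {hN} hf := hN N (leqnn _); have {hM} hg := hM M (leqnn _).
set F := ttrunc f N in hf *; set G := ttrunc g M in hg *.
exists (F * G); rewrite tpolyM hornerM.
have q0 k := exprn_ge0 k (q_ge0 K).
have qn k : q ^+ k != 0 by rewrite expf_neq0 // gt_eqF ?q_gt0.
have qi k : 0 <= (q ^+ k)^-1 by rewrite invr_ge0.
have hF : gle (tpoly F) (q ^+ a)^-1.
  by move=> k /=; apply: ttrunc_gle.
have e1 : (q ^+ (m + b + a)) * (q ^+ b)^-1 <= q ^+ m.
  rewrite -addnA addnCA addnC exprD -mulrA mulfV // mulr1; apply: q_anti.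
  exact: leq_addr.
have e2 : (q ^+ a)^-1 * q ^+ (m + a) <= q ^+ m by rewrite exprD mulrCA mulVf ?mulr1.
split.
  have -> : f * g - tpoly F * tpoly G = (f - tpoly F) * g + tpoly F * (g - tpoly G) by ring.
  apply: gleD => n; [apply: le_trans e1|apply: le_trans e2]; exact: gleM.
have -> : tev z f * tev z g - F.[z] * G.[z] =
  (tev z f - F.[z]) * tev z g + F.[z] * (tev z g - G.[z]) by ring.
have hgz : v (tev z g) <= (q ^+ b)^-1.
  by apply: cvg_le (tev_cvg g hz) _ => //; exists 0%N => n _; apply/horner_gle/ttrunc_gle.
have hFz : v F.[z] <= (q ^+ a)^-1 by apply/horner_gle/ttrunc_gle.
apply: avDle; [apply: le_trans e1|apply: le_trans e2]; apply: avM_le => //; exact: tev_near.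
Qed.

Lemma tev_const z c : v z <= 1 -> tev z (tconst v c) = c.
Proof. by move=> hz; rewrite -tpolyC tev_poly // hornerC. Qed.
Lemma tev_var z : v z <= 1 -> tev z (tvar v) = z.
Proof. by move=> hz; rewrite -tpolyX tev_poly // hornerX. Qed.

Lemma tev_le z f B : 0 <= B -> v z <= 1 -> gle f B -> v (tev z f) <= B.
Proof.
move=> B0 hz h; apply: cvg_le (tev_cvg f hz) _ => //.
by exists 0%N => n _; apply/horner_gle/ttrunc_gle.
Qed.

(** The maximum principle: [poly_cauchy] at radius 1, applied to a truncation, bounds the Gauss norm
    by the values on the disc. *)
Lemma tate_max f B : 0 <= B -> (forall z, v z <= 1 -> v (tev z f) <= B) -> gle f B.
Proof.
move=> B0 h n; apply: (@le_max_q K) => // m.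
have [N hN] := ttruncP f m; have {hN} hf := hN N (leqnn _).
have q0 k := exprn_ge0 k (q_ge0 K).
have -> : f n = (f n - (ttrunc f N)`_n) + (ttrunc f N)`_n by rewrite subrK.
apply: avDle; first by rewrite le_max hf orbT.
have := @poly_cauchy K (ttrunc f N) 1 (Num.max B (q ^+ m)) _ _ n.
rewrite av1 expr1n mulr1; apply => [|z hz]; first by rewrite le_max B0.
apply: (@av_near _ _ _ _ (tev z f)).
  by rewrite avBC le_max (tev_near hz (q0 m) hf) orbT.
by rewrite le_max h.
Qed.

Lemma tev_zmod z : v z <= 1 -> zmod_morphism (tev z).
Proof.
move=> hz f g; apply/eqP; rewrite eq_sym subr_eq -tevD //.
by rewrite subrK.
Qed.
Lemma tev_monoid z : v z <= 1 -> monoid_morphism (tev z).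
Proof. by move=> hz; split=> [|f g]; [exact: tev_const|exact: tevM]. Qed.

End TateEval.

(** * Points of Kummer towers *)

Section QpolyTheory.
Variables (S : comNzRingType) (h : {poly S}).
Hypotheses (sh : (1 < size h)%N) (hm : h \is monic).

Lemma mk_monicE : mk_monic h = h.
Proof. by rewrite /mk_monic sh hm. Qed.

Lemma size_qpoly (x : {poly %/ h}) : (size (x : {poly S}) <= (size h).-1)%N.
Proof. by apply: leq_trans (size_npoly x) _; rewrite mk_monicE. Qed.

Lemma qliftE (T : comNzRingType) (psi : S -> T) y (x : {poly %/ h}) N :
  (size (x : {poly S}) <= N)%N -> psi 0 = 0 ->
  qlift psi y x = \sum_(i < N) psi (x : {poly S})`_i * y ^+ i.
Proof.
move=> sN psi0; rewrite /qlift /map_poly horner_poly (big_ord_widen N (fun i => psi (x : {poly S})`_i * y ^+ i)) //.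
rewrite big_mkcond; apply: eq_bigr => i _; case: ltnP => // si.
by rewrite nth_default // psi0 mul0r.
Qed.

Lemma qlift_in (T : comNzRingType) (psi : {rmorphism S -> T}) y (f : {poly S}) :
  (map_poly psi h).[y] = 0 -> qlift psi y (in_qpoly h f) = (map_poly psi f).[y].
Proof.
move=> hy; rewrite /qlift /= mk_monicE.
have := Pdiv.RingMonic.rdivp_eq hm f => {2}->.
by rewrite rmorphD rmorphM hornerD hornerM hy mulr0 add0r.
Qed.

Lemma qlift_C (T : comNzRingType) (psi : S -> T) y c : psi 0 = 0 ->
  qlift psi y (qpolyC h c) = psi c.
Proof.
move=> p0; rewrite (@qliftE _ _ _ _ 1) ?big_ord1 ?expr0 ?mulr1 //= ?coefC //.
exact: size_polyC_leq1.
Qed.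

Lemma qlift_X (T : comNzRingType) (psi : {rmorphism S -> T}) y :
  (map_poly psi h).[y] = 0 -> qlift psi y (in_qpoly h 'X) = y.
Proof. by move=> hy; rewrite qlift_in // map_polyX hornerX. Qed.

Lemma qpoly_sum (x : {poly %/ h}) N : (size (x : {poly S}) <= N)%N ->
  x = \sum_(i < N) qpolyC h (x : {poly S})`_i * in_qpoly h 'X ^+ i.
Proof.
move=> sN; transitivity (in_qpoly h (x : {poly S})).
  exact/val_inj/esym/in_qpoly_small/size_mk_monic.
rewrite -{1}[x : {poly S}]coefK poly_def rmorph_sum /= (big_ord_widen N (fun i => in_qpoly h ((x : {poly S})`_i *: 'X^i))) //.
rewrite big_mkcond; apply: eq_bigr => i _; case: ltnP => si.
  rewrite -mul_polyC rmorphM rmorphXn; congr (_ * _); apply: val_inj => /=.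
  rewrite Pdiv.CommonRing.rmodp_small // (leq_ltn_trans (size_polyC_leq1 _)) //.
  by rewrite mk_monicE.
rewrite nth_default // ; apply/esym/eqP; rewrite (_ : qpolyC h 0 = 0) ?mul0r //.
exact: rmorph0.
Qed.

End QpolyTheory.

Section Kummer.
Variable K : cpdata.
Local Notation R := (cpR K).
Local Notation p := (cpp K).
Local Notation p_pr := (cpp_pr K).
Local Notation C := (cpC K).
Local Notation v := (cpv K).
Local Notation q := (v p%:R).
Local Notation zeta := (cpz K).
Local Notation A := (tate v).
Implicit Types (s : seq A).

Lemma kumpol_root (T : comNzRingType) (tw : tower A) a n (f : {rmorphism tw n -> T}) y :
  y ^+ (p ^ n) = f (str tw n a) -> (map_poly f (kumpol p tw a n)).[y] = 0.
Proof.
move=> e; rewrite /kumpol rmorphB /= map_polyXn map_polyC /= hornerD hornerN.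
by rewrite hornerXn hornerC e subrr.
Qed.

(** [r i n] is the chosen p^n-th root of the i-th entry of [s]; the head, which is adjoined last,
    uses [r 0]. *)
Fixpoint kev s (z : C) (r : nat -> nat -> C) n {struct s} : kummer p_pr s n -> C :=
  match s return kummer p_pr s n -> C with
  | [::] => tev z
  | a :: s' => qlift (@kev s' z (fun i => r i.+1) n) (r 0%N n)
  end.

Definition kval s z (r : nat -> nat -> C) :=
  v z <= 1 /\ forall i, (i < size s)%N -> r i 0%N = tev z s`_i /\
    forall n, r i n.+1 ^+ p = r i n.

Lemma kval_tl a s z r : kval (a :: s) z r -> kval s z (fun i => r i.+1).
Proof. by move=> [hz h]; split=> // i si; exact: (h i.+1). Qed.

Lemma kev_str_zmod s z r n : kval s z r ->
  [/\ zmod_morphism (@kev s z r n), monoid_morphism (@kev s z r n) &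
      forall a, kev z r (str (kummer p_pr s) n a) = tev z a].
Proof.
elim: s r => [|a s IH] r hr /=.
  by have [hz _] := hr; split=> //; [exact: tev_zmod|exact: tev_monoid].
have [h1 h2 h3] := IH _ (kval_tl hr).
pose f : {rmorphism kummer p_pr s n -> C} := HB.pack (@kev s z (fun i => r i.+1) n)
  (GRing.isZmodMorphism.Build _ _ _ h1) (GRing.isMonoidMorphism.Build _ _ _ h2).
have hy : (map_poly f (kumpol p (kummer p_pr s) a n)).[r 0%N n] = 0.
  apply: kumpol_root; have [_ /(_ 0%N isT)[r0 rS]] := hr.
  by rewrite (psys_pow _ rS) r0 /= h3.
have sh := kumpol_size p_pr (kummer p_pr s) a n.
have hm := kumpol_monic p_pr (kummer p_pr s) a n.
have [z1 z2] := qlift_morph sh hm hy.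
split=> //= b.
by rewrite qlift_C // -[LHS]/(f 0) rmorph0.
Qed.

(* Only the roots r i with i < size s are constrained. *)
Record pt s := Pt { pz : C; prt : nat -> nat -> C; ptP : kval s pz prt }.

Definition pev s (w : pt s) n : kummer p_pr s n -> C := @kev s (pz w) (prt w) n.

Lemma pev_zmod s (w : pt s) n : zmod_morphism (@pev s w n).
Proof. by have [] := kev_str_zmod n (ptP w). Qed.
Lemma pev_monoid s (w : pt s) n : monoid_morphism (@pev s w n).
Proof. by have [] := kev_str_zmod n (ptP w). Qed.
HB.instance Definition _ s (w : pt s) n :=
  GRing.isZmodMorphism.Build _ _ (@pev s w n) (@pev_zmod s w n).
HB.instance Definition _ s (w : pt s) n :=
  GRing.isMonoidMorphism.Build _ _ (@pev s w n) (@pev_monoid s w n).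

Lemma pz_le1 s (w : pt s) : v (pz w) <= 1. Proof. by have [] := ptP w. Qed.

Lemma pev_str s (w : pt s) n a : pev w (str (kummer p_pr s) n a) = tev (pz w) a.
Proof. have [_ _ h] := kev_str_zmod n (ptP w); exact: h. Qed.

Definition ptl a s (w : pt (a :: s)) : pt s := Pt (kval_tl (ptP w)).

Lemma prt0 s (w : pt s) i : (i < size s)%N -> prt w i 0 = tev (pz w) s`_i.
Proof. by move=> si; have [_ /(_ i si)[]] := ptP w. Qed.
Lemma prtS s (w : pt s) i n : (i < size s)%N -> prt w i n.+1 ^+ p = prt w i n.
Proof. by move=> si; have [_ /(_ i si)[]] := ptP w. Qed.

Lemma prt00 a s (w : pt (a :: s)) : prt w 0 0 = tev (pz w) a.
Proof. exact: (@prt0 (a :: s) w 0 isT). Qed.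
Lemma prt0S a s (w : pt (a :: s)) n : prt w 0 n.+1 ^+ p = prt w 0 n.
Proof. exact: (@prtS (a :: s) w 0 n isT). Qed.

Lemma kum_root a s (w : pt (a :: s)) n :
  (map_poly (@pev s (ptl w) n) (kumpol p (kummer p_pr s) a n)).[prt w 0 n] = 0.
Proof.
rewrite /kumpol rmorphB /= map_polyXn map_polyC /= !hornerE.
rewrite (psys_pow n (prt0S w)) prt00 pev_str.
by rewrite subrr.
Qed.

Lemma pev_X a s (w : pt (a :: s)) n : pev w (kumX p (kummer p_pr s) a n) = prt w 0 n.
Proof.
have sh := kumpol_size p_pr (kummer p_pr s) a n.
have hm := kumpol_monic p_pr (kummer p_pr s) a n.
exact: (qlift_X sh hm (kum_root w n)).
Qed.

Lemma pev_C a s (w : pt (a :: s)) n (c : kummer p_pr s n) :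
  pev w (qpolyC (kumpol p (kummer p_pr s) a n) c : kummer p_pr (a :: s) n) = pev (ptl w) c.
Proof. by apply: qlift_C; exact: rmorph0 (@pev s (ptl w) n). Qed.

Definition kcoef a s n (x : kummer p_pr (a :: s) n) i : kummer p_pr s n :=
  (polyn (x : {poly %/ kumpol p (kummer p_pr s) a n}))`_i.

Lemma kum_sum a s n (x : kummer p_pr (a :: s) n) :
  x = \sum_(i < p ^ n) (qpolyC (kumpol p (kummer p_pr s) a n) (kcoef x i) : kummer p_pr (a :: s) n)
     * (kumX p (kummer p_pr s) a n : kummer p_pr (a :: s) n) ^+ i.
Proof.
have sh := kumpol_size p_pr (kummer p_pr s) a n.
have hm := kumpol_monic p_pr (kummer p_pr s) a n.
apply: (qpoly_sum sh hm); apply: leq_trans (size_qpoly sh hm _) _.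
by rewrite size_XnsubC // expn_gt0 p_gt0.
Qed.

Lemma pev_sum a s n (w : pt (a :: s)) (x : kummer p_pr (a :: s) n) :
  pev w x = \sum_(i < p ^ n) pev (ptl w) (kcoef x i) * prt w 0 n ^+ i.
Proof.
rewrite {1}[x]kum_sum rmorph_sum; apply: eq_bigr => i _.
by rewrite rmorphM rmorphXn /= pev_C pev_X.
Qed.

Lemma pev_tr s (w : pt s) n (x : kummer p_pr s n) : pev w (tr (kummer p_pr s) n x) = pev w x.
Proof.
elim: s w x => [//|a s IH] w x.
rewrite [in RHS]pev_sum {1}[x]kum_sum rmorph_sum rmorph_sum; apply: eq_bigr => i _.
rewrite !rmorphM !rmorphXn /=; congr (_ * _ ^+ _).
  rewrite /adj_tr qlift_C /=; last by rewrite rmorph0 (rmorph0 (qpolyC _)).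
  by rewrite pev_C IH.
rewrite /adj_tr.
have -> : qlift (qpolyC (kumpol p (kummer p_pr s) a n.+1) \o tr (kummer p_pr s) n)
   (kumX p (kummer p_pr s) a n.+1 ^+ p) (kumX p (kummer p_pr s) a n) =
   kumX p (kummer p_pr s) a n.+1 ^+ p.
  apply: (qlift_X (kumpol_size p_pr (kummer p_pr s) a n) (kumpol_monic p_pr (kummer p_pr s) a n)).
  rewrite /kumpol rmorphB /= map_polyXn map_polyC /= hornerD hornerN hornerXn hornerC.
  by rewrite -exprM -expnS (kumXE p_pr) trstr subrr.
rewrite (rmorphXn (@pev (a :: s) w n.+1)) /= pev_X.
exact: prt0S.
Qed.

Definition units s := forall i, (i < size s)%N -> forall z, v z <= 1 -> v (tev z s`_i) = 1.

Lemma units_tl a s : units (a :: s) -> units s.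
Proof. by move=> h i si; exact: (h i.+1). Qed.

Lemma prt_unit s (w : pt s) i n : units s -> (i < size s)%N -> v (prt w i n) = 1.
Proof.
move=> us si; apply: (@avX_root _ _ _ _ (p ^ n)); first by rewrite expn_gt0 p_gt0.
by rewrite (psys_pow n (fun m => prtS w m si)) prt0 // us // pz_le1.
Qed.

Lemma pt_ex s z : v z <= 1 -> exists w : pt s, pz w = z.
Proof.
move=> hz; have hr : kval s z (fun i => @psys K (tev z s`_i)).
  by split=> // i _; split=> // n; exact: psysS.
by exists (Pt hr).
Qed.

Lemma rotP s (w : pt s) (e : nat -> nat -> C) :
  (forall i, e i 0%N = 1 /\ forall n, e i n.+1 ^+ p = e i n) ->
  kval s (pz w) (fun i n => e i n * prt w i n).
Proof.
move=> he; split; first exact: pz_le1.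
move=> i si; have [e0 eS] := he i; split; first by rewrite e0 mul1r prt0.
by move=> n; rewrite exprMn eS prtS.
Qed.

Lemma zeta0 : zeta 0 = 1.
Proof. by have := prim_expr_order (cpz_prim K 0); rewrite expn0 expr1. Qed.

Lemma zeta_psys k : (fun n => zeta n ^+ k) 0%N = 1 /\
   forall n, (fun n => zeta n ^+ k) n.+1 ^+ p = (fun n => zeta n ^+ k) n.
Proof.
by split=> [|n] /=; rewrite ?zeta0 ?expr1n // -exprM mulnC exprM cpz_compat.
Qed.

Lemma zrotP s (w : pt s) j k :
  kval s (pz w) (fun i n => (if i == j then zeta n ^+ k else 1) * prt w i n).
Proof.
apply: (@rotP s w (fun i n => if i == j then zeta n ^+ k else 1)) => i.
case: ifP => _; first exact: zeta_psys.
by split=> // n; rewrite expr1n.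
Qed.

Definition zrot s j k (w : pt s) : pt s := Pt (@zrotP s w j k).

Lemma av_zeta n : v (zeta n) = 1.
Proof. exact: av_prim_root (cpz_prim K n). Qed.

Lemma av_pn n : v (p ^ n)%:R = q ^+ n.
Proof. by rewrite natrX avX. Qed.

(** Fourier inversion for the group of p^n-th roots of unity acting on the outermost root. *)
Lemma coef_fourier a s n (w : pt (a :: s)) (x : kummer p_pr (a :: s) n) (i : 'I_(p ^ n)) :
  (p ^ n)%:R * (pev (ptl w) (kcoef x i) * prt w 0 n ^+ i) =
  \sum_(k < p ^ n) zeta n ^+ ((p ^ n - i) * k) * pev (zrot 0 k w) x.
Proof.
rewrite (eq_bigr (fun k : 'I_(p ^ n) => \sum_(l < p ^ n) pev (ptl w) (kcoef x l) * prt w 0 n ^+ l *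
   zeta n ^+ ((p ^ n - i + l) * k))); last first.
  move=> k _; rewrite pev_sum mulr_sumr; apply: eq_bigr => l _ /=.
  rewrite exprMn -exprM mulnDl exprD [(l * k)%N]mulnC.
  have -> : pev (ptl (zrot 0 k w)) (kcoef x l) = pev (ptl w) (kcoef x l).
    rewrite /pev /= (_ : (fun i0 n0 : nat => 1 * prt w i0.+1 n0) = fun i0 => prt w i0.+1) //.
    by apply/funext => i'; apply/funext => m; rewrite mul1r.
  ring.
rewrite exchange_big /= (bigD1 i) //= [X in _ + X]big1 ?addr0.
  rewrite -mulr_sumr (sum_prim_root _ (cpz_prim K n)) subnK ?dvdnn 1?mulrC //.
  exact/ltnW.
move=> l li; rewrite -mulr_sumr (sum_prim_root _ (cpz_prim K n)) ifF ?mulr0 //.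
apply/negbTE; apply: contra li => /dvdnP[c hc]; apply/eqP/val_inj => /=.
move: (ltn_ord l) (ltn_ord i) hc; move: (nat_of_ord l) (nat_of_ord i) => l' i'.
move: (p ^ n)%N => N.
by case: c => [|[|c]]; rewrite ?mulSn; nia.
Qed.

Lemma pt_cons a s (w : pt s) : exists w' : pt (a :: s),
  pz w' = pz w /\ forall n (x : kummer p_pr s n), pev (ptl w') x = pev w x.
Proof.
have hr : kval (a :: s) (pz w) (fun i => if i is j.+1 then prt w j else @psys K (tev (pz w) a)).
  split=> [|[|i]]; first exact: pz_le1.
    by split=> // n; exact: psysS.
  by move=> si; split=> [|n]; [exact: prt0|exact: prtS].
by exists (Pt hr).
Qed.

(** Averaging over p^n elements loses |p|^n. This is harmless at a fixed level; [kcoef_bound] gives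
    a loss independent of n on the toric tower. *)
Lemma kcoef_le a s n (x : kummer p_pr (a :: s) n) (i : 'I_(p ^ n)) (B : R) : units (a :: s) ->
  0 <= B -> (forall w : pt (a :: s), v (pev w x) <= B) ->
  forall w : pt s, v (pev w (kcoef x i)) <= B / q ^+ n.
Proof.
move=> us B0 h w; have [w' [_ <-]] := pt_cons a w.
rewrite ler_pdivlMr ?exprn_gt0 ?q_gt0 // mulrC -av_pn -avM.
have -> : v ((p ^ n)%:R * pev (ptl w') (kcoef x i)) =
  v ((p ^ n)%:R * (pev (ptl w') (kcoef x i) * prt w' 0 n ^+ i)).
  by rewrite !avM avX (prt_unit w' _ us) // expr1n mulr1.
rewrite coef_fourier; apply: av_sum_le => // k _.
by rewrite avM avX av_zeta expr1n mul1r.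
Qed.

Fixpoint mlat s n (B : R) {struct s} : kummer p_pr s n -> Prop :=
  match s return kummer p_pr s n -> Prop with
  | [::] => fun x => gle x B
  | a :: s' => fun x => forall i : 'I_(p ^ n), @mlat s' n B (kcoef x i)
  end.

Lemma mlatP s n (B : R) (x : kummer p_pr s n) : units s -> 0 <= B ->
  (forall w : pt s, v (pev w x) <= B) -> mlat (B / q ^+ (n * size s)) x.
Proof.
elim: s B x => [|a s IH] B x us B0 h /=.
  rewrite muln0 divr1; apply: tate_max => // z hz.
  by have [w wz] := pt_ex [::] hz; rewrite -wz; exact: h.
move=> i; have := @IH (B / q ^+ n) (kcoef x i) (units_tl us) _ _.
rewrite mulnS exprD invfM mulrA; apply; first by rewrite divr_ge0 ?exprn_ge0 ?q_ge0.
exact: kcoef_le.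
Qed.

Lemma lattice_morph (S T : comNzRingType) (j : {rmorphism A -> S}) (j' : {rmorphism A -> T})
   (f : {rmorphism S -> T}) (l : seq S) x : (forall a, f (j a) = j' a) ->
  in_lattice j l x -> in_lattice j' (map f l) (f x).
Proof.
move=> fj [c [hc ->]]; exists c; split=> //; rewrite rmorph_sum size_map.
by apply: eq_bigr => i _; rewrite rmorphM fj (nth_map 0).
Qed.

Lemma mlat_lattice s n (c : C) : exists l : seq (kummer p_pr s n), forall x,
  mlat (v c) x -> in_lattice (str (kummer p_pr s) n) l x.
Proof.
elim: s => [|a s [l hl]] /=.
  exists [:: tconst v c] => x hx; case: (eqVneq c 0) => [c0|c0].
    exists (fun=> 0); split=> [i|]; first exact: tball0.
    rewrite big_ord_recl big_ord0 /= mul0r addr0; apply: tateP => k /=.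
    by apply/(av_eq0 v)/eqP; rewrite eq_le av_ge0 andbT; have := hx k; rewrite c0 av0.
  exists (fun=> tconst v c^-1 * x); split=> [_ k|].
    have := @gleM K (tconst v c^-1) x (v c)^-1 (v c) _ hx k.
    rewrite mulVf ?av_neq0 //; apply => -[|k'] /=; rewrite ?avV // av0.
    by rewrite invr_ge0 av_ge0.
  rewrite big_ord_recl big_ord0 addr0 /= mulrAC -tpolyC -tpolyC -tpolyM -polyCM mulVf //.
  by rewrite tpolyC mul1r.
exists [seq y * z | y <- map (qpolyC (kumpol p (kummer p_pr s) a n)) l,
   z <- [seq kumX p (kummer p_pr s) a n ^+ i | i <- iota 0 (p ^ n)]] => x hx.
rewrite [x]kum_sum; apply: lattice_sum => i; apply: latticeM.
  by apply: lattice_morph (hl _ (hx i)).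
apply: lattice_mem; apply/mapP; exists (val i) => //.
by rewrite mem_iota /= add0n ltn_ord.
Qed.

Local Notation levO s n x := (@levO R C v A idfun (kummer p_pr s) n x).

(** At a fixed level the supremum norm and the norm by coefficients are equivalent, so a function
    bounded by 1 has all its powers in one lattice. Conversely a lattice is bounded at each point,
    and a value with bounded powers has norm at most 1. This is the bridge from the algebraic
    definition of power-boundedness to functions. *)
Lemma levOP s n (x : kummer p_pr s n) : units s ->
  levO s n x <-> forall w : pt s, v (pev w x) <= 1.
Proof.
move=> us; split=> [[l hl] w|h].
  pose M := \big[Num.max/1]_(y <- l) v (pev w y).
  have hM y : y \in l -> v (pev w y) <= M.
    rewrite /M; elim: l {hl M} => [//|b l IH]; rewrite inE big_cons le_max.
    by case/orP => [/eqP->|/IH->]; rewrite ?lexx // orbT.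
  have M1 : 1 <= M.
    rewrite /M; elim: l {hl M hM} => [|b l IH]; first by rewrite big_nil.
    by rewrite big_cons le_max IH orbT.
  apply: (@av_pow_bounded _ _ _ _ M) => k; rewrite -avX -rmorphXn.
  have [c [hc ->]] := hl k; rewrite rmorph_sum.
  apply: av_sum_le => [|i _]; first by apply: le_trans M1.
  rewrite rmorphM avM /= pev_str -[M]mul1r; apply: ler_pM; rewrite ?av_ge0 //.
    by apply: (tev_le ler01 (pz_le1 w)); exact: hc.
  exact/hM/mem_nth.
have [l hl] := mlat_lattice s n ((p%:R ^+ (n * size s))^-1 : C).
exists l => k; apply: (hl (x ^+ k)).
rewrite avV avX -[X in mlat X]mul1r; apply: mlatP => // w.
by rewrite rmorphXn; exact/avX1/h.
Qed.

Lemma pev_bounded s n (x : kummer p_pr s n) : units s ->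
  exists k, forall w : pt s, v (pev w x) <= (q ^+ k)^-1.
Proof.
have q0 k : 0 <= (q ^+ k)^-1 by rewrite invr_ge0 exprn_ge0 ?q_ge0.
elim: s x => [|a s IH] x us.
  by have [m hm] := gle_big x; exists m => w; apply: tev_le (hm); rewrite ?pz_le1.
have H N : exists k, forall i, (i < N)%N -> forall w : pt s, v (pev w (kcoef x i)) <= (q ^+ k)^-1.
  elim: N => [|N [k hk]]; first by exists 0%N.
  have [l hl] := IH (kcoef x N) (units_tl us); exists (k + l)%N => i.
  have mono k1 k2 : (k1 <= k2)%N -> (q ^+ k1)^-1 <= (q ^+ k2)^-1.
    by move=> k12; rewrite lef_pV2 ?posrE ?exprn_gt0 ?q_gt0 // q_anti.
  rewrite ltnS leq_eqVlt => /orP[/eqP->|/hk h] w.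
    by apply: le_trans (hl w) _; apply: mono; exact: leq_addl.
  by apply: le_trans (h w) _; apply: mono; exact: leq_addr.
have [k hk] := H (p ^ n)%N; exists k => w; rewrite pev_sum.
apply: av_sum_le => // i _; rewrite avM avX (prt_unit w _ us) // expr1n mulr1.
exact: hk.
Qed.

Definition kscal s n (c : C) : kummer p_pr s n := str (kummer p_pr s) n (tconst v c).

Lemma pev_scal s (w : pt s) n c : pev w (kscal s n c) = c.
Proof. by rewrite pev_str tev_const // pz_le1. Qed.

Lemma kscal_nat s n k : kscal s n k%:R = k%:R.
Proof. by rewrite /kscal -tpolyC !rmorph_nat. Qed.

Lemma kscalM s n c d : kscal s n (c * d) = kscal s n c * kscal s n d.
Proof. by rewrite /kscal -!tpolyC !rmorphM. Qed.

Lemma pOP s n m (x : kummer p_pr s n) : units s ->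
  pO p idfun m x <-> forall w : pt s, v (pev w x) <= q ^+ m.
Proof.
move=> us; split=> [[y hy <-] w|h].
  rewrite rmorphM rmorphXn rmorph_nat avM avX ler_piMr ?exprn_ge0 ?q_ge0 //.
  exact: (levOP _ us).1.
have qm : (p%:R : C) ^+ m != 0 by rewrite expf_neq0 ?pC_neq0.
exists (kscal s n (p%:R ^+ m)^-1 * x).
  apply/(levOP _ us) => w; rewrite rmorphM /= pev_scal avM avV avX mulrC.
  by rewrite ler_pdivrMr ?mul1r ?exprn_gt0 ?q_gt0 //.
have -> : p%:R ^+ m = kscal s n (p%:R ^+ m).
  by rewrite -!natrX kscal_nat.
by rewrite mulrA -kscalM mulfV // (kscal_nat s n 1) mul1r.
Qed.

End Kummer.

(** * The completed tower as an algebra of functions *)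

Section Completed.
Variable K : cpdata.
Local Notation R := (cpR K).
Local Notation p := (cpp K).
Local Notation p_pr := (cpp_pr K).
Local Notation C := (cpC K).
Local Notation v := (cpv K).
Local Notation q := (v p%:R).
Local Notation A := (tate v).
Variables (s : seq A) (us : units s).
Local Notation tw := (kummer p_pr s).
Local Notation E := (compl p (@idfun A) tw).
Local Notation cauchy := (@cauchy R C v p A idfun tw).
Local Notation null := (@null R C v p A idfun tw).
Local Notation cseq := (@cseq R C v p A idfun tw).
Local Notation cplus := (@cplus R C v p A idfun tw).

Lemma cauchyP (x : forall n, tw n) : cauchy x <->
  (exists k N, forall n, (N <= n)%N -> forall w : pt s, v (pev w (x n)) <= (q ^+ k)^-1) /\
  (forall m, exists N, forall n, (N <= n)%N -> forall w : pt s,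
      v (pev w (x n.+1) - pev w (x n)) <= q ^+ m).
Proof.
have e k n (w : pt s) (y : tw n) : v (pev w (p%:R ^+ k * y)) = q ^+ k * v (pev w y).
  by rewrite rmorphM rmorphXn rmorph_nat avM avX.
split=> -[[k [N h]] h2]; split.
- exists k, N => n /h/(levOP _ us) {}h w.
  by rewrite -[leRHS]div1r ler_pdivlMr ?exprn_gt0 ?q_gt0 // mulrC -e; exact: h.
- move=> m; have [M {}h2] := h2 m; exists M => n /h2/(pOP _ _ us) {}h2 w.
  by have := h2 w; rewrite rmorphB /= pev_tr.
- exists k, N => n /h {}h; apply/(levOP _ us) => w; rewrite e.
  by rewrite mulrC -ler_pdivlMr ?exprn_gt0 ?q_gt0 // div1r; exact: h.
- move=> m; have [M {}h2] := h2 m; exists M => n /h2 {}h2; apply/(pOP _ _ us) => w.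
  by rewrite rmorphB /= pev_tr.
Qed.

Lemma nullP (x : forall n, tw n) : null x <->
  forall m, exists N, forall n, (N <= n)%N -> forall w : pt s, v (pev w (x n)) <= q ^+ m.
Proof.
split=> h m; have [N {}h] := h m; exists N => n /h {}h; first exact/(pOP _ _ us).
by apply/(pOP _ _ us).
Qed.

Definition cev (w : pt s) (x : E) : C := limC (fun n => pev w (cs (repr x) n)).

Lemma cseq_cauchyC (y : cseq) w : cauchyC (fun n => pev w (y n)).
Proof.
move=> m; have [_ /(_ m)[N h]] := (cauchyP y).1 (csP y).
by exists N => n /h.
Qed.

Lemma cev_pi (y : cseq) w : cvgC (fun n => pev w (y n)) (cev w (compl_pi y)).
Proof.
have h1 := limP (@cseq_cauchyC (repr (compl_pi y)) w).
have := repr_compl y => /asboolP/nullP h m.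
have [N hN] := h m; have [M hM] := h1 m; exists (maxn N M) => n.
rewrite geq_max => /andP[/hN/(_ w) h2 /hM h3]; apply: avBtrans h3.
by rewrite avBC; have := h2; rewrite /= rmorphB.
Qed.

Lemma cev_pi_unif (y : cseq) m : exists N, forall n, (N <= n)%N -> forall w,
  v (pev w (y n) - cev w (compl_pi y)) <= q ^+ m.
Proof.
have [_ /(_ m)[N h]] := (cauchyP y).1 (csP y).
exists N => n Nn w; rewrite avBC; apply: cvg_near (cev_pi y w) _.
  by rewrite exprn_ge0 ?q_ge0.
exists N => n' Nn'; apply: (step_le (u := fun n => pev w (y n)) (N := N)) => // i Ni.
exact: h.
Qed.

Lemma cevD w : {morph cev w : x y / x + y}.
Proof.
move=> x y; rewrite -[in LHS](compl_piK x) -[in LHS](compl_piK y) compl_piD.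
apply: cvg_unique (cev_pi _ w) _.
have := cvgD (cev_pi (repr x) w) (cev_pi (repr y) w); rewrite !compl_piK.
by apply: cvg_ext; exists 0%N => n _; rewrite /= rmorphD.
Qed.

Lemma cevM w : {morph cev w : x y / x * y}.
Proof.
move=> x y; rewrite -[in LHS](compl_piK x) -[in LHS](compl_piK y).
rewrite -[_ * _]/(complM _ _) compl_piM.
apply: cvg_unique (cev_pi _ w) _.
have := cvgM (cev_pi (repr x) w) (cev_pi (repr y) w); rewrite !compl_piK.
by apply: cvg_ext; exists 0%N => n _; rewrite /= rmorphM.
Qed.

Lemma cev1 w : cev w 1 = 1.
Proof.
apply: cvg_unique (cev_pi 1 w) _.
by apply: cvg_ext (@cvg_const K 1); exists 0%N => n _; rewrite /= rmorph1.
Qed.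

Lemma cev_zmod w : zmod_morphism (cev w).
Proof. by move=> x y; apply/eqP; rewrite eq_sym subr_eq -cevD subrK. Qed.
Lemma cev_monoid w : monoid_morphism (cev w).
Proof. by split; [exact: cev1|exact: cevM]. Qed.
HB.instance Definition _ w := GRing.isZmodMorphism.Build E C (cev w) (cev_zmod w).
HB.instance Definition _ w := GRing.isMonoidMorphism.Build E C (cev w) (cev_monoid w).

Lemma cev_inj (x y : E) : (forall w, cev w x = cev w y) -> x = y.
Proof.
move=> h; rewrite -(compl_piK x) -(compl_piK y); apply: compl_piP.
apply/asboolP/nullP => m; have [N hN] := cev_pi_unif (repr x) m.
have [M hM] := cev_pi_unif (repr y) m; exists (maxn N M) => n.
rewrite geq_max => /andP[/hN h1 /hM h2] w; rewrite /= rmorphB /=.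
apply: avBtrans (h1 w) _; rewrite avBC; have := h2 w.
by rewrite !compl_piK h.
Qed.

Lemma cauchy_tail (y : cseq) N : cauchy (fun n => if (N <= n)%N then y n else 0).
Proof.
have [[k [M hM]] h2] := (cauchyP y).1 (csP y); apply/cauchyP; split.
  exists k, (maxn N M) => n; rewrite geq_max => /andP[-> /hM h] w; exact: h.
move=> m; have [M' hM'] := h2 m; exists (maxn N M') => n.
by rewrite geq_max => /andP[Nn /hM' h] w; rewrite Nn leqW //; exact: h.
Qed.

Lemma cplusP (x : E) : cplus x <-> forall w, v (cev w x) <= 1.
Proof.
split=> [[y [hy ->]] w|h].
  apply: (cvg_le ler01 (cev_pi y w)); exists 0%N => n _.
  exact: (levOP _ us).1.
have [N hN] := cev_pi_unif (repr x) 0.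
(* Membership in [cplus] asks for power-bounded terms at every index, so the initial terms, which
   are not controlled, are replaced by 0. *)
pose y := CSeq (cauchy_tail (repr x) N).
have yx : compl_pi y = x.
  rewrite -[RHS]compl_piK; apply: compl_piP; apply/asboolP/nullP => m.
  by exists N => n Nn w; rewrite /= Nn subrr rmorph0 av0 exprn_ge0 ?q_ge0.
exists y; split=> // n; apply/(levOP _ us) => w /=.
case: ifP => [/hN/(_ w)|_]; last by rewrite rmorph0 av0.
by rewrite compl_piK expr0 => h'; apply: av_near h' _.
Qed.

Lemma cev_bounded (x : E) : exists k, forall w, v (cev w x) <= (q ^+ k)^-1.
Proof.
have [[k [N h]] _] := (cauchyP (repr x)).1 (csP (repr x)).
exists k => w; rewrite -(compl_piK x); apply: cvg_le (cev_pi (repr x) w) _.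
  by rewrite invr_ge0 exprn_ge0 ?q_ge0.
by exists N => n /h.
Qed.

Lemma cev_dense (x : E) m : exists n (y : tw n), forall w, v (cev w x - pev w y) <= q ^+ m.
Proof.
have [N hN] := cev_pi_unif (repr x) m; exists N, (repr x N) => w.
by rewrite avBC; have := hN N (leqnn _) w; rewrite compl_piK.
Qed.

Lemma lift_level n n' (x : tw n) : (n <= n')%N -> exists y : tw n', forall w : pt s, pev w y = pev w x.
Proof.
move=> nn'; rewrite -(subnK nn'); elim: (n' - n)%N => [|k [y hy]]; first by exists x.
by exists (tr tw (k + n) y) => w; rewrite pev_tr.
Qed.

Lemma cev_surj (f : pt s -> C) :
  (forall m, exists n (x : tw n), forall w, v (f w - pev w x) <= q ^+ m) ->
  exists x : E, forall w, cev w x = f w.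
Proof.
move=> hf; pose Q n m (x : tw n) := forall w : pt s, v (f w - pev w x) <= q ^+ m.
(* A Cauchy sequence has its n-th term at level n, whereas the approximants come at uncontrolled
   levels. So at level n one takes an element as precise as that level permits, for the precisions
   below n. *)
have best n : exists x : tw n, forall m, (m < n)%N -> (exists y : tw n, Q n m y) -> Q n m x.
  suff: forall k, exists x : tw n, forall m, (m < k)%N -> (exists y, Q n m y) -> Q n m x by apply.
  elim=> [|k [x hx]]; first by exists 0.
  case: (pselect (exists y, Q n k y)) => [[y hy]|no].
    exists y => m mk _ w; apply: le_trans (hy w) _; exact: q_anti.
  exists x => m; rewrite ltnS leq_eqVlt => /orP[/eqP->//|]; exact: hx.
pose u n := sval (cid (best n)); have hu n := svalP (cid (best n)).
have near m : exists N, forall n, (N <= n)%N -> Q n m (u n).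
  have [n0 [x hx]] := hf m; exists (maxn n0 m.+1) => n; rewrite geq_max => /andP[n0n mn].
  apply: hu => //; have [y hy] := lift_level x n0n; exists y => w.
  by rewrite hy.
have cu : cauchy u.
  apply/cauchyP; split; last first.
    move=> m; have [N hN] := near m; exists N => n Nn w.
    apply: (@avBtrans _ _ _ _ (f w)); last by apply: hN.
    by rewrite avBC; apply: hN (leqW Nn) w.
  have [n0 [x0 hx0]] := hf 0%N; have [N hN] := near 0%N.
  have [k hk] := pev_bounded x0 us; exists k, N => n Nn w.
  have q1 : 1 <= (q ^+ k)^-1 by rewrite invf_ge1 ?exprn_gt0 ?q_gt0 // exprn_ile1 ?q_ge0 ?q_le1.
  apply: (@av_near _ _ _ _ (f w)).
    by rewrite avBC; apply: le_trans (hN n Nn w) _; rewrite expr0.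
  by apply: av_near (hk w); apply: le_trans (hx0 w) _; rewrite expr0.
exists (compl_pi (CSeq cu)) => w; apply: cvg_unique (cev_pi _ w) _ => m.
by have [N hN] := near m; exists N => n Nn; rewrite avBC; apply: hN.
Qed.

Lemma cev_clim (y : forall n, tw n) w : cauchy y ->
  cvgC (fun n => pev w (y n)) (cev w (clim p idfun y)).
Proof.
by move=> hy; rewrite /clim; case: pselect => // h; exact: (cev_pi (CSeq h) w).
Qed.

Lemma cauchy_const_str (b : A) : cauchy (fun n => str tw n b).
Proof.
apply/cauchyP; split.
  have [m hm] := gle_big b; exists m, 0%N => n _ w; rewrite pev_str.
  by apply: tev_le => //; rewrite ?pz_le1 // invr_ge0 exprn_ge0 ?q_ge0.
by move=> m; exists 0%N => n _ w; rewrite !pev_str subrr av0 exprn_ge0 ?q_ge0.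
Qed.

Lemma cev_cst b w : cev w (cst p idfun tw b) = tev (pz w) b.
Proof.
apply: cvg_unique (cev_clim w (cauchy_const_str b)) _.
by apply: cvg_ext (@cvg_const K _); exists 0%N => n _; rewrite pev_str.
Qed.

Lemma pev_trmax n (x : tw n) m w : (n <= m)%N -> pev w (trmax x m) = pev w x.
Proof.
move=> nm; rewrite /trmax; case: {-}_ / idP => // h.
have -> (i j : nat) (e : i = j) (y : tw i) : pev w (ecast i (tw i) e y) = pev w y by case: j / e.
by elim: (m - n)%N => //= k IH; rewrite pev_tr.
Qed.

Lemma cauchy_trmax n (x : tw n) : cauchy (trmax x).
Proof.
apply/cauchyP; split.
  by have [k hk] := pev_bounded x us; exists k, n => m nm w; rewrite pev_trmax.
move=> m; exists n => n' nn' w; rewrite !pev_trmax //; last exact: leqW.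
by rewrite subrr av0 exprn_ge0 ?q_ge0.
Qed.

Lemma cev_lev n (x : tw n) w : cev w (lev_emb p idfun x) = pev w x.
Proof.
apply: cvg_unique (cev_clim w (cauchy_trmax x)) _.
by apply: cvg_ext (@cvg_const K _); exists n => m nm; rewrite pev_trmax.
Qed.

Lemma padicP m (x : E) : padic_nbhs p cplus m x <-> forall w, v (cev w x) <= q ^+ m.
Proof.
split=> [[y /cplusP hy <-] w|h].
  by rewrite rmorphM rmorphXn rmorph_nat avM avX ler_piMr ?exprn_ge0 ?q_ge0 //; exact: hy.
have pm : (p%:R : C) ^+ m != 0 by rewrite expf_neq0 ?pC_neq0.
pose c := cst p idfun tw (tconst v (p%:R ^+ m)^-1).
have cE w : cev w c = (p%:R ^+ m)^-1 by rewrite cev_cst tev_const // pz_le1.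
exists (c * x).
  apply/cplusP => w; rewrite rmorphM /= cE avM avV avX mulrC.
  by rewrite ler_pdivrMr ?mul1r ?exprn_gt0 ?q_gt0.
apply: cev_inj => w; rewrite !rmorphM rmorphXn rmorph_nat /= cE.
by rewrite mulrA mulfV // mul1r.
Qed.
End Completed.

(** * Algebras of functions with the Frobenius property *)

Section FunAlg.
Variable K : cpdata.
Local Notation R := (cpR K).
Local Notation p := (cpp K).
Local Notation C := (cpC K).
Local Notation v := (cpv K).
Local Notation q := (v p%:R).
Variable Om : Type.
Local Notation fn := (Om -> C).
Implicit Types (D S : fn -> Prop) (f g h : fn).

Definition bd f (e : R) := forall w, v (f w) <= e.

Record calg D : Prop := Calg {
  cg_c : forall c, D (fun=> c);
  cg_D : forall f g, D f -> D g -> D (fun w => f w + g w);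
  cg_M : forall f g, D f -> D g -> D (fun w => f w * g w) }.

Record oalg S : Prop := Oalg {
  og_c : forall c, v c <= 1 -> S (fun=> c);
  og_D : forall f g, S f -> S g -> S (fun w => f w + g w);
  og_M : forall f g, S f -> S g -> S (fun w => f w * g w) }.

Lemma calg_oalg D : calg D -> oalg D.
Proof. by move=> [h1 h2 h3]; split=> // c _. Qed.

Lemma og_sum S I (r : seq I) (P : pred I) (F : I -> fn) : oalg S ->
  (forall i, P i -> S (F i)) -> S (fun w => \sum_(i <- r | P i) F i w).
Proof.
move=> hS h; elim: r => [|i r IH].
  have -> : (fun w => \sum_(i <- [::] | P i) F i w) = fun=> 0 by apply/funext => w; rewrite big_nil.
  by apply: (og_c hS); rewrite av0.
have -> : (fun w => \sum_(j <- i :: r | P j) F j w) =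
  if P i then fun w => F i w + \sum_(j <- r | P j) F j w else fun w => \sum_(j <- r | P j) F j w.
  by apply/funext => w; rewrite big_cons; case: ifP.
by case: ifP => // Pi; apply: (og_D hS) => //; exact: h.
Qed.

Lemma og_Z S c f : oalg S -> v c <= 1 -> S f -> S (fun w => c * f w).
Proof. by move=> hS hc hf; apply: (og_M hS hf) || apply: (og_M hS) => //; exact: og_c. Qed.

Lemma og_N S f : oalg S -> S f -> S (fun w => - f w).
Proof.
move=> hS hf; have -> : (fun w => - f w) = fun w => (-1) * f w by apply/funext => w; rewrite mulN1r.
by apply: og_Z => //; rewrite avN av1.
Qed.

Lemma og_B S f g : oalg S -> S f -> S g -> S (fun w => f w - g w).
Proof. by move=> hS hf hg; apply: (og_D hS) => //; apply: og_N. Qed.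

Lemma og_X S f n : oalg S -> S f -> S (fun w => f w ^+ n).
Proof.
move=> hS hf; elim: n => [|n IH]; first by apply: (og_c hS); rewrite av1.
by have := og_M hS hf IH; congr S; apply/funext => w; rewrite exprS.
Qed.

Lemma og_Mn S f n : oalg S -> S f -> S (fun w => f w *+ n).
Proof.
move=> hS hf; have := og_Z hS (av_nat v n) hf; congr S; apply/funext => w.
by rewrite mulr_natl.
Qed.

Lemma og_cross S f g : oalg S -> S f -> S g -> S (fun w => ccross p (f w) (g w)).
Proof.
move=> hS hf hg; apply: (og_sum _ hS) => i _; apply: og_Mn => //.
by apply: (og_M hS); apply: og_X.
Qed.

Lemma cg_Z D c f : calg D -> D f -> D (fun w => c * f w).
Proof. by move=> hD hf; apply: (cg_M hD) => //; exact: cg_c. Qed.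

Definition ball D f := D f /\ bd f 1.

Lemma ball_oalg D : calg D -> oalg (ball D).
Proof.
move=> hD; split=> [c hc|f g [hf bf] [hg bg]|f g [hf bf] [hg bg]].
- by split=> [|w]; first exact: cg_c.
- by split=> [|w]; [exact: cg_D|exact: avDle].
- by split=> [|w]; [exact: cg_M|exact: avM1].
Qed.

(** Semiperfectness modulo a: Frobenius is onto S/aS. *)
Definition semip S (a : C) := forall f, S f ->
  exists s r, [/\ S s, S r & forall w, f w = s w ^+ p + a * r w].

(* cancel the first two digits of an expansion f = s^p + a s'^p + a^2 r' into a
   single p-th power; the cross terms are bounded by |f| where |f| >= |a|^c *)
Lemma semip_rel S a b : oalg S -> (forall f, S f -> bd f 1) ->
  semip S a -> a = b ^+ p -> q <= v a -> v a <= 1 ->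
  forall c f, S f -> exists s r, [/\ S s, S r, forall w, f w = s w ^+ p + a * r w &
    forall w, v (r w) <= Num.max (v (f w)) (v a ^+ c)].
Proof.
move=> hS S1 hp ab qa a1.
have a0 : a != 0 by rewrite -(av_gt0 v); apply: lt_le_trans qa; exact: q_gt0.
have va0 := av_ge0 v a.
elim=> [|c IH] f Sf.
  have [s [r [Ss Sr e]]] := hp f Sf; exists s, r; split=> // w.
  by rewrite expr0 le_max S1 ?orbT.
have [s [r [Ss Sr e be]]] := IH f Sf; have [s' [r' [Ss' Sr' e' be']]] := IH r Sr.
have Sbs : S (fun w => b * s' w).
  by apply: og_Z => //; apply: (@avX_le1 _ _ _ _ p (p_gt0 K)); rewrite -ab.
have pa1 : v (p%:R / a) <= 1 by rewrite avf ler_pdivrMr ?av_gt0 // mul1r.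
exists (fun w => s w + b * s' w),
   (fun w => a * r' w - p%:R / a * ccross p (s w) (b * s' w)); split.
- exact: og_D.
- by apply: (og_B hS); apply: og_Z => //; exact: og_cross.
- move=> w; rewrite ccrossE ?cpp_pr // e e' exprMn -ab.
  rewrite [a * (a * r' w - _)]mulrBr [a * (p%:R / a * _)]mulrA [a * (_ / a)]mulrC divfK //.
  ring.
move=> w; set M := Num.max _ _.
have M0 : 0 <= M by rewrite le_max av_ge0.
have step x : x <= Num.max (v (f w)) (v a ^+ c) -> v a * x <= M.
  rewrite le_max => /orP[hx|hx]; rewrite le_max; apply/orP; [left|right].
    by apply: le_trans (ler_wpM2l va0 hx) _; rewrite ler_piMl ?av_ge0.
  by rewrite exprS; apply: ler_wpM2l.
have wk x : x <= Num.max (v (f w)) (v a ^+ c.+1) -> x <= Num.max (v (f w)) (v a ^+ c).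
  move=> hx; apply: le_trans hx _; rewrite ge_max le_max lexx /= le_max exprS.
  by rewrite ler_piMl ?exprn_ge0 ?orbT.
have hr' : v (r' w) <= Num.max (v (f w)) (v a ^+ c).
  by apply: le_trans (be' w) _; rewrite ge_max be le_max lexx orbT.
have hs : v (s w ^+ p) <= M.
  have -> : s w ^+ p = f w - a * r w by rewrite e addrK.
  by apply: avBle; [rewrite le_max lexx|rewrite avM step].
have hs' : v (s' w ^+ p) <= Num.max (v (f w)) (v a ^+ c).
  have -> : s' w ^+ p = r w - a * r' w by rewrite e' addrK.
  by apply: avBle => //; rewrite avM; apply/wk/step.
apply: avBle; first by rewrite avM step.
rewrite avM; apply: le_trans (_ : v (ccross p (s w) (b * s' w)) <= _).
  by rewrite ler_piMl ?av_ge0.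
by apply: ccross_le; rewrite ?cpp_pr // exprMn -ab avM step.
Qed.

(** The approximate root h is automatically in the ball ([frob_ball]). *)
Definition frob D := forall f, ball D f ->
  exists2 h, D h & forall w, v (f w - h w ^+ p) <= q.

Lemma frob_ball D f h : ball D f -> D h -> (forall w, v (f w - h w ^+ p) <= 1) -> ball D h.
Proof.
move=> [_ f1] Dh fh; split=> // w; apply: (@avX_le1 _ _ _ _ p (p_gt0 K)).
by apply: av_near (f1 w); rewrite avBC.
Qed.

Lemma frob_semip D : calg D -> frob D -> semip (ball D) p%:R.
Proof.
move=> hD fD f bf; have [h Dh fh] := fD f bf.
have bh : ball D h by apply: frob_ball (bf) Dh _ => w; apply: le_trans (fh w) (q_le1 K).
exists h, (fun w => p%:R^-1 * (f w - h w ^+ p)); split=> // [|w]; last first.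
  by rewrite mulVKf ?pC_neq0 // addrC subrK.
split.
  by apply: cg_Z => //; apply: (og_B (calg_oalg hD)); [case: bf|apply: og_X => //; exact: calg_oalg].
by move=> w; rewrite avM avV mulrC ler_pdivrMr ?q_gt0 // mul1r.
Qed.

(** The error is small relative to |f(w)| at each point, and not only uniformly; the approximation
    by compatible roots, and through it the division by u outside a small disc, rests on this. *)
Lemma frob_rel D : calg D -> frob D -> forall c f, ball D f ->
  exists2 h, ball D h & forall w, v (f w - h w ^+ p) <= q * Num.max (v (f w)) (q ^+ c).
Proof.
move=> hD fD c f bf; have p0 := p_gt0 K.
have [|s [r [Ss Sr e br]]] := @semip_rel (ball D) p%:R (@nroot K p p%:R) (ball_oalg hD) _
  (frob_semip hD fD) (esym (nrootK _ p0)) (lexx _) (q_le1 K) c f bf.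
  by move=> g [].
exists s => // w; have -> : f w - s w ^+ p = p%:R * r w by rewrite e addrAC subrr add0r.
by rewrite avM ler_wpM2l ?q_ge0.
Qed.

Lemma pow_arch (a : C) (e : R) : v a < 1 -> 0 < e -> exists k, v a ^+ k <= e.
Proof.
move=> a1 e0; case: (eqVneq a 0) => [->|a0].
  by exists 1%N; rewrite expr1 av0 ltW.
apply: contrapT => no; have : v a^-1 <= 1.
  apply: (@av_pow_bounded _ _ _ _ e^-1) => k; rewrite avV exprVn lef_pV2 ?posrE ?exprn_gt0 ?av_gt0 //.
  by rewrite leNgt; apply/negP => h; apply: no; exists k; exact: ltW.
by rewrite avV invf_le1 ?av_gt0 // leNgt a1.
Qed.

(** An error a e is corrected by adding b h', where b is a p-th root of a and h' an approximate p-th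
    root of e; the cross term is divisible by p. *)
Lemma frob_bump D a : calg D -> v a < 1 ->
  (forall f, ball D f -> exists2 h, D h & forall w, v (f w - h w ^+ p) <= v a) -> frob D.
Proof.
move=> hD a1 H; have p0 := p_gt0 K.
pose b := @nroot K p a; have ba : b ^+ p = a by exact: nrootK.
case: (eqVneq a 0) => [a0|a0].
  move=> f /H[h Dh fh]; exists h => // w; apply: le_trans (fh w) _.
  by rewrite a0 av0 q_ge0.
have [k hk] := pow_arch a1 (q_gt0 K).
suff HH : forall k f, ball D f -> exists2 h, D h & forall w, v (f w - h w ^+ p) <= Num.max q (v a ^+ k).
  move=> f /(HH k)[h Dh fh]; exists h => // w; apply: le_trans (fh w) _.
  by rewrite ge_max lexx.
have b1 : v b <= 1 by apply: (@avX_le1 _ _ _ _ p p0); rewrite ba ltW.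
elim=> [|{hk}k IH] f bf.
  exists (fun=> 0) => [|w]; first exact: cg_c.
  by rewrite expr0n gtn_eqF // subr0 expr0 le_max; case: bf => _ ->; rewrite orbT.
have [h Dh fh] := H f bf.
have bh : ball D h by apply: frob_ball (bf) Dh _ => w; apply: le_trans (fh w) (ltW a1).
have [|h' Dh' fh'] := IH (fun w => a^-1 * (f w - h w ^+ p)).
  split; last by move=> w; rewrite avM avV mulrC ler_pdivrMr ?av_gt0 // mul1r.
  by apply: cg_Z => //; apply: (og_B (calg_oalg hD)); [case: bf|apply: og_X => //; exact: calg_oalg].
exists (fun w => h w + b * h' w) => [|w].
  by apply: cg_D => //; apply: cg_Z.
rewrite ccrossE ?cpp_pr // exprMn ba.
have -> : f w - (h w ^+ p + a * h' w ^+ p + p%:R * ccross p (h w) (b * h' w)) =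
  a * (a^-1 * (f w - h w ^+ p) - h' w ^+ p) - p%:R * ccross p (h w) (b * h' w).
  by rewrite mulrBr mulVKf //; ring.
have h'1 : v (h' w) <= 1.
  apply: (@avX_le1 _ _ _ _ p p0).
  apply: (@av_near _ _ _ _ (a^-1 * (f w - h w ^+ p))).
    rewrite avBC; apply: le_trans (fh' w) _.
    by rewrite ge_max q_le1 /= exprn_ile1 ?av_ge0 // ltW.
  by rewrite avM avV mulrC ler_pdivrMr ?av_gt0 // mul1r.
apply: avBle.
  rewrite avM; apply: le_trans (ler_wpM2l (av_ge0 v a) (fh' w)) _.
  rewrite maxr_pMr ?av_ge0 // ge_max !le_max -exprS lexx orbT andbT.
  by rewrite ler_piMl ?q_ge0 // ltW.
rewrite le_max avM; apply/orP; left; rewrite ler_piMr ?q_ge0 //.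
apply: ccross_le => //; rewrite ?cpp_pr //; apply: avX1; first by case: bh => _ ->.
exact: avM1.
Qed.

Definition cl S := fun f => forall m, exists2 g, S g & forall w, v (f w - g w) <= q ^+ m.

Lemma cl_sub S f : S f -> cl S f.
Proof. by move=> Sf m; exists f => // w; rewrite subrr av0 exprn_ge0 ?q_ge0. Qed.

Lemma cl_mono S T : (forall f, S f -> T f) -> forall f, cl S f -> cl T f.
Proof. by move=> ST f h m; have [g Sg fg] := h m; exists g => //; exact: ST. Qed.

Lemma cl_cl S f : cl (cl S) f -> cl S f.
Proof.
move=> h m; have [g cg fg] := h m; have [g' Sg gg] := cg m.
by exists g' => // w; apply: avBtrans (gg w).
Qed.

Definition bounded f := exists k, forall w, v (f w) <= (q ^+ k)^-1.

Lemma qN_ge0 k : 0 <= (q ^+ k)^-1. Proof. by rewrite invr_ge0 exprn_ge0 ?q_ge0. Qed.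
Lemma qN_ge1 k : 1 <= (q ^+ k)^-1.
Proof. by rewrite invf_ge1 ?exprn_gt0 ?q_gt0 // exprn_ile1 ?q_ge0 ?q_le1. Qed.
Lemma qn_neq0 k : q ^+ k != 0. Proof. by rewrite expf_neq0 // gt_eqF ?q_gt0. Qed.

Lemma cl_bounded S : (forall f, S f -> bounded f) -> forall f, cl S f -> bounded f.
Proof.
move=> bS f h; have [g Sg fg] := h 0%N; have [k hk] := bS g Sg; exists k => w.
by apply: av_near (hk w); apply: le_trans (fg w) _; rewrite expr0 qN_ge1.
Qed.

Lemma cl_calg D : calg D -> (forall f, D f -> bounded f) -> calg (cl D).
Proof.
move=> hD bD; split=> [c|f g hf hg m|f g hf hg m]; first by apply: cl_sub; exact: cg_c.
  have [f' Df ff] := hf m; have [g' Dg gg] := hg m.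
  exists (fun w => f' w + g' w) => [|w]; first exact: cg_D.
  by rewrite opprD addrACA; apply: avDle.
have [k hk] := cl_bounded bD hf.
have [l hl] := cl_bounded bD hg.
have [f' Df ff] := hf (m + l)%N; have [g' Dg gg] := hg (m + k)%N.
exists (fun w => f' w * g' w) => [|w]; first exact: cg_M.
have -> : f w * g w - f' w * g' w = f w * (g w - g' w) + (f w - f' w) * (g w - (g w - g' w)).
  by ring.
have e : (q ^+ k)^-1 * q ^+ (m + k) = q ^+ m by rewrite exprD mulrCA mulVf ?mulr1 ?qn_neq0.
have e' : q ^+ (m + l) * (q ^+ l)^-1 = q ^+ m by rewrite exprD -mulrA mulfV ?mulr1 ?qn_neq0.
apply: avDle; first by rewrite -e; exact: avM_le.
rewrite -e'; apply: avM_le => //; apply: avBle => //.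
by apply: le_trans (gg w) _; apply: le_trans (qN_ge1 l); rewrite exprn_ile1 ?q_ge0 ?q_le1.
Qed.

Lemma frob_cl D : calg D -> frob D -> frob (cl D).
Proof.
move=> hD fD f [cf f1]; have [g Dg fg] := cf 1%N; rewrite expr1 in fg.
have [|h Dh gh] := fD g.
  by split=> // w; apply: av_near (f1 w); rewrite avBC; apply: le_trans (fg w) (q_le1 K).
by exists h; [exact: cl_sub|move=> w; apply: avBtrans (gh w)].
Qed.

Definition ext S := fun f => exists m, S (fun w => p%:R ^+ m * f w).

Lemma ext_sub S f : oalg S -> S f -> ext S f.
Proof. by move=> hS Sf; exists 0%N; have := Sf; congr S; apply/funext => w; rewrite mul1r. Qed.

Lemma ext_calg S : oalg S -> calg (ext S).
Proof.
move=> hS; have pk k : v (p%:R ^+ k : C) <= 1 by rewrite avX exprn_ile1 ?q_ge0 ?q_le1.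
split=> [c|f g [m hf] [n hg]|f g [m hf] [n hg]].
- have [m hm] := q_big (v c); exists m; apply: (og_c hS).
  by rewrite avM avX mulrC -ler_pdivlMr ?exprn_gt0 ?q_gt0 // div1r.
- exists (m + n)%N; have := og_D hS (og_Z hS (pk n) hf) (og_Z hS (pk m) hg).
  by congr S; apply/funext => w; rewrite exprD; ring.
- exists (m + n)%N; have := og_M hS hf hg.
  by congr S; apply/funext => w; rewrite exprD; ring.
Qed.

Lemma ext_bounded S : (forall f, S f -> bd f 1) -> forall f, ext S f -> bounded f.
Proof.
move=> S1 f [m hf]; exists m => w; have := S1 _ hf w.
by rewrite avM avX mulrC -ler_pdivlMr ?exprn_gt0 ?q_gt0 // div1r.
Qed.

(** The unit ball of S[1/p] may be larger than S. If p^m f is in S, the relative bound of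
    [semip_rel] for p^m f survives the division by p^m, once the exponent c satisfies |a|^c <=
    |p|^m. *)
Lemma ext_frob S a b : oalg S -> (forall f, S f -> bd f 1) ->
  semip S a -> a = b ^+ p -> q <= v a -> v a < 1 -> frob (ext S).
Proof.
move=> hS S1 hp ab qa a1; apply: (frob_bump (a := a) (ext_calg hS) a1) => f [[m hf] f1].
have [c hc] := pow_arch a1 (exprn_gt0 m (q_gt0 K)).
have [s [r [Ss Sr e br]]] := semip_rel hS S1 hp ab qa (ltW a1) c hf.
have p0 := p_gt0 K; pose P := @nroot K p (p%:R ^+ m).
have PE : P ^+ p = p%:R ^+ m by exact: nrootK.
have P0 : P != 0.
  by apply: contra_neq (_ : p%:R ^+ m != 0 :> C) => [P0|]; rewrite ?expf_neq0 ?pC_neq0 // -PE P0 expr0n gtn_eqF.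
exists (fun w => P^-1 * s w).
  exists m; have -> : (fun w => p%:R ^+ m * (P^-1 * s w)) = fun w => P ^+ p.-1 * s w.
    by apply/funext => w; rewrite -PE -{1}(prednK p0) exprSr -!mulrA mulVKf.
  apply: og_Z => //; apply: avX1; apply: (@avX_le1 _ _ _ _ p p0).
  by rewrite PE avX exprn_ile1 ?q_ge0 ?q_le1.
move=> w; rewrite exprMn exprVn PE.
have pm : p%:R ^+ m != 0 :> C by rewrite expf_neq0 ?pC_neq0.
have -> : f w - (p%:R ^+ m)^-1 * s w ^+ p = (p%:R ^+ m)^-1 * a * r w.
  apply: (mulfI pm); rewrite mulrBr !mulrA mulfV // !mul1r e.
  by rewrite addrAC subrr add0r.
rewrite !avM avV avX mulrAC -[leRHS]mul1r; apply: ler_wpM2r; first exact: av_ge0.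
rewrite mulrC ler_pdivrMr ?exprn_gt0 ?q_gt0 // mul1r; apply: le_trans (br w) _.
rewrite ge_max hc andbT avM avX -[leRHS]mulr1 ler_wpM2l ?exprn_ge0 ?q_ge0 //.
Qed.

Inductive gen (W : fn -> Prop) : fn -> Prop :=
| gen_c c : v c <= 1 -> gen W (fun=> c)
| gen_W f : W f -> gen W f
| gen_D f g : gen W f -> gen W g -> gen W (fun w => f w + g w)
| gen_M f g : gen W f -> gen W g -> gen W (fun w => f w * g w).

Lemma gen_oalg W : oalg (gen W).
Proof. by split=> *; [exact: gen_c|exact: gen_D|exact: gen_M]. Qed.

Lemma gen_bd W : (forall f, W f -> bd f 1) -> forall f, gen W f -> bd f 1.
Proof.
move=> W1 f; elim=> {f} [c c1 w|f /W1//|f g _ hf _ hg w|f g _ hf _ hg w] //.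
  exact: avDle.
exact: avM1.
Qed.

Lemma gen_semip W a : a != 0 -> q <= v a -> v a <= 1 ->
  (forall f, W f -> exists s r, [/\ gen W s, gen W r & forall w, f w = s w ^+ p + a * r w]) ->
  semip (gen W) a.
Proof.
move=> a0 qa a1 hW f; have hS := gen_oalg W.
have pa1 : v (p%:R / a) <= 1 by rewrite avf ler_pdivrMr ?av_gt0 // mul1r.
elim=> {f} [c c1|f /hW//|f g _ [s [r [Ss Sr e]]] _ [s' [r' [Ss' Sr' e']]]|f g _ [s [r [Ss Sr e]]] _ [s' [r' [Ss' Sr' e']]]].
- exists (fun=> @nroot K p c), (fun=> 0); split.
  + by apply: gen_c; apply: (@avX_le1 _ _ _ _ p (p_gt0 K)); rewrite nrootK ?p_gt0.
  + by apply: gen_c; rewrite av0.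
  + by move=> w; rewrite nrootK ?p_gt0 // mulr0 addr0.
- exists (fun w => s w + s' w), (fun w => (r w + r' w) - p%:R / a * ccross p (s w) (s' w)); split.
  + exact: gen_D.
  + by apply: (og_B hS); [exact: gen_D|apply: og_Z => //; exact: og_cross].
  + move=> w; rewrite ccrossE ?cpp_pr // e e'.
    rewrite [a * (_ - _)]mulrBr [a * (p%:R / a * _)]mulrA [a * (_ / a)]mulrC divfK //; ring.
- exists (fun w => s w * s' w), (fun w => r w * g w + s w ^+ p * r' w); split.
  + exact: gen_M.
  + apply: gen_D; first apply: gen_M => //; last by apply: gen_M => //; exact: og_X.
    have -> : g = fun w => s' w ^+ p + a * r' w by apply/funext.
    by apply: gen_D; [exact: og_X|exact: og_Z].
  + by move=> w; rewrite exprMn e e'; ring.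
Qed.

End FunAlg.

(** * Algebras generated by p-power roots of functions close to 1 *)

Section RootAlgebra.
Variable K : cpdata.
Local Notation R := (cpR K).
Local Notation p := (cpp K).
Local Notation C := (cpC K).
Local Notation v := (cpv K).
Local Notation q := (v p%:R).
Variables (Om J : Type) (X : J -> nat -> Om -> C) (d0 : C).
Hypothesis XS : forall j n w, X j n.+1 w ^+ p = X j n w.
Hypothesis d0q : q <= v d0.
Hypothesis d01 : v d0 < 1.
Hypothesis X0 : forall j w, v (X j 0%N w - 1) <= v d0.

Let d n := @psys K d0 n.
Let a : C := @nroot K 2 p%:R.
Let a2 : a ^+ 2 = p%:R. Proof. exact: nrootK. Qed.

Let va : v a ^+ 2 = q. Proof. by rewrite -avX a2. Qed.
Let a1 : v a < 1.
Proof. by apply: (@avX_lt1 _ _ _ _ 2) => //; rewrite a2 q_lt1. Qed.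
Let a_neq0 : a != 0.
Proof. by apply/eqP => a0; have := pC_neq0 K; rewrite -a2 a0 expr0n eqxx. Qed.
Let qa : q <= v a.
Proof. by rewrite -va expr2 ler_piMl ?av_ge0 // ltW. Qed.

Let dS n : v (d n.+1) ^+ p = v (d n). Proof. by rewrite -avX psysS. Qed.

Let d_lt1 n : v (d n) < 1.
Proof.
elim: n => [//|n IH]; apply: (@avX_lt1 _ _ _ _ p (p_gt0 K)); by rewrite avX dS.
Qed.

Let d_mono n : v (d n) <= v (d n.+1).
Proof.
rewrite -dS; case: p (p_gt0 K) => // k _; rewrite exprS ler_piMr ?av_ge0 //.
by rewrite exprn_ile1 ?av_ge0 // ltW.
Qed.

Let d_q n : q <= v (d n).
Proof. by elim: n => [//|n IH]; apply: le_trans IH (d_mono n). Qed.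

Let d_neq0 n : d n != 0.
Proof. by rewrite -(av_gt0 v); apply: lt_le_trans (d_q n); exact: q_gt0. Qed.

Let d_a n : v a <= v (d n.+1).
Proof.
elim: n => [|n IH]; last by apply: le_trans IH (d_mono _).
apply: (@avX_le _ _ _ _ p) => //; rewrite ?p_gt0 ?av_ge0 // dS avX.
apply: le_trans d0q; rewrite -va; apply: ler_wiXn2l; rewrite ?av_ge0 ?p_gt1 //.
exact: ltW.
Qed.

Let X1 j n w : v (X j n w) = 1.
Proof.
elim: n => [|n IH]; last by apply: (avX_root (p_gt0 K)); rewrite XS.
by rewrite -[RHS](av1 v); apply: av_eq_lt; rewrite av1; apply: le_lt_trans (X0 j w) d01.
Qed.

Lemma root_near j n w : v (X j n w - 1) <= v (d n).
Proof.
elim: n => [|n IH]; first exact: X0.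
set e := X j n.+1 w - 1; apply: (@avX_le _ _ _ _ p); rewrite ?p_gt0 ?av_ge0 // dS.
have e1 : v e <= 1 by apply: avBle; rewrite ?X1 ?av1.
have -> : e ^+ p = (X j n w - 1) - p%:R * ccross p 1 e.
  have := ccrossE 1 e (cpp_pr K); rewrite expr1n [1 + e]addrC subrK XS => ->; ring.
apply: avBle => //; rewrite avM; apply: le_trans (d_q n); rewrite ler_piMr ?q_ge0 //.
by apply: ccross_le; rewrite ?cpp_pr ?expr1n ?av1 ?avX1.
Qed.

(** Roots enter from level 1 on, where |d_(n+1)| >= |p|^(1/p) >= |p|^(1/2) = |a|; this makes the
    cross terms in [rgen_semip] divisible by a. *)
Definition rgen (f : Om -> C) := exists j n, f = fun w => (X j n.+1 w - 1) / d n.+1.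

Definition rootalg := ext (gen rgen).

Lemma rgen_bd f : rgen f -> bd f 1.
Proof.
move=> [j [n ->]] w; rewrite avf ler_pdivrMr ?av_gt0 // mul1r; exact: root_near.
Qed.

Lemma rgen_semip f : rgen f ->
  exists s r, [/\ gen rgen s, gen rgen r & forall w, f w = s w ^+ p + a * r w].
Proof.
move=> [j [n ->]]; have hS := gen_oalg rgen.
pose s w := (X j n.+2 w - 1) / d n.+2.
have Ss : gen rgen s by apply: gen_W; exists j, n.+1.
pose c := p%:R * d n.+2 / (d n.+1 * a).
have c1 : v c <= 1.
  rewrite /c avf avM avM ler_pdivrMr ?mulr_gt0 ?av_gt0 // mul1r.
  apply: le_trans (_ : q <= _); first by rewrite ler_piMr ?q_ge0 // ltW.
  by rewrite -va expr2 ler_wpM2r ?av_ge0.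
pose T w := \sum_(i < p.-1) (d n.+2 * s w) ^+ i *+ ('C(p, i.+1) %/ p).
exists s, (fun w => c * (s w * T w)); split=> // [|w].
  apply: (og_Z hS) => //; apply: (og_M hS) => //; apply: (og_sum _ hS) => i _.
  apply: og_Mn => //; apply: og_X => //; apply: (og_Z hS) => //; exact: ltW.
have e : X j n.+2 w = 1 + d n.+2 * s w.
  by rewrite /s mulrCA mulfV // mulr1 addrC subrK.
rewrite -(XS j n.+1) e ccrossE ?cpp_pr // expr1n exprMn psysS -/(d n.+1).
have -> : ccross p 1 (d n.+2 * s w) = d n.+2 * s w * T w.
  rewrite /ccross /T mulr_sumr; apply: eq_bigr => i _.
  by rewrite expr1n mul1r mulrnAr -exprS.
have h1 := d_neq0 n.+1; rewrite /c; field.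
by rewrite h1 a_neq0.
Qed.

Lemma rootalg_calg : calg rootalg.
Proof. exact/ext_calg/gen_oalg. Qed.

Lemma rootalg_bounded f : rootalg f -> bounded f.
Proof. by apply: ext_bounded; apply: gen_bd; exact: rgen_bd. Qed.

Lemma rootalg_frob : frob rootalg.
Proof.
have pa : a = (@nroot K p a) ^+ p by rewrite nrootK ?p_gt0.
apply: (ext_frob (gen_oalg rgen) (gen_bd rgen_bd) _ pa qa a1).
by apply: gen_semip => //; [exact: ltW|exact: rgen_semip].
Qed.

Lemma rootalg_root j n : rootalg (X j n).
Proof.
have hD := rootalg_calg.
have H k : rootalg (X j k.+1).
  have : rootalg (fun w => 1 + d k.+1 * ((X j k.+1 w - 1) / d k.+1)).
    apply: (cg_D hD); first exact: (cg_c hD).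
    apply: cg_Z => //; apply: (ext_sub (gen_oalg rgen)); apply: gen_W.
    by exists j, k.
  congr rootalg; apply/funext => w.
  by rewrite mulrCA mulfV // mulr1 addrC subrK.
case: n => // ; have := og_X p (calg_oalg hD) (H 0%N).
by congr rootalg; apply/funext => w; rewrite XS.
Qed.

Lemma rootalg_min D : calg D -> (forall j n, D (X j n)) -> forall f, rootalg f -> D f.
Proof.
move=> hD hX f [m hf].
have -> : f = fun w => (p%:R ^+ m)^-1 * (p%:R ^+ m * f w).
  by apply/funext => w; rewrite mulKf // expf_neq0 ?pC_neq0.
apply: cg_Z => //; elim: hf => {f} [c _|_ [j [n ->]]|f g _ hf _ hg|f g _ hf _ hg].
- exact: (cg_c hD).
- have := cg_Z (d n.+1)^-1 hD (cg_D hD (hX j n.+1) (cg_c hD (-1))).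
  by congr D; apply/funext => w; rewrite mulrC.
- exact: (cg_D hD).
- exact: (cg_M hD).
Qed.
End RootAlgebra.

(** * Approximation by elements with compatible p-power roots *)

Section Tilt.
Variable K : cpdata.
Local Notation R := (cpR K).
Local Notation p := (cpp K).
Local Notation C := (cpC K).
Local Notation v := (cpv K).
Local Notation q := (v p%:R).

(** The familiar gain of a factor p in a congruence under p-th powers, here relative to a scale M
    that may be small. *)
Lemma powdiff (a b : C) (e M : R) : 0 <= M -> 0 <= e -> e <= q ->
  v (a - b) <= e * M -> v b <= M -> v (a ^+ p - b ^+ p) <= q * e * M ^+ p.
Proof.
move=> M0 e0 eq ab bM; have p0 := p_gt0 K; have p1 := p_gt1 K.
have e1 : e <= 1 by apply: le_trans eq (q_le1 K).
have eM : 0 <= e * M by rewrite mulr_ge0.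
have -> : a ^+ p - b ^+ p = (a - b) ^+ p + p%:R * ccross p (a - b) b.
  by rewrite -{1}(subrK b a) ccrossE ?cpp_pr //; ring.
have h : v ((a - b) ^+ p) <= (e * M) ^+ p by rewrite avX; apply: lerXn2r; rewrite ?nnegrE ?av_ge0.
apply: avDle.
  apply: le_trans h _; rewrite exprMn; apply: ler_wpM2r; first exact: exprn_ge0.
  apply: le_trans (_ : e ^+ 2 <= _); first exact: ler_wiXn2l.
  by rewrite expr2 ler_wpM2r.
rewrite avM -mulrA; apply: ler_wpM2l; first exact: q_ge0.
apply: av_sum_le => [|i _]; first by rewrite mulr_ge0 // exprn_ge0.
apply: le_trans (avMn _ _ _) _; rewrite avM !avX.
apply: le_trans (_ : (e * M) ^+ (p - i.+1) * M ^+ i.+1 <= _).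
  apply: ler_pM; rewrite ?exprn_ge0 ?av_ge0 //; apply: lerXn2r; rewrite ?nnegrE ?av_ge0 //.
have ip : (i.+1 < p)%N by have := ltn_ord i; lia.
rewrite exprMn -mulrA -exprD subnK; last exact: ltnW.
apply: ler_wpM2r; first exact: exprn_ge0.
rewrite -[leRHS]expr1; apply: ler_wiXn2l => //; lia.
Qed.

Lemma powdiff_iter (a b : C) (M : R) j : 0 <= M -> v (a - b) <= q * M -> v b <= M ->
  v (a ^+ (p ^ j) - b ^+ (p ^ j)) <= q ^+ j.+1 * M ^+ (p ^ j).
Proof.
move=> M0 ab bM; elim: j => [|j IH]; first by rewrite !expr1.
rewrite !expnSr !exprM [q ^+ j.+2]exprS; apply: powdiff => //; rewrite ?exprn_ge0 ?q_ge0 //.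
  by rewrite exprS ler_piMr ?q_ge0 // exprn_ile1 ?q_ge0 ?q_le1.
by rewrite avX; apply: lerXn2r; rewrite ?nnegrE ?av_ge0.
Qed.

Variable Om : Type.
Variable D : (Om -> C) -> Prop.
Hypotheses (hD : calg D) (fD : frob D) (cD : forall f, cl D f -> D f).

(** The system U is an element of the tilt whose untilt approximates f. With s_0 = f and s_(j+1) an
    approximate p-th root of s_j, one takes U_k = lim s_(k+j)^(p^j). *)
Lemma tilt_lift (f : Om -> C) (c : C) : ball D f -> c != 0 -> v c <= 1 ->
  exists U : nat -> Om -> C, [/\ forall k, ball D (U k), forall k w, U k.+1 w ^+ p = U k w &
    forall w, v (f w - U 0%N w) <= q * Num.max (v (f w)) (v c)].
Proof.
move=> bf c0 c1; have p0 := p_gt0 K.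
have [n hn] := q_arch (e := v c) (etrans (av_gt0 v c) c0).
have /choice[st hst] : forall g, exists h, ball D g -> ball D h /\
    forall w, v (g w - h w ^+ p) <= q * Num.max (v (g w)) (v c).
  move=> g.
  case: (pselect (ball D g)) => [bg|nb]; last by exists g.
  have [h bh gh] := frob_rel hD fD n bg; exists h => _; split=> // w.
  apply: le_trans (gh w) _; apply: ler_wpM2l; first exact: q_ge0.
  by rewrite ge_max !le_max lexx /= (ltW hn) orbT.
pose s j := iter j st f.
have bs j : ball D (s j) by elim: j => [|j IH] //=; case: (hst _ IH).
pose e j := v (@psys K c j).
have eS j : e j.+1 ^+ p = e j by rewrite -avX psysS.
have e1 j : e j <= 1.
  by elim: j => [//|j IH]; apply: (@avX_le1 _ _ _ _ p p0); rewrite avX eS.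
have ec j : v c <= e j.
  elim: j => [//|j IH]; apply: le_trans IH _; rewrite -eS -{2}[e j.+1]expr1.
  by apply: ler_wiXn2l; rewrite ?av_ge0.
(* The scale satisfies M_(j+1)^p <= M_j, so errors stay relative to max(|f|, |c|) after raising to
   the power p^j. *)
pose M j w := Num.max (v (s j w)) (e j).
have M0 j w : 0 <= M j w by rewrite le_max av_ge0.
have M1 j w : M j w <= 1 by rewrite ge_max e1 andbT; case: (bs j).
have ds j w : v (s j.+1 w ^+ p - s j w) <= q * M j w.
  rewrite avBC; have [_ h] := hst _ (bs j); apply: le_trans (h w) _.
  by apply: ler_wpM2l; rewrite ?q_ge0 // ge_max !le_max lexx /= ec orbT.
have MS j w : M j.+1 w ^+ p <= M j w.
  rewrite /M; case: (leP (v (s j.+1 w))) => _; first by rewrite eS le_max lexx orbT.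
  rewrite -avX; apply: av_near (_ : v (s j w) <= _); last by rewrite le_max lexx.
  by apply: le_trans (ds j w) _; rewrite ler_piMl ?q_le1.
have Mj k j w : M (k + j)%N w ^+ (p ^ j) <= M k w.
  elim: j => [|j IH]; first by rewrite addn0 expr1.
  rewrite addnS expnS exprM; apply: le_trans IH.
  by apply: lerXn2r; rewrite ?nnegrE ?exprn_ge0.
pose x k w j := s (k + j)%N w ^+ (p ^ j).
have dx k w j : v (x k w j.+1 - x k w j) <= q ^+ j.+1 * M k w.
  rewrite /x addnS expnS exprM.
  apply: le_trans (powdiff_iter j (M0 (k + j)%N w) (ds _ _) _) _; first by rewrite le_max lexx.
  by apply: ler_wpM2l; rewrite ?exprn_ge0 ?q_ge0.
have dx' k w j : v (x k w j.+1 - x k w j) <= q ^+ j.+1.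
  by apply: le_trans (dx k w j) _; rewrite ler_piMr ?exprn_ge0 ?q_ge0.
have cx k w : cauchyC (x k w).
  move=> m; exists m => j mj; apply: le_trans (dx' k w j) _; apply: q_anti; exact: leqW.
pose U k w := limC (x k w).
have Ux k w : cvgC (x k w) (U k w) by apply: limP.
have near k w m : v (U k w - x k w m) <= q ^+ m.+1.
  apply: (cvg_near _ (Ux k w)); first by rewrite exprn_ge0 ?q_ge0.
  exists m => j mj; apply: (@step_le _ _ _ m) => // i mi.
  by apply: le_trans (dx' k w i) _; apply: q_anti.
have bU k : ball D (U k).
  split; last first.
    move=> w; apply: (av_near (y := x k w 0%N)); last by rewrite /x expn0 expr1; case: (bs (k + 0)%N).
    by apply: le_trans (near k w 0%N) _; rewrite expr1 q_le1.
  apply: cD => m; exists (fun w => x k w m); last first.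
    by move=> w; apply: le_trans (near k w m) _; apply: q_anti.
  by apply: (og_X _ (calg_oalg hD)); case: (bs (k + m)%N).
exists U; split=> // [k w|w].
  apply: (cvg_unique (u := fun j => x k w j.+1)); last first.
    by apply: (cvg_ext _ (cvg_shift 1 (Ux k w))); exists 0%N => j _; rewrite addn1.
  apply: (cvg_ext _ (cvgX p (Ux k.+1 w))); exists 0%N => j _.
  by rewrite /x expnSr exprM addSnnS.
rewrite avBC; apply: (cvg_near _ (Ux 0%N w)); first by rewrite mulr_ge0 ?q_ge0 // le_max av_ge0.
exists 0%N => j _; have -> : f w = x 0%N w 0%N by rewrite /x expn0 expr1.
apply: (@step_le _ _ _ 0%N) => // i _.
apply: le_trans (dx 0%N w i) _; apply: ler_wpM2r; first exact: (M0 0%N w).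
by rewrite exprS ler_piMr ?q_ge0 // exprn_ile1 ?q_ge0 ?q_le1.
Qed.

End Tilt.

(** * Closedness under p-th roots after adjoining the roots of a quotient U/g *)

Section Radical.
Variable K : cpdata.
Local Notation R := (cpR K).
Local Notation p := (cpp K).
Local Notation C := (cpC K).
Local Notation v := (cpv K).
Local Notation q := (v p%:R).
Variable Om : Type.
Variable D : (Om -> C) -> Prop.
Hypotheses (hD : calg D) (fD : frob D).

Let hO := ball_oalg hD.

(** A polynomial in one variable over the ball of D; the uniform degree bound makes a family of
    polynomials a single one over an algebra of functions. *)
Definition pp (P : Om -> {poly C}) :=
  (exists N, forall w, (size (P w) <= N)%N) /\ forall i, ball D (fun w => (P w)`_i).

Lemma ball0 : ball D (fun=> 0).
Proof. by apply: (og_c hO); rewrite av0. Qed.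

Lemma ppC f : ball D f -> pp (fun w => (f w)%:P).
Proof.
move=> bf; split=> [|i]; first by exists 1%N => w; exact: size_polyC_leq1.
case: i => [|i].
  by have := bf; congr (ball D _); apply/funext => w; rewrite coefC.
by have := ball0; congr (ball D _); apply/funext => w; rewrite coefC.
Qed.

Lemma ppXn n : pp (fun=> 'X^n).
Proof.
split=> [|i]; first by exists n.+1 => w; rewrite size_polyXn.
by apply: (og_c hO); rewrite coefXn; exact: av_nat.
Qed.

Lemma ppD P Q : pp P -> pp Q -> pp (fun w => P w + Q w).
Proof.
move=> [[N hN] hP] [[M hM] hQ]; split=> [|i].
  exists (maxn N M) => w; apply: leq_trans (size_polyD _ _) _.
  by rewrite geq_max !leq_max hN hM orbT.
by have := og_D hO (hP i) (hQ i); congr (ball D _); apply/funext => w; rewrite coefD.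
Qed.

Lemma ppM P Q : pp P -> pp Q -> pp (fun w => P w * Q w).
Proof.
move=> [[N hN] hP] [[M hM] hQ]; split=> [|i].
  exists (N + M)%N => w; apply: leq_trans (size_polyMleq _ _) _.
  by apply: leq_trans (leq_pred _) _; apply: leq_add.
have := @og_sum _ _ (ball D) _ (index_enum 'I_i.+1) predT
  (fun (j : 'I_i.+1) w => (P w)`_j * (Q w)`_(i - j)) hO (fun j _ => og_M hO (hP _) (hQ _)).
by congr (ball D _); apply/funext => w; rewrite coefM.
Qed.

Lemma ppZ c P : v c <= 1 -> pp P -> pp (fun w => c%:P * P w).
Proof. by move=> c1; apply: ppM; apply: ppC; exact: (og_c hO). Qed.

Lemma pp_exp P n : pp P -> pp (fun w => P w ^+ n).
Proof.
move=> hP; elim: n => [|n IH]; first exact: (ppXn 0).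
by have := ppM hP IH; congr pp; apply/funext => w; rewrite exprS.
Qed.

Lemma ppN P : pp P -> pp (fun w => - P w).
Proof.
move=> hP; have := @ppZ (-1) P _ hP; rewrite avN av1 => /(_ (lexx _)).
by congr pp; apply/funext => w; rewrite polyCN mulN1r.
Qed.

Lemma pp_comp P n : (0 < n)%N -> pp P -> pp (fun w => P w \Po 'X^n).
Proof.
move=> n0 [[N hN] hP]; split=> [|i].
  exists (N * n).+1 => w; case: (eqVneq (P w) 0) => [->|P0]; first by rewrite comp_poly0 size_poly0.
  have := size_comp_poly (P w) 'X^n; rewrite size_polyXn /= => e.
  apply: leq_trans (leqSpred _) _; rewrite ltnS e leq_mul2r; apply/orP; right.
  by apply: leq_trans (leq_pred _) _.
case: (boolP (n %| i)%N) => ni.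
  by have := hP (i %/ n)%N; congr (ball D _); apply/funext => w; rewrite coef_comp_poly_Xn // ni.
by have := ball0; congr (ball D _); apply/funext => w; rewrite coef_comp_poly_Xn // (negPf ni).
Qed.

Lemma pp_horner P x w : pp P -> v x <= 1 -> v (P w).[x] <= 1.
Proof.
move=> [_ hP] x1; rewrite horner_coef; apply: av_sum_le => // i _.
by apply: avM1; [case: (hP i)|exact: avX1].
Qed.

Lemma horner_in S P f : oalg S -> (forall g, ball D g -> S g) -> pp P -> S f ->
  S (fun w => (P w).[f w]).
Proof.
move=> hS DS [[N hN] hP] Sf.
have := @og_sum _ _ S _ (index_enum 'I_N) predT
  (fun (j : 'I_N) w => (P w)`_j * f w ^+ j) hS
   (fun j _ => og_M hS (DS _ (hP j)) (og_X j hS Sf)).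
by congr S; apply/funext => w; rewrite (horner_coef_wide _ (hN w)).
Qed.

Lemma frob_big (I : Type) (r : seq I) (F : I -> C) : (forall i, v (F i) <= 1) ->
  v ((\sum_(i <- r) F i) ^+ p - \sum_(i <- r) F i ^+ p) <= q.
Proof.
move=> F1; have p0 := p_gt0 K; elim: r => [|i r IH].
  by rewrite !big_nil expr0n gtn_eqF // subrr av0 q_ge0.
rewrite !big_cons ccrossE ?cpp_pr //; set S := \sum_(_ <- _) F _; set T := \sum_(_ <- _) _.
have S1 : v S <= 1 by apply: av_sum_le.
have -> : F i ^+ p + S ^+ p + p%:R * ccross p (F i) S - (F i ^+ p + T) =
   (S ^+ p - T) + p%:R * ccross p (F i) S by ring.
apply: avDle => //; rewrite avM ler_piMr ?q_ge0 //.
by apply: ccross_le; rewrite ?cpp_pr ?avX1.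
Qed.

Lemma pp_root P : pp P -> exists2 Q, pp Q &
  forall w x, v x <= 1 -> v ((Q w).[x] ^+ p - (P w).[x ^+ p]) <= q.
Proof.
move=> [[N hN] hP]; have p0 := p_gt0 K.
have /choice[h hh] : forall i, exists h, ball D h /\ forall w, v ((P w)`_i - h w ^+ p) <= q.
  move=> i; have [h Dh e] := fD (hP i); exists h; split=> //.
  by apply: frob_ball (hP i) Dh _ => w; apply: le_trans (e w) (q_le1 K).
exists (fun w => \poly_(i < N) h i w).
  split=> [|i]; first by exists N => w; exact: size_poly.
  case: (ltnP i N) => iN.
    by have := (hh i).1; congr (ball D _); apply/funext => w; rewrite coef_poly iN.
  by have := ball0; congr (ball D _); apply/funext => w; rewrite coef_poly ltnNge iN.
move=> w x x1; rewrite horner_poly (horner_coef_wide _ (hN w)).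
apply: avBtrans.
  apply: frob_big => i; apply: avM1; last exact: avX1.
  by case: (hh i) => -[].
rewrite -sumrB; apply: av_sum_le => [|i _]; first exact: q_ge0.
rewrite exprMn -!exprM mulnC -mulrBl avM avBC; apply: le_trans (ler_wpM2l (av_ge0 _ _) (avX1 _ x1)) _.
by rewrite mulr1; case: (hh i).
Qed.

Variables (U : nat -> Om -> C) (g : nat -> C).
Hypotheses (bU : forall k, ball D (U k)) (US : forall k w, U k.+1 w ^+ p = U k w).
Hypotheses (g_neq0 : forall k, g k != 0) (g_le1 : forall k, v (g k) <= 1).
Hypothesis gS : forall k, g k.+1 ^+ p = g k.

(** The p^k-th root of U_0/g_0; unlike the elements of the ball it may exceed 1 in norm. *)
Definition tz k w := U k w / g k.
Lemma tzS k w : tz k.+1 w ^+ p = tz k w.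
Proof. by rewrite /tz expr_div_n US gS. Qed.

Definition tgen : (Om -> C) -> Prop :=
  gen (fun f => ball D f \/ exists k, f = tz k).

Lemma tgen_oalg : oalg tgen. Proof. exact: gen_oalg. Qed.
Lemma tgen_ball f : ball D f -> tgen f. Proof. by move=> h; apply: gen_W; left. Qed.
Lemma tgen_tz k : tgen (tz k). Proof. by apply: gen_W; right; exists k. Qed.

Lemma tgen_poly f : tgen f -> exists k0, forall k, (k0 <= k)%N ->
  exists2 P, pp P & forall w, f w = (P w).[tz k w].
Proof.
elim=> {f} [c c1|f|f h _ [k0 IH] _ [k1 IH']|f h _ [k0 IH] _ [k1 IH']].
- exists 0%N => k _; exists (fun=> c%:P) => [|w]; last by rewrite hornerC.
  by apply: ppC; exact: (og_c hO).
- case=> [bf|[j ->]].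
    by exists 0%N => k _; exists (fun w => (f w)%:P) => [|w]; [exact: ppC|rewrite hornerC].
  exists j => k jk; exists (fun=> 'X^(p ^ (k - j))) => [|w]; first exact: ppXn.
  by rewrite hornerXn -(psys_powD (r := fun i => tz i w) (k - j) j (fun i => tzS i w)) subnK.
- exists (maxn k0 k1) => k; rewrite geq_max => /andP[/IH[P hP e] /IH'[Q hQ e']].
  by exists (fun w => P w + Q w) => [|w]; [exact: ppD|rewrite hornerD -e -e'].
- exists (maxn k0 k1) => k; rewrite geq_max => /andP[/IH[P hP e] /IH'[Q hQ e']].
  by exists (fun w => P w * Q w) => [|w]; [exact: ppM|rewrite hornerM -e -e'].
Qed.

(** Gauss's lemma for a linear factor. The recursion between the coefficients is run from the top if
    |x| <= 1, and from the bottom, dividing by x, if |x| > 1. *)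
Lemma poly_deflate (P : {poly C}) (x : C) : P.[x] = 0 -> (forall i, v P`_i <= 1) ->
  forall i, v (P %/ ('X - x%:P))`_i <= 1.
Proof.
move=> Px P1; set G := P %/ _.
have PG : P = G * ('X - x%:P) by rewrite divpK // dvdp_XsubCl; apply/rootP.
have ec i : P`_i.+1 = G`_i - x * G`_i.+1.
  by rewrite PG mulrBr coefB coefMX coefMC /= mulrC.
have e0 : P`_0 = - (x * G`_0) by rewrite PG mulrBr coefB coefMX coefMC /= sub0r mulrC.
case: (leP (v x) 1) => x1.
  have H n i : (size G <= i + n)%N -> v G`_i <= 1.
    elim: n i => [|n IH] i h; first by rewrite nth_default ?av0 // -[i]addn0.
    have -> : G`_i = P`_i.+1 + x * G`_i.+1 by rewrite ec subrK.
    by apply: avDle => //; apply: avM1 => //; apply: IH; rewrite addSnnS.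
  by move=> i; apply: (H (size G)); exact: leq_addl.
have H z : v (x * z) <= 1 -> v z <= 1.
  move=> h; apply: le_trans h; rewrite avM ler_peMl ?av_ge0 // ltW //.
elim=> [|i IH]; apply: H; first by rewrite -avN -e0.
have -> : x * G`_i.+1 = G`_i - P`_i.+1 by rewrite ec opprB addrC subrK.
exact: avBle.
Qed.

Lemma pp_deflate P k : pp P -> (forall w, (P w).[tz k w] = 0) ->
  pp (fun w => P w %/ ('X - (tz k w)%:P)).
Proof.
move=> hP Pz; have [[N hN] hPc] := hP; set G := fun w => _.
have sG w : (size (G w) <= N)%N.
  by apply: leq_trans (hN w); exact: leq_divp.
split=> [|i]; first by exists N.
split; last first.
  by move=> w; apply: poly_deflate => // j; case: (hPc j).
have PG w : P w = G w * ('X - (tz k w)%:P) by rewrite divpK // dvdp_XsubCl; apply/rootP.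
have ec w j : (G w)`_j = (P w)`_j.+1 + tz k w * (G w)`_j.+1.
  by rewrite PG mulrBr coefB coefMX coefMC /= [_ * tz k w]mulrC subrK.
have Dz : D (tz k).
  have := cg_Z (g k)^-1 hD (bU k).1; congr D; apply/funext => w.
  by rewrite /tz mulrC.
have H n j : (N <= j + n)%N -> D (fun w => (G w)`_j).
  elim: n j => [|n IH] j h.
    have := cg_c hD 0; congr D; apply/funext => w; rewrite nth_default //.
    by apply: leq_trans (sG w) _; rewrite -[j]addn0.
  have := cg_D hD (hPc j.+1).1 (cg_M hD Dz (IH j.+1 _)); rewrite addSnnS => /(_ h).
  by congr D; apply/funext => w; rewrite -ec.
by apply: (H N); exact: leq_addl.
Qed.

(** Up to factors g_k, whose norms tend to 1, f^p in pS implies f in p^(1/p) S. Write f = P(z) and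
    f^p/p = W(z) with z = [tz k]. Then H = P^p - pW vanishes at z, so H = (X - z) G with G integral.
    If G1(X)^p approximates G(X^p), the polynomials A = g_(k+1) P(X^p) and B = (g_(k+1) X - U_(k+1))
    G1 satisfy A^p = B^p modulo p on the unit disc, and B vanishes at [tz k.+1]. *)
Lemma tgen_radical (pi : C) f : pi ^+ p = p%:R -> tgen f ->
  tgen (fun w => p%:R^-1 * f w ^+ p) ->
  exists k0, forall k, (k0 <= k)%N -> tgen (fun w => g k * pi^-1 * f w).
Proof.
move=> pip Sf Sfp; have p0 := p_gt0 K.
have pi0 : pi != 0.
  by apply/eqP => e; have := pC_neq0 K; rewrite -pip e expr0n gtn_eqF // eqxx.
have pi1 : v pi ^+ p = q by rewrite -avX pip.
have [k0 hP] := tgen_poly Sf; have [k1 hW] := tgen_poly Sfp.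
exists (maxn k0 k1).+1 => -[//|k]; rewrite ltnS geq_max => /andP[/hP[P pP eP] /hW[W pW eW]].
pose H w := P w ^+ p - p%:R%:P * W w.
have pH : pp H.
  by apply: ppD; [exact: pp_exp|apply/ppN/ppZ => //; exact: q_le1].
have Hz w : (H w).[tz k w] = 0.
  by rewrite /H hornerD hornerN hornerM horner_exp hornerC -eP -eW mulVKf ?pC_neq0 // subrr.
pose G w := H w %/ ('X - (tz k w)%:P).
have pG : pp G := pp_deflate pH Hz.
have HG w : H w = G w * ('X - (tz k w)%:P) by rewrite divpK // dvdp_XsubCl; apply/rootP; exact: Hz.
have [G1 pG1 hG1] := pp_root pG.
pose A w := (g k.+1)%:P * (P w \Po 'X^p).
pose B w := ((g k.+1)%:P * 'X^1 - (U k.+1 w)%:P) * G1 w.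
have pA : pp A by apply: ppZ => //; exact: pp_comp.
have pB : pp B.
  by apply: ppM => //; apply: ppD; [apply: ppZ => //; exact: ppXn|apply: ppN; exact: ppC].
have g1 : v (g k) <= 1 := g_le1 k.
have AB w x : v x <= 1 -> v ((A w).[x] ^+ p - (B w).[x] ^+ p) <= q.
  move=> x1.
  rewrite /A /B !hornerM hornerD hornerN !hornerM !hornerC horner_comp !hornerXn expr1.
  set y := x ^+ p; rewrite !exprMn gS; have y1 : v y <= 1 by apply: avX1.
  have e1 : (P w).[y] ^+ p = (H w).[y] + p%:R * (W w).[y].
    by rewrite /H hornerD hornerN hornerM horner_exp hornerC subrK.
  have e2 : g k * (H w).[y] = (g k * y - U k w) * (G w).[y].
    rewrite HG hornerM hornerXsubC mulrCA mulrC mulrBr /tz mulrCA mulfV // mulr1 //.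
  have U1 j : v (U j w) <= 1 by case: (bU j).
  pose c := ccross p (g k.+1 * x - U k.+1 w) (U k.+1 w).
  have c1 : v c <= 1.
    apply: ccross_le; rewrite ?cpp_pr // ?avX1 //.
    by apply: avBle => //; apply: avM1.
  have e3 : (g k.+1 * x - U k.+1 w) ^+ p = (g k * y - U k w) - p%:R * c.
    have := ccrossE (g k.+1 * x - U k.+1 w) (U k.+1 w) (cpp_pr K).
    by rewrite subrK exprMn gS US -/y -/c => ->; ring.
  rewrite e1 e3 mulrDr e2.
  have -> : (g k * y - U k w) * (G w).[y] + g k * (p%:R * (W w).[y]) -
      (g k * y - U k w - p%:R * c) * (G1 w).[x] ^+ p =
     p%:R * (g k * (W w).[y] + c * (G1 w).[x] ^+ p) -
     (g k * y - U k w) * ((G1 w).[x] ^+ p - (G w).[y]) by ring.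
  apply: avBle.
    rewrite avM ler_piMr ?q_ge0 //; apply: avDle; apply: avM1 => //; first exact: pp_horner.
    by apply: avX1; exact: pp_horner.
  rewrite avM; apply: le_trans (ler_wpM2l (av_ge0 _ _) (hG1 w x x1)) _.
  rewrite ler_piMl ?q_ge0 //; apply: avBle => //; exact: avM1.
have ABd w x : v x <= 1 -> v ((A w).[x] - (B w).[x]) <= v pi.
  move=> x1; apply: (@avX_le _ _ _ _ p); rewrite ?av_ge0 // pi1.
  have := ccrossE ((A w).[x] - (B w).[x]) ((B w).[x]) (cpp_pr K); rewrite subrK.
  set c := ccross _ _ _ => e.
  have -> : ((A w).[x] - (B w).[x]) ^+ p = ((A w).[x] ^+ p - (B w).[x] ^+ p) - p%:R * c.
    by rewrite e; ring.
  apply: avBle; first exact: AB.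
  rewrite avM ler_piMr ?q_ge0 //; apply: ccross_le; rewrite ?cpp_pr // ?avX1 //.
    by apply: avBle; exact: pp_horner.
  exact: pp_horner.
(* As [tz k.+1] may lie outside the unit disc, the bound on A - B is transferred to the coefficients
   by [poly_cauchy] before evaluating. *)
pose E w := pi^-1%:P * (A w - B w).
have pE : pp E.
  have [[N hN] hc] := ppD pA (ppN pB); split=> [|i].
    exists N => w; rewrite /E mul_polyC; apply: leq_trans (size_scale_leq _ _) (hN w).
  split=> [|w].
    by have := cg_Z pi^-1 hD (hc i).1; congr D; apply/funext => w; rewrite coefCM.
  have := @poly_cauchy K (E w) 1 1 ler01 _ i; rewrite av1 expr1n mulr1; apply=> z z1.
  rewrite hornerM hornerC hornerD hornerN avM avV mulrC ler_pdivrMr ?av_gt0 // mul1r.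
  exact: ABd.
have := horner_in tgen_oalg tgen_ball pE (tgen_tz k.+1); congr tgen; apply/funext => w.
rewrite /E hornerM hornerC hornerD hornerN /A /B !hornerM hornerD hornerN !hornerM !hornerC.
rewrite horner_comp !hornerXn tzS -eP.
have -> : g k.+1 * tz k.+1 w ^+ 1 - U k.+1 w = 0.
  by rewrite expr1 /tz mulrCA mulfV // mulr1 subrr.
by rewrite mul0r subr0 mulrCA mulrA.
Qed.

End Radical.

(** * The coordinate of the normalized cusp *)

Section Cusp.
Variable K : cpdata.
Local Notation R := (cpR K).
Local Notation p := (cpp K).
Local Notation C := (cpC K).
Local Notation v := (cpv K).
Local Notation q := (v p%:R).
Variable Om : Type.
Local Notation fn := (Om -> C).
Variables (D0 : fn -> Prop) (t : fn).

(** The last clause is a Cauchy estimate on the disc |t| <= |tau|. In [FH] the constant c is chosen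
    before Q: the loss may not grow with Q. *)
Definition cusp_expansion (y : fn) (c Q : nat) := exists N (h : nat -> fn),
  [/\ forall k, D0 (h k), forall w, h 1%N w = 0,
      forall w, y w ^+ Q = \sum_(k < N) t w ^+ k * h k w &
      forall (tau : C) (beta : R), v tau <= 1 -> 0 <= beta ->
        (forall w, v (t w) <= v tau -> v (y w) <= beta) ->
        forall k w, v (h k w) * v tau ^+ k <= (q ^+ c)^-1 * beta ^+ Q].

Hypotheses (hD0 : calg D0) (bD0 : forall f, D0 f -> bounded f) (fD0 : frob D0).
Hypotheses (t1 : forall w, v (t w) <= 1).
Hypotheses (D2 : D0 (fun w => t w ^+ 2)) (D3 : D0 (fun w => t w ^+ 3)).
Hypothesis FH : forall y, D0 y -> exists c, forall Q, cusp_expansion y c Q.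

Let D := cl D0.
Let hD : calg D. Proof. exact: cl_calg. Qed.
Let fD : frob D. Proof. exact: frob_cl. Qed.
Let cD f : cl D f -> D f. Proof. exact: cl_cl. Qed.
Let u w := t w ^+ 2.
Let bu : ball D u. Proof. by split=> [|w]; [exact: cl_sub|exact: avX1]. Qed.

Section Fixed.
Variable tau : C.
Hypotheses (tau0 : tau != 0) (tau1 : v tau <= 1).
Let gam := tau ^+ 2.
Let g := @psys K gam.
Variable U : nat -> fn.
Hypotheses (bU : forall k, ball D (U k)) (US : forall k w, U k.+1 w ^+ p = U k w).
Hypothesis uU : forall w, v (u w - U 0%N w) <= q * Num.max (v (u w)) (v gam).

Local Notation S := (tgen D U g).
Let hS : oalg S. Proof. exact: tgen_oalg. Qed.
Let DS f : ball D f -> S f. Proof. exact: tgen_ball. Qed.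

Let gam0 : gam != 0. Proof. exact: expf_neq0. Qed.
Let gam1 : v gam <= 1. Proof. exact: avX1. Qed.
Let gS k : g k.+1 ^+ p = g k. Proof. exact: psysS. Qed.
Let g0 k : g k != 0.
Proof.
elim: k => [//|k IH]; apply: contraNneq IH => e.
by rewrite -gS e expr0n gtn_eqF ?p_gt0.
Qed.
Let g1 k : v (g k) <= 1.
Proof. by elim: k => [//|k IH]; apply: (@avX_le1 _ _ _ _ p (p_gt0 K)); rewrite gS. Qed.

Let s w := u w / gam.
Let pS m (f : fn) := S (fun w => p%:R ^+ m * f w).

Let pk1 k : v (p%:R ^+ k : C) <= 1.
Proof. by rewrite avX exprn_ile1 ?q_ge0 ?q_le1. Qed.

Let pS_mono m n f : (m <= n)%N -> pS m f -> pS n f.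
Proof.
move=> mn h; have := og_Z hS (pk1 (n - m)) h; congr S; apply/funext => w.
by rewrite mulrA -exprD subnK.
Qed.

Let pS_bounded f : D f -> exists m, pS m f.
Proof.
move=> Df; have [m hm] := cl_bounded bD0 Df; exists m; apply: DS; split.
  exact: (cg_Z _ hD).
by move=> w; rewrite avM avX mulrC -ler_pdivlMr ?exprn_gt0 ?q_gt0 // mul1r.
Qed.

Let Ds : D s.
Proof.
have := cg_Z gam^-1 hD bu.1; congr D; apply/funext => w; by rewrite /s mulrC.
Qed.

(** k is twice [mk k] plus 0 or 3, except for k = 1; hence t^k is [ek k] times a power of u, where
    [ek k] is 1 or t^3. *)
Let mk k := ((k - if odd k then 3 else 0)./2)%N.
Let ek k w := if odd k then t w ^+ 3 else 1.

Let mkE k : k != 1%N -> k = ((mk k).*2 + (if odd k then 3 else 0))%N.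
Proof. by rewrite /mk; case: ifP => ok k1; lia. Qed.

Let tk k w : k != 1%N -> t w ^+ k = ek k w * u w ^+ mk k.
Proof.
move=> k1; rewrite {1}(mkE k1) exprD mulrC /ek /u -exprM mul2n; congr (_ * _).
by case: ifP.
Qed.

Let bek k : ball D (ek k).
Proof.
rewrite /ek; split=> [|w]; last by case: ifP => _; [exact: avX1|rewrite av1].
by case: (odd k); [exact: cl_sub|exact: (cg_c hD)].
Qed.

(** Turns a bound at radius |tau| into one in powers of |gam| = |tau|^2; odd k cost a factor
    |tau|^(-3), which does not depend on k. *)
Let hk_bound (c : nat) : exists2 C1, (c <= C1)%N & forall k (x : C) (B : R), k != 1%N -> 0 <= B ->
  v x * v tau ^+ k <= (q ^+ c)^-1 * B -> v gam ^+ mk k * v x <= (q ^+ C1)^-1 * B.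
Proof.
have t3 : 0 < v tau ^+ 3 by rewrite exprn_gt0 ?av_gt0.
have [m hm] := q_big (v tau ^+ 3)^-1; exists (c + m)%N; first exact: leq_addr.
move=> k x B k1 B0; set c' := (q ^+ c)^-1 => h.
have E : (q ^+ (c + m))^-1 = c' / q ^+ m by rewrite exprD invfM.
have cB : 0 <= c' * B by rewrite mulr_ge0 ?qN_ge0.
rewrite /gam avX -exprM mul2n mulrC E mulrAC.
move: h; rewrite {1}(mkE k1); case: ifP => _ h.
  rewrite exprD mulrA -ler_pdivlMr // in h; apply: le_trans h _.
  by apply: ler_wpM2l.
rewrite addn0 in h; apply: le_trans h _; apply: ler_peMr => //; exact: qN_ge1.
Qed.

(* s = z_0 + p (delta / gamma) up to S *)
Let s_split : exists a d, [/\ S a, D0 d, forall w, v (d w) <= 1,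
  forall w, v (t w) <= v tau -> v (d w) <= v gam & forall w, s w = a w + p%:R * (d w / gam)].
Proof.
have [m hm] : exists m, q ^+ m < q * v gam by apply: q_arch; rewrite mulr_gt0 ?q_gt0 // av_gt0.
have [U' DU' UU'] := (bU 0%N).1 m.
have UU w : v (U 0%N w - U' w) <= q * v gam by apply: le_trans (UU' w) (ltW hm).
have pq : 0 <= q := q_ge0 K.
exists (fun w => tz U g 0 w + - (gam^-1 * (U 0%N w - U' w))), (fun w => p%:R^-1 * (u w - U' w)).
have hd w : v (p%:R^-1 * (u w - U' w)) <= Num.max (v (u w)) (v gam).
  rewrite avM avV mulrC ler_pdivrMr ?q_gt0 //.
  rewrite [X in _ <= X]mulrC.
  apply: (avBtrans (uU w)); apply: le_trans (UU w) _.
  by apply: ler_wpM2l; rewrite // le_max lexx orbT.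
split=> [||w|w tw|w].
- apply: (og_D hS); first exact: tgen_tz.
  apply: og_N => //; apply: DS; split=> [|w].
    apply: (cg_Z _ hD); apply: (og_B (calg_oalg hD)); [by case: (bU 0%N)|exact: cl_sub].
  rewrite avM avV mulrC ler_pdivrMr ?av_gt0 // mul1r; apply: le_trans (UU w) _.
  by rewrite ler_piMl ?av_ge0 ?q_le1.
- apply: cg_Z => //; exact: (og_B (calg_oalg hD0)).
- by apply: le_trans (hd w) _; rewrite ge_max gam1 andbT; case: bu.
- apply: le_trans (hd w) _; rewrite ge_max lexx andbT /u /gam !avX.
  by apply: lerXn2r; rewrite ?nnegrE ?av_ge0.
- rewrite /s /tz; have -> : g 0 = gam by [].
  have p0 := pC_neq0 K; field; by rewrite gam0 p0.
Qed.

(** The exponents of s are kept at most Q by leaving the surplus powers of u in the coefficients;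
    these remain integral by the estimate at radius 1, that is, by |d| <= 1. *)
Let capped d : D0 d -> (forall w, v (d w) <= 1) -> (forall w, v (t w) <= v tau -> v (d w) <= v gam) ->
  exists C1, forall Q, exists N (m : nat -> nat) (h : nat -> fn),
   [/\ forall l, (m l <= Q)%N, forall l, ball D (h l) &
    forall w, p%:R ^+ C1 * (d w / gam) ^+ Q = \sum_(l < N) h l w * s w ^+ m l].
Proof.
move=> Dd d1 dg; have [c hc] := FH Dd; have [C1 cC1 hC1] := hk_bound c.
exists C1 => Q; have [N [h [Dh h10 hQ hb]]] := hc Q.
exists N, (fun l => minn (mk l) Q), (fun l w => if l == 1%N then 0 else
  p%:R ^+ C1 * gam ^+ minn (mk l) Q / gam ^+ Q * h l w * (ek l w * u w ^+ (mk l - minn (mk l) Q))).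
split=> [l|l|w]; first exact: geq_minr.
  case: eqP => [_|/eqP l1]; first exact: ball0.
  apply: (og_M (ball_oalg hD)); last first.
    by apply: (og_M (ball_oalg hD)); [exact: bek|apply: (og_X _ (ball_oalg hD))].
  split=> [|w]; first by apply: (cg_Z _ hD); exact: cl_sub.
  rewrite !avM avV !avX -mulrA -mulrA; rewrite mulrC -ler_pdivlMr ?exprn_gt0 ?q_gt0 // mul1r.
  have gQ : 0 < v gam ^+ Q by rewrite exprn_gt0 ?av_gt0.
  rewrite mulrCA mulrC ler_pdivrMr; last by rewrite -!(avX v tau 2).
  case: (leqP (mk l) Q) => mQ.
    by rewrite -!(avX v tau 2); apply: hC1 => //; [exact: ltW|apply: hb; rewrite ?av_ge0].
  rewrite [leRHS]mulrC; apply: ler_wpM2l; first by rewrite !exprn_ge0 ?av_ge0.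
  have := hb 1 1; rewrite av1 => /(_ (lexx _) ler01 _ l w); rewrite !expr1n !mulr1.
  move=> h'; apply: le_trans (h' _) _ => [w' _|]; first exact: d1.
  rewrite lef_pV2 ?posrE ?exprn_gt0 ?q_gt0 //; exact: q_anti.
rewrite expr_div_n hQ mulr_suml mulr_sumr; apply: eq_bigr => l _.
case: eqP => [->|/eqP l1]; first by rewrite h10 mulr0 !mul0r mulr0.
rewrite tk //; set M := minn _ _.
have -> : u w ^+ mk l = u w ^+ (mk l - M) * (gam ^+ M * s w ^+ M).
  rewrite -exprMn [gam * _]mulrC /s divfK // -exprD subnK //; exact: geq_minl.
by ring.
Qed.

(** Each substitution of the identity into itself removes one p from the denominator of f. *)
Let absorb f X H M : S X -> S H -> (forall w, f w = X w + p%:R * H w * f w) -> pS M f -> S f.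
Proof.
move=> SX SH e; elim: M => [|M IH] h.
  by have := h; congr S; apply/funext => w; rewrite mul1r.
apply: IH; have := og_D hS (og_Z hS (pk1 M) SX) (og_M hS SH h).
by congr S; apply/funext => w; rewrite [in RHS]e exprS; ring.
Qed.

(** All powers of s have one common denominator. Expand (a + p d/gam)^Q by [capped]: small j are
    covered by the crude bound [small], exponents of s below Q by induction, and what has exponent Q
    carries a factor p, which [absorb] removes. *)
Let s_pow : exists Ca, forall Q, pS Ca (fun w => s w ^+ Q).
Proof.
have [a [d [Sa Dd d1 dg sE]]] := s_split.
have [C1 hC1] := capped Dd d1 dg; have [N0 hN0] := pS_bounded Ds.
have small Q : pS (N0 * Q) (fun w => s w ^+ Q).
  have := og_X Q hS hN0; congr S; apply/funext => w; by rewrite exprMn exprM.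
exists (C1 + N0 * C1)%N; elim/ltn_ind => Q IH.
case: (leqP Q C1) => QC.
  apply: pS_mono (small Q); apply: leq_trans (leq_addl _ _); exact: leq_mul.
set Ca := (C1 + N0 * C1)%N in IH *.
pose F w := p%:R ^+ Ca * s w ^+ Q.
pose T (f : fn) := exists X H, [/\ S X, S H & forall w, f w = X w + p%:R * H w * F w].
have S0 : S (fun=> 0) by apply: (og_c hS); rewrite av0.
have S1 : S (fun=> 1) by apply: (og_c hS); rewrite av1.
have TS f : S f -> T f.
  by move=> Sf; exists f, (fun=> 0); split=> // w; rewrite mulr0 mul0r addr0.
have TD I (r : seq I) (f : I -> fn) : (forall i, T (f i)) -> T (fun w => \sum_(i <- r) f i w).
  move=> Tf; elim: r => [|i r [X [H [SX SH e]]]].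
    by have := TS _ S0; congr T; apply/funext => w; rewrite big_nil.
  have [X' [H' [SX' SH' e']]] := Tf i.
  exists (fun w => X' w + X w), (fun w => H' w + H w).
  split=> [||w]; try exact: og_D.
  by rewrite big_cons e e'; ring.
have TM f f' : S f -> T f' -> T (fun w => f w * f' w).
  move=> Sf [X [H [SX SH e]]]; exists (fun w => f w * X w), (fun w => f w * H w).
  by split=> [||w]; try exact: og_M; rewrite e; ring.
have [X [H [SX SH e]]] : T F.
  have -> : F = fun w => \sum_(j < Q.+1) (a w ^+ (Q - j) *+ 'C(Q, j)) * (p%:R ^+ (Ca + j) * (d w / gam) ^+ j).
    apply/funext => w; rewrite /F sE exprDn mulr_sumr; apply: eq_bigr => j _.
    by rewrite exprMn -mulr_natl -[a w ^+ _ *+ _]mulr_natl exprD; ring.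
  apply: (TD) => j; apply: (TM); first by apply: og_Mn => //; exact: og_X.
  have [N [m [h [mj bh hE]]]] := hC1 j.
  have -> : (fun w => p%:R ^+ (Ca + j) * (d w / gam) ^+ j) =
     fun w => \sum_(l < N) (h l w * (p%:R ^+ (N0 * C1 + j) * s w ^+ m l)).
    apply/funext => w; have -> : (Ca + j = (N0 * C1 + j) + C1)%N by rewrite /Ca; lia.
    rewrite exprD -mulrA hE mulr_sumr; apply: eq_bigr => l _; ring.
  apply: (TD) => l; apply: (TM); first exact: DS.
  case: (leqP j C1) => jC.
    apply: TS; apply: (pS_mono (m := N0 * m l)); last exact: small.
    apply: leq_trans (leq_addr _ _); rewrite leq_mul2l; apply/orP; right.
    exact: leq_trans (mj l) jC.
  have E w : p%:R ^+ (N0 * C1 + j) * s w ^+ m l = p%:R ^+ (j - C1) * (p%:R ^+ Ca * s w ^+ m l).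
    by rewrite mulrA -exprD; congr (_ ^+ _ * _); rewrite /Ca; lia.
  case: (ltnP (m l) Q) => mQ.
    by apply: TS; have := og_Z hS (pk1 (j - C1)) (IH _ mQ); congr S; apply/funext => w.
  have mE : m l = Q by apply/eqP; rewrite eqn_leq mQ andbT (leq_trans (mj l)) // -ltnS.
  exists (fun=> 0), (fun=> p%:R ^+ (j - C1).-1); split=> // [|w]; first exact: (og_c hS).
  by rewrite E mE add0r -exprS prednK // subn_gt0.
apply: (absorb SX SH e (M := N0 * Q)).
have := og_Z hS (pk1 Ca) (small Q); rewrite /pS; congr S; apply/funext => w; rewrite /F; ring.
Qed.

Let level_pow y b : D0 y -> b != 0 -> (forall w, v (t w) <= v tau -> v (y w) <= v b) ->
  exists C0, forall Q, pS C0 (fun w => (y w / b) ^+ Q).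
Proof.
move=> Dy b0 yb; have [c hc] := FH Dy; have [C1 cC1 hC1] := hk_bound c.
have [Ca hCa] := s_pow; exists (Ca + C1)%N => Q.
have [N [h [Dh h10 hQ hb]]] := hc Q.
have bQ : 0 < v b ^+ Q by rewrite exprn_gt0 ?av_gt0.
rewrite /pS; suff -> : (fun w => p%:R ^+ (Ca + C1) * (y w / b) ^+ Q) = fun w => \sum_(l < N)
    (fun w => if l == 1%N :> nat then 0 else p%:R ^+ C1 * gam ^+ mk l / b ^+ Q * h l w) w * ek l w * (p%:R ^+ Ca * s w ^+ mk l).
  apply: (og_sum _ hS) => l _; apply: (og_M hS); last exact: hCa.
  apply: DS; apply: (og_M (ball_oalg hD)); last exact: bek.
  case: eqP => [_|/eqP l1]; first exact: ball0.
  split=> [|w]; first by apply: (cg_Z _ hD); exact: cl_sub.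
  rewrite !avM avV !avX -mulrA -mulrA mulrC -ler_pdivlMr ?exprn_gt0 ?q_gt0 // mul1r.
  rewrite mulrCA mulrC ler_pdivrMr //.
  by rewrite -!(avX v tau 2); apply: hC1 => //; [exact: ltW|apply: hb; rewrite ?av_ge0].
apply/funext => w; rewrite expr_div_n hQ mulr_suml mulr_sumr; apply: eq_bigr => l _.
case: eqP => [->|/eqP l1]; first by rewrite h10 mulr0 !mul0r mulr0.
rewrite tk //.
have -> : u w ^+ mk l = gam ^+ mk l * s w ^+ mk l.
  by rewrite -exprMn [gam * _]mulrC /s divfK.
by rewrite exprD; ring.
Qed.

(** Improves a common denominator of all powers to p. With pi0 = p^(1/(2p)), each use of
    [tgen_radical] gains pi0^2 and returns one pi0 to compensate g_k, so the exponent of pi0 falls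
    by one at a time, down to 2p. *)
Let level_div y b : D0 y -> b != 0 -> (forall w, v (t w) <= v tau -> v (y w) <= v b) ->
  S (fun w => p%:R * (y w / b)).
Proof.
move=> Dy b0 yb; have [C0 hC0] := level_pow Dy b0 yb.
have p0 := p_gt0 K; have p1 := p_gt1 K.
pose pi0 := @nroot K (2 * p) p%:R; have pi0E : pi0 ^+ (2 * p) = p%:R by rewrite nrootK // muln_gt0.
have pi00 : pi0 != 0.
  by apply/eqP => e; have := pC_neq0 K; rewrite -pi0E e expr0n muln_eq0 /= gtn_eqF // eqxx.
have vpi0 : v pi0 < 1.
  by apply: (@avX_lt1 _ _ _ _ (2 * p)); rewrite ?muln_gt0 // pi0E q_lt1.
have [n hn] := pow_arch vpi0 (etrans (av_gt0 v gam) gam0).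
have gbig k : (n <= k)%N -> v pi0 <= v (g k).
  move=> nk; apply: (@avX_le _ _ _ _ (p ^ k)); rewrite ?av_ge0 ?expn_gt0 ?p0 // avX.
  rewrite -(avX v (g k)) (psys_pow k gS); apply: le_trans hn.
  apply: ler_wiXn2l; rewrite ?av_ge0 ?(ltW vpi0) //.
  by apply: leq_trans nk _; apply: ltnW; exact: ltn_expl.
suff H k : (forall Q, S (fun w => pi0 ^+ (2 * p + k) * (y w / b) ^+ Q)) ->
     forall Q, S (fun w => pi0 ^+ (2 * p) * (y w / b) ^+ Q).
    have := H (2 * p * C0)%N _ 1%N; rewrite pi0E; apply => Q.
    have := og_Z hS (q_le1 K) (hC0 Q); congr S; apply/funext => w.
    by rewrite exprD (exprM pi0 (2 * p)) pi0E mulrA.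
  elim: k => [|k IH] h; first by rewrite addn0 in h.
  apply: IH => Q; set z := fun w => (y w / b) ^+ Q.
  have [||k0 hk0] := @tgen_radical _ _ _ hD fD _ _ bU US g0 g1 gS (pi0 ^+ 2) _ _ (h Q).
  - by rewrite -exprM.
  - have := og_Z hS (avX1 ((2 * p + k.+1) * p.-1 - 2 * p) (ltW vpi0)) (h (Q * p)%N).
    congr S; apply/funext => w; rewrite [(_ * _ ^+ Q) ^+ p]exprMn -!exprM -pi0E !mulrA; congr (_ * _).
    rewrite -exprD.
    have -> : ((2 * p + k.+1) * p = (2 * p) + ((2 * p + k.+1) * p.-1 - 2 * p + (2 * p + k.+1)))%N.
      have : (2 * p <= (2 * p + k.+1) * p.-1)%N.
        by apply: leq_trans (leq_addr k.+1 _) _; rewrite leq_pmulr // -subn1 subn_gt0.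
      have -> : ((2 * p + k.+1) * p = (2 * p + k.+1) * p.-1 + (2 * p + k.+1))%N by rewrite -mulnSr prednK.
      by move=> le2; rewrite [in RHS]addnA subnKC.
    by rewrite [in RHS]exprD mulKf // expf_neq0.
  pose kk := maxn k0 n.
  have := hk0 kk (leq_maxl _ _) => Sk.
  have c1 : v (pi0 / g kk) <= 1 by rewrite avf ler_pdivrMr ?av_gt0 // mul1r gbig // leq_maxr.
  have := og_Z hS c1 Sk; congr S; apply/funext => w.
  rewrite !addnS !exprS exprD /z.
  by have hg := g0 kk; field; rewrite hg pi00.
Qed.

(** One approximation step: the global error gains |p| and the error on |t| <= |tau| loses as much.
    To divide by u, write p y/b as a polynomial P in z, with z^(p^k) = U_0/gam. The part of P of
    degree at least p^k is a multiple of U_0/gam, which is close to u/gam, and yields r; the rest is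
    at most |u/gam| where |t| > |tau|. *)
Let descent e eta (eps : R) : D (fun w => u w * e w) -> eta != 0 -> 0 <= eps ->
  (forall w, v (e w) <= Num.max eps (v eta)) -> (forall w, v (t w) <= v tau -> v (e w) <= v eta) ->
  exists2 r, D r & (forall w, v (e w - r w) <= Num.max (q * eps) (v eta / q)) /\
    (forall w, v (t w) <= v tau -> v (e w - r w) <= v eta / q).
Proof.
move=> De eta0 eps0 he het; have p0 := pC_neq0 K; have q0 := q_gt0 K.
pose b := eta * gam; have b0 : b != 0 by rewrite mulf_neq0.
have ub w : v (t w) <= v tau -> v (u w) <= v gam.
  by move=> tw; rewrite /u /gam !avX; apply: lerXn2r; rewrite ?nnegrE ?av_ge0.
have ub' w : v tau < v (t w) -> v gam < v (u w).
  by move=> tw; rewrite /u /gam !avX; apply: ltrXn2r; rewrite ?nnegrE ?av_ge0.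
have [m hm] := q_arch (e := v b) (etrans (av_gt0 v b) b0).
have [y Dy ye] := De m.
have yb w : v (u w * e w - y w) <= v b by apply: le_trans (ye w) (ltW hm).
have ybt w : v (t w) <= v tau -> v (y w) <= v b.
  move=> tw; apply: (av_near (y := u w * e w)); first by rewrite avBC.
  by rewrite avM /b [v (eta * gam)]avM [v eta * _]mulrC; apply: ler_pM; rewrite ?av_ge0 ?ub ?het.
have [k0 hk] := tgen_poly hD US gS (level_div Dy b0 ybt).
have [P pP PE] := hk k0 (leqnn _); set k := k0 in P pP PE; rewrite -/k in PE.
pose z w := tz U g k w; pose z0 w := tz U g 0 w.
have z0E w : z w ^+ (p ^ k) = z0 w := psys_pow k (fun i => tzS US gS i w).
pose L w := (take_poly (p ^ k) (P w)).[z w]; pose T w := (drop_poly (p ^ k) (P w)).[z w].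
have PLT w : p%:R * (y w / b) = L w + T w * z0 w.
  by rewrite PE -{1}(poly_take_drop (p ^ k) (P w)) hornerD hornerM hornerXn z0E.
have pT : pp D (fun w => drop_poly (p ^ k) (P w)).
  have [[N hN] hc] := pP; split=> [|i].
    by exists N => w; rewrite size_drop_poly; apply: leq_trans (leq_subr _ _) (hN w).
  by have := hc (i + p ^ k)%N; congr (ball D _); apply/funext => w; rewrite coef_drop_poly.
have Dz : D z.
  have := cg_Z (g k)^-1 hD (bU k).1; congr D; apply/funext => w.
  by rewrite /z /tz mulrC.
pose r w := eta / p%:R * T w.
have Dr : D r.
  by apply: (cg_Z _ hD); apply: (horner_in (calg_oalg hD) _ pT Dz) => f [].
have small w : v (t w) <= v tau -> v (e w - r w) <= v eta / q.
  move=> tw; have uw := ub w tw.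
  have Uw : v (U 0%N w) <= v gam.
    apply: (av_near (y := u w)) => //; rewrite avBC; apply: le_trans (uU w) _.
    rewrite max_r //; by rewrite ler_piMl ?av_ge0 ?q_le1.
  have z01 : v (z0 w) <= 1 by rewrite /z0 /tz avf ler_pdivrMr ?av_gt0 // mul1r.
  have z1 : v (z w) <= 1.
    by apply: (@avX_le1 _ _ _ _ (p ^ k)); rewrite ?expn_gt0 ?p_gt0 // z0E.
  apply: avBle.
    by apply: le_trans (het w tw) _; rewrite ler_pdivlMr // ler_piMr ?av_ge0 ?q_le1.
  rewrite /r avM avf ler_piMr ?divr_ge0 ?av_ge0 //; exact: pp_horner pT z1.
exists r => //; split=> // w; case: (leP (v (t w)) (v tau)) => tw.
  by rewrite le_max (small w tw) orbT.
have uw := ub' w tw; have u0 : 0 < v (u w) by apply: le_lt_trans uw; exact: av_ge0.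
have uUw : v (U 0%N w - u w) <= q * v (u w).
  by rewrite avBC; apply: le_trans (uU w) _; rewrite max_l // ltW.
have Uw : v (U 0%N w) = v (u w).
  by apply: av_eq_lt; apply: le_lt_trans uUw _; rewrite gtr_pMl ?q_lt1.
have vz0 : v (z0 w) = v (u w) / v gam by rewrite /z0 /tz avf Uw.
have z01 : 1 < v (z0 w) by rewrite vz0 ltr_pdivlMr ?av_gt0 // mul1r.
have z1 : 1 <= v (z w).
  rewrite leNgt; apply/negP => h; have : v (z w) ^+ (p ^ k) <= 1 by rewrite exprn_ile1 ?av_ge0 ?ltW.
  by rewrite -avX z0E leNgt z01.
have Lw : v (L w) <= v (z0 w).
  rewrite /L horner_coef; apply: av_sum_le => [|i _]; first exact: av_ge0.
  have ik : (i < p ^ k)%N by apply: leq_trans (ltn_ord i) (size_take_poly _ _).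
  rewrite coef_take_poly ik avM -[leRHS]mul1r; apply: ler_pM; rewrite ?av_ge0 //.
    by case: pP => _ /(_ i)[].
  by rewrite -z0E !avX; apply: ler_weXn2l => //; exact: ltnW.
have E : u w * (e w - r w) = (u w * e w - y w) + b / p%:R * L w + r w * (U 0%N w - u w).
  have -> : y w = b / p%:R * (p%:R * (y w / b)) by field; rewrite p0 b0.
  rewrite PLT /r /z0 /tz /b; have -> : g 0 = gam by [].
  by field; rewrite gam0 p0.
set M := Num.max _ _.
have H : v (e w - r w) <= Num.max (v eta / q) (q * v (r w)).
  rewrite -(ler_pM2l u0) -(avM v (u w)) E.
  rewrite maxr_pMr; last exact: ltW.
  apply: avDle; last by rewrite le_max avM; apply/orP; right; rewrite mulrC mulrA [v (u w) * q]mulrC ler_wpM2r ?av_ge0.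
  rewrite le_max; apply/orP; left; apply: avDle.
    apply: le_trans (yb w) _; rewrite /b avM mulrC; apply: ler_pM; rewrite ?av_ge0 ?(ltW uw) //.
    by rewrite ler_pdivlMr // ler_piMr ?av_ge0 ?q_le1.
  rewrite avM avf /b avM; apply: le_trans (_ : v eta * v gam / q * (v (u w) / v gam) <= _).
    by apply: ler_wpM2l; rewrite ?divr_ge0 ?mulr_ge0 ?av_ge0 // -vz0.
  have g0' : v gam != 0 by rewrite av_neq0.
  by rewrite le_eqVlt; apply/orP; left; apply/eqP; field; rewrite g0' gt_eqF.
move: H; rewrite le_max => /orP[h|h]; first by rewrite le_max h orbT.
have rr : v (r w) <= Num.max (v (e w)) (v (e w - r w)).
  by apply: (av_near (y := e w)); rewrite ?(avBC v (r w)) le_max lexx ?orbT.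
move: rr; rewrite le_max => /orP[rr|rr].
  apply: le_trans h _; apply: le_trans (ler_wpM2l (q_ge0 K) (le_trans rr (he w))) _.
  rewrite maxr_pMr ?q_ge0 // ge_max !le_max lexx /=; apply/orP; right.
  apply: le_trans (_ : v eta <= _); first by rewrite ler_piMl ?av_ge0 ?q_le1.
  by rewrite ler_pdivlMr // ler_piMr ?av_ge0 ?q_le1.
have : v (e w - r w) <= 0.
  rewrite leNgt; apply/negP => pos.
  have := le_trans h (ler_wpM2l (q_ge0 K) rr); by rewrite leNgt gtr_pMl ?q_lt1.
by move=> x0; apply: le_trans x0 _; rewrite le_max mulr_ge0 ?q_ge0.
Qed.

(** After i steps the global error is max(|p|^i, |p|^(2J-i)), which is balanced at i = J; this
    explains the choice of tau. The steps apply because u t = t^3 is in D. *)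
Lemma cusp_descent J : tau = p%:R ^+ (2 * J) -> exists2 r, D r & forall w, v (t w - r w) <= q ^+ J.
Proof.
move=> tauE; have q0 := q_gt0 K.
suff H i : (i <= 2 * J)%N -> exists2 r, D r &
   (forall w, v (t w - r w) <= Num.max (q ^+ i) (v (p%:R ^+ (2 * J - i)))) /\
   (forall w, v (t w) <= v tau -> v (t w - r w) <= v (p%:R ^+ (2 * J - i))).
  have [|r Dr [h _]] := H J; first by rewrite mul2n -addnn leq_addr.
  exists r => // w; apply: le_trans (h w) _.
  have -> : (2 * J - J = J)%N by lia.
  by rewrite avX ge_max lexx.
elim: i => [_|i IH iJ].
  exists (fun=> 0); first exact: cg_c.
  by split=> w; rewrite subr0 ?subn0 ?expr0 -?tauE // le_max t1.
have [|r Dr [h h']] := IH; first exact: ltnW.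
have [|||r' Dr' [k k']] := @descent (fun w => t w - r w) (p%:R ^+ (2 * J - i)) (q ^+ i) _ _ _ h h'.
- have := og_B (calg_oalg hD) (cl_sub D3) (cg_M hD bu.1 Dr); congr D; apply/funext => w.
  by rewrite /u; ring.
- by rewrite expf_neq0 ?pC_neq0.
- by rewrite exprn_ge0 ?q_ge0.
have E : v (p%:R ^+ (2 * J - i)) / q = v (p%:R ^+ (2 * J - i.+1)).
  rewrite !avX; have -> : (2 * J - i = (2 * J - i.+1).+1)%N by lia.
  by rewrite exprSr mulfK // gt_eqF.
exists (fun w => r w + r' w); first exact: (cg_D hD).
rewrite E in k k'; split=> w; rewrite opprD addrA; last exact: k'.
by rewrite exprS; exact: k.
Qed.
End Fixed.

Lemma cusp_root : D t.
Proof.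
apply: cD => J; pose tau : C := p%:R ^+ (2 * J).
have tau0 : tau != 0 by rewrite expf_neq0 ?pC_neq0.
have tau1 : v tau <= 1 by rewrite avX exprn_ile1 ?q_ge0 ?q_le1.
have [U [bU US uU]] := tilt_lift hD fD cD bu (expf_neq0 2 tau0) (avX1 2 tau1).
exact: (cusp_descent tau0 tau1 bU US uU (erefl _)).
Qed.
End Cusp.

(** * Simple extensions by a root, and Fourier inversion *)

Section Span.
Variable K : cpdata.
Local Notation R := (cpR K).
Local Notation p := (cpp K).
Local Notation C := (cpC K).
Local Notation v := (cpv K).
Local Notation q := (v p%:R).
Variable Om : Type.
Local Notation fn := (Om -> C).
Implicit Types (S D : fn -> Prop) (f x : fn).

Definition xspan S x N f := exists F : nat -> fn, (forall i, S (F i)) /\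
  forall w, f w = \sum_(i < N) F i w * x w ^+ i.

Section Gen.
Variables (S : fn -> Prop) (x : fn) (N : nat).
Hypotheses (hS : calg S) (N0 : (0 < N)%N) (xN : S (fun w => x w ^+ N)).

Let S0 : S (fun=> 0) := cg_c hS 0.

Lemma xspan_sub f : S f -> xspan S x N f.
Proof.
move=> Sf; exists (fun i => if i == 0%N then f else fun=> 0); split=> [i|w]; first by case: ifP.
rewrite (bigD1 (Ordinal N0)) //= mulr1 big1 ?addr0 // => i.
by rewrite -val_eqE /= => /negPf ->; rewrite mul0r.
Qed.

Lemma xspanD f g : xspan S x N f -> xspan S x N g -> xspan S x N (fun w => f w + g w).
Proof.
move=> [F [SF e]] [G [SG e']]; exists (fun i w => F i w + G i w); split=> [i|w].
  exact: (cg_D hS).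
by rewrite e e' -big_split; apply: eq_bigr => i _; rewrite mulrDl.
Qed.

Lemma xspanZ f g : S f -> xspan S x N g -> xspan S x N (fun w => f w * g w).
Proof.
move=> Sf [F [SF e]]; exists (fun i w => f w * F i w); split=> [i|w]; first exact: (cg_M hS).
by rewrite e mulr_sumr; apply: eq_bigr => i _; rewrite mulrA.
Qed.

Lemma xspan_x f : xspan S x N f -> xspan S x N (fun w => x w * f w).
Proof.
move=> [F [SF e]]; exists (fun i => if i is i'.+1 then F i' else fun w => x w ^+ N * F N.-1 w).
split=> [[|i]|w] //; first exact: (cg_M hS).
rewrite e mulr_sumr; case: (N) N0 => // M _; rewrite [LHS]big_ord_recr [RHS]big_ord_recl /= addrC.
congr (_ + _); first by rewrite exprS; ring.
by apply: eq_bigr => i _; rewrite /bump /= add1n exprS; ring.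
Qed.

Lemma xspan_sum (I : Type) (r : seq I) (F : I -> fn) : (forall i, xspan S x N (F i)) ->
  xspan S x N (fun w => \sum_(i <- r) F i w).
Proof.
move=> h; elim: r => [|i r IH].
  by have := xspan_sub S0; congr xspan; apply/funext => w; rewrite big_nil.
by have := xspanD (h i) IH; congr xspan; apply/funext => w; rewrite big_cons.
Qed.

Lemma xspan_calg : calg (xspan S x N).
Proof.
split=> [c|f g|f g [F [SF e]] hg]; first by apply/xspan_sub; exact: (cg_c hS).
  exact: xspanD.
have -> : (fun w => f w * g w) = fun w => \sum_(i < N) F i w * (x w ^+ i * g w).
  by apply/funext => w; rewrite e mulr_suml; apply: eq_bigr => i _; rewrite mulrA.
apply: xspan_sum => i; apply: xspanZ => //; elim: (i : nat) => [|k IH].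
  by have := hg; congr xspan; apply/funext => w; rewrite mul1r.
by have := xspan_x IH; congr xspan; apply/funext => w; rewrite exprS mulrA.
Qed.

Lemma xspan_gen : xspan S x N x.
Proof.
have := xspan_x (xspan_sub (cg_c hS 1)); congr xspan; apply/funext => w; by rewrite mulr1.
Qed.
End Gen.

Lemma xspan_min S D x N f : calg D -> (forall g, S g -> D g) -> D x -> xspan S x N f -> D f.
Proof.
move=> hD SD Dx [F [SF e]]; have hO := calg_oalg hD.
have := @og_sum _ _ D _ (index_enum 'I_N) predT (fun (i : 'I_N) w => F i w * x w ^+ i) hO
  (fun i _ => og_M hO (SD _ (SF i)) (og_X i hO Dx)).
by congr D; apply/funext => w; rewrite e.
Qed.

Lemma iter_mul (T : Type) (r : T -> T) (x : T -> C) (z : C) k w :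
  (forall w, x (r w) = z * x w) -> x (iter k r w) = z ^+ k * x w.
Proof. by move=> h; elim: k => [|k IH] /=; rewrite ?mul1r // h IH exprS mulrA. Qed.

Lemma iter_inv (T U : Type) (r : T -> T) (x : T -> U) k w :
  (forall w, x (r w) = x w) -> x (iter k r w) = x w.
Proof. by move=> h; elim: k => [|k IH] //=; rewrite h. Qed.

Lemma fourier (N : nat) (z : C) (r : Om -> Om) (F : nat -> fn) x f : N.-primitive_root z ->
  (forall w, x (r w) = z * x w) -> (forall i w, F i (r w) = F i w) ->
  (forall w, f w = \sum_(i < N) F i w * x w ^+ i) ->
  forall (i : 'I_N) w, N%:R * (F i w * x w ^+ i) = \sum_(k < N) z ^+ ((N - i) * k) * f (iter k r w).
Proof.
move=> zp xr Fr fE i w.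
transitivity (\sum_(k < N) \sum_(j < N) (F j w * x w ^+ j) * z ^+ ((N - i + j) * k)).
  rewrite exchange_big (bigD1 i) //= [X in _ + X]big1 => [|j ji].
    by rewrite -mulr_sumr sum_prim_root // subnK ?dvdnn ?addr0 1?mulrC // ltnW.
  rewrite -mulr_sumr sum_prim_root // ifF ?mulr0 //; apply/negbTE.
  have iN := ltn_ord i; have jN := ltn_ord j; apply: contra ji; rewrite -val_eqE /=.
  move=> /dvdnP[[|[|k]] e]; lia.
apply: eq_bigr => k _; rewrite fE mulr_sumr; apply: eq_bigr => j _.
rewrite (iter_mul _ _ xr) (iter_inv (x := F j)) // exprMn -exprM mulnDl exprD (mulnC k); ring.
Qed.

Lemma fourier_le (N : nat) (z : C) (r : Om -> Om) (F : nat -> fn) x f (B : R) w : N.-primitive_root z ->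
  (forall w, x (r w) = z * x w) -> (forall i w, F i (r w) = F i w) ->
  (forall w, f w = \sum_(i < N) F i w * x w ^+ i) -> 0 <= B ->
  (forall k, v (f (iter k r w)) <= B) ->
  forall (i : 'I_N), v N%:R * (v (F i w) * v (x w) ^+ i) <= B.
Proof.
move=> zp xr Fr fE B0 fB i; rewrite -avX -!avM (fourier zp xr Fr fE).
by apply: av_sum_le => // k _; rewrite avM avX (av_prim_root zp) expr1n mul1r.
Qed.

End Span.

(** * Functions of finite level and their uniform closure *)

Section Levels.
Variable K : cpdata.
Local Notation R := (cpR K).
Local Notation p := (cpp K).
Local Notation p_pr := (cpp_pr K).
Local Notation C := (cpC K).
Local Notation v := (cpv K).
Local Notation q := (v p%:R).
Local Notation A := (tate v).
Variables (s : seq A) (us : units s).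
Local Notation E := (compl p (@idfun A) (kummer p_pr s)).
Local Notation cplus := (@cplus R C v p A idfun (kummer p_pr s)).

Definition lev (f : pt s -> C) := exists n (x : kummer p_pr s n), forall w, f w = pev w x.

Lemma lev_pev n (x : kummer p_pr s n) : lev (fun w => pev w x).
Proof. by exists n, x. Qed.

Lemma lev_calg : calg lev.
Proof.
have two f g : lev f -> lev g -> exists n (x y : kummer p_pr s n),
    (forall w, f w = pev w x) /\ (forall w, g w = pev w y).
  move=> [n [x ex]] [m [y ey]].
  have [x' ex'] := lift_level x (leq_maxl n m); have [y' ey'] := lift_level y (leq_maxr n m).
  by exists (maxn n m), x', y'; split=> w; rewrite ?ex' ?ey'.
split=> [c|f g hf hg|f g hf hg].
- by exists 0%N, (kscal s 0 c) => w; rewrite pev_scal.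
- by have [n [x [y [ex ey]]]] := two f g hf hg; exists n, (x + y) => w; rewrite rmorphD ex ey.
- by have [n [x [y [ex ey]]]] := two f g hf hg; exists n, (x * y) => w; rewrite rmorphM ex ey.
Qed.

Lemma lev_bounded f : lev f -> bounded f.
Proof. by move=> [n [x e]]; have [k hk] := pev_bounded x us; exists k => w; rewrite e. Qed.

Lemma cl_lev_calg : calg (cl lev).
Proof. exact: (cl_calg lev_calg lev_bounded). Qed.

Lemma lev_cev (x : E) : cl lev (fun w => cev w x).
Proof. by move=> m; have [n [y h]] := cev_dense us x m; exists (fun w => pev w y) => //; exact: lev_pev. Qed.

Lemma cev_lev_ex f : cl lev f -> exists x : E, forall w, cev w x = f w.
Proof.
move=> h; apply: cev_surj => // m; have [g [n [x e]] fg] := h m.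
by exists n, x => w; rewrite -e.
Qed.

Lemma lev_root i n : (i < size s)%N -> lev (fun w => prt w i n).
Proof.
have H : forall (l : seq A) i, (i < size l)%N -> exists m (x : kummer p_pr l m), forall w, prt w i n = pev w x.
  elim=> [//|a l IH] [|k] /= kl.
    by exists n, (kumX p (kummer p_pr l) a n) => w; rewrite pev_X.
  have [m [x e]] := IH k kl; exists m, (qpolyC (kumpol p (kummer p_pr l) a m) x : kummer p_pr (a :: l) m) => w.
  by rewrite pev_C -e.
exact: H.
Qed.

Lemma tev_in D : calg D -> (forall f, cl D f -> D f) -> D (fun w : pt s => pz w) ->
  forall a, D (fun w => tev (pz w) a).
Proof.
move=> hD cD Dt a; apply: cD => m; have [N hN] := ttruncP a m.
exists (fun w => (ttrunc a N).[pz w]).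
  have := @og_sum _ _ D _ (index_enum 'I_N) predT (fun (i : 'I_N) w => (ttrunc a N)`_i * pz w ^+ i)
    (calg_oalg hD) (fun i _ => cg_Z _ hD (og_X i (calg_oalg hD) Dt)).
  congr D; apply/funext => w; rewrite (horner_coef_wide _ (size_poly _ _)) //.
by move=> w; apply: tev_near; rewrite ?pz_le1 ?exprn_ge0 ?q_ge0 //; exact: hN.
Qed.

Lemma powerbddP (x : E) : powerbdd p cplus x <-> forall w, v (cev w x) <= 1.
Proof.
split=> [[m hm] w|h].
  apply: (@av_pow_bounded _ _ _ _ (q ^+ m)^-1) => k.
  have /(cplusP us) /(_ w) := hm k.
  by rewrite rmorphM !rmorphXn rmorph_nat avM !avX mulrC -ler_pdivlMr ?exprn_gt0 ?q_gt0 // mul1r.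
exists 0%N => k; apply/(cplusP us) => w.
by rewrite expr0 mul1r rmorphXn /=; exact: avX1.
Qed.

(** The integral subring is the unit ball of the supremum norm. For a uniformly closed algebra of
    bounded functions containing the constants, all axioms but the Frobenius condition hold with
    such a ring, uniformity even with exponent 0. *)
Lemma perfectoid_levels : frob (cl lev) ->
  perfectoid_affinoid v p (fun c => cst p idfun (kummer p_pr s) (tconst v c)) cplus.
Proof.
move=> fr; have hcst c w : cev w (cst p idfun (kummer p_pr s) (tconst v c)) = c.
  by rewrite cev_cst // tev_const // pz_le1.
split.
- split=> [a b|]; first by apply: (cev_inj us) => w; rewrite rmorphB /= !hcst.
  split=> [|a b]; apply: (cev_inj us) => w; first by rewrite hcst rmorph1.
  by rewrite rmorphM /= !hcst.
- by move=> c c1; apply/(cplusP us) => w; rewrite hcst.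
- split=> [|x y /(cplusP us) hx /(cplusP us) hy|x y /(cplusP us) hx /(cplusP us) hy];
    apply/(cplusP us) => w; rewrite ?rmorph1 ?av1 // ?rmorphB ?rmorphM.
    by apply: avBle; [exact: hx|exact: hy].
  by apply: avM1; [exact: hx|exact: hy].
- move=> x; have [k hk] := cev_bounded us x; exists k; apply/(cplusP us) => w.
  rewrite rmorphM rmorphXn rmorph_nat avM avX mulrC.
  by rewrite -ler_pdivlMr ?exprn_gt0 ?q_gt0 // mul1r; exact: hk.
- move=> x h; have H w : cev w x = 0 :> C.
    by apply: av_eq0_q => m; have /(padicP us)/(_ w) := h m.
  by apply: (cev_inj us) => w; rewrite H rmorph0.
- move=> u hu; have hc m : exists N, forall n, (N <= n)%N -> forall w, v (cev w (u n.+1) - cev w (u n)) <= q ^+ m.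
    have [N hN] := hu m; exists N => n Nn w.
    by have /(padicP us)/(_ w) := hN n.+1 n (leqW Nn) Nn; rewrite rmorphB.
  have cw w : cauchyC (fun n => cev w (u n)).
    by move=> m; have [N hN] := hc m; exists N => n Nn; exact: hN.
  pose f w := limC (fun n => cev w (u n)).
  have fu w : cvgC (fun n => cev w (u n)) (f w) := limP (cw w).
  have near m : exists N, forall n, (N <= n)%N -> forall w, v (f w - cev w (u n)) <= q ^+ m.
    have [N hN] := hc m; exists N => n Nn w.
    apply: (cvg_near _ (fu w)); first by rewrite exprn_ge0 ?q_ge0.
    exists n => k nk; apply: (@step_le _ (fun n => cev w (u n)) _ n) => // i ni; apply: hN; exact: leq_trans Nn ni.
  have [l hl] : exists l : E, forall w, cev w l = f w.
    apply/cev_lev_ex/cl_cl => m; have [N hN] := near m.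
    by exists (fun w => cev w (u N)); [exact: lev_cev|move=> w; exact: hN].
  exists l => m; have [N hN] := near m; exists N => n Nn; apply/(padicP us) => w.
  by rewrite rmorphB /= hl avBC; exact: hN.
- exists 0%N => x /powerbddP h; apply/(cplusP us) => w.
  by rewrite expr0 mul1r.
- move=> x /powerbddP h; have [|g cg fg] := fr (fun w => cev w x); first by split=> //; exact: lev_cev.
  have [y hy] := cev_lev_ex cg.
  have bg w : v (g w) <= 1.
    apply: (@avX_le1 _ _ _ _ p (p_gt0 K)); apply: av_near (h w); rewrite avBC.
    by apply: le_trans (fg w) (q_le1 K).
  have [z hz] : exists z : E, forall w, cev w z = p%:R^-1 * (cev w x - g w ^+ p).
    apply: cev_lev_ex; apply: (cg_Z _ cl_lev_calg); apply: (og_B (calg_oalg cl_lev_calg)); first exact: lev_cev.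
    exact: (og_X _ (calg_oalg cl_lev_calg) cg).
  exists y, z; split.
  + by apply/powerbddP => w; rewrite hy.
  + apply/powerbddP => w; rewrite hz avM avV mulrC ler_pdivrMr ?q_gt0 // mul1r; exact: fg.
  + apply: (cev_inj us) => w; rewrite rmorphD rmorphM rmorphXn rmorph_nat /= hy hz mulVKf ?pC_neq0 //.
    by rewrite addrC subrK.
- move=> x d c hc e; apply/(cplusP us) => w.
  have ew : cev w x ^+ d = \sum_(i < d) cev w (c i) * cev w x ^+ i.
    by rewrite -rmorphXn e rmorph_sum; apply: eq_bigr => i _; rewrite rmorphM rmorphXn.
  rewrite leNgt; apply/negP => x1.
  case: d e ew => [|d] e ew.
    by move/eqP: ew; rewrite big_ord0 expr0 oner_eq0.
  have : v (cev w x ^+ d.+1) <= v (cev w x) ^+ d.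
    rewrite ew; apply: av_sum_le => [|i _]; first by rewrite exprn_ge0 ?av_ge0.
    rewrite avM -[leRHS]mul1r; apply: ler_pM; rewrite ?av_ge0 //; first by have /(cplusP us) := hc i; apply.
    by rewrite avX; apply: ler_weXn2l; [exact: ltW|rewrite -ltnS].
  rewrite avX exprS ger_pMl ?exprn_gt0 ?(lt_trans ltr01) //.
  by rewrite leNgt x1.
Qed.
End Levels.

(** * The tower over the normalized cusp *)

Section CuspPerfectoid.
Variable K : cpdata.
Local Notation R := (cpR K).
Local Notation p := (cpp K).
Local Notation p_pr := (cpp_pr K).
Local Notation C := (cpC K).
Local Notation v := (cpv K).
Local Notation q := (v p%:R).
Local Notation A := (tate v).
Variable (w0 : C).
Hypotheses (w0_neq0 : w0 != 0) (w0_lt1 : v w0 < 1).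

Definition kumT k : A := 1 + tconst v w0 * tvar v ^+ k.

Lemma tev_kumT z k : v z <= 1 -> tev z (kumT k) = 1 + w0 * z ^+ k.
Proof.
move=> z1; have mz := tev_monoid z1; pose f := tev z.
have hX n : tev z (tvar v ^+ n) = z ^+ n.
  elim: n => [|n IH]; first by rewrite !expr0; exact: mz.1.
  by rewrite !exprS tevM // IH tev_var.
by rewrite /kumT tevD // tevM // tev_const // hX (tev_const _ z1 : tev z 1 = 1).
Qed.

Lemma units_kumT k l (s : seq A) : units s -> (0 < k)%N -> s = l -> units (kumT k :: s).
Proof.
move=> us k0 _ [_|i /us//] z z1; rewrite tev_kumT // -[RHS](av1 v).
apply: av_eq_lt; rewrite av1 addrAC subrr add0r avM; apply: le_lt_trans w0_lt1.
by rewrite ler_piMr ?av_ge0 // avX1.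
Qed.

Let s := [:: kumT 2; kumT 3].
Let us : units s.
Proof. by apply: units_kumT => //; apply: units_kumT => // -[]. Qed.
Local Notation Om := (pt s).

(** |d0| = max(|p|, |w0|), as the root algebra asks for |d0| >= |p| and for roots of functions
    within |d0| of 1. *)
Let d0 : C := if v w0 <= q then p%:R else w0.
Let d0q : q <= v d0. Proof. by rewrite /d0; case: (leP (v w0) q) => // /ltW. Qed.
Let d01 : v d0 < 1. Proof. by rewrite /d0; case: ifP => _ //; exact: q_lt1. Qed.
Let d0w : v w0 <= v d0. Proof. by rewrite /d0; case: ifP. Qed.

Let X (j : bool) n (w : Om) := prt w j n.
Let XS j n w : X j n.+1 w ^+ p = X j n w.
Proof. by apply: prtS; case: j. Qed.
Let X00 (j : bool) w : X j 0 w = 1 + w0 * pz w ^+ (2 + j).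
Proof. by rewrite /X prt0; [case: j; rewrite tev_kumT ?pz_le1|case: j]. Qed.
Let X0 j w : v (X j 0%N w - 1) <= v d0.
Proof.
rewrite X00 addrAC subrr add0r avM; apply: le_trans d0w.
by rewrite ler_piMr ?av_ge0 // avX1 ?pz_le1.
Qed.
Let X1 j n w : v (X j n w) = 1.
Proof. by apply: prt_unit => //; case: j. Qed.

Let D0 := rootalg X d0.
Let hD0 : calg D0. Proof. exact: rootalg_calg. Qed.
Let t (w : Om) := pz w.

Let Dt (k : bool) : D0 (fun w => t w ^+ (2 + k)).
Proof.
have := cg_Z w0^-1 hD0 (cg_D hD0 (rootalg_root XS d0q d01 k 0) (cg_c hD0 (-1))).
by congr D0; apply/funext => w; rewrite X00 addrAC subrr add0r mulKf.
Qed.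

(** The coordinate ring of the cusp: the polynomials in t^2 and t^3 are those without linear
    term. *)
Let S0 (f : Om -> C) := exists2 P : {poly C}, P`_1 = 0 & forall w, f w = P.[t w].
Let hS0 : calg S0.
Proof.
split=> [c|f g [P P1 eP] [Q Q1 eQ]|f g [P P1 eP] [Q Q1 eQ]].
- by exists c%:P => [|w]; rewrite ?coefC ?hornerC.
- by exists (P + Q) => [|w]; rewrite ?coefD ?P1 ?Q1 ?addr0 // hornerD eP eQ.
- exists (P * Q) => [|w]; last by rewrite hornerM eP eQ.
  by rewrite coefM big_ord_recl big_ord1 /= P1 Q1 mulr0 mul0r addr0.
Qed.

Let S0X (k : bool) n : S0 (fun w => X k n w ^+ (p ^ n)).
Proof.
exists (1 + w0%:P * 'X^(2 + k)) => [|w].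
  by rewrite coefD coefCM coefXn coef1; case: k; rewrite /= mulr0 addr0.
rewrite (psys_pow (r := fun n => X k n w)) // X00.
by rewrite hornerD hornerM hornerXn !hornerC.
Qed.

Let S1 n := xspan S0 (X false n) (p ^ n).
Let S2 n := xspan (S1 n) (X true n) (p ^ n).
Let pn0 n : (0 < p ^ n)%N. Proof. by rewrite expn_gt0 p_gt0. Qed.
Let hS1 n : calg (S1 n). Proof. exact: xspan_calg. Qed.
Let hS2 n : calg (S2 n).
Proof. by apply: xspan_calg => //; apply: xspan_sub. Qed.
Let S2X n j : S2 n (X j n).
Proof.
case: j; last by apply: xspan_sub => //; exact: xspan_gen.
by apply: xspan_gen => //; apply: xspan_sub.
Qed.
Let S2_mono n k f : S2 n f -> S2 (n + k)%N f.
Proof.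
have SX j : S2 (n + k)%N (X j n).
  have := og_X (p ^ k) (calg_oalg (hS2 (n + k)%N)) (S2X (n + k)%N j); congr S2.
  by apply/funext => w; rewrite addnC; exact: (psys_powD (r := fun n => X j n w)).
apply: xspan_min => // g; apply: xspan_min => // h hh.
by apply: xspan_sub => //; apply: xspan_sub.
Qed.

Let D0_S2 f : D0 f -> exists n, S2 n f.
Proof.
have two g h n m : S2 n g -> S2 m h -> S2 (n + m)%N g /\ S2 (n + m)%N h.
  by move=> hf hg; split; [|rewrite addnC]; exact: S2_mono.
apply: (rootalg_min (D := fun f => exists n, S2 n f)); last by move=> j n; exists n; exact: S2X.
split=> [c|g h [n hg] [m hh]|g h [n hg] [m hh]].
- by exists 0%N; exact: (cg_c (hS2 0)).
- by exists (n + m)%N; have [h1 h2] := two _ _ _ _ hg hh; exact: (cg_D (hS2 _)).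
- by exists (n + m)%N; have [h1 h2] := two _ _ _ _ hg hh; exact: (cg_M (hS2 _)).
Qed.

(** At level n, y^Q is a polynomial in two p^n-th roots over the coordinate ring of the cusp. Two
    Fourier inversions lose |p|^(2n) whatever Q is, and Cauchy's inequality then bounds the
    coefficients in t. *)
Let FH y : D0 y -> exists c, forall Q, cusp_expansion D0 t y c Q.
Proof.
move=> /D0_S2[n hy]; exists (n + n)%N => Q; set M := (p ^ n)%N.
have [G [SG yE]] := og_X Q (calg_oalg (hS2 n)) hy.
have /choice[F hF] : forall j, exists F : nat -> Om -> C, (forall i, S0 (F i)) /\
    forall w, G j w = \sum_(i < M) F i w * X false n w ^+ i.
  by move=> j; have [F] := SG j; exists F.
have /choice[P hP] : forall ij : nat * nat, exists P : {poly C}, P`_1 = 0 /\ forall w, F ij.1 ij.2 w = P.[t w].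
  by move=> [j i]; have [P P1 e] := (hF j).1 i; exists P.
pose N := \max_(j < M) \max_(i < M) size (P (j : nat, i : nat)).
have sP (j i : 'I_M) : (size (P (j : nat, i : nat)) <= N)%N.
  by apply: leq_trans (leq_bigmax j); apply: (leq_bigmax (F := fun i : 'I_M => size (P (j : nat, i : nat))) i).
exists N, (fun k w => \sum_(j < M) \sum_(i < M) (P (j : nat, i : nat))`_k * X false n w ^+ i * X true n w ^+ j).
have hO := calg_oalg hD0.
split=> [k|w|w|tau beta tau1 beta0 yb k w].
- apply: (og_sum _ hO) => j _; apply: (og_sum _ hO) => i _.
  by apply: (og_M hO); [apply: (cg_Z _ hD0)|]; apply: (og_X _ hO); exact: rootalg_root.
- by rewrite big1 // => j _; rewrite big1 // => i _; rewrite (hP _).1 !mul0r.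
- rewrite yE.
  under [RHS]eq_bigr do rewrite mulr_sumr.
  rewrite exchange_big; apply: eq_bigr => j _ /=; rewrite (hF j).2 mulr_suml.
  under [RHS]eq_bigr do rewrite mulr_sumr.
  rewrite exchange_big; apply: eq_bigr => i _ /=.
  rewrite ((hP (j : nat, i : nat)).2 w) (horner_coef_wide _ (sP j i)) !mulr_suml.
  by apply: eq_bigr => k _; ring.
have bQ : 0 <= beta ^+ Q by rewrite exprn_ge0.
have B0 : 0 <= (q ^+ (n + n))^-1 * beta ^+ Q by rewrite mulr_ge0 ?qN_ge0.
have PB (j i : 'I_M) z : v z <= v tau -> v (P (j : nat, i : nat)).[z] <= (q ^+ (n + n))^-1 * beta ^+ Q.
  move=> zt; have [w1 tw1] := pt_ex s (le_trans zt tau1).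
  have q2 : 0 < q ^+ (n + n) by rewrite exprn_gt0 ?q_gt0.
  rewrite mulrC ler_pdivlMr // mulrC exprD -mulrA.
  have hz := cpz_prim K n.
  have rX (a b : bool) w' : X a n (zrot b 1 w') = (if a == b then cpz K n else 1) * X a n w'.
    by rewrite /X /= expr1; case: a; case: b.
  pose r (b : bool) := @zrot K s b 1.
  have tr b w' : t (r b w') = t w' by [].
  have Fr b j' i' w' : F j' i' (r b w') = F j' i' w'.
    by rewrite ((hP (j', i')).2 w') ((hP (j', i')).2 (r b w')).
  have Gr j' w' : G j' (r true w') = G j' w'.
    by rewrite !(hF j').2; apply: eq_bigr => i' _; rewrite Fr rX mul1r.
  have step1 w' : t w' = z -> v (G j w') * q ^+ n <= beta ^+ Q.
    move=> tw; have := @fourier_le K Om M (cpz K n) (r true) G (X true n) (fun w => y w ^+ Q) (beta ^+ Q) w' hz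
      (fun w => rX true true w) Gr yE bQ _ j.
    rewrite X1 expr1n mulr1 av_pn mulrC; apply=> k'.
    by rewrite avX; apply: lerXn2r; rewrite ?nnegrE ?av_ge0 // yb // (iter_inv (x := t)) // tw.
  have := @fourier_le K Om M (cpz K n) (r false) (F j) (X false n) (G j) (beta ^+ Q / q ^+ n) w1 hz
      (fun w => rX false false w) (Fr false j) (hF j).2 _ _ i.
  rewrite X1 expr1n mulr1 av_pn ((hP (j : nat, i : nat)).2 w1) {1}/t tw1.
  move=> h; rewrite mulrC -ler_pdivlMr ?exprn_gt0 ?q_gt0 //; apply: h => [|k'].
    by rewrite divr_ge0 ?exprn_ge0 ?q_ge0.
  by rewrite ler_pdivlMr ?exprn_gt0 ?q_gt0 // step1 // (iter_inv (x := t)).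
rewrite -avX -avM mulr_suml; apply: av_sum_le => // j _; rewrite mulr_suml; apply: av_sum_le => // i _.
rewrite !avM avX [v (X false n w ^+ i)]avX [v (X true n w ^+ j)]avX !X1 !expr1n !mulr1.
by apply: poly_cauchy => // z; exact: PB.
Qed.

Lemma cusp_perfectoid : affinoid_perfectoid p_pr (kumT 2) (kumT 3).
Proof.
apply: (perfectoid_levels us); have hL := cl_lev_calg us.
have bD f : D0 f -> bounded f by exact: rootalg_bounded.
have fD : frob D0 by exact: rootalg_frob.
have t1 w : v (t w) <= 1 := pz_le1 w.
have Dt0 : cl D0 t := cusp_root hD0 bD fD t1 (Dt false) (Dt true) FH.
have hD : calg (cl D0) := cl_calg hD0 bD.
have DX j n : cl D0 (X j n) by apply: cl_sub; exact: rootalg_root.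
have LD f : cl (lev (s:=s)) f -> cl D0 f.
  move=> h; apply: cl_cl; apply: cl_mono h => {}f [n [x /funext ->]].
  have hO := calg_oalg hD.
  have -> : (fun w => pev w x) = fun w => \sum_(i < p ^ n) \sum_(j < p ^ n)
      tev (pz w) (kcoef (kcoef x i) j) * X true n w ^+ j * X false n w ^+ i.
    apply/funext => w; rewrite pev_sum; apply: eq_bigr => i _.
    by rewrite pev_sum mulr_suml; apply: eq_bigr => j _.
  apply: (og_sum _ hO) => i _; apply: (og_sum _ hO) => j _.
  apply: (og_M hO); last exact: (og_X _ hO (DX _ _)).
  apply: (og_M hO); last exact: (og_X _ hO (DX _ _)).
  by apply: (tev_in hD _ Dt0) => g; exact: cl_cl.
have DL f : cl D0 f -> cl (lev (s:=s)) f.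
  apply: cl_mono => {}f; apply: rootalg_min; first exact: lev_calg.
  by move=> j n; apply: lev_root; case: j.
move=> f [cf f1]; have [|h Dh fh] := frob_cl hD0 fD (f := f); first by split=> //; exact: LD.
by exists h => //; exact: DL.
Qed.
End CuspPerfectoid.

Lemma ptE (K : cpdata) (s : seq (tate (cpv K))) (w w' : pt s) :
  pz w = pz w' -> (forall i n, prt w i n = prt w' i n) -> w = w'.
Proof.
case: w w' => z r h [z' r' h'] /= e er; move: h'; rewrite -e => h'.
have err : r = r' by apply/funext => i; apply/funext => n.
by move: h; rewrite err => h; rewrite (Prop_irrelevance h h').
Qed.

(** * The Kummer torsor *)

Section KummerAction.
Variable K : cpdata.
Local Notation R := (cpR K).
Local Notation p := (cpp K).
Local Notation p_pr := (cpp_pr K).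
Local Notation C := (cpC K).
Local Notation v := (cpv K).
Local Notation q := (v p%:R).
Local Notation zeta := (cpz K).
Local Notation A := (tate v).

Lemma zresP n (x : C) : Defs.Zp v x -> v (x - (zres v p n x)%:R) <= q ^+ n.
Proof.
move=> hx; rewrite -avX.
have [m hm] := hx (v (p%:R ^+ n)) (etrans (av_gt0 v _) (expf_neq0 n (pC_neq0 K))).
exact: (xgetPex 0%N (P := [set m : nat | v (x - m%:R) <= v (p%:R ^+ n)]) (ex_intro _ m (ltW hm))).
Qed.

Lemma zeta_cong n (a b : nat) : v (a%:R - b%:R) <= q ^+ n -> zeta n ^+ a = zeta n ^+ b.
Proof.
wlog ab : a b / (a <= b)%N.
  move=> H; case: (leqP a b) => [/H//|/ltnW ba] h; apply/esym/(H _ _ ba).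
  by rewrite avBC.
move=> h; have : (p ^ n %| b - a)%N.
  case: (posnP (b - a)) => [->|ba]; first exact: dvdn0.
  by apply: (av_nat_dvd (K := K)) ba; rewrite natrB // avBC.
move=> /dvdnP[k e]; rewrite -(subnKC ab) e exprD mulnC exprM.
by rewrite (prim_expr_order (cpz_prim K n)) expr1n mulr1.
Qed.

Definition zpow n (x : C) := zeta n ^+ zres v p n x.

Lemma zpowE n x (m : nat) : Defs.Zp v x -> v (x - m%:R) <= q ^+ n -> zpow n x = zeta n ^+ m.
Proof.
move=> hx h; apply: zeta_cong; apply: avBtrans h; rewrite avBC; exact: zresP.
Qed.

Lemma zpowS n x : Defs.Zp v x -> zpow n.+1 x ^+ p = zpow n x.
Proof.
move=> hx; rewrite /zpow -exprM mulnC exprM cpz_compat; apply: zeta_cong.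
apply: (avBtrans (y := x)); last exact: zresP.
rewrite avBC; apply: le_trans (zresP _ hx) _; exact: q_anti.
Qed.

Lemma zpow0 x : zpow 0 x = 1. Proof. by rewrite /zpow zeta0 expr1n. Qed.

Lemma natZp (m : nat) : Defs.Zp v (m%:R : C).
Proof. by move=> e e0; exists m; rewrite subrr av0. Qed.

Lemma zpow_nat n m : zpow n m%:R = zeta n ^+ m.
Proof. by apply: zpowE; [exact: natZp|rewrite subrr av0 exprn_ge0 ?q_ge0]. Qed.

Lemma zeroZp : Defs.Zp v (0 : C). Proof. exact: (natZp 0). Qed.

Lemma ZpP (x : C) : (forall m, exists k : nat, v (x - k%:R) <= q ^+ m) -> Defs.Zp v x.
Proof.
move=> h e e0; have [m hm] := q_arch e0; have [k hk] := h m.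
by exists k; apply: le_lt_trans hm.
Qed.

Lemma ZpD x y : Defs.Zp v x -> Defs.Zp v y -> Defs.Zp v (x + y).
Proof.
move=> hx hy; apply: ZpP => m; exists (zres v p m x + zres v p m y)%N.
by rewrite natrD opprD addrACA; apply: avDle; exact: zresP.
Qed.

Lemma Zp_le1 x : Defs.Zp v x -> v x <= 1.
Proof.
move=> hx; apply: (av_near (y := (zres v p 0 x)%:R)); last exact: av_nat.
exact: (zresP 0 hx).
Qed.

Lemma ZpM x y : Defs.Zp v x -> Defs.Zp v y -> Defs.Zp v (x * y).
Proof.
move=> hx hy; apply: ZpP => m; exists (zres v p m x * zres v p m y)%N.
set a := zres v p m x; set b := zres v p m y.
have -> : x * y - (a * b)%:R = (x - a%:R) * y + a%:R * (y - b%:R) by rewrite natrM; ring.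
apply: avDle.
  rewrite -[leRHS]mulr1; apply: avM_le; [exact: zresP|exact: Zp_le1].
rewrite -[leRHS]mul1r; apply: avM_le; [exact: av_nat|exact: zresP].
Qed.

Definition zvec (g : seq C) := forall i, Defs.Zp v g`_i.

Section Points.
Variable s : seq A.

Lemma gactP (g : seq C) (w : pt s) : kval s (pz w) (fun i n => (if `[< zvec g >] then zpow n g`_i else 1) * prt w i n).
Proof.
apply: rotP => i; case: asboolP => hg; last by rewrite expr1n.
by split=> [|n]; [exact: zpow0|exact: zpowS].
Qed.

(** Made total by acting trivially when some entry of g is outside Z_p. *)
Definition gact g (w : pt s) : pt s := Pt (gactP g w).

Lemma gact_r g w i n : zvec g -> prt (gact g w) i n = zpow n g`_i * prt w i n.
Proof. by move=> hg /=; rewrite asboolT. Qed.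
End Points.

Lemma kact0 s g n : @kact R C v p p_pr zeta A idfun s g n 0 = 0.
Proof. by case: s => [//|a s]; rewrite /= /qlift map_poly0 horner0. Qed.

Lemma pev_kact s g n (x : kummer p_pr s n) (w : pt s) : zvec g ->
  pev w (@kact R C v p p_pr zeta A idfun s g n x) = pev (gact g w) x.
Proof.
elim: s g x w => [|a s IH] g x w hg; first by [].
rewrite [RHS]pev_sum /=.
have hb : zvec (behead g) by move=> i; rewrite nth_behead.
have sz : (size (polyn (x : {poly %/ kumpol p (kummer p_pr s) a n})) <= p ^ n)%N.
  apply: leq_trans (size_qpoly (kumpol_size p_pr _ a n) (kumpol_monic p_pr _ a n) _) _.
  by rewrite size_XnsubC // expn_gt0 p_gt0.
rewrite (qliftE _ sz); last by rewrite /= kact0 raddf0.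
rewrite rmorph_sum; apply: eq_bigr => i _.
rewrite rmorphM rmorphXn rmorphM /= [pev w (qpolyC _ _)]pev_C IH //.
rewrite [pev w (kumX _ _ _ _)]pev_X.
have -> : pev w (qpolyC (kumpol p (kummer p_pr s) a n) (str (kummer p_pr s) n (tconst v (zeta n ^+ zres v p n (head 0 g)))) : kummer p_pr (a :: s) n) = zpow n (head 0 g).
  by rewrite pev_C pev_str tev_const ?pz_le1.
rewrite asboolT // nth0; congr (_ * _).
rewrite (_ : gact (behead g) (ptl w) = ptl (gact g w)) //.
by apply/ptE => //= k m; rewrite !asboolT // nth_behead.
Qed.

(** [mlatP] with bound 0: a function vanishing at all points has zero coefficients. *)
Lemma pev_inj s n (x y : kummer p_pr s n) : units s -> (forall w : pt s, pev w x = pev w y) -> x = y.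
Proof.
move=> us h; apply/eqP; rewrite -subr_eq0; apply/eqP.
have : mlat (0 / q ^+ (n * size s)) (x - y).
  by apply: mlatP => // w; rewrite (rmorphB (@pev K s w n)) /= h subrr av0.
rewrite mul0r; move: (x - y); elim: s {us x y h} => [|a s IH] x /= h.
  by apply: tateP => k; apply/(av_eq0 v)/le_anti; rewrite (h k) av_ge0.
rewrite (kum_sum x) big1 // => i _; rewrite (IH _ (h i)).
by rewrite [qpolyC _ 0]raddf0 mul0r.
Qed.

End KummerAction.

(** * Finite etale algebras: bases, composition, Kummer extensions *)

Section FEdef.
Variables (A B : comNzRingType) (phi : {rmorphism A -> B}).

Definition fe_basis (I : finType) (y : I -> B) (f : I -> B -> A) :=
  [/\ forall i, alinear phi (f i), forall b, b = \sum_i phi (f i b) * y i &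
      forall g, alinear phi g -> exists! x, forall b, g b = \sum_i f i (x * b * y i)].

Lemma fe_basis_finite (I : finType) y f : @fe_basis I y f -> finite_etale phi.
Proof.
move=> [h1 h2 h3]; exists #|I|, (y \o enum_val), (f \o enum_val).
have E (T : nmodType) (F : I -> T) : \sum_i F i = \sum_(i < #|I|) F (enum_val i).
  by rewrite (reindex _ (onW_bij _ (enum_val_bij I))).
split=> [i|b|g hg] /=; [exact: h1|by rewrite -(E _ (fun i => phi (f i b) * y i))|].
have [x [hx ux]] := h3 g hg; exists x; split=> [b|x' hx'].
  by rewrite -(E _ (fun i => f i (x * b * y i))).
by apply: ux => b; rewrite (E _ (fun i => f i (x' * b * y i))).
Qed.

Lemma alinear_add g : alinear phi g -> forall x y, g (x + y) = g x + g y.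
Proof. by move=> hg x y; have := hg 1 x y; rewrite rmorph1 !mul1r. Qed.
Lemma alinear0 g : alinear phi g -> g 0 = 0.
Proof. by move=> hg; apply: (@addrI _ (g 0)); rewrite -alinear_add // !addr0. Qed.
Lemma alinearZ g : alinear phi g -> forall a x, g (phi a * x) = a * g x.
Proof. by move=> hg a x; have := hg a x 0; rewrite !addr0 (alinear0 hg) addr0. Qed.
Lemma alinear_sum g (I : Type) (r : seq I) (F : I -> B) : alinear phi g ->
  g (\sum_(i <- r) F i) = \sum_(i <- r) g (F i).
Proof.
move=> hg; elim: r => [|i r IH]; first by rewrite !big_nil alinear0.
by rewrite !big_cons alinear_add // IH.
Qed.
End FEdef.

Section FEComp.
Variables (A B D : comNzRingType) (phi : {rmorphism A -> B}) (psi : {rmorphism B -> D}).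
Variable chi : {rmorphism A -> D}.
Hypothesis chiE : forall a, chi a = psi (phi a).

(** Transitivity of the trace. For fixed c, the form b -> g(psi b * c) is represented by a unique G
    c; uniqueness makes G linear over B, so that G is represented in turn. *)
Lemma fe_basis_comp (I J : finType) (y : I -> B) f (z : J -> D) h : fe_basis phi y f -> fe_basis psi z h ->
  fe_basis chi (fun ij : I * J => psi (y ij.1) * z ij.2) (fun ij c => f ij.1 (h ij.2 c)).
Proof.
move=> [f1 f2 f3] [h1 h2 h3].
pose T c := \sum_j h j (c * z j).
have hT : alinear psi T.
  move=> b c c'; rewrite /T mulr_sumr -big_split; apply: eq_bigr => j _ /=.
  by rewrite mulrDl -mulrA h1.
have TE x b : \sum_(ij : I * J) f ij.1 (h ij.2 (x * b * (psi (y ij.1) * z ij.2))) =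
    \sum_i f i (T (x * b) * y i).
  rewrite -(pair_bigA _ (fun i j => f i (h j (x * b * (psi (y i) * z j))))) /=.
  apply: eq_bigr => i _; rewrite -(alinear_sum _ _ (f1 i)); congr (f i _).
  rewrite /T mulr_suml; apply: eq_bigr => j _.
  by rewrite mulrCA (alinearZ (h1 j)) mulrC.
split=> [[i j] a c c' /=|c|g hg].
- by rewrite chiE h1 f1.
- rewrite {1}(h2 c) -(pair_bigA _ (fun i j => chi (f i (h j c)) * (psi (y i) * z j))) exchange_big /=.
  apply: eq_bigr => j _; rewrite {1}(f2 (h j c)) rmorph_sum mulr_suml; apply: eq_bigr => i _.
  by rewrite rmorphM -mulrA chiE.
have gb c : alinear phi (fun b => g (psi b * c)).
  by move=> a b b'; rewrite rmorphD rmorphM mulrDl -chiE -mulrA hg.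
have /choice[G hG] : forall c, exists x, forall b, g (psi b * c) = \sum_i f i (x * b * y i).
  by move=> c; have [x [hx _]] := f3 _ (gb c); exists x.
have uG c x : (forall b, g (psi b * c) = \sum_i f i (x * b * y i)) -> x = G c.
  by have [x' [_ ux]] := f3 _ (gb c) => hx; rewrite -(ux _ hx) -(ux _ (hG c)).
have lG : alinear psi G.
  move=> b c c'; apply/esym/uG => b'.
  rewrite mulrDr (alinear_add hg) mulrA -rmorphM (hG c) (hG c') -big_split; apply: eq_bigr => i _ /=.
  by rewrite -(alinear_add (f1 i)); congr (f i _); ring.
have [x [hx ux]] := h3 G lG; exists x; split=> [c|x' hx'].
  rewrite TE /T -hx; have := hG c 1; rewrite rmorph1 mul1r => ->.
  by apply: eq_bigr => i _; rewrite mulr1.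
apply: ux => c; apply/esym/uG => b; rewrite hx' TE; apply: eq_bigr => i _; congr (f i _).
by rewrite mulrCA [T _](alinearZ hT) /T; ring.
Qed.
End FEComp.

Section FEKummer.
Variables (S : comNzRingType) (N : nat) (a a' n' : S).
Hypotheses (N0 : (0 < N)%N) (aa : a * a' = 1) (nn : N%:R * n' = 1).
Let h := 'X^N - a%:P.
Let sh : (1 < size h)%N. Proof. by rewrite size_XnsubC. Qed.
Let hm : h \is monic. Proof. exact: monicXnsubC. Qed.
Let Q := {poly %/ h}.
Let X : Q := in_qpoly h 'X.
Let cf (i : nat) (x : Q) : S := (polyn x)`_i.

Let XN : X ^+ N = qpolyC h a.
Proof.
rewrite /X -rmorphXn; apply: val_inj => /=; rewrite (mk_monicE sh hm).
have -> : 'X^N = 1 * h + a%:P by rewrite mul1r addrNK.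
rewrite Pdiv.RingMonic.rmodp_addl_mul_small //.
by rewrite (leq_ltn_trans (size_polyC_leq1 _)).
Qed.

Let xE (x : Q) : x = \sum_(i < N) qpolyC h (cf i x) * X ^+ i.
Proof.
apply: (qpoly_sum sh hm); apply: leq_trans (size_qpoly sh hm _) _.
by rewrite size_XnsubC.
Qed.

Let cf_lin i : alinear (qpolyC h) (cf i).
Proof.
move=> b x y; rewrite /cf (poly_of_qpolyD (h := h)) coefD; congr (_ + _).
rewrite (poly_of_qpolyM (h := h)) qpolyCE mul_polyC Pdiv.CommonRing.rmodp_small ?coefZ //.
exact: leq_ltn_trans (size_scale_leq _ _) (size_mk_monic x).
Qed.

Let cfX i k : (k < N)%N -> cf i (X ^+ k) = (i == k)%:R.
Proof.
move=> kN; rewrite /cf /X -rmorphXn in_qpoly_small ?coefXn //.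
by rewrite (mk_monicE sh hm) size_polyXn size_XnsubC.
Qed.

Let cfXD i k j : (k < N)%N -> (j < N)%N -> cf i (X ^+ k * X ^+ j) =
  if (k + j < N)%N then (i == k + j)%N%:R else a * (i == k + j - N)%N%:R.
Proof.
move=> kN jN; rewrite -exprD; case: ltnP => kj; first exact: cfX.
by rewrite -{1}(subnKC kj) exprD XN (alinearZ (cf_lin i)) cfX //; lia.
Qed.

Let cf0 x j : (j < N)%N -> cf 0 (x * X ^+ j) = if j == 0%N then cf 0 x else a * cf (N - j) x.
Proof.
move=> jN; rewrite {1}(xE x) mulr_suml (alinear_sum _ _ (cf_lin 0)).
under eq_bigr => k _ do rewrite -mulrA (alinearZ (cf_lin 0)) cfXD //.
case: eqP => [->|/eqP j0].
  rewrite (bigD1 (Ordinal N0)) //= addn0 N0 mulr1 big1 ?addr0 // => k.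
  rewrite -val_eqE /= addn0 ltn_ord => k0.
  by rewrite eq_sym (negPf k0) mulr0.
have jl : (N - j < N)%N by lia.
rewrite (bigD1 (Ordinal jl)) //= ifF; last by apply/negbTE; lia.
have -> : (N - j + j - N = 0)%N by lia.
rewrite eqxx mulr1 mulrC big1 ?addr0 // => k.
rewrite -val_eqE /= => kj; case: ltnP => kjN.
  by rewrite (_ : (0%N == _) = false) ?mulr0 //; apply/negbTE; lia.
by rewrite (_ : (0%N == _) = false) ?mulr0 //; apply/negbTE; have := ltn_ord k; lia.
Qed.

Let trE c : \sum_(i < N) cf i (c * X ^+ i) = N%:R * cf 0 c.
Proof.
under eq_bigr => i _ do rewrite {1}(xE c) mulr_suml (alinear_sum _ _ (cf_lin i)).
rewrite exchange_big /= (bigD1 (Ordinal N0)) //= [X in _ + X]big1 ?addr0 => [|k].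
  under eq_bigr => i _ do rewrite -mulrA (alinearZ (cf_lin i)) cfXD // add0n ltn_ord eqxx mulr1.
  by rewrite sumr_const card_ord mulr_natl.
rewrite -val_eqE /= => k0; apply: big1 => i _.
rewrite -mulrA (alinearZ (cf_lin i)) cfXD //.
have ki := ltn_ord k; have iN := ltn_ord i.
by case: ltnP => kj; rewrite (_ : (_ == _) = false) ?mulr0 //; apply/negbTE; lia.
Qed.

(** The trace is N times the constant coefficient, so that 1 is paired with itself and X^k with
    X^(N-k) only, by the units N and N a. The coefficients of [x0] are read off from this. *)
Lemma fe_basis_kummer : @fe_basis S {poly %/ h} (qpolyC h) 'I_N
  (fun i => in_qpoly h 'X ^+ i) (fun i x => (polyn x)`_i).
Proof.
split=> [i|b|g hg]; [exact: cf_lin|exact: xE|].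
pose x0 : Q := in_qpoly h (\poly_(k < N) (if k == 0%N then g 1 * n' else g (X ^+ (N - k)) * a' * n')).
have x0E k : (k < N)%N -> cf k x0 = if k == 0%N then g 1 * n' else g (X ^+ (N - k)) * a' * n'.
  move=> kN; rewrite /cf /x0 in_qpoly_small; first by rewrite coef_poly kN.
  rewrite (mk_monicE sh hm) size_XnsubC //; apply: leq_ltn_trans (size_poly _ _) _; exact: ltnSn.
have key x : (forall b, g b = \sum_(i < N) cf i (x * b * X ^+ i)) <->
   forall k, (k < N)%N -> cf k x = if k == 0%N then g 1 * n' else g (X ^+ (N - k)) * a' * n'.
  have E j : (j < N)%N -> \sum_(i < N) cf i (x * X ^+ j * X ^+ i) = N%:R * (if j == 0%N then cf 0 x else a * cf (N - j) x).
    by move=> jN; rewrite trE cf0.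
  split=> [H k kN|H b].
    case: eqP => [->|/eqP k0].
      by have := H (X ^+ 0); rewrite E //= expr0 => ->; rewrite mulrC mulrA [n' * _]mulrC nn mul1r.
    have kl : (N - k < N)%N by lia.
    have := H (X ^+ (N - k)); rewrite E // ifF; last by apply/negbTE; lia.
    have -> : (N - (N - k) = k)%N by lia.
    move=> ->; transitivity ((N%:R * n') * (a * a') * cf k x); last by ring.
    by rewrite aa nn !mul1r.
  have lg : alinear (qpolyC h) (fun b => \sum_(i < N) cf i (x * b * X ^+ i)).
    by move=> c d d'; rewrite !trE mulrDr [x * (_ * _)]mulrCA (cf_lin 0); ring.
  rewrite (xE b) (alinear_sum _ _ hg) [RHS](alinear_sum _ _ lg); apply: eq_bigr => j _.
  rewrite (alinearZ hg) (alinearZ lg) E //; congr (_ * _); case: eqP => [->|/eqP j0].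
    by rewrite (H 0%N N0) eqxx mulrCA nn mulr1.
  have jl : (N - j < N)%N by lia.
  rewrite (H _ jl) ifF; last by apply/negbTE; have := ltn_ord j; lia.
  have -> : (N - (N - j) = j)%N by have := ltn_ord j; lia.
  transitivity ((N%:R * n') * (a * a') * g (X ^+ j)); last by ring.
  by rewrite aa nn !mul1r.
exists x0; split=> [|x /key hx]; first exact/key.
rewrite (xE x0) (xE x); apply: eq_bigr => k _; by rewrite hx ?x0E.
Qed.
End FEKummer.

Lemma root_inv (S : comNzRingType) (N : nat) (y u u' : S) : (0 < N)%N -> u * u' = 1 -> y ^+ N = u ->
  exists y', y * y' = 1.
Proof. by move=> N0 uu e; exists (y ^+ N.-1 * u'); rewrite mulrA -exprS prednK // e. Qed.

(** * Interpolation at roots of unity *)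

Section Vandermonde.
Variables (S : comNzRingType) (N : nat) (z n' y y' : S).
Hypotheses (nn : N%:R * n' = 1) (yy : y * y' = 1) (zN : z ^+ N = 1).
Hypothesis zsum : forall k, \sum_(i < N) z ^+ (k * i) = if (N %| k)%N then N%:R else 0.

Lemma lagrange_ex (c : nat -> S) : exists F : nat -> S,
  forall g : 'I_N, \sum_(i < N) F i * (z ^+ g * y) ^+ i = c g.
Proof.
exists (fun i => n' * y' ^+ i * \sum_(k < N) z ^+ ((N - k) * i) * c k) => g.
transitivity (\sum_(i < N) \sum_(k < N) n' * c k * z ^+ ((N - k + g) * i)).
  apply: eq_bigr => i _; rewrite mulr_sumr mulr_suml; apply: eq_bigr => k _.
  rewrite exprMn -exprM mulnDl exprD.
  transitivity (n' * c k * (z ^+ ((N - k) * i) * z ^+ (g * i)) * (y * y') ^+ i).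
    by rewrite exprMn; ring.
  by rewrite yy expr1n mulr1.
rewrite exchange_big (bigD1 g) //= [X in _ + X]big1 => [|k kg].
  rewrite -mulr_sumr zsum subnK ?dvdnn ?addr0; last exact: ltnW.
  by rewrite mulrAC [n' * _]mulrC nn mul1r.
rewrite -mulr_sumr zsum ifF ?mulr0 //; apply/negbTE.
have gN := ltn_ord g; have kN := ltn_ord k; apply: contra kg; rewrite -val_eqE /=.
move=> /dvdnP[[|[|j]] e]; lia.
Qed.

Lemma lagrange_uniq (F : nat -> S) :
  (forall g : 'I_N, \sum_(i < N) F i * (z ^+ g * y) ^+ i = 0) -> forall i : 'I_N, F i = 0.
Proof.
move=> h i.
have : \sum_(g < N) z ^+ ((N - i) * g) * (\sum_(j < N) F j * (z ^+ g * y) ^+ j) = N%:R * (F i * y ^+ i).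
  transitivity (\sum_(g < N) \sum_(j < N) F j * y ^+ j * z ^+ ((N - i + j) * g)).
    apply: eq_bigr => g _; rewrite mulr_sumr; apply: eq_bigr => j _.
    by rewrite exprMn -exprM mulnDl exprD (mulnC g); ring.
  rewrite exchange_big (bigD1 i) //= [X in _ + X]big1 => [|j ji].
    by rewrite -mulr_sumr zsum subnK ?dvdnn ?addr0 1?mulrC // ltnW.
  rewrite -mulr_sumr zsum ifF ?mulr0 //; apply/negbTE.
  have iN := ltn_ord i; have jN := ltn_ord j; apply: contra ji; rewrite -val_eqE /=.
  move=> /dvdnP[[|[|k]] e]; lia.
rewrite big1 => [e|g _]; last by rewrite h mulr0.
transitivity ((N%:R * n') * (y * y') ^+ i * F i); first by rewrite nn yy expr1n !mul1r.
by rewrite exprMn; transitivity (n' * y' ^+ i * (N%:R * (F i * y ^+ i))); [ring|rewrite -e mulr0].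
Qed.
End Vandermonde.

Section Torsor.
Variable K : cpdata.
Local Notation R := (cpR K).
Local Notation p := (cpp K).
Local Notation p_pr := (cpp_pr K).
Local Notation C := (cpC K).
Local Notation v := (cpv K).
Local Notation q := (v p%:R).
Local Notation zeta := (cpz K).
Local Notation A := (tate v).
Variables (a1 a2 b1 b2 : A).
Hypotheses (ab1 : a1 * b1 = 1) (ab2 : a2 * b2 = 1).
Let s := [:: a1; a2].
Hypothesis us : units s.
Local Notation B := (kummer p_pr s).
Let pn0 n : (0 < p ^ n)%N. Proof. by rewrite expn_gt0 p_gt0. Qed.

Let invn n : A := tconst v (p ^ n)%:R^-1.
Let tev_inj (f g : A) : (forall z, v z <= 1 -> tev z f = tev z g) -> f = g.
Proof.
move=> h; have us0 : units (Nil A) by move=> [].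
apply: (@pev_inj K [::] 0 f g us0) => w; exact: h (pz_le1 w).
Qed.
Let tev_nat z (m : nat) : v z <= 1 -> tev z m%:R = m%:R.
Proof.
move=> z1; have [w <-] := pt_ex (Nil A) z1.
exact: (rmorph_nat (@pev K [::] w 0) m).
Qed.
Let invnP n : (p ^ n)%:R * invn n = 1.
Proof.
apply: tev_inj => z z1; rewrite tevM // tev_nat // tev_const //.
rewrite (tev_nat 1 z1) mulfV //; apply: natC_neq0; exact: pn0.
Qed.

Lemma kummer_finite_etale n : finite_etale (str B n).
Proof.
have h1 := @fe_basis_kummer A (p ^ n) a2 b2 (invn n) (pn0 n) ab2 (invnP n).
pose S2 := kummer p_pr [:: a2] n.
have e1 : (str (kummer p_pr [:: a2]) n a1) * (str (kummer p_pr [:: a2]) n b1) = 1 by rewrite -rmorphM ab1 rmorph1.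
have e2 : (p ^ n)%:R * (str (kummer p_pr [:: a2]) n (invn n)) = 1.
  by rewrite -(rmorph_nat (str (kummer p_pr [:: a2]) n)) -rmorphM invnP rmorph1.
have h2 := fe_basis_kummer (pn0 n) e1 e2.
exact: fe_basis_finite (@fe_basis_comp _ _ _ _ _ (str B n) (fun a => erefl) _ _ _ _ _ _ h1 h2).
Qed.

Section Level.
Variable n : nat.
Let z : B n := kscal s n (zeta n).
Let y1 : B n := @Defs.root1 R C v p p_pr a1 a2 n.
Let y2 : B n := @Defs.root2 R C v p p_pr a1 a2 n.

Let zv (g h : nat) : @zvec K [:: g%:R; h%:R].
Proof. by move=> [|[|i]] /=; rewrite ?nth_nil; [exact: natZp|exact: natZp|exact: zeroZp]. Qed.

Let pev_y1 w : pev w y1 = prt w 0 n. Proof. exact: pev_X. Qed.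
Let pev_y2 w : pev w y2 = prt w 1 n.
Proof. by rewrite /y2 /Defs.root2 [LHS]pev_C; exact: pev_X. Qed.

Let actE1 (g h : nat) : @actB R C v p p_pr zeta a1 a2 g%:R h%:R n y1 = z ^+ g * y1.
Proof.
apply: (pev_inj us) => w; rewrite /actB (pev_kact _ _ (zv g h)) rmorphM rmorphXn /=.
by rewrite pev_scal !pev_y1 gact_r ?zpow_nat.
Qed.
Let actE2 (g h : nat) : @actB R C v p p_pr zeta a1 a2 g%:R h%:R n y2 = z ^+ h * y2.
Proof.
apply: (pev_inj us) => w; rewrite /actB (pev_kact _ _ (zv g h)) rmorphM rmorphXn /=.
by rewrite pev_scal !pev_y2 gact_r ?zpow_nat.
Qed.

Let pev_nat (w : pt s) (m : nat) : pev w (m%:R : B n) = m%:R.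
Proof. exact: (rmorph_nat (@pev K s w n)). Qed.

Let zN : z ^+ (p ^ n) = 1.
Proof.
apply: (pev_inj us) => w; rewrite rmorphXn /= pev_scal (prim_expr_order (cpz_prim K n)).
exact: (esym (rmorph1 (@pev K s w n))).
Qed.
Let zsum k : \sum_(i < p ^ n) z ^+ (k * i) = if (p ^ n %| k)%N then (p ^ n)%:R else 0.
Proof.
apply: (pev_inj us) => w; rewrite rmorph_sum /=.
transitivity (\sum_(i < p ^ n) zeta n ^+ (k * i)).
  by apply: eq_bigr => i _; rewrite rmorphXn /= pev_scal.
rewrite sum_prim_root; last exact: cpz_prim.
by case: ifP => _; [rewrite (pev_nat w (p ^ n))|rewrite (pev_nat w 0)].
Qed.
Let nn : (p ^ n)%:R * str B n (invn n) = 1.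
Proof. by rewrite -(rmorph_nat (str B n)) -rmorphM invnP rmorph1. Qed.

Let str_inv a b : a * b = 1 -> str B n a * str B n b = 1.
Proof. by move=> ab; rewrite -rmorphM ab rmorph1. Qed.
Let y1N : y1 ^+ (p ^ n) = str B n a1.
Proof.
apply: (pev_inj us) => w; rewrite rmorphXn /= pev_y1 pev_str.
by rewrite (psys_pow (r := prt w 0)) ?prt0 // => m; exact: prtS.
Qed.
Let y2N : y2 ^+ (p ^ n) = str B n a2.
Proof.
apply: (pev_inj us) => w; rewrite rmorphXn /= pev_y2 pev_str.
by rewrite (psys_pow (r := prt w 1)) ?prt0 // => m; exact: prtS.
Qed.

Local Notation T := (kummer p_pr [:: str B n a2] n).
Let h2 := kumpol p (const_tower (B n)) (str B n a2) n.
Let h1 := kumpol p (kummer p_pr [:: str B n a2]) (str B n a1) n.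
Let sh2 : (1 < size h2)%N. Proof. exact: (kumpol_size p_pr). Qed.
Let hm2 : h2 \is monic. Proof. exact: (kumpol_monic p_pr). Qed.
Let sh1 : (1 < size h1)%N. Proof. exact: (kumpol_size p_pr). Qed.
Let hm1 : h1 \is monic. Proof. exact: (kumpol_monic p_pr). Qed.
Let sz2 (x : {poly %/ h2}) : (size (polyn x) <= p ^ n)%N.
Proof. by apply: leq_trans (size_qpoly sh2 hm2 x) _; rewrite size_XnsubC. Qed.
Let sz1 (x : {poly %/ h1}) : (size (polyn x) <= p ^ n)%N.
Proof. by apply: leq_trans (size_qpoly sh1 hm1 x) _; rewrite size_XnsubC. Qed.

Let in2 (F : nat -> B n) i : (i < p ^ n)%N -> (polyn (in_qpoly h2 (\poly_(j < p ^ n) F j)))`_i = F i.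
Proof.
move=> ij; rewrite in_qpoly_small ?coef_poly ?ij // (mk_monicE sh2 hm2) size_XnsubC //.
by apply: leq_ltn_trans (size_poly _ _) _.
Qed.
Let in1 (F : nat -> T) i : (i < p ^ n)%N -> (polyn (in_qpoly h1 (\poly_(j < p ^ n) F j)))`_i = F i.
Proof.
move=> ij; rewrite in_qpoly_small ?coef_poly ?ij // (mk_monicE sh1 hm1) size_XnsubC //.
by apply: leq_ltn_trans (size_poly _ _) _.
Qed.

Let actE (g h : nat) (f : @selfprod R C v p p_pr a1 a2 n) : @selfprod_act R C v p p_pr zeta a1 a2 g%:R h%:R n f =
  \sum_(i < p ^ n) (\sum_(j < p ^ n) (polyn ((polyn (f : {poly %/ h1}))`_i : {poly %/ h2}))`_j * (z ^+ h * y2) ^+ j) * (z ^+ g * y1) ^+ i.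
Proof.
rewrite /selfprod_act actE1 actE2 (qliftE _ (sz1 f)); last by rewrite /qlift map_poly0 horner0.
by apply: eq_bigr => i _; rewrite (qliftE _ (sz2 _)).
Qed.

(** Interpolation is done in the outer root and, coefficient by coefficient, in the inner one; both
    roots are units because [a1] and [a2] are. *)
Lemma selfprod_bij (b : 'I_(p ^ n) -> 'I_(p ^ n) -> B n) : exists! f : @selfprod R C v p p_pr a1 a2 n,
  forall g h : 'I_(p ^ n), @selfprod_act R C v p p_pr zeta a1 a2 (g : nat)%:R (h : nat)%:R n f = b g h.
Proof.
have [y1' yy1] := root_inv (pn0 n) (str_inv ab1) y1N.
have [y2' yy2] := root_inv (pn0 n) (str_inv ab2) y2N.
pose b' (g h : nat) := b (insubd (Ordinal (pn0 n)) g) (insubd (Ordinal (pn0 n)) h).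
have b'E (g h : 'I_(p ^ n)) : b' g h = b g h by rewrite /b' !valKd.
have /choice[F hF] : forall h, exists F : nat -> B n, forall g : 'I_(p ^ n),
    \sum_(i < p ^ n) F i * (z ^+ g * y1) ^+ i = b' g h.
  by move=> h; exact: (lagrange_ex nn yy1 zsum (fun g => b' g h)).
have /choice[G hG] : forall i, exists G : nat -> B n, forall h : 'I_(p ^ n),
    \sum_(j < p ^ n) G j * (z ^+ h * y2) ^+ j = F h i.
  by move=> i; exact: (lagrange_ex nn yy2 zsum (fun h => F h i)).
exists (in_qpoly h1 (\poly_(i < p ^ n) in_qpoly h2 (\poly_(j < p ^ n) G i j))).
have key f : (forall g h : 'I_(p ^ n), @selfprod_act R C v p p_pr zeta a1 a2 (g : nat)%:R (h : nat)%:R n f = b g h) ->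
    forall i j : 'I_(p ^ n), (polyn ((polyn (f : {poly %/ h1}))`_i : {poly %/ h2}))`_j = G i j.
  move=> hf i j.
  pose X i j := (polyn ((polyn (f : {poly %/ h1}))`_i : {poly %/ h2}))`_j - G i j.
  suff : X i j = 0 by move/eqP; rewrite subr_eq0 => /eqP.
  apply: (lagrange_uniq nn yy2 zsum (F := X i)) => h.
  pose Y i := \sum_(j < p ^ n) X i j * (z ^+ h * y2) ^+ j.
  apply: (lagrange_uniq nn yy1 zsum (F := Y)) => g.
  transitivity (@selfprod_act R C v p p_pr zeta a1 a2 (g : nat)%:R (h : nat)%:R n f - b' g h); last by rewrite hf b'E subrr.
  rewrite -hF actE -sumrB; apply: eq_bigr => i' _; rewrite -hG -mulrBl -sumrB; congr (_ * _).
  by apply: eq_bigr => j' _; rewrite -mulrBl.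
split=> [g h|f hf].
  rewrite actE -b'E -hF; apply: eq_bigr => i _; rewrite in1 // -hG; congr (_ * _).
  by apply: eq_bigr => j _; rewrite in2.
apply: val_inj; apply/polyP => i; case: (ltnP i (p ^ n)) => iN; last first.
  rewrite [LHS]nth_default ?[RHS]nth_default //; apply: leq_trans iN; exact: sz1.
rewrite [LHS]in1 //; apply: val_inj; apply/polyP => j; case: (ltnP j (p ^ n)) => jN; last first.
  rewrite [LHS]nth_default ?[RHS]nth_default //; apply: leq_trans jN; exact: sz2.
transitivity (G i j); first exact: in2.
exact: (esym (key f hf (Ordinal iN) (Ordinal jN))).
Qed.
End Level.

Lemma kummer_torsor : profinite_etale_torsor p_pr zeta a1 a2.
Proof.
move=> n; split; [exact: kummer_finite_etale|exact: selfprod_bij|move=> g h hg hh x].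
have hz : zvec [:: g; h] by move=> [|[|i]] //=; rewrite nth_nil; exact: zeroZp.
apply: (pev_inj us) => w; rewrite /actB (pev_kact _ _ hz) !pev_tr (pev_kact _ _ hz) //.
Qed.
End Torsor.

Section Inverse.
Variable K : cpdata.
Local Notation C := (cpC K).
Local Notation v := (cpv K).
Local Notation q := (v (cpp K)%:R).
Variable w0 : C.
Hypothesis w0_lt1 : v w0 < 1.

(** The geometric series in -w0 t^k. *)
Lemma kumT_inv k : (0 < k)%N -> exists b, kumT w0 k * b = 1.
Proof.
move=> k0; pose c n : C := if (k %| n)%N then (- w0) ^+ (n %/ k) else 0.
have hc : tends0 v c.
  move=> e e0; have [m hm] := pow_arch w0_lt1 (divr_gt0 e0 (ltr0n _ 2)).
  exists (m * k)%N => n; rewrite /c; case: ifP => [kn mn|_ _]; last by rewrite av0.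
  apply: le_lt_trans (_ : e / 2 < e); last by rewrite ltr_pdivrMr // ltr_pMr // ltr1n.
  apply: le_trans hm; rewrite avX avN; apply: ler_wiXn2l; rewrite ?av_ge0 ?(ltW w0_lt1) //.
  by rewrite leq_divRL.
exists (Tate hc).
have -> : kumT w0 k = tpoly (1 + w0%:P * 'X^k).
  by rewrite /kumT rmorphD rmorphM rmorph1 rmorphXn /= tpolyC tpolyX.
apply: tateP => n /=.
transitivity (c n + w0 * (if (k <= n)%N then c (n - k)%N else 0)).
  transitivity (\sum_(i < n.+1) (i == 0%N :> nat)%:R * c (n - i)%N + \sum_(i < n.+1) w0 * ((i == k :> nat)%:R * c (n - i)%N)).
    rewrite -big_split; apply: eq_bigr => i _ /=.
    by rewrite coefD coef1 coefCM coefXn; ring.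
  congr (_ + _).
    by rewrite big_ord_recl big1 ?subn0 ?mul1r ?addr0 // => i _; rewrite mul0r.
  rewrite -mulr_sumr; congr (_ * _); case: leqP => kn.
    have kn' : (k < n.+1)%N by [].
    rewrite (bigD1 (Ordinal kn')) //= eqxx mul1r big1 ?addr0 // => i.
    by rewrite -val_eqE /= => /negPf ->; rewrite mul0r.
  by rewrite big1 // => i _; rewrite ltn_eqF ?mul0r // (leq_ltn_trans _ kn) // -ltnS.
rewrite /c; case: n => [|n].
  by rewrite dvdn0 div0n leqNgt k0 mulr0 addr0.
case: (leqP k n.+1) => kn; last by rewrite mulr0 addr0 gtnNdvd.
rewrite -{1 2}(subnK kn) dvdn_addl //; case: ifP => dv; last by rewrite mulr0 addr0.
by rewrite divnDr // divnn k0 addn1 exprS; ring.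
Qed.
End Inverse.

(** * Dividing by xi *)

Section Tilted.
Variable K : cpdata.
Local Notation R := (cpR K).
Local Notation p := (cpp K).
Local Notation C := (cpC K).
Local Notation v := (cpv K).
Local Notation q := (v p%:R).
Local Notation zeta := (cpz K).
Implicit Types (l : nat -> C).

(* A sequence l stands for an element of W(O^flat): l n is the image of its n-th inverse
   Frobenius twist, and [tdelta] is the delta-structure. *)
Definition tdelta l n : C := (l n - l n.+1 ^+ p) / p%:R.

(** Bounds the iterates of [tdelta] up to order k. Having all orders ([inW]) plays the role of
    integrality in A_inf; the filtration by k is what makes inductions possible. *)
Fixpoint inWk k l : Prop :=
  (forall n, v (l n) <= 1) /\ (if k is k'.+1 then inWk k' (tdelta l) else True).

Definition inW l := forall k, inWk k l.

Lemma inWk_le1 k l : inWk k l -> forall n, v (l n) <= 1.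
Proof. by case: k => [|k] []. Qed.

Lemma inWk_mono k l : inWk k.+1 l -> inWk k l.
Proof.
elim: k l => [|k IH] l; first by move=> [h _].
by move=> [h1 h2]; split=> //; exact: IH.
Qed.

Lemma inWk_shift k l : inWk k l -> inWk k (fun n => l n.+1).
Proof. by elim: k l => [|k IH] l [h1 h2]; split=> //; apply: (IH (tdelta l)). Qed.

Lemma tdeltaE l n : l n = l n.+1 ^+ p + p%:R * tdelta l n.
Proof. by rewrite /tdelta mulrCA mulfV ?pC_neq0 // mulr1 addrC subrK. Qed.

Lemma tdelta_eq l n x : l n = l n.+1 ^+ p + p%:R * x -> tdelta l n = x.
Proof. by move=> e; apply: (mulfI (pC_neq0 K)); apply: (addrI (l n.+1 ^+ p)); rewrite -tdeltaE. Qed.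

Lemma tdeltaD l m n : tdelta (fun n => l n + m n) n =
  tdelta l n + tdelta m n + (-1) * ccross p (l n.+1) (m n.+1).
Proof.
by apply: tdelta_eq; rewrite ccrossE ?cpp_pr // {1}(tdeltaE l) {1}(tdeltaE m); ring.
Qed.

Lemma tdeltaM l m n : tdelta (fun n => l n * m n) n =
  l n.+1 ^+ p * tdelta m n + m n.+1 ^+ p * tdelta l n + p%:R * (tdelta l n * tdelta m n).
Proof.
by apply: tdelta_eq; rewrite exprMn {1}(tdeltaE l) {1}(tdeltaE m); ring.
Qed.

(** Such sequences are the Teichmuller elements, which the delta-operator kills. *)
Lemma inW_root l : (forall n, v (l n) <= 1) -> (forall n, l n.+1 ^+ p = l n) -> inW l.
Proof.
have z : inW (fun=> 0).
  elim=> [|k IH]; first by split=> // n; rewrite av0.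
  split=> [n|]; first by rewrite av0.
  have -> : tdelta (fun=> 0) = fun=> 0.
    by apply/funext => n; apply: tdelta_eq; rewrite expr0n gtn_eqF ?p_gt0 // mulr0 addr0.
  exact: IH.
move=> h e [|k]; split=> //; have -> : tdelta l = fun=> 0; last exact: z.
by apply/funext => n; apply: tdelta_eq; rewrite mulr0 addr0 e.
Qed.

Lemma inW0 : inW (fun=> 0).
Proof. by apply: inW_root => n; rewrite ?av0 // expr0n gtn_eqF ?p_gt0. Qed.
Lemma inW1 : inW (fun=> 1).
Proof. by apply: inW_root => n; rewrite ?av1 // expr1n. Qed.
Lemma inWN1 : inW (fun=> -1).
Proof.
elim=> [|k IH]; first by split=> // n; rewrite avN av1.
split=> [n|]; first by rewrite avN av1.
case: (boolP (odd p)) => [op|]; last first.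
  (* For p = 2 the constant -1 is not its own p-th power, and delta(-1) = -1. *)
  case: (even_prime (cpp_pr K)) => [p2 _|-> //].
  have -> : tdelta (fun=> -1) = fun=> -1; last exact: IH.
  by apply/funext => n; apply: tdelta_eq; rewrite p2; ring.
have -> : tdelta (fun=> -1) = fun=> 0; last exact: inW0.
apply/funext => n; apply: tdelta_eq; by rewrite -signr_odd op mulr0 addr0 expr1.
Qed.

Definition wsub (S : (nat -> C) -> Prop) := [/\ S (fun=> 0), S (fun=> 1), S (fun=> -1),
  forall l m, S l -> S m -> S (fun n => l n + m n) &
  forall l m, S l -> S m -> S (fun n => l n * m n)].

Section WSub.
Variable S : (nat -> C) -> Prop.
Hypothesis hS : wsub S.

Lemma wsub_sum (I : Type) (r : seq I) (F : I -> nat -> C) : (forall i, S (F i)) ->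
  S (fun n => \sum_(i <- r) F i n).
Proof.
case: hS => s0 _ _ sD _ h; elim: r => [|i r IH].
  by have := s0; congr S; apply/funext => n; rewrite big_nil.
by have := sD _ _ (h i) IH; congr S; apply/funext => n; rewrite big_cons.
Qed.

Lemma wsub_X l k : S l -> S (fun n => l n ^+ k).
Proof.
case: hS => _ s1 _ _ sM h; elim: k => [|k IH]; first exact: s1.
by have := sM _ _ h IH; congr S; apply/funext => n; rewrite exprS.
Qed.

Lemma wsub_Mn l k : S l -> S (fun n => l n *+ k).
Proof.
case: hS => s0 _ _ sD _ h; elim: k => [|k IH]; first exact: s0.
by have := sD _ _ h IH; congr S; apply/funext => n; rewrite mulrS.
Qed.

Lemma wsub_nat k : S (fun=> k%:R).
Proof. by case: hS => _ s1 _ _ _; have := wsub_Mn k s1. Qed.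

Lemma wsub_B l m : S l -> S m -> S (fun n => l n - m n).
Proof.
case: hS => _ _ sN sD sM hl hm; have := sD _ _ hl (sM _ _ sN hm); congr S.
by apply/funext => n; rewrite mulN1r.
Qed.

Lemma wsub_cross l m : S l -> S m -> S (fun n => ccross p (l n) (m n)).
Proof.
case: (hS) => _ _ _ _ sM hl hm; apply: wsub_sum => i; apply: wsub_Mn.
by apply: sM; apply: wsub_X.
Qed.
End WSub.

Lemma inWk_sub k : wsub (inWk k).
Proof.
elim: k => [|k IH].
  split; try (by split=> // n; rewrite ?avN ?av0 ?av1).
    by move=> l m [hl _] [hm _]; split=> // n; exact: avDle.
  by move=> l m [hl _] [hm _]; split=> // n; exact: avM1.
have [s0 s1 sN sD sM] := IH.
split; [exact: inW0|exact: inW1|exact: inWN1| |].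
  move=> l m hl hm; split=> [n|]; first by apply: avDle; [exact: inWk_le1 hl _|exact: inWk_le1 hm _].
  have -> : tdelta (fun n => l n + m n) = fun n =>
     tdelta l n + tdelta m n + (-1) * ccross p (l n.+1) (m n.+1) by apply/funext => n; exact: tdeltaD.
  apply: (sD); first by apply: (sD); [case: hl|case: hm].
  apply: (sM); first exact: sN.
  by apply: (wsub_cross IH); apply/inWk_shift/inWk_mono.
move=> l m hl hm; split=> [n|]; first by apply: avM1; [exact: inWk_le1 hl _|exact: inWk_le1 hm _].
have -> : tdelta (fun n => l n * m n) = fun n =>
  l n.+1 ^+ p * tdelta m n + m n.+1 ^+ p * tdelta l n + p%:R * (tdelta l n * tdelta m n).
  by apply/funext => n; exact: tdeltaM.
have [_ dl] := hl; have [_ dm] := hm.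
apply: (sD); last by apply: (sM); [exact: (wsub_nat IH)|exact: sM].
by apply: (sD); apply: (sM) => //; apply: (wsub_X IH); apply/inWk_shift/inWk_mono.
Qed.

Lemma inW_sub : wsub inW.
Proof.
split; [exact: inW0|exact: inW1|exact: inWN1| |] => l m hl hm k;
  have [_ _ _ sD sM] := inWk_sub k; [exact: sD|exact: sM].
Qed.

(** delta(p l) = l - p^(p-1) l'^p, with l' the shift of l: a factor p gains one order. *)
Lemma inWk_p k l : inWk k l -> inWk k.+1 (fun n => p%:R * l n).
Proof.
move=> hl; have hS := inWk_sub k; have [_ _ _ _ sM] := hS.
split=> [n|]; first by apply: avM1; [exact: q_le1|exact: inWk_le1 hl _].
have -> : tdelta (fun n => p%:R * l n) = fun n => l n - p%:R ^+ p.-1 * l n.+1 ^+ p.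
  apply/funext => n; apply: tdelta_eq; have e : (p%:R : C) ^+ p = p%:R * p%:R ^+ p.-1 by rewrite -exprS prednK ?p_gt0.
  by rewrite exprMn e; ring.
apply: (wsub_B hS) => //; apply: (sM); first exact: (wsub_X hS _ (wsub_nat hS p)).
by apply: (wsub_X hS); exact: inWk_shift.
Qed.

(** Solve the same identity for l: the correction p^(p-1) l'^p is p times an element of an order
    already known. *)
Lemma inWk_divp k l : (forall n, v (l n) <= 1) -> inWk k.+1 (fun n => p%:R * l n) -> inWk k l.
Proof.
move=> h; elim: k => [|k IH] hp; first by [].
have hl := IH (inWk_mono hp); have hS := inWk_sub k.+1; have [_ _ _ sD sM] := hS.
have hk := inWk_sub k; have [_ _ _ _ sMk] := hk.
have [_ dp] := hp.
have -> : l = fun n => tdelta (fun n => p%:R * l n) n + p%:R * (p%:R ^+ p.-2 * l n.+1 ^+ p).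
  apply/funext => n; have e := tdeltaE (fun n => p%:R * l n) n.
  apply: (mulfI (pC_neq0 K)); rewrite e exprMn mulrDr addrC; congr (_ + _).
  have [k' pk] : exists k', p = k'.+2 by exists p.-2; have := p_gt1 K; lia.
  rewrite !mulrA; congr (_ * _); rewrite pk /=; by rewrite !exprS mulrA.
apply: (sD) => //; apply: inWk_p; apply: (sMk); first exact: (wsub_X hk _ (wsub_nat hk p)).
by apply: (wsub_X hk); apply: inWk_shift.
Qed.

Lemma inW_divp l : (forall n, v (l n) <= 1) -> inW (fun n => p%:R * l n) -> inW l.
Proof. by move=> h hp k; apply: inWk_divp => //; exact: hp. Qed.

(** Here l_0 = p delta(l)_0, and delta(l) has a zero tail again, so l_0 is divisible by all powers
    of p. *)
Lemma inW_tail l : inW l -> (forall n, l n.+1 = 0) -> l 0%N = 0.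
Proof.
move=> hW hl; apply: av_eq0_q => k; elim: k l hl {hW}(hW k) => [|k IH] l hl; first by move=> [h _].
move=> [_ hd]; have := IH _ _ hd; rewrite /tdelta hl expr0n gtn_eqF ?p_gt0 // subr0 avf ler_pdivrMr ?q_gt0 //.
rewrite exprSr; apply=> n; by rewrite !hl expr0n gtn_eqF ?p_gt0 // subr0 mul0r.
Qed.

(** The sequence of xi = 1 + [eps^(1/p)] + ... + [eps^((p-1)/p)], a generator of the kernel of
    theta; its entry at 0 vanishes. *)
Definition txi n : C := \sum_(i < p) zeta n.+1 ^+ i.

Lemma txiE n : txi n * (zeta n.+1 - 1) = zeta n - 1.
Proof. by rewrite mulrC /txi -subrX1 cpz_compat. Qed.

Lemma zeta_neq1 n : zeta n.+1 != 1.
Proof.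
apply/eqP => e; have := prim_order_dvd (cpz_prim K n.+1) 1.
rewrite expr1 e eqxx dvdn1 => /eqP h.
by have := ltn_expl n.+1 (p_gt1 K); rewrite h.
Qed.

Lemma txi0 : txi 0 = 0.
Proof.
have := txiE 0; rewrite zeta0 subrr => /eqP; rewrite mulf_eq0 => /orP[/eqP //|].
by rewrite subr_eq0 (negPf (zeta_neq1 0)).
Qed.

Lemma inW_zeta k : inW (fun n => zeta (n + k)%N).
Proof. by apply: inW_root => n; rewrite ?av_zeta // addSn cpz_compat. Qed.

Lemma inW_txi : inW txi.
Proof.
apply: (wsub_sum inW_sub) => i; apply: (wsub_X inW_sub).
by have := inW_zeta 1; congr inW; apply/funext => n; rewrite addn1.
Qed.

Lemma av_zeta1X i : (0 < i < p)%N -> v (zeta 1 ^+ i - 1) = v (zeta 1 - 1).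
Proof.
move=> /andP[i0 ip]; have zp := cpz_prim K 1; rewrite expn1 in zp.
have le (z : C) j : v z <= 1 -> v (z ^+ j - 1) <= v (z - 1).
  move=> z1; rewrite subrX1 avM ler_piMr ?av_ge0 //; apply: av_sum_le => // k _; exact: avX1.
apply/le_anti; rewrite le ?av_zeta //=.
have /(coprimeP _ i0)[[a b] /= ab] : coprime i p.
  by rewrite coprime_sym prime_coprime ?cpp_pr // gtnNdvd.
have e : zeta 1 = (zeta 1 ^+ i) ^+ a.
  have e : (i * a = b * p + 1)%N by lia.
  by rewrite -exprM e exprD mulnC exprM (prim_expr_order zp) expr1n mul1r.
by rewrite {1}e; apply: le; apply: avX1; rewrite av_zeta.
Qed.

(** The product of 1 - zeta_1^i over 0 < i < p is p, and its factors have equal norms. *)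
Lemma av_zeta1 : v (zeta 1 - 1) ^+ p.-1 = q.
Proof.
have zp := cpz_prim K 1; rewrite expn1 in zp.
have prodE : \prod_(1 <= i < p) (1 - zeta 1 ^+ i) = p%:R.
  have := factor_Xn_sub_1 zp; rewrite big_ltn ?p_gt0 // expr0 subrX1.
  have X0 : 'X - 1%:P != 0 :> {poly C} by rewrite polyXsubC_eq0.
  move/(mulfI X0)/(congr1 (fun P => P.[1])); rewrite horner_prod horner_sum.
  under eq_bigr do rewrite hornerXsubC.
  move=> ->; under eq_bigr do rewrite hornerXn expr1n.
  by rewrite sumr_const card_ord.
have -> : q = \prod_(1 <= i < p) v (1 - zeta 1 ^+ i).
  by rewrite -prodE; elim/big_ind2: _ => [|x x' y y' <- <-|//]; rewrite ?av1 ?avM.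
rewrite (eq_big_nat _ _ (F2 := fun=> v (zeta 1 - 1))); last by move=> i hi; rewrite avBC av_zeta1X.
by rewrite big_const_nat GRing.iter_mulr_1 subn1.
Qed.

(** The lower bound is carried through the induction: it makes a^p dominate the cross term in (1 +
    a)^p = 1 + b. *)
Lemma av_zetaS n : v (zeta n.+2 - 1) ^+ p = v (zeta n.+1 - 1) /\ q <= v (zeta n.+1 - 1) ^+ p.-1.
Proof.
have p0 := p_gt0 K; have p1 := p_gt1 K; have q0 := q_gt0 K.
suff H n' : q <= v (zeta n'.+1 - 1) ^+ p.-1 -> v (zeta n'.+2 - 1) ^+ p = v (zeta n'.+1 - 1) /\
     q <= v (zeta n'.+2 - 1) ^+ p.-1.
  have G m : q <= v (zeta m.+1 - 1) ^+ p.-1.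
    by elim: m => [|m IH]; [rewrite av_zeta1|case: (H m IH)].
  by split; [case: (H n (G n))|exact: G].
set b := zeta n'.+1 - 1; set a := zeta n'.+2 - 1 => hb.
have a0 : 0 < v a by rewrite av_gt0 subr_eq0 zeta_neq1.
have a1 : v a <= 1 by apply: avBle; rewrite ?av_zeta ?av1.
have ab : b = a ^+ p + p%:R * ccross p 1 a.
  have := ccrossE 1 a (cpp_pr K); rewrite addrC subrK cpz_compat expr1n /b => ->; ring.
have cr : v (ccross p 1 a) <= v a.
  apply: av_sum_le => [|i _]; first exact: av_ge0.
  apply: le_trans (avMn _ _ _) _; rewrite expr1n mul1r avX exprS ler_piMr ?av_ge0 //.
  by rewrite exprn_ile1 ?av_ge0.
have pa : v (b - a ^+ p) <= q * v a.
  by rewrite ab addrAC subrr add0r avM ler_wpM2l ?q_ge0.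
have big : q < v a ^+ p.-1.
  rewrite ltNge; apply/negP => small.
  have bq : v b <= q * v a.
    apply: av_near pa _; rewrite avX -{1}(prednK p0) exprSr; apply: ler_wpM2r small; exact: av_ge0.
  have : v b ^+ p.-1 <= (q * v a) ^+ p.-1 by apply: lerXn2r; rewrite ?nnegrE ?mulr_ge0 ?av_ge0.
  move=> /(le_trans hb); rewrite exprMn leNgt => /negP; apply.
  have pp0 : (0 < p.-1)%N by lia.
  apply: (@le_lt_trans _ _ (q * v a ^+ p.-1)).
    apply: ler_wpM2r; first by rewrite exprn_ge0 ?av_ge0.
    by rewrite -[leRHS]expr1; apply: ler_wiXn2l; rewrite ?q_ge0 ?q_le1.
  apply: le_lt_trans (ler_wpM2l (q_ge0 K) small) _.
  by rewrite gtr_pMl ?q_lt1.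
split; last exact: ltW.
rewrite -avX; apply/esym/av_eq_lt; apply: le_lt_trans pa _.
by rewrite avX -{2}(prednK p0) exprSr ltr_pM2r.
Qed.

Lemma txi_neq0 n : txi n.+1 != 0.
Proof.
have := txiE n.+1; apply: contra_eqN => /eqP ->; rewrite mul0r eq_sym subr_eq0.
exact: zeta_neq1.
Qed.

Lemma av_txiS n : v (txi n.+2) ^+ p = v (txi n.+1).
Proof.
have z m : v (zeta m.+1 - 1) != 0 by rewrite av_neq0 subr_eq0 zeta_neq1.
have E m : v (txi m.+1) = v (zeta m.+1 - 1) / v (zeta m.+2 - 1).
  by rewrite -txiE avM mulfK.
by rewrite !E expr_div_n !(av_zetaS _).1.
Qed.

Lemma av_txi1 : v (txi 1) ^+ p = q.
Proof.
have z m : v (zeta m.+1 - 1) != 0 by rewrite av_neq0 subr_eq0 zeta_neq1.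
have -> : v (txi 1) = v (zeta 1 - 1) / v (zeta 2 - 1) by rewrite -txiE avM mulfK.
rewrite expr_div_n (av_zetaS 0).1 -{1}(prednK (p_gt0 K)) exprSr mulfK //; exact: av_zeta1.
Qed.

End Tilted.

Section Division.
Variable K : cpdata.
Local Notation R := (cpR K).
Local Notation p := (cpp K).
Local Notation C := (cpC K).
Local Notation v := (cpv K).
Local Notation q := (v p%:R).
Local Notation zeta := (cpz K).
Local Notation txi := (@txi K).
Implicit Types (P : nat -> C).

Definition tu P n : C := P n / txi n.
(** Approximates the Teichmuller representative of P/xi modulo p. The quotient is taken at the index
    n + j + 1, which is never 0, where xi vanishes. *)
Definition tw_seq P n j : C := tu P (n + j).+1 ^+ (p ^ j.+1).
Definition tw P n : C := limC (tw_seq P n).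
Definition tstep P n : C := (P n - txi n * tw P n) / p%:R.
Definition titer i P := iter i tstep P.
(** The Teichmuller expansion of P/xi: the i-th digit comes from the i-th remainder of the
    division. *)
Definition tlam P n : C := limC (fun m => \sum_(i < m) p%:R ^+ i * tw (titer i P) n).

(** The rate of convergence: |p/xi_n| <= |p/xi_1| < 1 for n >= 1. *)
Let th : C := p%:R / txi 1.
Let xi1 : v (txi 1) != 0. Proof. by rewrite av_neq0 txi_neq0. Qed.
Let xi_lt1 n : v (txi n.+1) < 1.
Proof.
have h1 : v (txi 1) < 1 by apply: (@avX_lt1 _ _ _ _ p (p_gt0 K)); rewrite avX av_txi1 q_lt1.
elim: n => [//|n IH]; apply: (@avX_lt1 _ _ _ _ p (p_gt0 K)); by rewrite avX av_txiS.
Qed.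
Let xi_mono n : v (txi n.+1) <= v (txi n.+2).
Proof.
rewrite -av_txiS -[leRHS]expr1; apply: ler_wiXn2l; rewrite ?av_ge0 ?p_gt0 //.
exact: ltW (xi_lt1 n.+1).
Qed.
Let xi_le n m : (n <= m)%N -> v (txi n.+1) <= v (txi m.+1).
Proof.
by elim: m => [|m IH]; [rewrite leqn0 => /eqP ->|rewrite leq_eqVlt => /orP[/eqP -> //|/IH h]; exact: le_trans (xi_mono m)].
Qed.
Let th1 : v th < 1.
Proof.
apply: (@avX_lt1 _ _ _ _ p (p_gt0 K)); rewrite avX /th avf expr_div_n av_txi1.
have e : q ^+ p = q ^+ p.-1 * q by rewrite -exprSr prednK ?p_gt0.
rewrite e mulfK ?gt_eqF ?q_gt0 // exprn_ilt1 ?q_ge0 ?q_lt1 //.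
by have := p_gt1 K; lia.
Qed.
Let qth : q <= v th.
Proof. by rewrite /th avf ler_pdivlMr ?av_gt0 ?txi_neq0 // ler_piMr ?q_ge0 // ltW. Qed.
Let eth n : q / v (txi n.+1) <= v th.
Proof. by rewrite /th avf ler_wpM2l ?q_ge0 // lef_pV2 ?posrE ?av_gt0 ?txi_neq0 // xi_le. Qed.

Let powth (a b : C) (e : R) : 0 <= e -> e <= v th -> v (a - b) <= e -> v b <= 1 ->
  v (a ^+ p - b ^+ p) <= e * v th.
Proof.
move=> e0 eth' ab b1; have p0 := p_gt0 K; have p1 := p_gt1 K.
have e1 : e <= 1 by apply: le_trans eth' (ltW th1).
have -> : a ^+ p - b ^+ p = (a - b) ^+ p + p%:R * ccross p (a - b) b.
  by rewrite -{1}(subrK b a) ccrossE ?cpp_pr //; ring.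
apply: avDle.
  rewrite avX; apply: le_trans (_ : e ^+ p <= _); first by apply: lerXn2r; rewrite ?nnegrE ?av_ge0.
  apply: le_trans (_ : e ^+ 2 <= _); first exact: ler_wiXn2l.
  by rewrite expr2 ler_wpM2l.
rewrite avM mulrC; apply: ler_pM; rewrite ?av_ge0 //.
apply: av_sum_le => // i _; apply: le_trans (avMn _ _ _) _; rewrite avM.
rewrite -[leRHS]mulr1; apply: ler_pM; rewrite ?av_ge0 //; last exact: avX1.
rewrite avX; have ip : (0 < p - i.+1)%N by have := ltn_ord i; lia.
case: (p - i.+1)%N ip => // k _; rewrite exprS; apply: le_trans (ab).
rewrite ler_piMr ?av_ge0 // exprn_ile1 ?av_ge0 //; exact: le_trans ab e1.
Qed.

Let powth_iter (a b : C) (e : R) j : 0 <= e -> e <= v th -> v (a - b) <= e -> v b <= 1 ->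
  v (a ^+ (p ^ j) - b ^+ (p ^ j)) <= e * v th ^+ j.
Proof.
move=> e0 eth' ab b1; elim: j => [|j IH]; first by rewrite !expr1 mulr1.
rewrite !expnSr !exprM exprSr mulrA; apply: powth; rewrite ?mulr_ge0 ?exprn_ge0 ?av_ge0 //.
  by apply: le_trans eth'; rewrite ler_piMr // exprn_ile1 ?av_ge0 // ltW.
by apply: avX1.
Qed.

Section One.
Variable P : nat -> C.
Hypotheses (WP : inW P) (P0 : P 0%N = 0).

Let dP n : v (tdelta P n) <= 1. Proof. by have [_ h] := WP 1; case: h. Qed.
Let dxi n : v (tdelta txi n) <= 1. Proof. by have [_ h] := inW_txi K 1; case: h. Qed.

(** P_0 = 0 gives |P_1|^p <= |p| = |xi_1|^p. From there on P_(n+1)^p equals P_n modulo p, while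
    |xi_(n+1)|^p = |xi_n| >= |p|. *)
Let P_le n : v (P n.+1) <= v (txi n.+1).
Proof.
have p0 := p_gt0 K.
suff [h1 h2] : v (P n.+1 ^+ p) <= v (txi n.+1 ^+ p) /\ q <= v (txi n.+1 ^+ p).
  by apply: (@avX_le _ _ _ _ p) => //; rewrite ?av_ge0 // -(avX v (txi _)).
elim: n => [|n [IH1 IH2]]; rewrite avX [v (txi _ ^+ _)]avX ?av_txi1 ?av_txiS.
  rewrite -avX; have e := tdeltaE P 0; rewrite P0 in e.
  have -> : P 1 ^+ p = - (p%:R * tdelta P 0) by apply/eqP; rewrite -addr_eq0 -e.
  by rewrite avN avM ler_piMr ?q_ge0.
have xq : q <= v (txi n.+1).
  apply: le_trans IH2 _; rewrite avX -{2}[v (txi _)]expr1; apply: ler_wiXn2l => //.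
    exact: av_ge0.
  exact: ltW (xi_lt1 n).
split=> //; rewrite -avX; have -> : P n.+2 ^+ p = P n.+1 - p%:R * tdelta P n.+1 by rewrite {1}(tdeltaE P n.+1) addrK.
apply: avBle.
  by apply: (@avX_le _ _ _ _ p) => //; rewrite ?av_ge0 // -(avX v (txi _)).
rewrite avM; apply: le_trans xq; rewrite ler_piMr ?q_ge0 //.
Qed.

Let u1 n : v (tu P n.+1) <= 1.
Proof. by rewrite /tu avf ler_pdivrMr ?av_gt0 ?txi_neq0 // mul1r. Qed.

Let du n : v (tu P n.+2 ^+ p - tu P n.+1) <= q / v (txi n.+1).
Proof.
have x1 := txi_neq0 K n; have x2 := txi_neq0 K n.+1.
have -> : tu P n.+2 ^+ p - tu P n.+1 =
  p%:R * ((P n.+2 ^+ p * tdelta txi n.+1 - txi n.+2 ^+ p * tdelta P n.+1) / (txi n.+2 ^+ p * txi n.+1)).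
  have -> : tu P n.+1 = (P n.+2 ^+ p + p%:R * tdelta P n.+1) / (txi n.+2 ^+ p + p%:R * tdelta txi n.+1).
    by rewrite -!tdeltaE.
  rewrite /tu expr_div_n [in RHS](tdeltaE txi n.+1).
  have y2 : txi n.+2 ^+ p != 0 by rewrite expf_neq0.
  have y1 : txi n.+2 ^+ p + p%:R * tdelta txi n.+1 != 0 by rewrite -tdeltaE.
  by field; rewrite y2 y1.
rewrite avM; apply: ler_wpM2l; first exact: q_ge0.
rewrite avf avM avX av_txiS ler_pdivrMr ?mulr_gt0 ?av_gt0 //.
rewrite mulKf ?av_neq0 //; apply: avBle; rewrite avM -[leRHS]mulr1; apply: ler_pM; rewrite ?av_ge0 //.
  by rewrite avX -av_txiS; apply: lerXn2r; rewrite ?nnegrE ?av_ge0.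
by rewrite avX av_txiS.
Qed.

Let dseq n j : v (tw_seq P n j.+1 - tw_seq P n j) <= q / v (txi n.+1) * v th ^+ j.+1.
Proof.
rewrite /tw_seq addnS [(p ^ j.+2)%N]expnS exprM; apply: powth_iter; rewrite ?eth //.
  by rewrite divr_ge0 ?av_ge0.
apply: le_trans (du (n + j)) _; apply: ler_wpM2l; first exact: q_ge0.
by rewrite lef_pV2 ?posrE ?av_gt0 ?txi_neq0 // xi_le // leq_addr.
Qed.

Let dseq' n j : v (tw_seq P n j.+1 - tw_seq P n j) <= v th ^+ j.
Proof.
apply: le_trans (dseq n j) _; rewrite exprS mulrA -[leRHS]mul1r; apply: ler_wpM2r.
  by rewrite exprn_ge0 ?av_ge0.
apply: mulr_ile1; rewrite ?divr_ge0 ?av_ge0 ?(ltW th1) //; exact: le_trans (eth n) (ltW th1).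
Qed.

Let cseq n : cauchyC (tw_seq P n).
Proof.
move=> m; have [k hk] := pow_arch th1 (exprn_gt0 m (q_gt0 K)); exists k => j kj.
apply: le_trans (dseq' n j) _; apply: le_trans hk; apply: ler_wiXn2l => //; first exact: av_ge0.
exact: ltW.
Qed.

Lemma tw_cvg n : cvgC (tw_seq P n) (tw P n).
Proof. exact: (limP (cseq n)). Qed.

Lemma tw_unif n j : v (tw P n - tw_seq P n j) <= v th ^+ j.
Proof.
apply: (cvg_near _ (tw_cvg n)); first by rewrite exprn_ge0 ?av_ge0.
exists j => k jk; apply: (@step_le _ (tw_seq P n) _ j) => // i ji.
by apply: le_trans (dseq' n i) _; apply: ler_wiXn2l; rewrite ?av_ge0 ?(ltW th1).
Qed.

Lemma twS n : tw P n.+1 ^+ p = tw P n.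
Proof.
apply: (cvg_unique (u := fun j => tw_seq P n j.+1)); last first.
  by apply: (cvg_ext _ (cvg_shift 1 (tw_cvg n))); exists 0%N => j _; rewrite addn1.
apply: (cvg_ext _ (cvgX p (tw_cvg n.+1))); exists 0%N => j _.
by rewrite /tw_seq -exprM -expnSr addnS addSn.
Qed.

Lemma tw_le1 n : v (tw P n) <= 1.
Proof.
apply: (cvg_le ler01 (tw_cvg n)); exists 0%N => j _; exact: avX1.
Qed.

(** This bounds the remainder [tstep], which [inW_divp] then places in the ring, so that the
    division can be iterated. *)
Lemma tw_near n : v (P n - txi n * tw P n) <= q.
Proof.
case: n => [|n]; first by rewrite P0 txi0 mul0r subr0 av0 q_ge0.
have x1 := txi_neq0 K n.
have -> : P n.+1 - txi n.+1 * tw P n.+1 = txi n.+1 * (tu P n.+1 - tw P n.+1).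
  by rewrite mulrBr /tu mulrCA mulfV // mulr1.
rewrite avM mulrC -ler_pdivlMr ?av_gt0 // avBC.
have e0 : 0 <= q / v (txi n.+1) by rewrite divr_ge0 ?av_ge0.
apply: (avBtrans (y := tw_seq P n.+1 0)); last first.
  by rewrite /tw_seq addn0 expn1; exact: du.
apply: (cvg_near e0 (tw_cvg n.+1)); exists 0%N => k _.
apply: (@step_le _ (tw_seq P n.+1) _ 0%N) => // j _.
apply: le_trans (dseq n.+1 j) _; apply: le_trans (_ : q / v (txi n.+2) <= _).
  by rewrite ler_piMr ?divr_ge0 ?av_ge0 // exprn_ile1 ?av_ge0 // ltW.
by apply: ler_wpM2l; rewrite ?q_ge0 // lef_pV2 ?posrE ?av_gt0 ?txi_neq0.
Qed.

Lemma tw_inW : inW (tw P).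
Proof. by apply: inW_root; [exact: tw_le1|exact: twS]. Qed.

Lemma tstepE n : P n = txi n * tw P n + p%:R * tstep P n.
Proof. by rewrite /tstep mulrCA mulfV ?pC_neq0 // mulr1 addrC subrK. Qed.

Lemma tstep_inW : inW (tstep P).
Proof.
apply: inW_divp => [n|]; first by rewrite /tstep avf ler_pdivrMr ?q_gt0 // mul1r tw_near.
have [_ _ _ _ sM] := inW_sub K.
have := wsub_B (inW_sub K) WP (sM _ _ (inW_txi K) tw_inW); congr inW.
by apply/funext => n; rewrite {1}tstepE addrAC subrr add0r.
Qed.

Lemma tstep0 : tstep P 0 = 0.
Proof. by rewrite /tstep P0 txi0 mul0r subr0 mul0r. Qed.
End One.

Lemma titer_inW i P : inW P -> P 0%N = 0 -> inW (titer i P) /\ titer i P 0%N = 0.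
Proof.
move=> hP P0; elim: i => [|i [IH1 IH2]] //=; split; [exact: tstep_inW|exact: tstep0].
Qed.

Lemma titerS i P : titer i.+1 P = titer i (tstep P).
Proof. by rewrite /titer -iterSr. Qed.

Section Quotient.
Variable P : nat -> C.
Hypotheses (WP : inW P) (P0 : P 0%N = 0).

Let W1 i n : v (tw (titer i P) n) <= 1.
Proof. by have [h1 h2] := titer_inW i WP P0; exact: tw_le1. Qed.

Let term i n : v (p%:R ^+ i * tw (titer i P) n) <= q ^+ i.
Proof. by rewrite avM avX ler_piMr ?exprn_ge0 ?q_ge0. Qed.

Lemma tlam_cvg n : cvgC (fun m => \sum_(i < m) p%:R ^+ i * tw (titer i P) n) (tlam P n).
Proof.
apply: limP => m; exists m => k mk; rewrite big_ord_recr /= addrAC subrr add0r.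
by apply: le_trans (term k n) _; exact: q_anti.
Qed.

Lemma tlam_unif n m : v (tlam P n - \sum_(i < m) p%:R ^+ i * tw (titer i P) n) <= q ^+ m.
Proof.
apply: (cvg_near _ (tlam_cvg n)); first by rewrite exprn_ge0 ?q_ge0.
exists m => k mk; apply: (@step_le _ (fun m => \sum_(i < m) p%:R ^+ i * tw (titer i P) n) _ m) => // j mj.
by rewrite big_ord_recr /= addrAC subrr add0r; apply: le_trans (term j n) _; exact: q_anti.
Qed.

Lemma tlam_le1 n : v (tlam P n) <= 1.
Proof. by have := tlam_unif n 0; rewrite big_ord0 subr0. Qed.

Lemma tlam_sum n m : P n = txi n * \sum_(i < m) p%:R ^+ i * tw (titer i P) n + p%:R ^+ m * titer m P n.
Proof.
elim: m => [|m IH]; first by rewrite big_ord0 mulr0 add0r mul1r.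
have [h1 h2] := titer_inW m WP P0.
rewrite {1}IH big_ord_recr /= {1}(tstepE (titer m P) n) exprSr; ring.
Qed.

Lemma tlamE n : P n = txi n * tlam P n.
Proof.
apply: (cvg_unique (u := fun m => txi n * \sum_(i < m) p%:R ^+ i * tw (titer i P) n)); last first.
  exact: (cvgM (cvg_const _) (tlam_cvg n)).
move=> k; exists k => m km; rewrite (tlam_sum n m) opprD addrA subrr add0r avN avM avX.
have [h1 _] := titer_inW m WP P0.
apply: le_trans (_ : q ^+ m <= _); last exact: q_anti.
by rewrite ler_piMr ?exprn_ge0 ?q_ge0 //; exact: inWk_le1 (h1 0%N) _.
Qed.
End Quotient.

Lemma tlam_step P n : inW P -> P 0%N = 0 -> tlam P n = tw P n + p%:R * tlam (tstep P) n.
Proof.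
move=> hP P0; have hS := tstep_inW hP P0; have S0 := tstep0 P0.
apply: (cvg_unique (u := fun m => \sum_(i < m.+1) p%:R ^+ i * tw (titer i P) n)).
  by apply: (cvg_ext _ (cvg_shift 1 (tlam_cvg hP P0 n))); exists 0%N => m _; rewrite addn1.
apply: (cvg_ext _ (cvgD (cvg_const (tw P n)) (cvgM (cvg_const p%:R) (tlam_cvg hS S0 n)))).
exists 0%N => m _; rewrite big_ord_recl mul1r /=; congr (_ + _).
rewrite mulr_sumr; apply: eq_bigr => i _; rewrite /bump add1n exprS -mulrA.
by rewrite -titerS.
Qed.

(** Induction on the order: the leading digit is a Teichmuller element, and the rest is multiplied
    by p, which gains one order. *)
Lemma tlam_inW P : inW P -> P 0%N = 0 -> inW (tlam P).
Proof.
move=> hP P0 k; elim: k P hP P0 => [|k IH] P hP P0; first by split=> // n; exact: tlam_le1.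
have -> : tlam P = fun n => tw P n + p%:R * tlam (tstep P) n.
  by apply/funext => n; exact: tlam_step.
have [_ _ _ sD _] := inWk_sub K k.+1; apply: sD; first exact: tw_inW.
by apply: inWk_p; apply: IH; [exact: tstep_inW|exact: tstep0].
Qed.

Section Functions.
Variables (Om : Type) (D : (Om -> C) -> Prop).
Hypotheses (hD : calg D) (cD : forall f, cl D f -> D f).
Variable P : nat -> Om -> C.
Hypotheses (WP : forall w, inW (P^~ w)) (P0 : forall w, P 0%N w = 0).
Hypothesis DP : forall n, D (P n).

Let Dtw (Q : nat -> Om -> C) : (forall w, inW (Q^~ w)) -> (forall w, Q 0%N w = 0) -> (forall n, D (Q n)) ->
  forall n, D (fun w => tw (Q^~ w) n).
Proof.
move=> WQ Q0 DQ n; apply: cD => m; have [k hk] := pow_arch th1 (exprn_gt0 m (q_gt0 K)).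
exists (fun w => tw_seq (Q^~ w) n k); last by move=> w; apply: le_trans (tw_unif (WQ w) (Q0 w) n k) hk.
apply: (og_X _ (calg_oalg hD)).
by have := cg_Z (txi (n + k).+1)^-1 hD (DQ (n + k).+1); congr D; apply/funext => w; rewrite mulrC.
Qed.

Lemma tlam_fun n : D (fun w => tlam (P^~ w) n).
Proof.
have hO := calg_oalg hD.
have Di i : forall n, D (fun w => titer i (P^~ w) n).
  elim: i => [|i IH] k //=; have Dk := Dtw (fun w => (titer_inW i (WP w) (P0 w)).1) (fun w => (titer_inW i (WP w) (P0 w)).2) IH k.
  have := cg_Z p%:R^-1 hD (og_B hO (IH k) (cg_Z (txi k) hD Dk)).
  by congr D; apply/funext => w; rewrite mulrC.
apply: cD => m; exists (fun w => \sum_(i < m) p%:R ^+ i * tw (titer i (P^~ w)) n); last first.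
  by move=> w; exact: tlam_unif.
apply: (og_sum _ hO) => i _; apply: (cg_Z _ hD).
exact: (Dtw (fun w => (titer_inW i (WP w) (P0 w)).1) (fun w => (titer_inW i (WP w) (P0 w)).2) (Di i)).
Qed.
End Functions.

(** xi can be cancelled at the indices n >= 1 only; [inW_tail] recovers the index 0, which is the
    one that theta sees. *)
Lemma txi_cancel l m : inW l -> inW m -> (forall n, txi n * l n = txi n * m n) -> l 0%N = m 0%N.
Proof.
move=> hl hm e; apply/eqP; rewrite -subr_eq0; apply/eqP.
apply: (inW_tail (wsub_B (inW_sub K) hl hm)) => n.
by rewrite (mulfI (txi_neq0 K n) (e n.+1)) subrr.
Qed.
End Division.

(** * A function on which the Galois group acts by translations *)

Section Primitive.
Variable K : cpdata.
Local Notation R := (cpR K).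
Local Notation p := (cpp K).
Local Notation C := (cpC K).
Local Notation v := (cpv K).
Local Notation q := (v p%:R).
Local Notation zeta := (cpz K).
Local Notation txi := (@txi K).
Variables (Om : Type) (D : (Om -> C) -> Prop).
Hypotheses (hD : calg D) (cD : forall f, cl D f -> D f).
Variables (x s : nat -> Om -> C) (t : Om -> C) (w0 c : C) (k : nat).
Hypotheses (xS : forall n w, x n.+1 w ^+ p = x n w) (sS : forall n w, s n.+1 w ^+ p = s n w).
Hypotheses (Dx : forall n, D (x n)) (Ds : forall n, D (s n)).
Hypotheses (x1 : forall n w, v (x n w) = 1) (s1 : forall n w, v (s n w) = 1).
Hypotheses (w01 : v w0 <= 1) (c1 : v c <= 1) (c0 : c != 0).
Hypotheses (x0E : forall w, x 0%N w = 1 + w0 * t w ^+ k) (s0E : forall w, s 0%N w = 1 + c * t w).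
Hypothesis Dxi : D (fun w => (x 0%N w)^-1).

Let psys1 (a : C) n : v a <= 1 -> v (@psys K a n) <= 1.
Proof.
by move=> a1; elim: n => [//|n IH]; apply: (@avX_le1 _ _ _ _ p (p_gt0 K)); rewrite psysS.
Qed.
Let ck := @psys K (c ^+ k).
Let wk := @psys K w0.
Let ckW : inW ck.
Proof. by apply: inW_root => n; [apply: psys1; exact: avX1|exact: psysS]. Qed.
Let wkW : inW wk.
Proof. by apply: inW_root => n; [exact: psys1|exact: psysS]. Qed.
Let xW w : inW (x^~ w).
Proof. by apply: inW_root => n; rewrite ?x1. Qed.
Let sW w : inW (s^~ w).
Proof. by apply: inW_root => n; rewrite ?s1. Qed.

(* [c^k][x] - [c^k] - [w0]([s] - 1)^k, whose value at 0 is
   c^k (1 + w0 t^k) - c^k - w0 (c t)^k = 0 *)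
Let P n w := ck n * x n w - ck n - wk n * (s n w - 1) ^+ k.

Let PW w : inW (P^~ w).
Proof.
have hS := inW_sub K; have [_ w1 _ _ sM] := hS.
apply: (wsub_B hS); last by apply: (sM) => //; apply: (wsub_X hS); exact: (wsub_B hS).
by apply: (wsub_B hS) => //; exact: sM.
Qed.

Let P0 w : P 0%N w = 0.
Proof.
rewrite /P x0E s0E /ck /wk !psys0.
have -> : 1 + c * t w - 1 = c * t w by ring.
by rewrite exprMn; ring. Qed.

Let DP n : D (P n).
Proof.
have hO := calg_oalg hD.
apply: (og_B hO); first by apply: (og_B hO); [exact: (cg_Z _ hD)|exact: (cg_c hD)].
by apply: (cg_Z _ hD); apply: (og_X _ hO); apply: (og_B hO) => //; exact: (cg_c hD).
Qed.

Let ell w := tlam (P^~ w) 0.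
Let kap : C := zeta 1 - 1.
Let kap0 : kap != 0. Proof. by rewrite subr_eq0 zeta_neq1. Qed.

(** [kap] is the image under theta of [eps^(1/p)] - 1 = ([eps] - 1)/xi; the denominator normalizes
    the first translation to -1. *)
Definition primitive w := - ell w / (c ^+ k * x 0%N w * kap).

Let x0_neq0 w : x 0%N w != 0.
Proof. by rewrite -(av_gt0 v) x1 ltr01. Qed.

Lemma primitive_in : D primitive.
Proof.
have De : D ell := tlam_fun hD cD PW P0 DP 0.
have := cg_Z (- (c ^+ k * kap)^-1) hD (cg_M hD De Dxi); congr D; apply/funext => w.
have h1 := x0_neq0 w; have h2 : c ^+ k != 0 by exact: expf_neq0.
by rewrite /primitive; field; rewrite h1 kap0 h2.
Qed.

Lemma primitive_fix w w' : (forall n, x n w' = x n w) -> (forall n, s n w' = s n w) ->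
  primitive w' = primitive w.
Proof.
move=> ex es; rewrite /primitive ex /ell.
by have -> : P^~ w' = P^~ w by apply/funext => n; rewrite /P ex es.
Qed.

(** Rotating x adds [c^k]([eps] - 1)[x] to P, which is xi times ([eps^(1/p)] - 1)[c^k][x]. *)
Lemma primitive_rot_x w w' : (forall n, x n w' = zeta n * x n w) -> (forall n, s n w' = s n w) ->
  primitive w' = primitive w - 1.
Proof.
move=> ex es; have hS := inW_sub K; have [_ w1 _ sD sM] := hS.
have zW : inW (fun n => zeta n.+1 - 1).
  by apply: (wsub_B hS) => //; have := inW_zeta K 1; congr inW; apply/funext => n; rewrite addn1.
have e : ell w' = ell w + kap * ck 0 * x 0%N w.
  apply: (txi_cancel (l := tlam (P^~ w')) (m := fun n => tlam (P^~ w) n + (zeta n.+1 - 1) * ck n * x n w)).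
  - exact: tlam_inW.
  - by apply: sD; [exact: tlam_inW|apply: (sM) => //; exact: sM].
  move=> n; rewrite -(tlamE (PW w') (P0 w')) mulrDr -(tlamE (PW w) (P0 w)) !mulrA txiE.
  by rewrite /P ex es; ring.
have h1 := x0_neq0 w; have h2 : c ^+ k != 0 by exact: expf_neq0.
rewrite /primitive e ex zeta0 mul1r /ck psys0; field; by rewrite kap0 h1 h2.
Qed.

(** Rotating s changes ([s] - 1)^k by ([eps] - 1)[s] times the sum [T], whose k terms all become (c
    t)^(k-1) at index 0. *)
Lemma primitive_rot_s w w' : (forall n, x n w' = x n w) -> (forall n, s n w' = zeta n * s n w) ->
  primitive w' = primitive w + w0 * s 0%N w * k%:R * (c * t w) ^+ k.-1 / (c ^+ k * x 0%N w).
Proof.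
move=> ex es; have hS := inW_sub K; have [_ w1 _ sD sM] := hS.
have zW : inW (fun n => zeta n.+1 - 1).
  by apply: (wsub_B hS) => //; have := inW_zeta K 1; congr inW; apply/funext => n; rewrite addn1.
have zW0 : inW (fun n => zeta n) by have := inW_zeta K 0; congr inW; apply/funext => n; rewrite addn0.
pose T n := \sum_(i < k) (zeta n * s n w - 1) ^+ (k.-1 - i) * (s n w - 1) ^+ i.
have TW : inW T.
  apply: (wsub_sum hS) => i; apply: (sM); apply: (wsub_X hS); apply: (wsub_B hS) => //; exact: sM.
have e : ell w' = ell w - wk 0 * (kap * s 0%N w * T 0%N).
  apply: (txi_cancel (l := tlam (P^~ w')) (m := fun n => tlam (P^~ w) n - wk n * ((zeta n.+1 - 1) * s n w * T n))).
  - exact: tlam_inW.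
  - apply: (wsub_B hS); first exact: tlam_inW.
    by apply: (sM) => //; apply: (sM) => //; exact: sM.
  move=> n; rewrite -(tlamE (PW w') (P0 w')) mulrBr -(tlamE (PW w) (P0 w)) /P ex es.
  have E : (zeta n * s n w - 1) ^+ k - (s n w - 1) ^+ k = (txi n * (zeta n.+1 - 1)) * s n w * T n.
    by rewrite subrXX txiE /T; congr (_ * _); ring.
  have -> : (zeta n * s n w - 1) ^+ k = (s n w - 1) ^+ k + (txi n * (zeta n.+1 - 1)) * s n w * T n by rewrite -E [RHS]addrC subrK.
  by ring.
have T0 : T 0%N = k%:R * (c * t w) ^+ k.-1.
  rewrite /T zeta0 mul1r s0E addrAC subrr add0r.
  rewrite (eq_bigr (fun=> (c * t w) ^+ k.-1)) => [|i _]; last first.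
    by rewrite -exprD subnK //; have := ltn_ord i; lia.
  by rewrite sumr_const card_ord mulr_natl.
have h1 := x0_neq0 w; have h2 : c ^+ k != 0 by exact: expf_neq0.
rewrite /primitive e ex T0 /wk psys0; field; by rewrite kap0 h1 h2.
Qed.
End Primitive.

(** * Descent of invariants along a perfectoid tower *)

(** Newton interpolation: each divided difference loses one factor rho, a lower bound for the
    distances between the nodes. *)
Lemma newton_coef (R : realType) (C : closedFieldType) (v : absval R C) (es : seq C) (rho B : R) (F : {poly C}) :
  0 < rho -> rho <= 1 -> 0 <= B -> (forall e, e \in es -> v e <= 1) ->
  pairwise (fun a b => rho <= v (a - b)) es -> (size F <= size es)%N ->
  (forall e, e \in es -> v F.[e] <= B) -> forall k, v F`_k <= B / rho ^+ size es.
Proof.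
move=> r0 r1; elim: es B F => [|e es IH] B F B0 es1 pw sF Fe k.
  by have /eqP -> : F == 0; rewrite ?coef0 ?av0 ?divr_ge0 // -size_poly_eq0 -leqn0.
set G := (F - F.[e]%:P) %/ ('X - e%:P).
have FG : F - F.[e]%:P = G * ('X - e%:P).
  by rewrite divpK // dvdp_XsubCl; apply/rootP; rewrite hornerD hornerN hornerC subrr.
move: pw => /= /andP[/allP pe pw].
have sG : (size G <= size es)%N.
  rewrite size_divp ?polyXsubC_eq0 // size_XsubC /= leq_subLR add1n.
  apply: leq_trans (size_polyD _ _) _; rewrite geq_max sF size_polyN.
  by apply: leq_trans (size_polyC_leq1 _) _.
have Bk n : B / rho ^+ n <= B / rho ^+ n.+1.
  apply: ler_wpM2l => //; rewrite lef_pV2 ?posrE ?exprn_gt0 // exprS ler_piMl //; exact/exprn_ge0/ltW.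
have BB n : B <= B / rho ^+ n.
  by elim: n => [|n IHn]; [rewrite divr1|exact: le_trans (Bk n)].
have Gk j : v G`_j <= B / rho ^+ (size es).+1.
  have -> : B / rho ^+ (size es).+1 = (B / rho) / rho ^+ size es by rewrite exprS invfM mulrA.
  apply: IH => // [||e' he']; first by rewrite divr_ge0 // ltW.
    by move=> e' he'; apply: es1; rewrite inE he' orbT.
  have d := pe e' he'; have d0 : 0 < v (e' - e) by rewrite avBC; apply: lt_le_trans d.
  have -> : G.[e'] = (F.[e'] - F.[e]) / (e' - e).
    have := congr1 (fun P => P.[e']) FG; rewrite hornerD hornerN hornerC hornerM hornerXsubC => ->.
    by rewrite mulfK // -(av_neq0 v) gt_eqF.
  rewrite avf; apply: ler_pM; rewrite ?invr_ge0 ?av_ge0 //.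
    by apply: avBle; apply: Fe; rewrite inE ?eqxx ?he' ?orbT.
  by rewrite lef_pV2 ?posrE // avBC.
have -> : F = F.[e]%:P + G * ('X - e%:P) by rewrite -FG addrC subrK.
have B2 : 0 <= B / rho ^+ (size es).+1 by rewrite divr_ge0 ?exprn_ge0 // ltW.
rewrite coefD mulrBr coefB coefMX coefMC coefC; apply: avDle.
  case: eqP => _; last by rewrite av0.
  by apply: le_trans (BB _); apply: Fe; rewrite inE eqxx.
apply: avBle; first by case: eqP => _; rewrite ?av0.
by rewrite avM -[leRHS]mulr1; apply: ler_pM; rewrite ?av_ge0 // es1 // inE eqxx.
Qed.

(** * One layer of degree p: approximation and descent *)

Section Layer.
Variable K : cpdata.
Local Notation R := (cpR K).
Local Notation p := (cpp K).
Local Notation C := (cpC K).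
Local Notation v := (cpv K).
Local Notation q := (v p%:R).
Local Notation zeta := (cpz K).
Local Notation p0 := (p_gt0 K).
Local Notation p1 := (p_gt1 K).

Lemma cross_small (h b : C) : v h <= 1 -> v b <= 1 -> v (ccross p h b) <= v h.
Proof.
move=> h1 b1; apply: av_sum_le => [|i _]; first exact: av_ge0.
apply: le_trans (avMn _ _ _) _; rewrite avM !avX.
have ip : (0 < p - i.+1)%N by have := ltn_ord i; lia.
case: (p - i.+1)%N ip => // k _; rewrite exprS -mulrA ler_piMr ?av_ge0 //.
by apply: mulr_ile1; rewrite ?exprn_ge0 ?exprn_ile1 ?av_ge0.
Qed.

Lemma cross_first (h b : C) : v h <= 1 -> v b <= 1 -> v (ccross p h b - h * b ^+ p.-1) <= v h ^+ 2.
Proof.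
move=> h1 b1; rewrite /ccross.
have [k pk] : exists k, p = k.+2 by exists p.-2; have := p1; lia.
rewrite pk /= big_ord_recr /= subSS subSnn expr1 binSn divnn /= mulr1n addrK.
apply: av_sum_le => [|i _]; first by rewrite exprn_ge0 ?av_ge0.
apply: le_trans (avMn _ _ _) _; rewrite avM !avX.
have ik := ltn_ord i.
have [j ->] : exists j, (k.+2 - i.+1 = j.+2)%N by exists (k.+2 - i.+1 - 2)%N; lia.
rewrite !exprS mulrA -!mulrA; apply: ler_wpM2l; first exact: av_ge0.
rewrite expr0 ler_wpM2l ?av_ge0 //; apply: mulr_ile1; rewrite ?mulr_ge0 ?exprn_ge0 ?av_ge0 ?exprn_ile1 ?av_ge0 //.
by apply: mulr_ile1; rewrite ?exprn_ge0 ?exprn_ile1 ?av_ge0.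
Qed.

(** (a - b)^p and a^p - b^p differ by p times a cross term bounded by |a - b|. *)
Lemma pow_sub (a b : C) (e : R) : v (a - b) <= 1 -> v b <= 1 -> v (a ^+ p - b ^+ p) <= e ->
  q * v (a - b) <= e -> v (a - b) ^+ p <= e.
Proof.
move=> h1 b1 ab he; rewrite -avX.
have -> : (a - b) ^+ p = (a ^+ p - b ^+ p) - p%:R * ccross p (a - b) b.
  by have := ccrossE (a - b) b (cpp_pr K); rewrite subrK => ->; ring.
apply: avBle => //; apply: le_trans he; rewrite avM; apply: ler_wpM2l; first exact: q_ge0.
exact: cross_small.
Qed.

Lemma sub_pow (a b : C) (e : R) : v (a - b) <= 1 -> v b <= 1 -> v (a - b) ^+ p <= e ->
  q * v (a - b) <= e -> v (a ^+ p - b ^+ p) <= e.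
Proof.
move=> h1 b1 ab he.
have -> : a ^+ p - b ^+ p = (a - b) ^+ p + p%:R * ccross p (a - b) b.
  by rewrite -{1}(subrK b a) ccrossE ?cpp_pr //; ring.
apply: avDle; first by rewrite avX.
apply: le_trans he; rewrite avM; apply: ler_wpM2l; first exact: q_ge0.
exact: cross_small.
Qed.

Variable Om : Type.
Variable D : (Om -> C) -> Prop.
Hypotheses (hD : calg D) (fD : frob D).
Variables (x y : Om -> C) (sg : Om -> Om).
Hypotheses (Dx : D x) (Dxi : D (fun w => (x w)^-1)) (yx : forall w, y w ^+ p = x w).
Hypotheses (y1 : forall w, v (y w) = 1) (ysg : forall w, y (sg w) = zeta 1 * y w).
Hypothesis Dsg : forall f, D f -> forall w, f (sg w) = f w.

Let hO := calg_oalg hD.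
Let x1 w : v (x w) = 1. Proof. by rewrite -yx avX y1 expr1n. Qed.
Let bx : ball D x. Proof. by split=> // w; rewrite x1. Qed.
Let y0 w : y w != 0. Proof. by rewrite -(av_gt0 v) y1 ltr01. Qed.

(** Up to the factor |p|^(-1/((p-1) p^(J+1))) the bound is |p|^(1/(p-1)) = |zeta_1 - 1|, the
    distance between y and its conjugates. Each step writes x - r^p = d^p h', with d of the size of
    the present error, and adds to r the product of d and an approximate p-th root of h'. *)
Lemma layer_approx J (pi : C) : pi ^+ (p.-1 * p ^ J.+1) = p%:R ->
  exists2 r, D r & forall w, v (y w - r w) <= v pi ^+ (p ^ J.+1).-1.
Proof.
elim: J pi => [|J IH] pi piE.
  have [h Dh xh] := fD bx; exists h => // w; have [_ h1] := frob_ball bx Dh (fun w => le_trans (xh w) (q_le1 K)).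
  rewrite expn1; have yh : v (y w - h w) <= 1 by apply: avBle; rewrite ?y1.
  apply: (@avX_le _ _ _ _ p); rewrite ?p0 ?exprn_ge0 ?av_ge0 // -exprM.
  rewrite expn1 in piE; rewrite -(avX v pi) piE avX; apply: pow_sub => //.
    by rewrite yx; exact: xh.
  by rewrite ler_piMr ?q_ge0.
have [|r Dr yr] := IH (pi ^+ p); first by rewrite -exprM mulnCA -expnS.
have vpi : v pi ^+ (p.-1 * p ^ J.+2) = q by rewrite -avX piE.
have pi1 : v pi <= 1.
  apply: (@avX_le1 _ _ _ _ (p.-1 * p ^ J.+2)); last by rewrite piE q_le1.
  by rewrite muln_gt0 expn_gt0 p0 andbT; have := p1; lia.
pose d := (pi ^+ p) ^+ (p ^ J.+1).-1.
have P0 : (0 < p ^ J.+1)%N by rewrite expn_gt0 p0.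
have dE : d = pi ^+ (p ^ J.+2 - p) by rewrite /d -exprM -subn1 mulnBr muln1 -expnS.
have yr' w : v (y w - r w) <= v d by rewrite /d avX.
have Np : (0 < p.-1 * p ^ J.+2)%N by rewrite muln_gt0 expn_gt0 p0 andbT; have := p1; lia.
have pi0 : pi != 0.
  by apply/eqP => e; have := pC_neq0 K; rewrite -piE e expr0n (gtn_eqF Np) eqxx.
have d0 : d != 0 by rewrite /d !expf_neq0.
have d1 : v d <= 1 by rewrite dE avX exprn_ile1 ?av_ge0.
have Pp : (p <= p ^ J.+2)%N by rewrite -{1}(expn1 p) leq_pexp2l ?p0.
have qd : q <= v d ^+ p.-1.
  rewrite -vpi dE avX -exprM; apply: ler_wiXn2l; rewrite ?av_ge0 //.
  by rewrite mulnC leq_mul2l leq_subr orbT.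
have dp : v d ^+ p = v d ^+ p.-1 * v d by rewrite -exprSr prednK ?p0.
have qdp : q * v d <= v d ^+ p by rewrite dp ler_wpM2r ?av_ge0.
have r1 w : v (r w) <= 1 by apply: av_near (_ : v (y w) <= 1); rewrite ?y1 // avBC; exact: le_trans (yr' w) d1.
have [|h Dh xh] := fD (f := fun w => (d ^+ p)^-1 * (x w - r w ^+ p)).
  split=> [|w]; first by apply: (cg_Z _ hD); apply: (og_B hO) => //; exact: (og_X _ hO).
  rewrite avM avV mulrC ler_pdivrMr ?av_gt0 ?expf_neq0 // mul1r -yx.
  apply: sub_pow => //; rewrite ?[v (d ^+ p)]avX; first exact: le_trans (yr' w) d1.
    by apply: lerXn2r; rewrite ?nnegrE ?av_ge0.
  by apply: le_trans qdp; apply: ler_wpM2l; rewrite ?q_ge0.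
have h1 w : v (h w) <= 1.
  have : v ((d ^+ p)^-1 * (x w - r w ^+ p)) <= 1.
    rewrite avM avV mulrC ler_pdivrMr ?av_gt0 ?expf_neq0 // mul1r -yx.
    apply: sub_pow => //; rewrite ?[v (d ^+ p)]avX; first exact: le_trans (yr' w) d1.
      by apply: lerXn2r; rewrite ?nnegrE ?av_ge0.
    by apply: le_trans qdp; apply: ler_wpM2l; rewrite ?q_ge0.
  move=> h1; apply: (@avX_le1 _ _ _ _ p p0); apply: av_near h1; rewrite avBC.
  exact: le_trans (xh w) (q_le1 K).
exists (fun w => r w + d * h w); first by apply: (cg_D hD) => //; exact: cg_Z.
move=> w; set r' := r w + d * h w.
have dh : v (d * h w) <= v d by rewrite avM ler_piMr ?av_ge0.
have yd : v (y w - r') <= v d by rewrite /r' opprD addrA; apply: avBle.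
have r'1 : v r' <= 1 by apply: avDle => //; exact: le_trans dh d1.
apply: (@avX_le _ _ _ _ p); rewrite ?p0 ?exprn_ge0 ?av_ge0 // -exprM avX.
have -> : v pi ^+ ((p ^ J.+2).-1 * p) = q * v d.
  rewrite -vpi dE avX -exprD; congr (_ ^+ _).
  have -> : ((p ^ J.+2).-1 * p = p ^ J.+2 * p - p)%N by rewrite -subn1 mulnBl mul1n.
  have -> : (p.-1 * p ^ J.+2 = p ^ J.+2 * p - p ^ J.+2)%N by rewrite -subn1 mulnBl mul1n mulnC.
  by rewrite addnBA // subnK // leq_pmulr ?p0.
apply: pow_sub => //; first exact: le_trans yd d1.
  have -> : y w ^+ p - r' ^+ p = d ^+ p * ((d ^+ p)^-1 * (x w - r w ^+ p) - h w ^+ p) - p%:R * ccross p (d * h w) (r w).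
    rewrite yx /r' [r w + _]addrC ccrossE ?cpp_pr // exprMn mulrBr mulVKf ?expf_neq0 //; ring.
  apply: avBle.
    rewrite avM [leRHS]mulrC; apply: ler_pM; rewrite ?av_ge0 ?xh //.
    by rewrite avX -[leRHS]expr1; apply: ler_wiXn2l; rewrite ?av_ge0 ?p0.
  rewrite avM; apply: ler_wpM2l; first exact: q_ge0.
  by apply: le_trans (cross_small _ _) (dh) => //; exact: le_trans dh d1.
by apply: ler_wpM2l; rewrite ?q_ge0.
Qed.

Lemma layer_trace g : xspan D y p g -> D (fun w => \sum_(j < p) g (iter j sg w)).
Proof.
move=> [F [DF gE]]; have zp := cpz_prim K 1; rewrite expn1 in zp.
have := cg_Z p%:R hD (DF 0%N); congr D; apply/funext => w.
have := fourier zp ysg (fun i w => Dsg (DF i) w) gE (Ordinal p0) w.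
rewrite /= mulr1 => ->; apply: eq_bigr => k _.
by rewrite subn0 exprM (prim_expr_order zp) expr1n mul1r.
Qed.

Lemma xspan_layer : calg (xspan D y p).
Proof. by apply: xspan_calg; rewrite ?p0 //; have := Dx; congr D; apply/funext => w; rewrite yx. Qed.

Let Yg : xspan D y p y.
Proof. by apply: xspan_gen; rewrite ?p0 //; have := Dx; congr D; apply/funext => w; rewrite yx. Qed.
Let Ysub f : D f -> xspan D y p f.
Proof. by apply: xspan_sub; rewrite ?p0. Qed.
Let hY := calg_oalg xspan_layer.
Let Yinv : xspan D y p (fun w => (y w)^-1).
Proof.
have := og_M hY (og_X p.-1 hY Yg) (Ysub Dxi); congr xspan; apply/funext => w.
by rewrite -yx -{2}(prednK p0) exprS invfM mulrCA mulfV ?mulr1 // expf_neq0.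
Qed.

(** ((y - r)/y)^(p-1) has trace p, as only the constant term of its expansion in r/y survives. Since
    y - r has nearly the size |p|^(1/(p-1)), the division by p costs only |p|^(-1/p^(J+1)). *)
Lemma layer_descend J (pi : C) f g (e : R) : pi ^+ (p.-1 * p ^ J.+1) = p%:R ->
  (forall w, f (sg w) = f w) -> xspan D y p g -> (forall w, v (f w - g w) <= e) ->
  exists2 g', D g' & forall w, v (f w - g' w) <= (v pi ^+ p.-1)^-1 * e.
Proof.
move=> piE fsg hg fg; have [r Dr yr] := layer_approx piE.
have zp := cpz_prim K 1; rewrite expn1 in zp.
have pp0 : p%:R != 0 :> C := pC_neq0 K.
(* al has trace 1 over D *)
pose al w := p%:R^-1 * ((y w - r w) / y w) ^+ p.-1.
have Yal : xspan D y p al.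
  apply: (cg_Z _ xspan_layer); apply: (og_X _ hY); apply: (og_M hY) => //.
  by apply: (og_B hY) => //; exact: Ysub.
exists (fun w => \sum_(j < p) al (iter j sg w) * g (iter j sg w)).
  by apply: (layer_trace (g := fun w => al w * g w)); exact: (og_M hY).
have P0 : (0 < p ^ J.+1)%N by rewrite expn_gt0 p0.
have vpi : v pi ^+ (p.-1 * p ^ J.+1) = q by rewrite -avX piE.
have Np : (0 < p.-1 * p ^ J.+1)%N by rewrite muln_gt0 expn_gt0 p0 andbT; have := p1; lia.
have vpi0 : 0 < v pi.
  by rewrite av_gt0; apply/eqP => e0; have := pC_neq0 K; rewrite -piE e0 expr0n (gtn_eqF Np) eqxx.
have al_le w : v (al w) <= (v pi ^+ p.-1)^-1.
  rewrite avM avV avX avf y1 divr1 mulrC ler_pdivrMr ?q_gt0 // -vpi.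
  apply: le_trans (_ : (v pi ^+ (p ^ J.+1).-1) ^+ p.-1 <= _).
    by apply: lerXn2r; rewrite ?nnegrE ?exprn_ge0 ?av_ge0.
  rewrite -exprM mulrC ler_pdivlMr ?exprn_gt0 // -exprD.
  have -> : ((p ^ J.+1).-1 * p.-1 + p.-1 = p.-1 * p ^ J.+1)%N.
    by rewrite -{2}(mul1n p.-1) -mulnDl addn1 prednK // mulnC.
  by [].
have alsum w : \sum_(j < p) al (iter j sg w) = 1.
  have aE j : al (iter j sg w) = p%:R^-1 * (1 - zeta 1 ^+ (p.-1 * j) * (r w / y w)) ^+ p.-1.
    rewrite /al (iter_mul _ _ ysg) (iter_inv (x := r)); last exact: Dsg.
    have zj0 : zeta 1 ^+ j != 0 by rewrite expf_neq0 // -(av_gt0 v) av_zeta ltr01.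
    have zz : zeta 1 ^+ (p.-1 * j) = (zeta 1 ^+ j)^-1.
      apply: (mulfI zj0); rewrite mulfV // -exprD -{1}(mul1n j) -mulnDl add1n prednK ?p0 //.
      by rewrite exprM (prim_expr_order zp) expr1n.
    rewrite zz; congr (_ * _ ^+ _); have := y0 w; move=> yw; field; by rewrite yw zj0.
  under eq_bigr do rewrite aE exprBn mulr_sumr.
  rewrite exchange_big /= big_ord_recl /= [X in _ + X]big1 => [|i _].
    under eq_bigr do rewrite !expr0 expr1n !mulr1.
    rewrite addr0 sumr_const card_ord /= bin0 mulr1n.
    by rewrite mulr1 -[_ *+ p]mulr_natr mulVf.
  have E : \sum_(j < p) zeta 1 ^+ ((p.-1 * i.+1) * j) = 0.
    rewrite sum_prim_root // ifF //; apply/negbTE.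
    rewrite Gauss_dvdr; last by rewrite -{1}(prednK p0) coprimeSn.
    by rewrite gtnNdvd //; have := ltn_ord i; have := p1; lia.
  rewrite /bump /= add1n.
  transitivity (p%:R^-1 * ((-1) ^+ i.+1 * (r w / y w) ^+ i.+1 *+ 'C(p.-1, i.+1)) * \sum_(j < p) zeta 1 ^+ ((p.-1 * i.+1) * j)).
    rewrite mulr_sumr; apply: eq_bigr => j _; rewrite expr1n mulr1 exprMn -exprM.
    rewrite (mulnAC p.-1 i.+1 j).
    move: (zeta 1 ^+ _) (_ ^+ i.+1) (_ ^+ i.+1) 'C(_, _) (p%:R^-1 : C) => a b b' n pi'.
    by rewrite !mulrnAr !mulrnAl; congr (_ *+ n); ring.
  by rewrite E mulr0.
move=> w; have -> : f w = \sum_(j < p) al (iter j sg w) * f (iter j sg w).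
  under eq_bigr do rewrite (iter_inv (x := f)) //.
  by rewrite -mulr_suml alsum mul1r.
rewrite -sumrB; apply: av_sum_le => [|j _].
  by rewrite mulr_ge0 ?invr_ge0 ?exprn_ge0 ?av_ge0 //; apply: le_trans (fg w); exact: av_ge0.
by rewrite -mulrBr avM; apply: ler_pM; rewrite ?av_ge0.
Qed.

End Layer.

(** * One layer of degree p: the Frobenius condition *)

Section LayerFrob.
Variable K : cpdata.
Local Notation R := (cpR K).
Local Notation p := (cpp K).
Local Notation C := (cpC K).
Local Notation v := (cpv K).
Local Notation q := (v p%:R).
Local Notation zeta := (cpz K).
Local Notation p0 := (p_gt0 K).
Local Notation p1 := (p_gt1 K).
Variable Om : Type.
Variable D : (Om -> C) -> Prop.

Section Coefs.
Hypothesis hD : calg D.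
Definition dpoly (P : Om -> {poly C}) := forall j, D (fun w => (P w)`_j).
Let hO := calg_oalg hD.

Lemma dpolyC f : D f -> dpoly (fun w => (f w)%:P).
Proof.
move=> Df [|j]; first by have := Df; congr D; apply/funext => w; rewrite coefC.
by have := cg_c hD 0; congr D; apply/funext => w; rewrite coefC.
Qed.
Lemma dpolyX : dpoly (fun=> 'X).
Proof. by move=> j; exact: (cg_c hD). Qed.
Lemma dpolyD P Q : dpoly P -> dpoly Q -> dpoly (fun w => P w + Q w).
Proof. by move=> hP hQ j; have := cg_D hD (hP j) (hQ j); congr D; apply/funext => w; rewrite coefD. Qed.
Lemma dpolyM P Q : dpoly P -> dpoly Q -> dpoly (fun w => P w * Q w).
Proof.
move=> hP hQ j.
have := @og_sum _ _ D _ (index_enum 'I_j.+1) predT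
  (fun (i : 'I_j.+1) w => (P w)`_i * (Q w)`_(j - i)) hO (fun i _ => og_M hO (hP _) (hQ _)).
by congr D; apply/funext => w; rewrite coefM.
Qed.
Lemma dpoly_exp P n : dpoly P -> dpoly (fun w => P w ^+ n).
Proof.
move=> hP; elim: n => [|n IH]; first by apply: dpolyC; exact: (cg_c hD).
by have := dpolyM hP IH; congr dpoly; apply/funext => w; rewrite exprS.
Qed.
Lemma dpoly_sum (I : Type) (r : seq I) (F : I -> Om -> {poly C}) :
  (forall i, dpoly (F i)) -> dpoly (fun w => \sum_(i <- r) F i w).
Proof.
move=> h; elim: r => [|i r IH].
  by have := dpolyC (cg_c hD 0); congr dpoly; apply/funext => w; rewrite big_nil.
by have := dpolyD (h i) IH; congr dpoly; apply/funext => w; rewrite big_cons.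
Qed.
End Coefs.

Hypotheses (hD : calg D) (fD : frob D).
Variables (x y : Om -> C) (sg : Om -> Om).
Hypotheses (Dx : D x) (Dxi : D (fun w => (x w)^-1)) (yx : forall w, y w ^+ p = x w).
Hypotheses (y1 : forall w, v (y w) = 1) (ysg : forall w, y (sg w) = zeta 1 * y w).
Hypothesis Dsg : forall f, D f -> forall w, f (sg w) = f w.

Let hO := calg_oalg hD.
Let x1 w : v (x w) = 1. Proof. by rewrite -yx avX y1 expr1n. Qed.
Let Y := xspan D y p.
Let hY : calg Y. Proof. exact: (xspan_layer hD Dx yx). Qed.
Let hYO := calg_oalg hY.
Let Yg : Y y.
Proof. by apply: xspan_gen; rewrite ?p0 //; have := Dx; congr D; apply/funext => w; rewrite yx. Qed.
Let Ysub f : D f -> Y f.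
Proof. by apply: xspan_sub; rewrite ?p0. Qed.

(** Y is generated over D by e = (y - r)/d, where |zeta_1 - 1| = |pi| |d|. The equation y^p = x
    reads [xi] = e^p + pi^(p-1) e r^(p-1) up to small terms. So if xi1^p approximates [xi], then xi1
    - e is, after scaling, an approximate p-th root of e r^(p-1); since r^p is close to x,
    approximate roots of r and 1/x turn it into one of e. *)
Lemma layer_frob : frob Y.
Proof.
pose pi := @nroot K (p.-1 * p ^ 2) p%:R.
have Np : (0 < p.-1 * p ^ 2)%N by rewrite muln_gt0 expn_gt0 p0 andbT; have := p1; lia.
have piE : pi ^+ (p.-1 * p ^ 2) = p%:R by rewrite nrootK.
have vpi : v pi ^+ (p.-1 * p ^ 2) = q by rewrite -avX piE.
have pi0 : pi != 0.
  by apply/eqP => e; have := pC_neq0 K; rewrite -piE e expr0n (gtn_eqF Np) eqxx.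
have pi1 : v pi < 1 by apply: (@avX_lt1 _ _ _ _ _ Np); rewrite piE q_lt1.
have vp0 : 0 < v pi by rewrite av_gt0.
have [r Dr yr] := layer_approx hD fD Dx yx y1 piE.
pose d := pi ^+ (p ^ 2).-1; have d0 : d != 0 by rewrite expf_neq0.
have yd w : v (y w - r w) <= v d by rewrite /d avX.
have P2 : (p + 2 <= p ^ 2)%N \/ p = 2%N.
  case: (ltngtP p 2) => [|h|->]; [by have := p1; lia|left|by right].
  by rewrite expnS expn1; apply: leq_trans (_ : (3 * p <= _)%N); [lia|rewrite leq_mul2r h orbT].
have P1 : (p + 1 < p ^ 2)%N by case: P2 => [|->]; lia.
have d1 : v d < 1 by rewrite /d avX exprn_ilt1 ?av_ge0 //; lia.
have dle1 := ltW d1.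
have qdE : q = v (pi ^+ p.-1) * v d ^+ p.-1.
  rewrite /d !avX -vpi -exprM -exprD; congr (_ ^+ _).
  have -> : (p.-1 + (p ^ 2).-1 * p.-1 = (1 + (p ^ 2).-1) * p.-1)%N by rewrite mulnDl mul1n.
  by rewrite add1n prednK ?expn_gt0 ?p0 // mulnC.
have qd : q <= v d ^+ p.-1.
  by rewrite qdE ler_piMl ?exprn_ge0 ?av_ge0 // avX exprn_ile1 ?av_ge0 // ltW.
have pp : (0 < p.-1)%N by have := p1; lia.
have qd1 : q <= v d.
  apply: le_trans qd _; rewrite -[leRHS]expr1; apply: ler_wiXn2l; rewrite ?av_ge0 //.
have dpS : v d ^+ p = v d ^+ p.-1 * v d by rewrite -exprSr prednK ?p0.
have qdp : q * v d <= v d ^+ p by rewrite dpS ler_wpM2r ?av_ge0.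
have r1 w : v (r w) <= 1 by apply: av_near (_ : v (y w) <= 1); rewrite ?y1 // avBC; exact: le_trans (yd w) dle1.
pose e w := (y w - r w) / d.
have e1 w : v (e w) <= 1 by rewrite avf ler_pdivrMr ?av_gt0 // mul1r.
have Ye : Y e.
  have := cg_Z d^-1 hY (og_B hYO Yg (Ysub Dr)); congr Y; apply/funext => w.
  by rewrite mulrC.
have ye w : y w = r w + d * e w by rewrite /e mulrCA mulfV // mulr1 addrC subrK.
have xr w : v (x w - r w ^+ p) <= v d ^+ p.
  rewrite -yx; apply: sub_pow => //; first exact: le_trans (yd w) dle1.
    by apply: lerXn2r; rewrite ?nnegrE ?av_ge0.
  by apply: le_trans qdp; apply: ler_wpM2l; rewrite ?q_ge0.
pose xi w := (d ^+ p)^-1 * (x w - r w ^+ p).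
have bxi : ball D xi.
  split=> [|w]; first by apply: (cg_Z _ hD); apply: (og_B hO) => //; exact: (og_X _ hO).
  by rewrite avM avV avX mulrC ler_pdivrMr ?exprn_gt0 ?av_gt0 // mul1r.
have [xi1 Dxi1 xiE] := fD bxi.
have bxi1 := frob_ball bxi Dxi1 (fun w => le_trans (xiE w) (q_le1 K)).
have br : ball D r by [].
have [r2 Dr2 r2E] := fD br; have [_ br2] := frob_ball br Dr2 (fun w => le_trans (r2E w) (q_le1 K)).
have bxv : ball D (fun w => (x w)^-1) by split=> // w; rewrite avV x1 invr1.
have [x2 Dx2 x2E] := fD bxv; have [_ bx2] := frob_ball bxv Dx2 (fun w => le_trans (x2E w) (q_le1 K)).
pose pi2 := @nroot K p pi; have pi2E : pi2 ^+ p = pi by rewrite nrootK ?p0.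
pose k := pi2 ^+ p.-1; have kE : k ^+ p = pi ^+ p.-1 by rewrite /k -exprM mulnC exprM pi2E.
have k0 : k != 0 by apply/eqP => h; have := expf_neq0 p.-1 pi0; rewrite -kE h expr0n gtn_eqF ?p0 ?eqxx.
pose G w := (xi1 w - e w) / k.
pose E w := G w * r2 w * x2 w.
have YE : Y E.
  apply: (og_M hYO); last exact: Ysub.
  apply: (og_M hYO); last exact: Ysub.
  have := cg_Z k^-1 hY (og_B hYO (Ysub Dxi1) Ye); congr Y; apply/funext => w.
  by rewrite mulrC.
have pd : p%:R = pi ^+ p.-1 * d ^+ p.-1 :> C.
  rewrite -piE /d -exprM -exprD; congr (_ ^+ _).
  have -> : (p.-1 + (p ^ 2).-1 * p.-1 = (1 + (p ^ 2).-1) * p.-1)%N by rewrite mulnDl mul1n.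
  by rewrite add1n prednK ?expn_gt0 ?p0 // mulnC.
have Gp w : v (G w ^+ p - e w * r w ^+ p.-1) <= v d.
  have kp0 : pi ^+ p.-1 != 0 by rewrite expf_neq0.
  rewrite -(ler_pM2l (_ : 0 < v (pi ^+ p.-1))) ?av_gt0 // -avM mulrBr.
  have -> : pi ^+ p.-1 * G w ^+ p = (xi1 w - e w) ^+ p by rewrite /G expr_div_n kE mulrCA mulfV // mulr1.
  have bq : q <= v (pi ^+ p.-1) * v d.
    rewrite qdE; apply: ler_wpM2l; first exact: av_ge0.
    by rewrite -[leRHS]expr1; apply: ler_wiXn2l; rewrite ?av_ge0.
  (* d^p xi = (de)^p + p cross (de, r) *)
  have crossE : xi w = e w ^+ p + pi ^+ p.-1 * (d^-1 * ccross p (d * e w) (r w)).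
    apply: (mulfI (expf_neq0 p d0)); rewrite /xi mulVKf ?expf_neq0 // -yx ye [r w + _]addrC ccrossE ?cpp_pr //.
    have -> : d ^+ p = d ^+ p.-1 * d by rewrite -exprSr prednK ?p0.
    rewrite exprMn; have -> : d ^+ p = d ^+ p.-1 * d by rewrite -exprSr prednK ?p0.
    by rewrite pd; field.
  have cr : v (d^-1 * ccross p (d * e w) (r w) - e w * r w ^+ p.-1) <= v d.
    have de : v (d * e w) <= v d by rewrite avM ler_piMr ?av_ge0.
    have de1 : v (d * e w) <= 1 := le_trans de dle1.
    have -> : d^-1 * ccross p (d * e w) (r w) - e w * r w ^+ p.-1 =
       d^-1 * (ccross p (d * e w) (r w) - d * e w * r w ^+ p.-1) by field.
    rewrite avM avV mulrC ler_pdivrMr ?av_gt0 //; apply: le_trans (cross_first de1 (r1 w)) _.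
    by rewrite -expr2; apply: lerXn2r; rewrite ?nnegrE ?av_ge0.
  have [_ bx1] := bxi1.
  have h1 : v ((xi1 w - e w) ^+ p - (xi w - e w ^+ p)) <= q.
    have := ccrossE (xi1 w - e w) (e w) (cpp_pr K); rewrite subrK => h.
    have -> : (xi1 w - e w) ^+ p - (xi w - e w ^+ p) = (xi1 w ^+ p - xi w) - p%:R * ccross p (xi1 w - e w) (e w).
      by rewrite h; ring.
    apply: avBle; first by rewrite avBC.
    rewrite avM ler_piMr ?q_ge0 //; apply: le_trans (cross_small _ _) _ => //; by apply: avBle.
  have h2 : xi w - e w ^+ p = pi ^+ p.-1 * (d^-1 * ccross p (d * e w) (r w)).
    by rewrite {1}crossE addrAC subrr add0r.
  have -> : (xi1 w - e w) ^+ p - pi ^+ p.-1 * (e w * r w ^+ p.-1) =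
     ((xi1 w - e w) ^+ p - (xi w - e w ^+ p)) + pi ^+ p.-1 * (d^-1 * ccross p (d * e w) (r w) - e w * r w ^+ p.-1).
    by rewrite h2; ring.
  apply: avDle; first exact: le_trans h1 bq.
  by rewrite avM; apply: ler_wpM2l; rewrite ?av_ge0.
have G1 w : v (G w) <= 1.
  apply: (@avX_le1 _ _ _ _ p p0); apply: (av_near (y := e w * r w ^+ p.-1)).
    exact: le_trans (Gp w) dle1.
  by apply: avM1 => //; exact: avX1.
have E1 w : v (E w) <= 1 by rewrite /E; apply: avM1 => //; exact: avM1.
have Ep w : v (e w - E w ^+ p) <= v d.
  have xw0 : x w != 0 by rewrite -(av_gt0 v) x1.
  have s1 : v (e w - G w ^+ p * (r w * (x w)^-1)) <= v d.
    have -> : e w - G w ^+ p * (r w * (x w)^-1) =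
       (x w)^-1 * (e w * (x w - r w ^+ p)) - (G w ^+ p - e w * r w ^+ p.-1) * (r w * (x w)^-1).
      have -> : r w ^+ p = r w ^+ p.-1 * r w by rewrite -exprSr prednK ?p0.
      by field.
    apply: avBle.
      rewrite avM avV x1 invr1 mul1r avM; apply: le_trans (_ : v (x w - r w ^+ p) <= _).
        by rewrite ler_piMl ?av_ge0.
      by apply: le_trans (xr w) _; rewrite -[leRHS]expr1; apply: ler_wiXn2l; rewrite ?av_ge0 ?p0.
    rewrite avM; apply: le_trans (_ : v (G w ^+ p - e w * r w ^+ p.-1) <= _) => //.
    by rewrite ler_piMr ?av_ge0 // avM avV x1 invr1 mulr1.
  have EE : E w ^+ p = G w ^+ p * (r2 w ^+ p * x2 w ^+ p).
    by rewrite /E [(_ * x2 w) ^+ p]exprMn [(_ * r2 w) ^+ p]exprMn -mulrA.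
  apply: avBtrans s1 _; rewrite EE -mulrBr avM.
  apply: le_trans (_ : v (r w * (x w)^-1 - r2 w ^+ p * x2 w ^+ p) <= _).
    by rewrite ler_piMl ?av_ge0 //; exact: avX1.
  have -> : r w * (x w)^-1 - r2 w ^+ p * x2 w ^+ p =
    (r w - r2 w ^+ p) * (x w)^-1 + r2 w ^+ p * ((x w)^-1 - x2 w ^+ p) by ring.
  apply: le_trans qd1; apply: avDle; rewrite avM.
    by rewrite avV x1 invr1 mulr1; exact: r2E.
  by apply: le_trans (x2E w); rewrite ler_piMl ?av_ge0 //; exact: avX1.
(* The coefficients of f in e lose |pi|^(-p) against the precision |d| = |pi|^(p^2-1) of the root of
   e. The exponent p^2 - p - 1 is positive even for p = 2. *)
apply: (frob_bump (a := pi ^+ (p ^ 2 - p - 1)) hY).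
  by rewrite avX exprn_ilt1 ?av_ge0 // -lt0n -subnDA subn_gt0.
move=> f [[F [DF fE]] f1].
(* f as a polynomial in e. Its coefficients are bounded by interpolation at the conjugates of e,
   whose mutual distances are |zeta_1 - 1|/|d| = |pi|. *)
pose Phi w : {poly C} := \sum_(i < p) (F i w)%:P * ((r w)%:P + d%:P * 'X) ^+ i.
have dPhi : dpoly Phi.
  apply: (dpoly_sum hD) => i; apply: (dpolyM hD); first exact: (dpolyC hD (DF i)).
  apply: (dpoly_exp hD); apply: (dpolyD hD); first exact: (dpolyC hD).
  by apply: (dpolyM hD); [apply: (dpolyC hD); exact: (cg_c hD)|exact: (dpolyX hD)].
have PhiE w z : (Phi w).[z] = \sum_(i < p) F i w * (r w + d * z) ^+ i.
  rewrite /Phi horner_sum; apply: eq_bigr => i _.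
  by rewrite hornerM horner_exp hornerD hornerM !hornerC hornerX.
have sPhi w : (size (Phi w) <= p)%N.
  apply: (big_ind (fun P : {poly C} => size P <= p)%N) => [|P Q hP hQ|i _].
  - by rewrite size_poly0.
  - by apply: leq_trans (size_polyD _ _) _; rewrite geq_max hP.
  rewrite mul_polyC; apply: leq_trans (size_scale_leq _ _) _; apply: leq_trans (size_poly_exp_leq _ _) _.
  have s2 : (size ((r w)%:P + d%:P * 'X)%R <= 2)%N.
    apply: leq_trans (size_polyD _ _) _; rewrite geq_max (leq_trans (size_polyC_leq1 _)) //=.
    by rewrite mul_polyC; apply: leq_trans (size_scale_leq _ _) _; rewrite size_polyX.
  apply: leq_trans (_ : i.+1 <= _)%N => //; rewrite ltnS.
  by rewrite -[leqRHS]mul1n leq_mul2r -ltnS; apply/orP; right; case: (size _) s2 => [|[|[|m]]].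
have zp := cpz_prim K 1; rewrite expn1 in zp.
have iterE j w : e (iter j sg w) = (zeta 1 ^+ j * y w - r w) / d.
  by rewrite /e (iter_mul _ _ ysg) (iter_inv (x := r)) //; exact: Dsg.
have fj j w : f (iter j sg w) = (Phi w).[e (iter j sg w)].
  rewrite fE PhiE; apply: eq_bigr => i _; rewrite (iter_inv (x := F i)); last exact: Dsg.
  rewrite (iter_mul _ _ ysg); congr (_ * _ ^+ _).
  by rewrite iterE mulrCA mulfV // mulr1 addrC subrK.
have zd : v (zeta 1 - 1) = v pi * v d.
  apply/eqP; rewrite -(@eqrXn2 _ p.-1) ?mulr_ge0 ?av_ge0 // av_zeta1 qdE exprMn avX //.
have coef w i : v (Phi w)`_i <= (v pi ^+ p)^-1.
  pose es := [seq e (iter j sg w) | j <- iota 0 p].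
  have ses : size es = p by rewrite size_map size_iota.
  have -> : (v pi ^+ p)^-1 = 1 / v pi ^+ size es by rewrite ses div1r.
  apply: newton_coef => //; rewrite ?ses //.
  - exact: ltW.
  - by move=> z /mapP[j _ ->].
  - rewrite pairwise_map.
    have pw : pairwise ltn (iota 0 p).
      have := iota_ltn_sorted 0 p; rewrite sorted_pairwise //; exact: ltn_trans.
    apply: sub_in_pairwise pw => // [j j' + + jj'] /=; rewrite !mem_iota !add0n /= => jp jp'.
    rewrite !iterE -mulrBl opprB addrA subrK -mulrBl avf avM y1 mulr1 ler_pdivlMr ?av_gt0 // -zd.
    have -> : zeta 1 ^+ j - zeta 1 ^+ j' = - (zeta 1 ^+ j * (zeta 1 ^+ (j' - j) - 1)).
      by rewrite mulrBr -exprD subnKC ?mulr1 ?opprB // ltnW.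
    rewrite avN avM avX av_zeta expr1n mul1r av_zeta1X //.
    by rewrite subn_gt0 [(j < j')%N]jj' /=; apply: leq_ltn_trans (leq_subr _ _) jp'.
  - by move=> z /mapP[j _ ->]; rewrite -fj.
have vP : 0 < v pi ^+ p by rewrite exprn_gt0.
have /choice[g hg] : forall i, exists g, ball D g /\ forall w, v (pi ^+ p * (Phi w)`_i - g w ^+ p) <= q.
  move=> i; have b : ball D (fun w => pi ^+ p * (Phi w)`_i).
    split=> [|w]; first by apply: (cg_Z _ hD); exact: dPhi.
    by rewrite avM avX mulrC -ler_pdivlMr // div1r.
  have [g Dg gE] := fD b; exists g; split=> //.
  by apply: frob_ball b Dg _ => w; apply: le_trans (gE w) (q_le1 K).
exists (fun w => pi^-1 * \sum_(i < p) g i w * E w ^+ i).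
  apply: (cg_Z _ hY); apply: (og_sum _ hYO) => i _; apply: (og_M hYO); last exact: (og_X _ hYO).
  by apply: Ysub; case: (hg i) => -[].
move=> w; rewrite exprMn exprVn.
have fw : f w = (pi ^+ p)^-1 * \sum_(i < p) pi ^+ p * (Phi w)`_i * e w ^+ i.
  have := fj 0%N w; rewrite /= => ->; rewrite (horner_coef_wide _ (sPhi w)) mulr_sumr.
  by apply: eq_bigr => i _; rewrite mulrA mulKf // expf_neq0.
rewrite fw -mulrBr avM avV avX.
have -> : v (pi ^+ (p ^ 2 - p - 1)) = (v pi ^+ p)^-1 * v d.
  have vPn : v pi ^+ p != 0 by rewrite gt_eqF.
  apply: (mulfI vPn); rewrite mulVKf // /d !avX -exprD; congr (_ ^+ _); clear -P1; lia.
apply: ler_wpM2l; first by rewrite invr_ge0 ltW.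
apply: avBtrans (_ : v (_ - \sum_(i < p) (g i w * E w ^+ i) ^+ p) <= _) _; last first.
  rewrite avBC; apply: le_trans qd1; apply: frob_big => i; apply: avM1; last exact: avX1.
  by case: (hg i) => -[].
rewrite -sumrB; apply: av_sum_le => [|i _]; first exact: av_ge0.
have [[_ gi1] giE] := hg i.
have -> : pi ^+ p * (Phi w)`_i * e w ^+ i - (g i w * E w ^+ i) ^+ p =
   (pi ^+ p * (Phi w)`_i - g i w ^+ p) * e w ^+ i + g i w ^+ p * (e w ^+ i - (E w ^+ p) ^+ i).
  by rewrite [(g i w * _) ^+ p]exprMn exprAC mulrBl mulrBr addrA subrK.
apply: avDle; rewrite avM.
  apply: le_trans qd1; apply: le_trans (giE w); rewrite ler_piMr ?av_ge0 //; exact: avX1.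
apply: le_trans (_ : v (e w ^+ i - (E w ^+ p) ^+ i) <= _).
  by rewrite ler_piMl ?av_ge0 //; exact: avX1.
rewrite subrXX avM; apply: le_trans (Ep w); rewrite ler_piMr ?av_ge0 //.
apply: av_sum_le => // j _; apply: avM1; apply: avX1 => //; exact: avX1.
Qed.
End LayerFrob.

(** * Towers of p-power roots over a perfectoid algebra *)

Section KummerTower.
Variable K : cpdata.
Local Notation R := (cpR K).
Local Notation p := (cpp K).
Local Notation C := (cpC K).
Local Notation v := (cpv K).
Local Notation q := (v p%:R).
Local Notation zeta := (cpz K).
Local Notation p0 := (p_gt0 K).
Local Notation p1 := (p_gt1 K).
Variables (Om : Type) (D : (Om -> C) -> Prop).
Hypotheses (hD : calg D) (fD : frob D) (bD : forall f, D f -> bounded f) (cD : forall f, cl D f -> D f).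
Variables (y : nat -> Om -> C) (sg : Om -> Om).
Hypotheses (yS : forall n w, y n.+1 w ^+ p = y n w) (y1 : forall n w, v (y n w) = 1).
Hypotheses (Dy : D (y 0%N)) (Dyi : D (fun w => (y 0%N w)^-1)).
Hypotheses (ysg : forall n w, y n (sg w) = zeta n * y n w).
Hypothesis Dsg : forall f, D f -> forall w, f (sg w) = f w.

Definition kspan n := xspan D (y n) (p ^ n).

Let pn n : (0 < p ^ n)%N. Proof. by rewrite expn_gt0 p0. Qed.
Let yN n w : y n w ^+ (p ^ n) = y 0%N w.
Proof. exact: (@psys_pow K (y^~ w) n (fun m => yS m w)). Qed.

Lemma kspan_calg n : calg (kspan n).
Proof. by apply: (xspan_calg hD (pn n)); have := Dy; congr D; apply/funext => w; rewrite yN. Qed.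
Let hO n := calg_oalg (kspan_calg n).

Lemma kspan_sub n f : D f -> kspan n f.
Proof. by move=> Df; apply: xspan_sub; rewrite ?pn. Qed.

Lemma kspan_gen n : kspan n (y n).
Proof.
by apply: (xspan_gen hD (pn n)); have := Dy; congr D; apply/funext => w; rewrite yN.
Qed.

Lemma kspan_inv n : kspan n (fun w => (y n w)^-1).
Proof.
have := og_M (hO n) (og_X (p ^ n).-1 (hO n) (kspan_gen n)) (kspan_sub n Dyi).
congr kspan; apply/funext => w; have yw : y n w != 0 by rewrite -(av_gt0 v) y1.
by rewrite -(yN n) -{2}(prednK (pn n)) exprS invfM mulrCA mulfV ?mulr1 // expf_neq0.
Qed.

Lemma kspanS n f : kspan n f -> kspan n.+1 f.
Proof.
apply: (xspan_min (kspan_calg n.+1)); first exact: kspan_sub.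
by have := og_X p (hO n.+1) (kspan_gen n.+1); congr kspan; apply/funext => w; rewrite yS.
Qed.

Lemma kspan_mono n m f : (n <= m)%N -> kspan n f -> kspan m f.
Proof. by move=> /subnK <-; elim: (m - n)%N => [//|k IH] /IH; exact: kspanS. Qed.

Lemma kspan_layer n f : kspan n.+1 f <-> xspan (kspan n) (y n.+1) p f.
Proof.
split; last first.
  apply: (xspan_min (kspan_calg n.+1)); [exact: kspanS|exact: kspan_gen].
have hL := xspan_layer (kspan_calg n) (kspan_gen n) (yS n).
have Yn : kspan n (fun w => y n.+1 w ^+ p).
  by have := kspan_gen n; congr kspan; apply/funext => w; rewrite yS.
apply: (xspan_min hL) => [g Dg|].
  by apply: xspan_sub; rewrite ?p0 //; [exact: kspan_calg|exact: kspan_sub].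
exact: (xspan_gen (kspan_calg n) p0 Yn).
Qed.

Let sgn n := iter (p ^ n) sg.
Let zetaX n : zeta n.+1 ^+ (p ^ n) = zeta 1.
Proof.
by have := @psys_powD K zeta n 1 (cpz_compat K); rewrite addn1.
Qed.
Let ysgn n w : y n.+1 (sgn n w) = zeta 1 * y n.+1 w.
Proof. by rewrite /sgn (iter_mul _ _ (ysg n.+1)) zetaX. Qed.
Let Dsgn n f : kspan n f -> forall w, f (sgn n w) = f w.
Proof.
move=> [F [DF fE]] w; rewrite !fE; apply: eq_bigr => i _.
rewrite /sgn (iter_inv _ _ (Dsg (DF i))) (iter_mul _ _ (ysg n)).
by rewrite (prim_expr_order (cpz_prim K n)) mul1r.
Qed.

Let Dlayer f : kspan 0 f -> D f.
Proof.
by apply: (xspan_min hD).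
Qed.

Lemma kspan_frob n : frob (kspan n).
Proof.
elim: n => [|n IH].
  move=> f [/Dlayer Df f1]; have [h Dh fh] := fD (conj Df f1).
  by exists h => //; exact: kspan_sub.
have h := layer_frob (kspan_calg n) IH (kspan_gen n) (kspan_inv n) (yS n) (y1 n.+1) (ysgn n) (@Dsgn n).
move=> f [/kspan_layer Df f1]; have [g Dg fg] := h f (conj Df f1).
by exists g => //; apply/kspan_layer.
Qed.

Lemma kspan_bounded n f : kspan n f -> bounded f.
Proof.
move=> [F [DF fE]].
suff H m : exists k, forall w, v (\sum_(i < m) F i w * y n w ^+ i) <= (q ^+ k)^-1.
  by have [k hk] := H (p ^ n)%N; exists k => w; rewrite fE.
elim: m => [|m [k IH]]; first by exists 0%N => w; rewrite big_ord0 av0 invr1.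
have [l hl] := bD (DF m); exists (k + l)%N => w; rewrite big_ord_recr /=.
have mono i j : (q ^+ i)^-1 <= (q ^+ (i + j))^-1.
  by rewrite lef_pV2 ?posrE ?exprn_gt0 ?q_gt0 //; apply: q_anti; exact: leq_addr.
apply: avDle; first exact: le_trans (IH w) (mono _ _).
by rewrite avM avX y1 expr1n mulr1 addnC; apply: le_trans (hl w) (mono _ _).
Qed.

Definition kunion f := exists n, kspan n f.
Definition ktower := cl kunion.

Lemma kunion_calg : calg kunion.
Proof.
have two f g : kunion f -> kunion g -> exists n, kspan n f /\ kspan n g.
  move=> [n hn] [m hm]; exists (maxn n m).
  by split; [apply: kspan_mono hn; exact: leq_maxl|apply: kspan_mono hm; exact: leq_maxr].
split=> [c|f g hf hg|f g hf hg].
- by exists 0%N; exact: (cg_c (kspan_calg 0)).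
- by have [n [h1 h2]] := two _ _ hf hg; exists n; exact: (cg_D (kspan_calg n)).
- by have [n [h1 h2]] := two _ _ hf hg; exists n; exact: (cg_M (kspan_calg n)).
Qed.

Let bU f : kunion f -> bounded f. Proof. by move=> [n]; exact: kspan_bounded. Qed.

Lemma ktower_calg : calg ktower.
Proof. exact: (cl_calg kunion_calg bU). Qed.
Lemma ktower_bounded f : ktower f -> bounded f.
Proof. exact: (cl_bounded bU). Qed.
Lemma ktower_closed f : cl ktower f -> ktower f.
Proof. exact: cl_cl. Qed.
Lemma ktower_frob : frob ktower.
Proof.
apply: (frob_cl kunion_calg) => f [[n Df] f1]; have [g Dg fg] := kspan_frob (conj Df f1).
by exists g => //; exists n.
Qed.
Lemma ktower_sub f : D f -> ktower f.
Proof. by move=> Df; apply: cl_sub; exists 0%N; exact: kspan_sub. Qed.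
Lemma ktower_gen n : ktower (y n).
Proof. by apply: cl_sub; exists n; exact: kspan_gen. Qed.

Let b n : R := v (@psys K p%:R n).
Let bS n : b n.+1 ^+ p = b n. Proof. by rewrite /b -avX psysS. Qed.
Let b1 n : b n < 1.
Proof.
elim: n => [|n IH]; first exact: q_lt1.
by apply: (@avX_lt1 _ _ _ _ p p0); rewrite psysS.
Qed.
Let bg n : 0 < b n.
Proof.
elim: n => [|n IH]; first exact: q_gt0.
rewrite lt_neqAle av_ge0 andbT eq_sym; apply/eqP => e.
by have := bS n; rewrite e expr0n (gtn_eqF p0) => e'; have := IH; rewrite -e' ltxx.
Qed.

(* The loss at layer i is |p|^(-1/p^i), and 1/p + ... + 1/p^n <= 1 - 1/p^n. *)
Let descend n g f e : (forall w, f (sg w) = f w) -> kspan n g -> (forall w, v (f w - g w) <= e) ->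
  exists2 g', D g' & forall w, v (f w - g' w) <= q^-1 * b n * e.
Proof.
move=> fs; elim: n g e => [|n IH] g e Dg fg.
  by exists g => [|w]; [exact: Dlayer|rewrite /b mulVf ?mul1r // gt_eqF ?q_gt0].
have pp : (0 < p.-1)%N by have := p1; case: p => [|[]].
pose pi := @nroot K p.-1 (@psys K p%:R n.+1).
have piE : pi ^+ p.-1 = @psys K p%:R n.+1 by rewrite nrootK.
have pE : pi ^+ (p.-1 * p ^ n.+1) = p%:R.
  by rewrite exprM piE (@psys_pow K (@psys K p%:R) n.+1) // => m; exact: psysS.
have fsn w : f (sgn n w) = f w by rewrite /sgn (iter_inv _ _ fs).
have [g1 Dg1 fg1] := layer_descend (kspan_calg n) (kspan_frob (n := n)) (kspan_gen n) (kspan_inv n)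
  (yS n) (y1 n.+1) (ysgn n) (@Dsgn n) pE fsn ((kspan_layer n g).1 Dg) fg.
have [g2 Dg2 fg2] := IH _ _ Dg1 fg1; exists g2 => // w; apply: le_trans (fg2 w) _.
have e0 : 0 <= e by apply: le_trans (fg w); exact: av_ge0.
rewrite -avX piE -/(b n.+1) !mulrA; apply: ler_wpM2r => //.
rewrite ler_pdivrMr ?bg // -mulrA; apply: ler_wpM2l; first by rewrite invr_ge0 q_ge0.
by rewrite -bS -expr2; apply: ler_wiXn2l; rewrite ?p1 // ?ltW.
Qed.

(** The loss of the whole descent is at most 1/|p| at every level, so one extra digit in the
    approximation at finite level compensates it. *)
Lemma ktower_fix f : ktower f -> (forall w, f (sg w) = f w) -> D f.
Proof.
move=> Ef fs; apply: cD => m; have [g [n Dg] fg] := Ef m.+1.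
have [g' Dg' fg'] := descend fs Dg fg; exists g' => // w; apply: le_trans (fg' w) _.
rewrite exprS mulrAC mulKf ?gt_eqF ?q_gt0 // mulrC ler_piMl ?exprn_ge0 ?q_ge0 //.
exact: ltW.
Qed.
End KummerTower.

(** * Tate traces and locally analytic elements *)

Lemma big_ord_mul (V : nmodType) (a b : nat) (F : nat -> V) :
  \sum_(k < a * b) F k = \sum_(j < a) \sum_(l < b) F (j + a * l)%N.
Proof.
rewrite exchange_big /=; elim: b => [|b IH]; first by rewrite muln0 !big_ord0.
rewrite big_ord_recr /= -IH mulnSr big_split_ord /=; congr (_ + _).
by apply: eq_bigr => i _; rewrite addnC.
Qed.

(** * Averages over p-power roots of unity *)

Section Moments.
Variable K : cpdata.
Local Notation R := (cpR K).
Local Notation p := (cpp K).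
Local Notation p_pr := (cpp_pr K).
Local Notation C := (cpC K).
Local Notation v := (cpv K).
Local Notation q := (v p%:R).
Local Notation zeta := (cpz K).
Local Notation p0 := (p_gt0 K).
Local Notation p1 := (p_gt1 K).

Lemma av_subX1 (z : C) k : v z <= 1 -> v (z ^+ k - 1) <= v (z - 1).
Proof.
move=> z1; rewrite subrX1 avM ler_piMr ?av_ge0 //.
by apply: av_sum_le => // i _; exact: avX1.
Qed.

Lemma av_zeta1_bounds : q <= v (zeta 1 - 1) < 1.
Proof.
have h := av_zeta1 K; have pp : (0 < p.-1)%N by have := p1; case: p => [|[]].
have l1 : v (zeta 1 - 1) < 1 by apply: (@avX_lt1 _ _ _ _ p.-1) => //; rewrite avX h q_lt1.
by rewrite l1 andbT -h -[leRHS]expr1; apply: ler_wiXn2l; rewrite ?av_ge0 ?ltW.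
Qed.

Lemma av_zetaX n : v (zeta n.+1 - 1) ^+ (p ^ n) = v (zeta 1 - 1).
Proof.
elim: n => [|n IH]; first by rewrite expr1.
by rewrite expnS exprM (av_zetaS K n).1.
Qed.

(** For k prime to p, some p-power of zeta_n^k has exact order p, hence distance at least |p| from
    1, and taking powers does not increase the distance from 1. *)
Lemma av_zeta_root n k : zeta n ^+ k != 1 -> q <= v (zeta n ^+ k - 1).
Proof.
elim: n k => [|n IH] k; first by rewrite zeta0 expr1n eqxx.
case: (boolP (p %| k)%N) => [/dvdnP[l ->]|pk _].
  by rewrite mulnC exprM cpz_compat; exact: IH.
have : v ((zeta n.+1 ^+ k) ^+ (p ^ n) - 1) <= v (zeta n.+1 ^+ k - 1).
  by apply: av_subX1; rewrite avX av_zeta expr1n.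
apply: le_trans; have zp := cpz_prim K 1; rewrite expn1 in zp.
have -> : zeta n.+1 ^+ k ^+ (p ^ n) = zeta 1 ^+ (k %% p).
  rewrite -exprM mulnC exprM; have := @psys_powD K zeta n 1 (cpz_compat K); rewrite addn1 => ->.
  by rewrite (prim_expr_mod zp).
rewrite av_zeta1X; first by have /andP[] := av_zeta1_bounds.
by rewrite lt0n -/(dvdn p k) pk ltn_mod p0.
Qed.

Section Level.
Variable M : nat.
Let Q := (p ^ M.+1)%N.
Let z := zeta M.+1.
Let e := v (z - 1).
Let zQ : Q.-primitive_root z := cpz_prim K M.+1.
Let Q0 : (0 < Q)%N. Proof. by rewrite expn_gt0 p0. Qed.
Let e0 : 0 < e. Proof. by rewrite av_gt0 subr_eq0 zeta_neq1. Qed.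

(** e^Q = |zeta_1 - 1|^p = |p| |zeta_1 - 1|. The lower bound is the origin of the factor |p|^(-2) in
    [avg_le]. *)
Let eQ : q ^+ 2 <= e ^+ Q <= q.
Proof.
have /andP[h1 h2] := av_zeta1_bounds.
have -> : e ^+ Q = q * v (zeta 1 - 1).
  by rewrite /e /z /Q expnS mulnC exprM av_zetaX -[X in _ ^+ X](prednK p0) exprSr av_zeta1.
by rewrite expr2 ler_pM2l ?q_gt0 // h1 ler_piMr ?q_ge0 // ltW.
Qed.
Let e1 : e <= 1.
Proof.
by apply: avBle; rewrite ?av_zeta ?av1.
Qed.

(* z - 1 has the largest absolute value among the roots of (1 + y)^Q - 1. *)
Lemma near_root y : v y <= e -> v ((y + 1) ^+ Q - 1) <= e ^+ Q.
Proof.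
move=> ye; have -> : (y + 1) ^+ Q - 1 = \prod_(0 <= i < Q) (y + 1 - z ^+ i).
  have := congr1 (fun P : {poly C} => P.[y + 1]) (factor_Xn_sub_1 zQ).
  rewrite horner_prod hornerD hornerN hornerC hornerXn => <-.
  by apply: eq_bigr => i _; rewrite hornerXsubC.
rewrite big_mkord; suff H (n : nat) : v (\prod_(i < n) (y + 1 - z ^+ i)) <= e ^+ n by exact: H.
elim: n => [|n IH]; first by rewrite big_ord0 av1.
rewrite big_ord_recr /= exprSr avM; apply: ler_pM; rewrite ?av_ge0 //.
have -> : y + 1 - z ^+ n = y - (z ^+ n - 1) by rewrite opprB addrA addrAC.
by apply: avBle => //; apply: av_subX1; rewrite av_zeta.
Qed.

(** Cauchy's inequality for (1 + y)^Q - 1 at radius e. *)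
Let bin_le i : (0 < i)%N -> v ('C(Q, i))%:R * e ^+ i <= e ^+ Q.
Proof.
move=> i0; pose P : {poly C} := \poly_(i < Q.+1) (if i == 0%N then 0 else ('C(Q, i))%:R).
have PE y : P.[y] = (y + 1) ^+ Q - 1.
  rewrite horner_poly (addrC y) exprDn !big_ord_recl /= bin0 !expr0 mul0r add0r subn0 expr1n mulr1 mulr1n.
  rewrite [1 + _]addrC addrK; apply: eq_bigr => k _.
  by rewrite expr1n mul1r mulr_natl.
have := @poly_cauchy K P (z - 1) (e ^+ Q) (exprn_ge0 _ (ltW e0)) _ i.
rewrite coef_poly ltnS (gtn_eqF i0) /e; case: leqP => iQ.
  by apply=> y hy; rewrite PE; exact: near_root.
by move=> _; rewrite bin_small // av0 mul0r exprn_ge0 // av_ge0.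
Qed.

Lemma avg_small (P : {poly C}) : (size P <= Q)%N -> \sum_(k < Q) P.[z ^+ k] = Q%:R * P`_0.
Proof.
move=> sP; under eq_bigr do rewrite (horner_coef_wide _ sP).
rewrite exchange_big /= (bigD1 (Ordinal Q0)) //= [X in _ + X]big1 ?addr0 => [|i i0].
  by under eq_bigr do rewrite expr0 mulr1; rewrite sumr_const card_ord mulr_natl.
under eq_bigr do rewrite -exprM mulnC.
rewrite -mulr_sumr (sum_prim_root _ zQ) ifF ?mulr0 //; apply/negbTE.
apply: contra i0 => /dvdn_leq h; apply/eqP/val_inj => /=; case: (posnP i) => // /h.
by rewrite leqNgt ltn_ord.
Qed.

Let mom j : C := (Q%:R)^-1 * \sum_(k < Q) (z ^+ k - 1) ^+ j.

(* For j >= Q the moments satisfy the recursion given by (1 + y)^Q = 1 at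
   y = z^k - 1. *)
Let mom_le j : v (mom j) * q ^+ 2 <= e ^+ j.
Proof.
have [/andP[eQ1 eQ2]] := eQ.
have QC : Q%:R != 0 :> C := natC_neq0 K Q0.
elim/ltn_ind: j => j IH; case: (ltnP j Q) => jQ.
  have -> : mom j = (-1) ^+ j.
    rewrite /mom; have := @avg_small (('X - 1%:P) ^+ j); rewrite size_exp_XsubC => /(_ jQ).
    under eq_bigr do rewrite horner_exp hornerXsubC.
    move=> ->; rewrite mulKf // -horner_coef0 horner_exp hornerXsubC sub0r //.
  rewrite avX avN av1 expr1n mul1r; apply: le_trans eQ1 _.
  by apply: ler_wiXn2l; [exact: ltW|exact: e1|exact: ltnW].
have -> : mom j = - \sum_(i < Q.-1) ('C(Q, i.+1))%:R * mom (i.+1 + (j - Q))%N.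
  rewrite /mom; under [in RHS]eq_bigr do rewrite mulrCA.
  rewrite -mulr_sumr -mulrN; congr (_ * _).
  under [in RHS]eq_bigr do rewrite mulr_sumr.
  rewrite [in RHS]exchange_big /= -sumrN; apply: eq_bigr => k _.
  under [in RHS]eq_bigr do rewrite exprD mulrA.
  rewrite -mulr_suml -mulNr -{1}(subnKC jQ) exprD; congr (_ * _).
  have : (1 + (z ^+ k - 1)) ^+ Q = 1.
    by rewrite addrC subrK -exprM mulnC exprM (prim_expr_order zQ) expr1n.
  move: (z ^+ k - 1) => u; case: Q Q0 => // n _.
  rewrite exprDn big_ord_recl big_ord_recr /= !bin0 binn expr0 !mulr1n subnn expr0 mul1r expr1n mul1r => /eqP; rewrite -subr_eq0 addrAC subrr add0r addr_eq0.
  rewrite eq_sym eqr_oppLR => /eqP ->.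
  by congr (- _); apply: eq_bigr => i _; rewrite expr1n mul1r mulr_natl.
rewrite avN -ler_pdivlMr ?exprn_gt0 ?q_gt0 //; apply: av_sum_le.
  by rewrite divr_ge0 ?exprn_ge0 ?q_ge0 ?(ltW e0).
move=> i _; rewrite ler_pdivlMr ?exprn_gt0 ?q_gt0 // avM -mulrA.
have iQ : (i.+1 < Q)%N by have := ltn_ord i; rewrite -ltnS prednK.
apply: le_trans (ler_wpM2l (av_ge0 _ _) (IH _ _)) _.
  by rewrite -{2}(subnKC jQ) ltn_add2r.
rewrite exprD mulrA -{2}(subnKC jQ) exprD; apply: ler_wpM2r; last exact: bin_le.
exact: exprn_ge0 (ltW e0).
Qed.

(** Expand b at 1: Cauchy's inequality at radius e bounds the coefficients and [mom_le] the moments,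
    and the powers of e cancel. The loss is the same at every level. *)
Lemma avg_leS (b : {poly C}) (B : R) : 0 <= B -> (forall u, v (u ^+ Q - 1) <= q -> v b.[u] <= B) ->
  v ((Q%:R)^-1 * \sum_(k < Q) b.[z ^+ k]) <= B / q ^+ 2.
Proof.
move=> B0 hb; pose b' := b \Po ('X + 1%:P).
have bE y : b.[y] = b'.[y - 1] by rewrite horner_comp hornerD hornerX hornerC subrK.
have [/andP[eQ1 eQ2]] := eQ.
have cf := @poly_cauchy K b' (z - 1) B B0 _.
have {}cf j : v b'`_j * e ^+ j <= B.
  apply: cf => y hy; rewrite horner_comp hornerD hornerX hornerC; apply: hb.
  exact: le_trans (near_root hy) eQ2.
have -> : Q%:R^-1 * \sum_(k < Q) b.[z ^+ k] = \sum_(j < size b') b'`_j * mom j.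
  rewrite /mom; under [RHS]eq_bigr do rewrite mulrCA.
  rewrite -mulr_sumr; congr (_ * _); under [RHS]eq_bigr do rewrite mulr_sumr.
  rewrite exchange_big /=; apply: eq_bigr => k _; by rewrite bE horner_coef.
have q2 : 0 < q ^+ 2 by rewrite exprn_gt0 ?q_gt0.
apply: av_sum_le => [|j _]; first by rewrite divr_ge0 // ltW.
rewrite ler_pdivlMr // avM -mulrA; apply: le_trans (cf j).
by apply: ler_wpM2l; [exact: av_ge0|exact: mom_le].
Qed.
End Level.

Lemma avg_le M (b : {poly C}) (B : R) : 0 <= B ->
  (forall u, v (u ^+ (p ^ M) - 1) <= q -> v b.[u] <= B) ->
  v (((p ^ M)%:R)^-1 * \sum_(k < p ^ M) b.[zeta M ^+ k]) <= B / q ^+ 2.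
Proof.
case: M => [|M] B0 hb; last exact: avg_leS.
rewrite big_ord_recl big_ord0 addr0 invr1 mul1r expr0.
apply: le_trans (hb 1 _) _; first by rewrite expr1n subrr av0 q_ge0.
rewrite ler_pdivlMr ?exprn_gt0 ?q_gt0 // ler_piMr // exprn_ile1 ?q_ge0 ?q_le1 //.
Qed.
End Moments.

(** * Coefficients on the toric tower, bounded uniformly in the level *)

Section Traces.
Variable K : cpdata.
Local Notation R := (cpR K).
Local Notation p := (cpp K).
Local Notation p_pr := (cpp_pr K).
Local Notation C := (cpC K).
Local Notation v := (cpv K).
Local Notation q := (v p%:R).
Local Notation zeta := (cpz K).
Local Notation p0 := (p_gt0 K).
Variable c : C.
Hypotheses (c0 : c != 0) (c1 : v c < 1).
Local Notation T := (kumT c 1).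
Local Notation pT := (pt [:: T]).

Lemma units_T : units [:: T].
Proof. by apply: (@units_kumT K c c1 1 [::] [::]). Qed.

Lemma pow_cong (e : C) : e != 0 -> exists L, forall u, v (u - 1) <= q -> v (u ^+ (p ^ L) - 1) <= v e.
Proof.
move=> e0; have ve : 0 < v e by rewrite av_gt0.
have [L hL] := q_arch ve; exists L => u u1; have h := @powdiff_iter K u 1 1 L ler01.
move: h; rewrite av1 expr1n expr1n !mulr1 => /(_ u1 (lexx _)) h.
by apply: le_trans (h) _; apply: le_trans (ltW hL); apply: q_anti.
Qed.

(** Any two p^N-th roots of 1 + c z differ by a rotation, so a given one extends to a compatible
    system. *)
Lemma pt_root N z s : v z <= 1 -> s ^+ (p ^ N) = 1 + c * z -> exists w : pT, pz w = z /\ prt w 0 N = s.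
Proof.
move=> z1 sN; have [w0 w0z] := pt_ex [:: T] z1.
have rN : prt w0 0 N ^+ (p ^ N) = 1 + c * z.
  by rewrite (psys_pow (r := prt w0 0)) ?prt0 //= ?w0z ?tev_kumT ?expr1 // => m; exact: prtS.
have r0 : prt w0 0 N != 0 by rewrite -(av_gt0 v) (prt_unit w0 _ units_T).
have [|k hk] := prim_rootP (cpz_prim K N) (x := s / prt w0 0 N).
  rewrite expr_div_n sN rN mulfV // -rN expf_neq0 //.
exists (zrot 0 k w0); split=> //=.
by rewrite -hk divfK.
Qed.

(* A coefficient is an average over the p^N-th roots of unity.  The average over
   the p^(N-L)-th ones is bounded by avg_le, and only p^L is lost. *)
Lemma kcoef_bound : exists L, forall N (x : kummer p_pr [:: T] N) (B : R), 0 < B ->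
  (forall w : pT, v (pev w x) <= B) ->
  forall (i : 'I_(p ^ N)) (w : pt [::]), v (pev w (kcoef x i)) <= B / q ^+ L.
Proof.
have [L hL] := pow_cong c0; exists (L + 2)%N => N x B B0 hx i w'.
case: (leqP N L) => [NL|/ltnW LN].
  apply: le_trans (kcoef_le i units_T (ltW B0) hx w') _.
  rewrite ler_pM2l // lef_pV2 ?posrE ?exprn_gt0 ?q_gt0 //; apply: q_anti.
  exact: leq_trans NL (leq_addr _ _).
have [w [_ <-]] := pt_cons T w'.
set P := (p ^ N)%N in i *; pose M := (N - L)%N.
have PE : P = (p ^ L * p ^ M)%N by rewrite -expnD subnKC.
have sumP (F : nat -> C) : \sum_(k < P) F k = \sum_(j < p ^ L) \sum_(l < p ^ M) F (j + p ^ L * l)%N.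
  by have := big_ord_mul (p ^ L) (p ^ M) F; rewrite -PE.
have P0 : (0 < P)%N by rewrite expn_gt0 p0.
have BN : 0 < B * q ^+ N by rewrite mulr_gt0 ?exprn_gt0 ?q_gt0.
have [m hm] := q_arch BN.
have /choice[Pi hPi] : forall i : nat, exists Q : {poly C}, gle (kcoef x i - tpoly Q : tate v) (q ^+ m).
  by move=> j; have [n hn] := ttruncP (kcoef x j : tate v) m; exists (ttrunc (kcoef x j : tate v) n); exact: hn.
(* The substitution t = (s^P - 1)/c makes x, up to the precision of the truncations, a polynomial in
   the root s alone, considered on |s^P - 1| <= |c|. *)
pose a : {poly C} := \sum_(j < P) (Pi j \Po (c^-1 *: ('X^P - 1%:P))) * 'X^j.
have aE s : a.[s] = \sum_(j < P) (Pi j).[c^-1 * (s ^+ P - 1)] * s ^+ j.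
  rewrite /a horner_sum; apply: eq_bigr => j _.
  by rewrite hornerM hornerXn horner_comp hornerZ hornerD hornerXn hornerN hornerC.
have near (w1 : pT) : v (pev w1 x - a.[prt w1 0 N]) <= q ^+ m.
  have sN : prt w1 0 N ^+ P = 1 + c * pz w1.
    by rewrite (psys_pow (r := prt w1 0)) ?prt0 //= ?tev_kumT ?expr1 ?pz_le1 // => k; exact: prtS.
  rewrite aE sN pev_sum -sumrB; apply: av_sum_le => [|j _]; first by rewrite exprn_ge0 ?q_ge0.
  rewrite -mulrBl avM avX (prt_unit w1 _ units_T) // expr1n mulr1 addrAC subrr add0r mulKf //.
  apply: tev_near; rewrite ?exprn_ge0 ?q_ge0 ?pz_le1 //; exact: hPi.
have mB : q ^+ m <= B.
  apply: le_trans (ltW hm) _; rewrite ler_piMr ?(ltW B0) // exprn_ile1 ?q_ge0 ?q_le1 //.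
have aB s : v (s ^+ P - 1) <= v c -> v a.[s] <= B.
  move=> hs; have z1 : v (c^-1 * (s ^+ P - 1)) <= 1.
    by rewrite avM avV mulrC ler_pdivrMr ?av_gt0 // mul1r.
  have [|w1 [w1z w1s]] := @pt_root N _ s z1; first by rewrite mulVKf // addrC subrK.
  rewrite -w1s; apply: (av_near (y := pev w1 x)) (hx w1).
  by rewrite avBC; apply: le_trans (near w1) mB.
set s := prt w 0 N; have s1 : v s = 1 by rewrite (prt_unit w _ units_T).
have sN : s ^+ P = 1 + c * pz w.
  by rewrite (psys_pow (r := prt w 0)) ?prt0 //= ?tev_kumT ?expr1 ?pz_le1 // => k; exact: prtS.
have PC : P%:R != 0 :> C := natC_neq0 K P0.
(* The P-th roots of unity split into p^L cosets of the p^M-th ones; [b j] is the function to be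
   averaged on the j-th coset, Fourier factor included. *)
pose b j : {poly C} := (a \Po ((s * zeta N ^+ j) *: 'X)) * 'X^(P - i).
have bE j u : (b j).[u] = a.[s * zeta N ^+ j * u] * u ^+ (P - i).
  by rewrite hornerM horner_comp hornerZ hornerX hornerXn.
have zP : zeta N ^+ P = 1 := prim_expr_order (cpz_prim K N).
have bB j u : v (u ^+ (p ^ M) - 1) <= q -> v (b j).[u] <= B.
  move=> hu; have uP : v (u ^+ P - 1) <= v c by rewrite PE mulnC exprM; exact: hL.
  have u1 : v u = 1.
    apply: (avX_root P0); rewrite -[RHS](av1 v); apply: av_eq_lt; rewrite av1.
    exact: le_lt_trans uP c1.
  rewrite bE avM avX u1 expr1n mulr1; apply: aB.
  rewrite exprMn exprMn -exprM [(j * P)%N]mulnC exprM zP expr1n mulr1 sN mulrDl mul1r addrAC.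
  apply: avDle uP _; rewrite avM avX u1 expr1n mulr1 avM ler_piMr ?av_ge0 ?pz_le1 //.
have zM l : zeta N ^+ (p ^ L * l) = zeta M ^+ l.
  rewrite exprM; congr (_ ^+ _); rewrite -(@psys_powD K zeta L M (cpz_compat K)).
  by rewrite subnKC.
have avg : v (P%:R^-1 * \sum_(k < P) zeta N ^+ ((P - i) * k) * a.[s * zeta N ^+ k]) <= B / q ^+ (L + 2).
  have -> : P%:R^-1 * \sum_(k < P) zeta N ^+ ((P - i) * k) * a.[s * zeta N ^+ k] =
     (p ^ L)%:R^-1 * \sum_(j < p ^ L) zeta N ^+ ((P - i) * j) *
        ((p ^ M)%:R^-1 * \sum_(l < p ^ M) (b j).[zeta M ^+ l]).
    under [in RHS]eq_bigr do rewrite mulrCA.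
    rewrite -mulr_sumr mulrA -invfM -natrM -PE; congr (_ * _).
    rewrite (sumP (fun k => zeta N ^+ ((P - i) * k) * a.[s * zeta N ^+ k])); apply: eq_bigr => j _; rewrite mulr_sumr; apply: eq_bigr => l _.
    rewrite bE -[zeta M ^+ l]zM -mulrA -exprD mulnDr exprD -exprM [(p ^ L * l * _)%N]mulnC.
    by rewrite -[LHS]mulrA; congr (_ * _); exact: mulrC.
  rewrite avM avV natrX avX exprD invfM [leRHS]mulrCA; apply: ler_wpM2l.
    by rewrite invr_ge0 exprn_ge0 ?q_ge0.
  apply: av_sum_le => [|j _]; first by rewrite mulr_ge0 ?invr_ge0 ?exprn_ge0 ?q_ge0 // ltW.
  rewrite avM avX av_zeta expr1n mul1r; apply: avg_le; first exact: ltW.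
  exact: bB.
have cE := coef_fourier w x i.
have -> : v (pev (ptl w) (kcoef x i)) = v (pev (ptl w) (kcoef x i) * s ^+ i).
  by rewrite avM avX s1 expr1n mulr1.
have -> : pev (ptl w) (kcoef x i) * s ^+ i = P%:R^-1 * \sum_(k < P) zeta N ^+ ((P - i) * k) * pev (zrot 0 k w) x.
  by rewrite -cE mulKf.
apply: (av_near (y := P%:R^-1 * \sum_(k < P) zeta N ^+ ((P - i) * k) * a.[s * zeta N ^+ k])) avg.
rewrite -mulrBr -sumrB avM avV natrX avX.
apply: le_trans (_ : (q ^+ N)^-1 * q ^+ m <= _).
  apply: ler_wpM2l; first by rewrite invr_ge0 exprn_ge0 ?q_ge0.
  apply: av_sum_le => [|k _]; first by rewrite exprn_ge0 ?q_ge0.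
  rewrite -mulrBr avM avX av_zeta expr1n mul1r.
  by have := near (zrot 0 k w); rewrite /= [zeta N ^+ k * _]mulrC.
apply: le_trans (_ : B <= _).
  by rewrite mulrC ler_pdivrMr ?exprn_gt0 ?q_gt0 // ltW.
by rewrite ler_peMr ?(ltW B0) // qN_ge1.
Qed.
End Traces.

(** * Locally analytic functions on the toric tower *)

Section LocAn.
Variable K : cpdata.
Local Notation R := (cpR K).
Local Notation p := (cpp K).
Local Notation p_pr := (cpp_pr K).
Local Notation C := (cpC K).
Local Notation v := (cpv K).
Local Notation q := (v p%:R).
Local Notation zeta := (cpz K).
Local Notation p0 := (p_gt0 K).
Local Notation A := (tate v).

Lemma tate_complete (g : nat -> A) (B : R) : 0 <= B ->
  (forall m, gle (g m.+1 - g m) (B * q ^+ m)) -> exists G : A, forall m, gle (G - g m) (B * q ^+ m).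
Proof.
move=> B0 hg; have pos m : 0 <= B * q ^+ m by rewrite mulr_ge0 ?exprn_ge0 ?q_ge0.
have [k hk] := q_big B.
have cau n : cauchyC (fun m => g m n).
  move=> m; exists (m + k)%N => j mj; apply: le_trans (hg j n) _.
  apply: le_trans (_ : (q ^+ k)^-1 * q ^+ (m + k) <= _).
    by apply: ler_pM; rewrite ?exprn_ge0 ?q_ge0 //; last exact: q_anti.
  by rewrite exprD mulrC mulfK // gt_eqF ?exprn_gt0 ?q_gt0.
have near n m : v (limC (fun m => g m n) - g m n) <= B * q ^+ m.
  apply: (cvg_near (pos m) (limP (@cau n))); exists m => j mj.
  apply: (@step_le _ (fun m => g m n) _ m) => // i mi; apply: le_trans (hg i n) _.
  by apply: ler_wpM2l => //; exact: q_anti.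
have t0 : tends0 v (fun n => limC (fun m => g m n)).
  move=> e e0; have e2 : 0 < e / (B + 1) by rewrite divr_gt0 // ltr_wpDl.
  have [m hm] := q_arch e2; have [N hN] := tcoefP (g m) e0; exists N => n /hN h.
  rewrite -(subrK (g m n) (limC _)); apply: le_lt_trans (avD _ _ _) _.
  rewrite gt_max h andbT; apply: le_lt_trans (near n m) _.
  case: (eqVneq B 0) => [->|Bn]; first by rewrite mul0r.
  have B1 : 0 < B by rewrite lt_neqAle eq_sym Bn.
  apply: lt_trans (_ : B * (e / (B + 1)) < _); first by rewrite ltr_pM2l.
  by rewrite mulrCA gtr_pMr // ltr_pdivrMr ?mul1r ?ltrDl ?ltr_wpDl.
by exists (Tate t0) => m n /=; exact: near.
Qed.

Variable c : C.
Hypotheses (c0 : c != 0) (c1 : v c < 1).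
Local Notation T := (kumT c 1).
Local Notation pT := (pt [:: T]).
Local Notation lv := (kummer p_pr [:: T]).

Definition kmk N (F : nat -> A) : lv N := in_qpoly (kumpol p (kummer p_pr [::]) T N) (\poly_(i < p ^ N) (F i : kummer p_pr [::] N)).

Lemma kcoef_mk N F i : (i < p ^ N)%N -> kcoef (kmk N F) i = F i.
Proof.
move=> iN; rewrite /kcoef /kmk in_qpoly_small ?coef_poly ?iN //.
rewrite (mk_monicE (kumpol_size p_pr _ _ _) (kumpol_monic p_pr _ _ _)).
rewrite size_XnsubC ?expn_gt0 ?p0 // ltnS; exact: size_poly.
Qed.

Lemma kcoefB N (x y : lv N) i : kcoef (x - y) i = kcoef x i - kcoef y i.
Proof. by rewrite /kcoef -coefB. Qed.

Lemma pev_mk N F (w : pT) : pev w (kmk N F) = \sum_(i < p ^ N) tev (pz w) (F i) * prt w 0 N ^+ i.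
Proof. by rewrite pev_sum; apply: eq_bigr => i _; rewrite kcoef_mk. Qed.

Let qn n : 0 < q ^+ n. Proof. by rewrite exprn_gt0 ?q_gt0. Qed.

(** At a fixed level the loss in [kcoef_le] is the constant |p|^N, so that uniform convergence gives
    convergence of the coefficients. *)
Lemma level_closed N (f : pT -> C) :
  (forall m, exists d : lv N, forall w, v (f w - pev w d) <= q ^+ m) -> exists d : lv N, forall w, f w = pev w d.
Proof.
move=> /choice[d hd]; have pN : (0 < p ^ N)%N by rewrite expn_gt0 p0.
have B0 : 0 <= (q ^+ N)^-1 by rewrite invr_ge0 ltW.
have /choice[G hG] : forall i : nat, exists G : A, (i < p ^ N)%N -> forall m, gle (G - kcoef (d m) i) ((q ^+ N)^-1 * q ^+ m).
  move=> i; case: (ltnP i (p ^ N)) => iN; last by exists 0.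
  have [|G hG] := @tate_complete (fun m => kcoef (d m) i) _ B0.
    move=> m; apply: tate_max => [|z z1]; first by rewrite mulr_ge0 // ltW.
    have [w wz] := pt_ex [::] z1; rewrite -wz mulrC.
    have := @kcoef_le K T [::] N (d m.+1 - d m) (Ordinal iN) (q ^+ m) (units_T c1) (ltW (qn m)).
    move=> /(_ _ w); rewrite /= kcoefB; apply=> w1; rewrite rmorphB /=.
    apply: avBtrans (_ : v (_ - f w1) <= _) _; last exact: hd.
    by rewrite avBC; apply: le_trans (hd _ _) _; exact: q_anti.
  by exists G.
exists (kmk N G) => w; apply/eqP; rewrite -subr_eq0; apply/eqP/(@av_eq0_q K) => m.
apply: avBtrans (_ : v (_ - pev w (d (m + N)%N)) <= _) _.
  by apply: le_trans (hd _ _) _; apply: q_anti; exact: leq_addr.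
rewrite pev_mk pev_sum -sumrB; apply: av_sum_le => [|i _]; first exact: ltW.
rewrite -mulrBl avM avX (prt_unit w _ (units_T c1)) // expr1n mulr1 avBC.
have := hG i (ltn_ord i) (m + N)%N; rewrite exprD mulrCA mulVf ?gt_eqF // mulr1 => h.
rewrite -[pev (ptl w) _]/(tev (pz w) (kcoef (d (m + N)%N) i)).
have mz := tev_zmod (pz_le1 w).
by rewrite -(mz _ _); apply: tev_le; rewrite ?pz_le1 // ltW.
Qed.

Variable k : nat.
Definition kgam (w : pT) := zrot 0 (p ^ k) w.
Definition kdiff (g : pT -> C) (w : pT) : C := g (kgam w) - g w.

(** Each difference lowers the degree by one, and differences do not enlarge ultrametric errors. *)
Lemma kdiff_poly w h : forall (g : pT -> C) (P : {poly C}) (e : R),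
  (forall i : nat, v (g (iter i kgam w) - P.[i%:R]) <= e) -> (size P <= h)%N ->
  forall i, v (iter h kdiff g (iter i kgam w)) <= e.
Proof.
elim: h => [|h IH] g P e hP sP i.
  by move: sP (hP i); rewrite leqn0 size_poly_eq0 => /eqP ->; rewrite horner0 subr0.
rewrite iterSr; apply: (IH _ (P \Po ('X + 1%:P) - P)) => [j|].
  rewrite /kdiff -iterS hornerD hornerN horner_comp hornerD hornerX hornerC natr1.
  have -> : g (iter j.+1 kgam w) - g (iter j kgam w) - (P.[j.+1%:R] - P.[j%:R]) =
    (g (iter j.+1 kgam w) - P.[j.+1%:R]) - (g (iter j kgam w) - P.[j%:R]) by ring.
  exact: avBle.
case: (posnP (size P)) => [/eqP|sP0]; first by rewrite size_poly_eq0 => /eqP ->; rewrite comp_poly0 subr0 size_poly0.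
apply/leq_sizeP => j hj; rewrite coefB.
have s2 := @size_comp_poly2 _ P ('X + 1%:P) (size_XaddC _).
have l2 : lead_coef (P \Po ('X + 1%:P)) = lead_coef P.
  by rewrite lead_coef_comp ?size_XaddC // lead_coefXaddC expr1n mulr1.
case: (ltngtP j (size P).-1) => [jP|jP|->].
- by exfalso; move: jP hj sP; move: (size P) => n; clear; lia.
- by rewrite !nth_default ?subr0 // ?s2 -(prednK sP0).
- by move: l2; rewrite /lead_coef s2 => ->; rewrite subrr.
Qed.

Lemma kdiff_le w e h : forall g g' : pT -> C, (forall w, v (g w - g' w) <= e) ->
  v (iter h kdiff g w - iter h kdiff g' w) <= e.
Proof.
elim: h w => [|h IH] w g g' hg; first exact: hg.
have -> : iter h.+1 kdiff g w - iter h.+1 kdiff g' w =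
  (iter h kdiff g (kgam w) - iter h kdiff g' (kgam w)) - (iter h kdiff g w - iter h kdiff g' w).
  by rewrite /= /kdiff; ring.
by apply: avBle; apply: IH.
Qed.

Let eta N i : C := zeta N ^+ (p ^ k * i) - 1.

Lemma kdiff_lev N (x : lv N) h w : iter h kdiff (fun w => pev w x) w =
  pev w (kmk N (fun i => tconst v (eta N i ^+ h) * kcoef x i)).
Proof.
elim: h w => [|h IH] w; rewrite pev_mk.
  rewrite [LHS]pev_sum; apply: eq_bigr => i _.
  by rewrite tevM ?pz_le1 // tev_const ?pz_le1 // expr0 mul1r.
rewrite /= /kdiff !IH !pev_mk -sumrB; apply: eq_bigr => i _ /=.
rewrite !tevM ?pz_le1 // !tev_const ?pz_le1 // exprMn -exprM exprSr /eta; ring.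
Qed.

(* The h-th difference multiplies the i-th coefficient by eta^h, where |eta| >= |p|
   unless the i-th term is of level k, and it kills polynomials of degree < h. *)
Lemma la_level (f : pT -> C) (B : R) : cl (@lev K [:: T]) f -> 0 < B ->
  (forall w h, (2 <= h)%N -> exists2 P : {poly C}, (size P <= h)%N &
     forall i : nat, v (f (iter i kgam w) - P.[i%:R]) <= q ^+ (2 * h) * B) ->
  exists x : lv k, forall w, f w = pev w x.
Proof.
move=> cf B0 hf; have [L hL] := kcoef_bound c0 c1.
apply: level_closed => m.
have [h h2 hB] : exists2 h, (2 <= h)%N & q ^+ h * B / q ^+ L <= q ^+ m.
  have e0 : 0 < q ^+ m * q ^+ L / B by rewrite divr_gt0 // mulr_gt0.
  have [h0 hh0] := q_arch e0; exists (h0 + 2)%N; first exact: leq_addl.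
  rewrite ler_pdivrMr // -ler_pdivlMr //; apply: le_trans (ltW hh0).
  by apply: q_anti; exact: leq_addr.
have qB : 0 < q ^+ (2 * h) * B by rewrite mulr_gt0.
have [m1 hm1] := q_arch qB; pose m' := (m1 + m)%N.
have hm' : q ^+ m' <= q ^+ (2 * h) * B.
  by apply: le_trans (ltW hm1); apply: q_anti; exact: leq_addr.
have [g [N0 [x0 gE]] fg] := cf m'.
pose N := maxn k N0; have [x xE] := lift_level x0 (leq_maxr k N0).
have fx w : v (f w - pev w x) <= q ^+ m' by rewrite xE -gE; exact: fg.
have kN : (k <= N)%N := leq_maxl k N0.
have dB w : v (pev w (kmk N (fun i => tconst v (eta N i ^+ h) * kcoef x i))) <= q ^+ (2 * h) * B.
  rewrite -kdiff_lev; apply: (av_near (y := iter h kdiff f w)).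
    by rewrite avBC; apply: le_trans hm'; exact: kdiff_le.
  have [P sP hP] := hf w h h2; exact: (kdiff_poly hP sP 0).
(* The i-th power of the p^N-th root is a power of the p^k-th root when [a] divides i. *)
pose a := (p ^ (N - k))%N; pose b := (p ^ k)%N.
have ab : (p ^ N = a * b)%N by rewrite -expnD subnK.
have a0 : (0 < a)%N by rewrite expn_gt0 p0.
have b0 : (0 < b)%N by rewrite expn_gt0 p0.
have cB (i : nat) (w : pt [::]) : (i < p ^ N)%N -> ~~ (a %| i)%N -> v (tev (pz w) (kcoef x i)) <= q ^+ m.
  move=> iN ai; have := hL N _ _ qB dB (Ordinal iN) w; rewrite /= kcoef_mk //.
  rewrite -[pev w _]/(tev (pz w) _) tevM ?pz_le1 // tev_const ?pz_le1 // avM avX => hx.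
  have et : q <= v (eta N i).
    apply: av_zeta_root; apply: contra ai; rewrite -(prim_order_dvd (cpz_prim K N)).
    by rewrite ab mulnC dvdn_pmul2l.
  apply: le_trans hB; rewrite -(ler_pM2l (qn h)).
  apply: le_trans (_ : v (eta N i) ^+ h * v (tev (pz w) (kcoef x i)) <= _).
    by apply: ler_wpM2r; rewrite ?av_ge0 //; apply: lerXn2r; rewrite ?nnegrE ?av_ge0 ?q_ge0.
  by apply: le_trans hx _; rewrite !mulrA -exprD addnn -mul2n.
exists (kmk k (fun j => kcoef x (a * j)%N)) => w.
apply: avBtrans (_ : v (_ - pev w x) <= _) _.
  by apply: le_trans (fx w) _; apply: q_anti; exact: leq_addl.
have sumE : pev w x = \sum_(j < a) \sum_(l < b) tev (pz w) (kcoef x (j + a * l)%N) * prt w 0 N ^+ (j + a * l).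
  rewrite pev_sum; have := big_ord_mul a b (fun i => tev (pz w) (kcoef x i) * prt w 0 N ^+ i).
  by rewrite -ab.
rewrite sumE pev_mk (bigD1 (Ordinal a0)) //= addrAC -sumrB.
have sa : prt w 0 N ^+ a = prt w 0 k.
  rewrite -{1}(subnK kN); apply: (psys_powD (r := prt w 0)) => n; exact: prtS.
rewrite big1 ?add0r => [|l _]; last by rewrite add0n exprM sa subrr.
apply: av_sum_le => [|j j0]; first exact: ltW.
apply: av_sum_le => [|l _]; first exact: ltW.
rewrite avM avX (prt_unit w _ (units_T c1)) // expr1n mulr1.
apply: (cB _ (ptl w)).
  have := ltn_ord j; have := ltn_ord l; rewrite ab; move: (nat_of_ord l) (nat_of_ord j) => l' j' hl hj.
  apply: leq_trans (_ : a + a * l' <= _)%N; first by rewrite ltn_add2r.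
  by rewrite -mulnS leq_mul2l hl orbT.
rewrite dvdn_addl ?dvdn_mulr //; apply: contra j0 => /dvdn_leq h0; apply/eqP/val_inj => /=.
by case: (posnP j) => // /h0; rewrite leqNgt ltn_ord.
Qed.
End LocAn.

(** * The invariants of G are the toric functions *)

Section Invariants.
Variable K : cpdata.
Local Notation R := (cpR K).
Local Notation p := (cpp K).
Local Notation p_pr := (cpp_pr K).
Local Notation C := (cpC K).
Local Notation v := (cpv K).
Local Notation q := (v p%:R).
Local Notation zeta := (cpz K).
Local Notation p0 := (p_gt0 K).
Local Notation A := (tate v).
Variables w0 c : C.
Hypotheses (w01 : v w0 < 1) (c0 : c != 0) (c1 : v c < 1).
Local Notation T1 := (kumT w0 2).
Local Notation T2 := (kumT w0 3).
Local Notation T := (kumT c 1).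
Local Notation s := [:: T1; T2; T].
Local Notation Om := (pt s).

Lemma units_s : units s.
Proof.
apply: (@units_kumT K w0 w01 2 _ [:: T2; T]) => //; apply: (@units_kumT K w0 w01 3 _ [:: T]) => //.
exact: (@units_kumT K c c1 1 [::] [::]).
Qed.

Let d0 : C := if v c <= q then p%:R else c.
Let d0q : q <= v d0. Proof. by rewrite /d0; case: (leP (v c) q) => // /ltW. Qed.
Let d01 : v d0 < 1. Proof. by rewrite /d0; case: ifP => _ //; exact: q_lt1. Qed.
Let cd0 : v c <= v d0. Proof. by rewrite /d0; case: ifP. Qed.
Let X (j : unit) n (w : Om) := prt w 2 n.
Let XS j n w : X j n.+1 w ^+ p = X j n w. Proof. exact: prtS. Qed.
Lemma prt20 (w : Om) : prt w 2 0 = 1 + c * pz w.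
Proof. by rewrite prt0 //= tev_kumT ?pz_le1 // expr1. Qed.
Let X0 j w : v (X j 0%N w - 1) <= v d0.
Proof.
rewrite /X prt20 addrAC subrr add0r avM; apply: le_trans cd0.
by rewrite ler_piMr ?av_ge0 ?pz_le1.
Qed.

(** The completed toric tower, as functions on the points of the product of the two towers; it
    contains t = (T - 1)/c, hence all Tate series. *)
Definition toric := cl (rootalg X d0).

Let hr : calg (rootalg X d0) . Proof. exact: rootalg_calg. Qed.
Let br f : rootalg X d0 f -> bounded f. Proof. exact: (rootalg_bounded XS d0q d01 X0). Qed.

Lemma toric_calg : calg toric. Proof. exact: cl_calg hr br. Qed.
Lemma toric_bounded f : toric f -> bounded f. Proof. exact: (cl_bounded br). Qed.
Lemma toric_closed f : cl toric f -> toric f. Proof. exact: cl_cl. Qed.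
Lemma toric_frob : frob toric.
Proof. apply: (frob_cl hr); exact: rootalg_frob. Qed.
Lemma toric_root n : toric (fun w => prt w 2 n).
Proof. by apply: cl_sub; exact: (rootalg_root XS d0q d01 tt n). Qed.
Lemma toric_pz : toric (fun w => pz w).
Proof.
have := cg_Z c^-1 toric_calg (og_B (calg_oalg toric_calg) (toric_root 0) (cg_c toric_calg 1)).
by congr toric; apply/funext => w; rewrite prt20 addrAC subrr add0r mulKf.
Qed.
Lemma toric_tev a : toric (fun w => tev (pz w) a).
Proof. exact: (tev_in toric_calg toric_closed toric_pz). Qed.

Lemma toric_min D f : calg D -> (forall n, D (fun w => prt w 2 n)) -> toric f -> cl D f.
Proof. by move=> hD hX; apply: cl_mono => g; apply: rootalg_min. Qed.

Lemma toric_cl_lev f : toric f -> cl (lev (s:=s)) f.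
Proof. by apply: toric_min; [exact: lev_calg|move=> n; exact: lev_root]. Qed.

Lemma toric_ext f w w' : pz w = pz w' -> (forall n, prt w 2 n = prt w' 2 n) -> toric f -> f w = f w'.
Proof.
move=> ez er /(toric_min (D := fun f => f w = f w')) h.
apply/eqP; rewrite -subr_eq0; apply/eqP/(@av_eq0_q K) => m.
have [||g e hg] := h _ _ m; first by split=> // g g' /= -> ->.
  by move=> n /=.
by apply: avBtrans (hg w) _; rewrite e avBC.
Qed.

Lemma toric_rot f j k w : toric f -> (j < 2)%N -> f (zrot j k w) = f w.
Proof.
move=> tf j2; apply: (toric_ext _ _ tf) => // n /=.
by rewrite ifN ?mul1r // eq_sym ltn_eqF.
Qed.

(** A set-theoretic section of the projection from points of the product to points of the toric
    tower, by choosing roots of T1 and T2. *)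
Lemma toric_sec : exists sec : pt [:: T] -> Om, forall u n (x : kummer p_pr [:: T] n),
  pev (ptl (ptl (sec u))) x = pev u x.
Proof.
have /choice[sec h] : forall u : pt [:: T], exists w : Om, forall n (x : kummer p_pr [:: T] n), pev (ptl (ptl w)) x = pev u x.
  move=> u; have [u1 [_ h1]] := pt_cons T2 u; have [u2 [_ h2]] := pt_cons T1 u1.
  by exists u2 => n x; rewrite -h1 -(pev_C u1) -h2 pev_C.
by exists sec.
Qed.

Lemma sec_coord (u : pt [:: T]) (w : Om) : (forall n (x : kummer p_pr [:: T] n), pev (ptl (ptl w)) x = pev u x) ->
  pz w = pz u /\ forall n, prt w 2 n = prt u 0 n.
Proof.
move=> h; split=> [|n].
  have := h 0%N (str (kummer p_pr [:: T]) 0 (tvar v)); rewrite !pev_str /= !tev_var //; exact: pz_le1.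
by have := h n (kumX p (kummer p_pr [::]) T n); rewrite !pev_X.
Qed.

Lemma toric_desc f : toric f -> exists2 F, cl (@lev K [:: T]) F & forall w, f w = F (ptl (ptl w)).
Proof.
move=> tf; have [sec hs] := toric_sec.
have ez u := (sec_coord (hs u)).1; have er u := (sec_coord (hs u)).2.
exists (f \o sec) => [|w]; last by apply: (toric_ext _ _ tf); rewrite ?ez // => n; rewrite er.
move=> m; have := toric_min (D := fun f => exists2 F, @lev K [:: T] F & forall u, f (sec u) = F u) _ _ tf m.
have us : units [:: T] by exact: (@units_kumT K c c1 1 [::] [::]).
have hl := @lev_calg K [:: T].
case; last by move=> g [F lF e] fg; exists F => // u /=; rewrite -e.
  split=> [a|g g' [F lF e] [F' lF' e']|g g' [F lF e] [F' lF' e']].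
  - by exists (fun=> a) => //; exact: (cg_c hl).
  - by exists (fun u => F u + F' u) => [|u]; [exact: (cg_D hl)|rewrite e e'].
  - by exists (fun u => F u * F' u) => [|u]; [exact: (cg_M hl)|rewrite e e'].
by move=> n; exists (fun u => prt u 0 n) => //; exact: lev_root.
Qed.

Lemma toric_inv k j : (0 < k)%N -> (j < 2)%N -> nth 0 s j = kumT w0 k -> toric (fun w => (prt w j 0)^-1).
Proof.
move=> k0 j2 sj; have [b hb] := kumT_inv w01 k0.
have := toric_tev b; congr toric; apply/funext => w; have z1 := pz_le1 w.
have e : prt w j 0 * tev (pz w) b = 1.
  by rewrite prt0 ?(leq_trans j2) // sj -tevM // hb tev_const.
have x0 : prt w j 0 != 0 by apply/eqP => h; move: e; rewrite h mul0r => /eqP; rewrite eq_sym oner_eq0.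
by apply: (mulfI x0); rewrite e mulfV.
Qed.

Let y1 n (w : Om) := prt w 1 n.
Let y0 n (w : Om) := prt w 0 n.
Let y1S n w : y1 n.+1 w ^+ p = y1 n w. Proof. exact: prtS. Qed.
Let y0S n w : y0 n.+1 w ^+ p = y0 n w. Proof. exact: prtS. Qed.
Let y1u n w : v (y1 n w) = 1. Proof. by rewrite (prt_unit w _ units_s). Qed.
Let y0u n w : v (y0 n w) = 1. Proof. by rewrite (prt_unit w _ units_s). Qed.
Let y1D : toric (y1 0%N).
Proof. by have := toric_tev T2; congr toric; apply/funext => w; rewrite /y1 prt0. Qed.
Let y0D : toric (y0 0%N).
Proof. by have := toric_tev T1; congr toric; apply/funext => w; rewrite /y0 prt0. Qed.
Let y1i : toric (fun w => (y1 0%N w)^-1). Proof. exact: (@toric_inv 3 1). Qed.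
Let y0i : toric (fun w => (y0 0%N w)^-1). Proof. exact: (@toric_inv 2 0). Qed.
Let y1r n w : y1 n (zrot 1 1 w) = zeta n * y1 n w. Proof. by rewrite /y1 /= expr1. Qed.
Let y0r n w : y0 n (zrot 0 1 w) = zeta n * y0 n w. Proof. by rewrite /y0 /= expr1. Qed.
Let D0 := toric_calg.
Let F0 := toric_frob.
Let I0 f : toric f -> forall w, f (zrot 1 1 w) = f w. Proof. by move=> h w; apply: toric_rot. Qed.

Let D1 := ktower toric y1.
Let hD1 : calg D1. Proof. exact: (ktower_calg D0 toric_bounded y1S y1u y1D). Qed.
Let bD1 f : D1 f -> bounded f. Proof. exact: (ktower_bounded toric_bounded y1u). Qed.
Let cD1 f : cl D1 f -> D1 f. Proof. exact: ktower_closed. Qed.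
Let fD1 : frob D1. Proof. exact: (ktower_frob D0 F0 y1S y1u y1D y1i y1r I0). Qed.
Let sub1 f : toric f -> D1 f. Proof. exact: ktower_sub. Qed.
Let I1 f : D1 f -> forall w, f (zrot 0 1 w) = f w.
Proof.
move=> h w; apply/eqP; rewrite -subr_eq0; apply/eqP/(@av_eq0_q K) => m.
have [g [n [F [hF gE]]] fg] := h m; apply: avBtrans (fg _) _.
rewrite avBC; have -> : g (zrot 0 1 w) = g w; last exact: fg.
rewrite !gE; apply: eq_bigr => i _; rewrite (toric_rot 1 w (hF i)) //.
by congr (_ * _ ^+ _); rewrite /y1 /= mul1r.
Qed.
Let D2 := ktower D1 y0.
Let hD2 : calg D2. Proof. exact: (ktower_calg hD1 bD1 y0S y0u (sub1 y0D)). Qed.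
Let sub2 f : D1 f -> D2 f. Proof. exact: ktower_sub. Qed.

(** The product of the towers is obtained from the toric one by adjoining the roots of T2 and then
    those of T1; [ktower_fix] removes them in the opposite order. *)
Lemma lev_fixed f : cl (lev (s:=s)) f -> (forall w, f (zrot 0 1 w) = f w) -> (forall w, f (zrot 1 1 w) = f w) ->
  toric f.
Proof.
move=> cf f0 f1.
have Df : D2 f.
  apply: (ktower_closed (D := D1) (y := y0)); apply: cl_mono cf => g [n [x gE]].
  have hO := calg_oalg hD2.
  have -> : g = fun w => \sum_(i < p ^ n) \sum_(j < p ^ n) \sum_(k < p ^ n)
      tev (pz w) (kcoef (kcoef (kcoef x i) j) k) * prt w 2 n ^+ k * prt w 1 n ^+ j * prt w 0 n ^+ i.
    apply/funext => w; rewrite gE pev_sum; apply: eq_bigr => i _.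
    rewrite pev_sum mulr_suml; apply: eq_bigr => j _.
    by rewrite pev_sum !mulr_suml; apply: eq_bigr => k _.
  apply: (og_sum _ hO) => i _; apply: (og_sum _ hO) => j _; apply: (og_sum _ hO) => k _.
  apply: (og_M hO); last by apply: (og_X _ hO); exact: (ktower_gen hD1 y0S (sub1 y0D)).
  apply: (og_M hO); last by apply: (og_X _ hO); apply: sub2; exact: (ktower_gen D0 y1S y1D).
  by apply: sub2; apply: sub1; apply: (cg_M D0); [exact: toric_tev|apply: (og_X _ (calg_oalg D0)); exact: toric_root].
have Df1 : D1 f.
  by apply: (ktower_fix hD1 fD1 cD1 y0S y0u (sub1 y0D) (sub1 y0i) y0r I1 Df).
exact: (ktower_fix D0 F0 toric_closed y1S y1u y1D y1i y1r I0 Df1).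
Qed.
End Invariants.

(** * The geometric Sen map *)

Section Continuity.
Variable K : cpdata.
Local Notation R := (cpR K).
Local Notation p := (cpp K).
Local Notation p_pr := (cpp_pr K).
Local Notation C := (cpC K).
Local Notation v := (cpv K).
Local Notation q := (v p%:R).
Local Notation zeta := (cpz K).
Local Notation A := (tate v).

Lemma pev_ext (s : seq A) n (x : kummer p_pr s n) (w w' : pt s) : pz w = pz w' ->
  (forall i, (i < size s)%N -> prt w i n = prt w' i n) -> pev w x = pev w' x.
Proof.
elim: s x w w' => [|a s IH] x w w' ez er; first by rewrite /pev /= ez.
rewrite !pev_sum; apply: eq_bigr => i _; rewrite (er 0%N) //; congr (_ * _).
by apply: IH => // j js; exact: (er j.+1).
Qed.

Lemma cl_lev_ext (s : seq A) f (w w' : pt s) : cl (lev (s:=s)) f -> pz w = pz w' ->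
  (forall i n, (i < size s)%N -> prt w i n = prt w' i n) -> f w = f w'.
Proof.
move=> cf ez er; apply/eqP; rewrite -subr_eq0; apply/eqP/(@av_eq0_q K) => m.
have [g [n [x gE]] fg] := cf m; apply: avBtrans (fg w) _.
have -> : g w = g w' by rewrite !gE; apply: pev_ext => // i si; exact: er.
by rewrite avBC.
Qed.

Lemma gact_cont (s : seq A) f : cl (lev (s:=s)) f -> forall m, exists N, forall g g', zvec g -> zvec g' ->
  (forall i, v (g`_i - g'`_i) <= q ^+ N) -> forall w, v (f (gact g w) - f (gact g' w)) <= q ^+ m.
Proof.
move=> cf m; have [h [n [x hE]] fh] := cf m; exists n => g g' zg zg' gg w.
apply: avBtrans (fh _) _; have -> : h (gact g w) = h (gact g' w); last by rewrite avBC.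
rewrite !hE; apply: pev_ext => // i si; rewrite !gact_r //; congr (_ * _).
apply: zeta_cong.
apply: (avBtrans (y := g`_i)); first by rewrite avBC; apply: zresP.
by apply: avBtrans (gg i) _; apply: zresP.
Qed.
End Continuity.

Section SenPrimitive.
Variable K : cpdata.
Local Notation R := (cpR K).
Local Notation p := (cpp K).
Local Notation p_pr := (cpp_pr K).
Local Notation C := (cpC K).
Local Notation v := (cpv K).
Local Notation q := (v p%:R).
Local Notation zeta := (cpz K).
Variables w0 c : C.
Hypotheses (w01 : v w0 < 1) (c0 : c != 0) (c1 : v c < 1).
Local Notation s := [:: kumT w0 2; kumT w0 3; kumT c 1].
Local Notation Om := (pt s).
Variable l : nat.
Hypothesis l2 : (l < 2)%N.

(** The index l is 0 or 1 here, so that k = 2 + l. *)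
Definition sen_prim (w : Om) : C :=
  primitive (fun n w => prt w l n) (fun n w => prt w 2 n) w0 c (2 + l) w.
Definition sen_b (w : Om) : C :=
  w0 * prt w 2 0 * (2 + l)%:R * (c * pz w) ^+ (1 + l) / (c ^+ (2 + l) * prt w l 0).

Let us : units s := units_s w01 c1.
Let l3 : (l < 3)%N := ltnW l2.
Let sl : s`_l = kumT w0 (2 + l). Proof. by case: l l2 => [|[|]]. Qed.
Let xS n (w : Om) : prt w l n.+1 ^+ p = prt w l n. Proof. exact: prtS. Qed.
Let sS n (w : Om) : prt w 2 n.+1 ^+ p = prt w 2 n. Proof. exact: prtS. Qed.
Let x1 n (w : Om) : v (prt w l n) = 1. Proof. by rewrite (prt_unit w _ us). Qed.
Let s1 n (w : Om) : v (prt w 2 n) = 1. Proof. by rewrite (prt_unit w _ us). Qed.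
Let x0E (w : Om) : prt w l 0 = 1 + w0 * pz w ^+ (2 + l).
Proof. by rewrite prt0 // sl tev_kumT ?pz_le1. Qed.
Let s0E (w : Om) : prt w 2 0 = 1 + c * pz w := prt20 w.
Let Dx n : cl (lev (s:=s)) (fun w => prt w l n). Proof. by apply: cl_sub; exact: lev_root. Qed.
Let Ds n : cl (lev (s:=s)) (fun w => prt w 2 n). Proof. by apply: cl_sub; exact: lev_root. Qed.
Let hC := cl_lev_calg us.
Let Dti : toric (fun w : Om => (prt w l 0)^-1).
Proof. by apply: (@toric_inv K w0 c w01 c0 c1 (2 + l) l). Qed.

Lemma sen_b_toric : toric sen_b.
Proof.
have hT := @toric_calg K w0 c c1; have hO := calg_oalg hT.
have := cg_Z (w0 * (2 + l)%:R / c ^+ (2 + l)) hT (cg_M hT (cg_M hT (toric_root w0 c1 0)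
  (og_X (1 + l) hO (cg_Z c hT (toric_pz w0 c0 c1)))) Dti).
congr toric; apply/funext => w; rewrite /sen_b.
have h1 : c ^+ (2 + l) != 0 by exact: expf_neq0.
have h2 : prt w l 0 != 0 by rewrite -(av_gt0 v) x1.
by move: (c ^+ (2 + l)) h1 => e h1; field; rewrite h1 h2.
Qed.

Lemma sen_prim_lev : cl (lev (s:=s)) sen_prim.
Proof.
apply: (primitive_in hC (cl_cl (S:=_)) xS sS Dx Ds x1 s1 (ltW w01) (ltW c1) c0 x0E s0E).
exact: toric_cl_lev Dti.
Qed.

Let fixed w w' : (forall n, prt w' l n = prt w l n) -> (forall n, prt w' 2 n = prt w 2 n) ->
  sen_prim w' = sen_prim w.
Proof. by move=> ex es; exact: primitive_fix. Qed.

Let rot_x a (w w' : Om) : (forall n, prt w' l n = zeta n ^+ a * prt w l n) ->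
  (forall n, prt w' 2 n = prt w 2 n) -> sen_prim w' = sen_prim w - a%:R.
Proof.
elim: a w' => [|a IH] w' ex es.
  by rewrite subr0; apply: fixed => // n; rewrite ex mul1r.
have e2 n : prt (zrot l a w) 2 n = prt w 2 n by rewrite /= ifN ?mul1r // eq_sym ltn_eqF.
have el n : prt (zrot l a w) l n = zeta n ^+ a * prt w l n by rewrite /= eqxx.
have -> : sen_prim w' = sen_prim (zrot l a w) - 1.
  apply: (primitive_rot_x xS sS x1 s1 (ltW w01) (ltW c1) c0 x0E s0E) => n.
    by rewrite ex el exprS mulrA.
  by rewrite es e2.
by rewrite (IH _ el e2) -addrA -opprD natr1.
Qed.

Let rot_s a (w w' : Om) : pz w' = pz w -> (forall n, prt w' l n = prt w l n) ->
  (forall n, prt w' 2 n = zeta n ^+ a * prt w 2 n) -> sen_prim w' = sen_prim w + a%:R * sen_b w.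
Proof.
elim: a w' => [|a IH] w' ez ex es.
  by rewrite mul0r addr0; apply: fixed => // n; rewrite es mul1r.
have el n : prt (zrot 2 a w) l n = prt w l n by rewrite /= ifN ?mul1r // ltn_eqF.
have e2 n : prt (zrot 2 a w) 2 n = zeta n ^+ a * prt w 2 n by [].
have -> : sen_prim w' = sen_prim (zrot 2 a w) + sen_b (zrot 2 a w).
  apply: (primitive_rot_s xS sS x1 s1 (ltW w01) (ltW c1) c0 x0E s0E) => n.
    by rewrite ex el.
  by rewrite es e2 exprS mulrA.
rewrite (IH (zrot 2 a w) erefl el e2) -addrA -[a.+1%:R]natr1 mulrDl mul1r; congr (_ + (_ + _)).
by rewrite /sen_b el e2 zeta0 expr1n mul1r.
Qed.

(** For natural numbers the formula iterates the two rotations. Entries in Z_p are reached by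
    continuity, where [kb] accounts for the size of [sen_b]. *)
Lemma sen_prim_gact g w : zvec g -> sen_prim (gact g w) = sen_prim w - g`_l + g`_2 * sen_b w.
Proof.
move=> zg; apply/eqP; rewrite -subr_eq0; apply/eqP/(@av_eq0_q K) => m.
have [N hN] := gact_cont sen_prim_lev m; have [kb hb] := toric_bounded c1 sen_b_toric.
pose N' := (N + (m + kb))%N; pose a i := if (i < size g)%N then zres v p N' g`_i else 0%N.
pose g' := [seq (zres v p N' x)%:R | x <- g] : seq C.
have g'E i : g'`_i = (a i)%:R.
  by rewrite /a; case: ltnP => h; [rewrite (nth_map 0)|rewrite nth_default ?size_map].
have zg' : zvec g' by move=> i; rewrite g'E; exact: natZp.
have gg i : v (g`_i - g'`_i) <= q ^+ N'.
  rewrite g'E /a; case: ltnP => h; first exact: zresP.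
  by rewrite nth_default // subrr av0 exprn_ge0 ?q_ge0.
have gg' i : v (g'`_i - g`_i) <= q ^+ m.
  by rewrite avBC; apply: le_trans (gg i) _; apply: q_anti; rewrite /N' addnCA leq_addr.
have e : sen_prim (gact g' w) = sen_prim w - g'`_l + g'`_2 * sen_b w.
  rewrite !g'E; pose u := zrot l (a l) w.
  have e2 n : prt u 2 n = prt w 2 n by rewrite /= ifN ?mul1r // eq_sym ltn_eqF.
  have el n : prt u l n = zeta n ^+ a l * prt w l n by rewrite /= eqxx.
  have bu : sen_b u = sen_b w by rewrite /sen_b e2 el zeta0 expr1n mul1r.
  rewrite -(rot_x el e2) -bu; apply: rot_s => // n; rewrite gact_r // g'E zpow_nat ?el // e2.
  by [].
apply: (avBtrans (y := sen_prim (gact g' w))).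
  by apply: hN => // i; apply: le_trans (gg i) _; apply: q_anti; exact: leq_addr.
rewrite e; have -> : sen_prim w - g'`_l + g'`_2 * sen_b w - (sen_prim w - g`_l + g`_2 * sen_b w) =
  (g'`_2 - g`_2) * sen_b w - (g'`_l - g`_l) by ring.
apply: avBle (gg' l); rewrite avM.
apply: le_trans (_ : q ^+ (m + kb) * (q ^+ kb)^-1 <= _).
  apply: ler_pM; rewrite ?av_ge0 //; rewrite avBC; apply: le_trans (gg 2%N) _.
  by apply: q_anti; exact: leq_addl.
by rewrite exprD mulfK // gt_eqF ?exprn_gt0 ?q_gt0.
Qed.

End SenPrimitive.

Section ActionEval.
Variable K : cpdata.
Local Notation R := (cpR K).
Local Notation p := (cpp K).
Local Notation p_pr := (cpp_pr K).
Local Notation C := (cpC K).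
Local Notation v := (cpv K).
Local Notation q := (v p%:R).
Local Notation zeta := (cpz K).
Local Notation A := (tate v).
Variable s : seq A.
Hypothesis us : units s.
Local Notation E := (compl p (@idfun A) (kummer p_pr s)).

Lemma cev_cact (g : seq C) (x : E) (w : pt s) : zvec g -> cev w (cact zeta g x) = cev (gact g w) x.
Proof.
move=> zg; have hc : cauchy p idfun (fun n => @kact R C v p p_pr zeta A idfun s g n (repr x n)).
  have [[k [N h1]] h2] := (cauchyP us (repr x)).1 (csP (repr x)); apply/(cauchyP us); split.
    by exists k, N => n Nn w1; rewrite pev_kact //; exact: h1.
  by move=> m; have [M hM] := h2 m; exists M => n Mn w1; rewrite !pev_kact //; exact: hM.
apply: (cvg_unique (cev_clim us w hc)).
rewrite -[in X in cvgC _ X](compl_piK x).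
by apply: (cvg_ext _ (cev_pi us (repr x) (gact g w))); exists 0%N => n _; rewrite pev_kact.
Qed.

Lemma pev_kbc (l : seq A) n (x : kummer p_pr l n) (w : pt l) (w' : pt (map idfun l)) :
  pz w' = pz w -> (forall i, (i < size l)%N -> prt w' i n = prt w i n) ->
  pev w' (kbc (p_pr := p_pr) idfun x : kummer p_pr (map idfun l) n) = pev w x.
Proof.
elim: l x w w' => [|a l IH] x w w' ez er; first by rewrite /pev /= ez.
rewrite [RHS]pev_sum /=.
have kbc0 : kbc (p_pr := p_pr) (s := l) (n := n) (@idfun A) 0 = 0.
  by case: (l) => [//|b l']; rewrite /= /qlift map_poly0 horner0.
have sz : (size (polyn (x : {poly %/ kumpol p (kummer p_pr l) a n})) <= p ^ n)%N.
  apply: leq_trans (size_qpoly (kumpol_size p_pr _ a n) (kumpol_monic p_pr _ a n) _) _.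
  by rewrite size_XnsubC // expn_gt0 p_gt0.
rewrite (qliftE _ sz); last by rewrite /= kbc0 raddf0.
rewrite rmorph_sum; apply: eq_bigr => i _.
rewrite rmorphM rmorphXn /= [pev w' (qpolyC _ _)]pev_C [pev w' (kumX _ _ _ _)]pev_X er //.
by congr (_ * _); apply: IH => // j jl; exact: (er j.+1).
Qed.
End ActionEval.

Section SenModule.
Variable K : cpdata.
Local Notation R := (cpR K).
Local Notation p := (cpp K).
Local Notation p_pr := (cpp_pr K).
Local Notation C := (cpC K).
Local Notation v := (cpv K).
Local Notation q := (v p%:R).
Local Notation zeta := (cpz K).
Local Notation A := (tate v).
Variables w0 c : C.
Hypotheses (w01 : v w0 < 1) (c0 : c != 0) (c1 : v c < 1).
Local Notation T1 := (kumT w0 2).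
Local Notation T2 := (kumT w0 3).
Local Notation T := (kumT c 1).
Local Notation s := [:: T1; T2; T].
Local Notation Om := (pt s).
Local Notation OX := (OU p_pr T1 T2 T (@idfun A)).

Let us : units s := units_s w01 c1.

Definition ev (w : Om) : OX -> C := @cev K s w.
Lemma ev_zmod w : zmod_morphism (ev w). Proof. exact: cev_zmod. Qed.
Lemma ev_monoid w : monoid_morphism (ev w). Proof. exact: cev_monoid. Qed.
HB.instance Definition _ w := GRing.isZmodMorphism.Build OX C (ev w) (ev_zmod w).
HB.instance Definition _ w := GRing.isMonoidMorphism.Build OX C (ev w) (ev_monoid w).

Lemma evD w (x y : OX) : ev w (x + y) = ev w x + ev w y. Proof. exact: rmorphD. Qed.
Lemma evB w (x y : OX) : ev w (x - y) = ev w x - ev w y. Proof. exact: rmorphB. Qed.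
Lemma evM w (x y : OX) : ev w (x * y) = ev w x * ev w y. Proof. exact: rmorphM. Qed.
Lemma ev0 w : ev w 0 = 0. Proof. exact: rmorph0. Qed.

Lemma ev_inj (x y : OX) : (forall w, ev w x = ev w y) -> x = y.
Proof. exact: (@cev_inj K s us x y). Qed.

Lemma ev_lev (x : OX) : cl (lev (s:=s)) (fun w => ev w x).
Proof. exact: (lev_cev us x). Qed.

Lemma ev_ex f : cl (lev (s:=s)) f -> exists x : OX, forall w, ev w x = f w.
Proof. exact: (cev_lev_ex us). Qed.

Lemma ev_cst a w : ev w (OUcst p_pr T1 T2 T idfun a) = a.
Proof. by rewrite /ev (cev_cst us) tev_const // pz_le1. Qed.

Lemma ev_nbhs m (x : OX) : OUnbhs m x <-> forall w, v (ev w x) <= q ^+ m.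
Proof. exact: (padicP us m x). Qed.

Definition gG (g : 'rV[C]_2) : seq C := [:: g 0 0; g 0 1; 0].
Definition gT (x : C) : seq C := [:: 0; 0; x].

Lemma zvec_gG g : Zpd v g -> zvec (gG g).
Proof.
by move=> hg [|[|[|i]]] /=; rewrite ?nth_nil; [exact: hg|exact: hg|exact: zeroZp|exact: zeroZp].
Qed.
Lemma zvec_gT x : Defs.Zp v x -> zvec (gT x).
Proof.
by move=> hx [|[|[|i]]] /=; rewrite ?nth_nil //; exact: zeroZp.
Qed.

Lemma ev_actG g (x : OX) w : Zpd v g -> ev w (actG zeta g x) = ev (gact (gG g) w) x.
Proof. by move=> hg; exact: (cev_cact us x w (zvec_gG hg)). Qed.
Lemma ev_actGamma a (x : OX) w : Defs.Zp v a -> ev w (actGamma zeta a x) = ev (gact (gT a) w) x.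
Proof. by move=> ha; exact: (cev_cact us x w (zvec_gT ha)). Qed.

(** Needed to use the axiom on Higgs fields with X' = X: the pullback of theta there is a base
    change along the identity. *)
Lemma ev_cbc (x : OX) w : ev w (cbc (phi := @idfun A) (@idfun A) (@idfun A) (x : compl p idfun (kummer p_pr s))) = ev w x.
Proof.
have kE n (y : kummer p_pr s n) (w' : Om) : pev w' (kbc (p_pr := p_pr) idfun y : kummer p_pr s n) = pev w' y.
  exact: (@pev_kbc K s n y w' w').
pose x' : compl p (@idfun A) (kummer p_pr s) := x.
have hc : cauchy p idfun (fun n => kbc (p_pr := p_pr) idfun (repr x' n) : kummer p_pr s n).
  have [[k [N h1]] h2] := (cauchyP us (repr x')).1 (csP (repr x')); apply/(cauchyP us); split.
    by exists k, N => n Nn w1; rewrite kE; exact: h1.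
  by move=> m; have [M hM] := h2 m; exists M => n Mn w1; rewrite !kE; exact: hM.
apply: (cvg_unique (cev_clim us w hc)).
rewrite -[X in cvgC _ X]/(@cev K s w x') -[in X in cvgC _ X](compl_piK x').
by apply: (cvg_ext _ (cev_pi us (repr x') w)); exists 0%N => n _; rewrite kE.
Qed.

Lemma ev_emb n (x : torA p_pr T (@idfun A) n) w :
  ev w (torA_emb T1 T2 x) = @pev K [:: T] (ptl (ptl w)) n x.
Proof. by rewrite /ev /torA_emb [LHS](cev_lev us) /torA_lev !pev_C. Qed.

Lemma pev_addmul (u : pt [:: T]) n (a x y : kummer p_pr [:: T] n) :
  pev u (a * x + y) = pev u a * pev u x + pev u y.
Proof. by rewrite rmorphD rmorphM. Qed.

Lemma ev_embP n (a x y : torA p_pr T (@idfun A) n) w :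
  ev w (torA_emb T1 T2 (a * x + y)) = ev w (torA_emb T1 T2 a) * ev w (torA_emb T1 T2 x) + ev w (torA_emb T1 T2 y).
Proof.
have e := etrans (ev_emb (a * x + y) w) (@pev_addmul (ptl (ptl w)) n a x y).
have h (d : torA p_pr T (@idfun A) n) := esym (ev_emb d w).
exact: etrans e (congr2 +%R (congr2 *%R (h a) (h x)) (h y)).
Qed.

Lemma ev_emb0 n w : ev w (torA_emb T1 T2 (0 : torA p_pr T (@idfun A) n)) = 0.
Proof. by rewrite ev_emb; exact: (rmorph0 (@pev K [:: T] (ptl (ptl w)) n)). Qed.

Lemma emb_inj n (x y : torA p_pr T (@idfun A) n) :
  (forall w, ev w (torA_emb T1 T2 x) = ev w (torA_emb T1 T2 y)) -> x = y.
Proof.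
move=> h; apply: (@pev_inj K [:: T] n x y (units_T c1)) => u.
have [sec hs] := toric_sec w0 c.
have e := etrans (esym (ev_emb x (sec u))) (etrans (h (sec u)) (ev_emb y (sec u))).
exact: etrans (esym (hs u n x)) (etrans e (hs u n y)).
Qed.

(** The function descends to the toric tower, and a Cauchy sequence representing it there is mapped
    back to the product. *)
Lemma toric_Ator (x : OX) : toric (fun w => ev w x) -> Ator x.
Proof.
move=> tx; have usT := units_T c1; have [F cF FE] := toric_desc c1 tx.
have [y hy] := cev_lev_ex usT cF.
have cy := csP (repr y); have [[k [N h1]] h2] := (cauchyP usT (repr y)).1 cy.
have hc : cauchy p idfun (fun n => torA_lev T1 T2 (repr y n : torA p_pr T (@idfun A) n) : kummer p_pr s n).
  apply/(cauchyP us); split.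
    by exists k, N => n Nn w1; rewrite !pev_C; exact: h1.
  by move=> m'; have [M' hM'] := h2 m'; exists M' => n Mn w1; rewrite !pev_C; exact: hM'.
exists (fun n => repr y n); split=> //; apply: ev_inj => w.
rewrite FE -hy; apply/esym; apply: (cvg_unique (cev_clim us w hc)).
rewrite -[in X in cvgC _ X](compl_piK y).
by apply: (cvg_ext _ (cev_pi usT (repr y) (ptl (ptl w)))); exists 0%N => n _; rewrite !pev_C.
Qed.
End SenModule.

Lemma sum2 (V : nmodType) (F : 'I_2 -> V) : \sum_i F i = F 0 + F 1.
Proof. by rewrite 2!big_ord_recl big_ord0 addr0; congr (F _ + F _); apply: val_inj. Qed.

Lemma ord2P (P : 'I_2 -> Prop) : P 0 -> P 1 -> forall i, P i.
Proof. by move=> P0 P1 [[|[|//]] h]; [have -> : Ordinal h = 0|have -> : Ordinal h = 1]; try exact: val_inj. Qed.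

Lemma ord2_other (i l : 'I_2) : i != l -> i = 1 - l.
Proof. by move: i l; apply: ord2P; apply: ord2P => //= _; exact: val_inj. Qed.

Lemma cV2P (V : Type) (u u' : 'cV[V]_2) : u 0 0 = u' 0 0 -> u 1 0 = u' 1 0 -> u = u'.
Proof. by move=> h0 h1; apply/matrixP; apply: ord2P => j; rewrite ord1. Qed.

(** * The unipotent representations *)

Section Rep.
Variables (R : realType) (C : closedFieldType) (v : absval R C) (p : nat) (l : 'I_2).

Definition urep (g : 'rV[C]_2) : 'M[C]_2 := 1%:M + g 0 l *: delta_mx 0 1.
Definition uder (l' : 'I_2) : 'M[C]_2 := (l' == l)%:R *: delta_mx 0 1.

Lemma Zp_Qp x : Defs.Zp v x -> Qp v x.
Proof.
move=> hx e e0; have [m hm] := hx e e0; exists (m%:R : rat).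
have -> : ratr (m%:R : rat) = m%:R :> C; last by [].
by rewrite -[m%:R in LHS]/((m%:Z)%:~R) /ratr rat.numq_int rat.denq_int divr1.
Qed.

Lemma urep_drho : is_drho v p urep uder.
Proof.
move=> l' m; exists 0%N => x hx x0 _ i j.
have uE y : urep (y *: delta_mx 0 l') = 1%:M + (y * (l' == l)%:R) *: delta_mx 0 1.
  by rewrite /urep !mxE eqxx [l == l']eq_sym.
rewrite !uE mul0r scale0r addr0 addrAC subrr add0r scalerA mulrA mulVf // mul1r subrr.
by rewrite mxE /= av0 av_ge0.
Qed.

Lemma urep_la : la_rep v p urep.
Proof.
split.
- move=> g hg i j; rewrite /urep !mxE.
  have Zn (n : nat) : Defs.Zp v (n%:R : C) by move=> e e0; exists n; rewrite subrr av0.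
  apply: Zp_Qp; case: (boolP ((i == 0) && (j == 1))) => [/andP[/eqP -> /eqP ->]|_].
    by rewrite mulr1 /= add0r; exact: hg.
  by rewrite mulr0 addr0; exact: Zn.
- by rewrite /urep mxE scale0r addr0.
- move=> g h hg hh; rewrite /urep mulmxDl mul1mx mulmxDr mulmx1 mxE scalerDl.
  rewrite -scalemxAl -scalemxAr mul_delta_mx_cond /= scaler0 scaler0 addr0.
  by rewrite -addrA; congr (_ + _); rewrite addrC.
move=> x0 hx0; exists 0%N.
(* The representation is affine in g: only the constant term and the linear term in the l-th
   variable occur. *)
pose c (i : 'I_2 -> nat) : 'M[C]_2 := if (i 0 == 0%N) && (i 1 == 0%N) then urep x0 else
  if (i l == 1%N) && (i (1 - l) == 0%N) then delta_mx 0 1 else 0.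
exists c; split=> [m|x hx m].
  exists 2%N => i hi a b; rewrite /c ifN; last first.
    by apply: contraL hi; rewrite sum2 => /andP[/eqP -> /eqP ->].
  rewrite ifN; first by rewrite !mxE mulr0 /= av0 av_ge0.
  apply: contraL hi; rewrite sum2; move: l; apply: ord2P.
    by rewrite subr0 => /andP[/eqP -> /eqP ->].
  by rewrite subrr => /andP[/eqP -> /eqP ->].
exists 2%N => N' N2 a b.
have N0 : (0 < N')%N by apply: leq_trans N2.
pose o0 : 'I_N' := Ordinal N0; pose o1 : 'I_N' := Ordinal N2.
pose f0 : {ffun 'I_2 -> 'I_N'} := [ffun=> o0].
pose f1 : {ffun 'I_2 -> 'I_N'} := [ffun i => if i == l then o1 else o0].
have f10 : f1 != f0 by apply/eqP => /ffunP/(_ l); rewrite !ffunE eqxx => /(congr1 val).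
have nl : (1 - l == l) = false by move: l; apply: ord2P.
rewrite (bigD1 f0) //= (bigD1 f1) //= [X in _ + (_ + X)]big1 ?addr0.
  have -> : c (fun l0 => f0 l0) = urep x0 by rewrite /c !ffunE.
  have -> : c (fun l0 => f1 l0) = delta_mx 0 1.
    rewrite /c !ffunE eqxx nl /=; case: ifP => //; move: l; apply: ord2P => /=; rewrite ?eqxx //.
  rewrite big1 => [|i _]; last by rewrite ffunE; exact: expr0.
  rewrite (bigD1 l) //= big1 => [|i il]; last by rewrite ffunE (negPf il); exact: expr0.
  rewrite ffunE eqxx [_ ^+ o1]expr1 mulr1 scale1r expr0 mul1r scale1r.
  have -> : urep (x0 + x) - (urep x0 + x 0 l *: delta_mx 0 1) = 0; last by rewrite mxE /= av0 av_ge0.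
  by rewrite /urep mxE scalerDl addrA subrr.
move=> f /andP[ff0 ff1]; rewrite /c.
case: ifP => [/andP[/eqP h0 /eqP h1]|_].
  by case/eqP: ff0; apply/ffunP; apply: ord2P; apply: val_inj; rewrite ffunE /= ?h0 ?h1.
case: ifP => [/andP[/eqP h0 /eqP h1]|_]; last by rewrite scaler0.
case/eqP: ff1; apply/ffunP => i; apply: val_inj; rewrite ffunE.
case: (eqVneq i l) => [-> //|il] /=; by rewrite (ord2_other il).
Qed.
End Rep.

Lemma sum_ffun1 (V : nmodType) N (G : {ffun 'I_1 -> 'I_N} -> V) :
  \sum_f G f = \sum_(n < N) G [ffun=> n].
Proof.
rewrite (reindex (fun n : 'I_N => [ffun=> n] : {ffun 'I_1 -> 'I_N})) //.
exists (fun f : {ffun 'I_1 -> 'I_N} => f 0) => [n _|f _]; first by rewrite ffunE.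
by apply/ffunP => i; rewrite ffunE ord1.
Qed.

Lemma mxDE (V : zmodType) m n (A B : 'M[V]_(m, n)) i j : (A + B) i j = A i j + B i j.
Proof. by rewrite mxE. Qed.
Lemma mxBE (V : zmodType) m n (A B : 'M[V]_(m, n)) i j : (A - B) i j = A i j - B i j.
Proof. by rewrite !mxE. Qed.

(** * The decompletion for a unipotent representation *)

Section Unipotent.
Variable K : cpdata.
Local Notation R := (cpR K).
Local Notation p := (cpp K).
Local Notation C := (cpC K).
Local Notation v := (cpv K).
Local Notation q := (v p%:R).
(* Stand-ins for the completed product of the towers (E), its toric subalgebras
   A_n (B n) and A_tor (Bc), and evaluation at points (ev). *)
Variables (Om : Type) (E : comPzRingType) (ev : Om -> E -> C).
Hypotheses (evD : forall w x y, ev w (x + y) = ev w x + ev w y)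
  (evB : forall w x y, ev w (x - y) = ev w x - ev w y)
  (evM : forall w x y, ev w (x * y) = ev w x * ev w y)
  (ev0 : forall w, ev w 0 = 0)
  (ev_inj : forall x y, (forall w, ev w x = ev w y) -> x = y)
  (ev_bd : forall x, exists k, forall w, v (ev w x) <= (q ^+ k)^-1).
Variables (cst : C -> E) (aG : 'rV[C]_2 -> Om -> Om) (aT : C -> Om -> Om)
  (actg : 'rV[C]_2 -> E -> E) (actt : C -> E -> E) (nb : nat -> set E).
Hypotheses (ev_cst : forall a w, ev w (cst a) = a)
  (ev_actg : forall g x w, Zpd v g -> ev w (actg g x) = ev (aG g w) x)
  (ev_actt : forall a x w, Defs.Zp v a -> ev w (actt a x) = ev (aT a w) x)
  (nbP : forall m x, nb m x <-> forall w, v (ev w x) <= q ^+ m).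
Variables (B : nat -> comNzRingType) (emb : forall n, B n -> E) (embc : forall n, C -> B n).
Arguments emb {n}.
Hypotheses (ev_emb : forall n (a x y : B n) w, ev w (emb (a * x + y)) = ev w (emb a) * ev w (emb x) + ev w (emb y))
  (ev_emb0 : forall n w, ev w (emb (0 : B n)) = 0)
  (ev_embc : forall n a w, ev w (emb (embc n a)) = a)
  (emb_aG : forall g n (a : B n) w, Zpd v g -> ev (aG g w) (emb a) = ev w (emb a))
  (emb_aT : forall x y n (a : B n) w, Defs.Zp v x -> Defs.Zp v y -> v (x - y) <= q ^+ n ->
     ev (aT x w) (emb a) = ev (aT y w) (emb a))
  (aT0 : forall w, aT 0 w = w).
Variables (l : 'I_2) (L : E) (b0 : B 0).
Hypotheses (L_aG : forall g w, Zpd v g -> ev (aG g w) L = ev w L - g 0 l)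
  (L_aT : forall x w, Defs.Zp v x -> ev (aT x w) L = ev w L + x * ev w (emb b0)).
Variable Bc : set E.
Hypothesis fixed_Bc : forall x, (forall g w, Zpd v g -> ev (aG g w) x = ev w x) -> Bc x.
Hypothesis la_B : forall x k (M : R), (forall g w, Zpd v g -> ev (aG g w) x = ev w x) -> 0 < M ->
  (forall w h, (2 <= h)%N -> exists2 P : {poly C}, (size P <= h)%N &
     forall i : nat, v (ev (aT (p ^ k * i)%:R w) x - P.[i%:R]) <= q ^+ (2 * h) * M) ->
  exists a : B k, x = emb a.

Let qn n : 0 < q ^+ n. Proof. by rewrite exprn_gt0 ?q_gt0. Qed.
Let emb_T0 x n (a : B n) w : Defs.Zp v x -> v x <= q ^+ n -> ev (aT x w) (emb a) = ev w (emb a).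
Proof. by move=> hx xn; rewrite (@emb_aT x 0 n a w hx (@zeroZp K)) ?aT0 // subr0. Qed.

Let emb_mul n (x y : B n) w : ev w (emb (x * y)) = ev w (emb x) * ev w (emb y).
Proof. by have := ev_emb x y 0 w; rewrite ev_emb0 !addr0. Qed.

Definition secU : set 'cV[E]_2 :=
  [set u | forall g, Zpd v g -> map_mx cst (urep l g) *m map_mx (actg g) u = u]%classic.
(** The vector x e_1 + y (L, 1). *)
Definition umk (x y : E) : 'cV[E]_2 := \col_i (if i == 0 then x + y * L else y).
Definition umod : set 'cV[E]_2 := [set u | exists a b : B 0, u = umk (emb a) (emb b)]%classic.
Definition orb (u : 'cV[E]_2) (x : C) : 'cV[E]_2 := map_mx (actt x) u.

Lemma umk0 x y : umk x y 0 0 = x + y * L. Proof. by rewrite mxE. Qed.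
Lemma umk1 x y : umk x y 1 0 = y. Proof. by rewrite mxE. Qed.

Lemma secUP u : secU u <-> forall g, Zpd v g -> forall w,
  ev (aG g w) (u 0 0) + g 0 l * ev (aG g w) (u 1 0) = ev w (u 0 0) /\
  ev (aG g w) (u 1 0) = ev w (u 1 0).
Proof.
have E0 g : (map_mx cst (urep l g) *m map_mx (actg g) u) 0 0 =
    cst 1 * actg g (u 0 0) + cst (g 0 l) * actg g (u 1 0).
  by rewrite mxE sum2 !mxE /= mulr0 mulr1 addr0 add0r.
have E1 g : (map_mx cst (urep l g) *m map_mx (actg g) u) 1 0 =
    cst 0 * actg g (u 0 0) + cst 1 * actg g (u 1 0).
  by rewrite mxE sum2 !mxE /= mulr0 !addr0.
split=> [h g hg w|h g hg].
  have e := h g hg; split.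
    by rewrite -[in RHS]e E0 evD !evM !ev_cst mul1r !ev_actg.
  by rewrite -[in RHS]e E1 evD !evM !ev_cst mul1r mul0r add0r !ev_actg.
apply: cV2P; apply: ev_inj => w; have [e0 e1] := h g hg w.
  by rewrite E0 evD !evM !ev_cst mul1r !ev_actg.
by rewrite E1 evD !evM !ev_cst mul1r mul0r add0r !ev_actg.
Qed.

Lemma umod_sec u : umod u -> secU u.
Proof.
move=> [a [b ->]]; apply/secUP => g hg w; rewrite umk0 umk1 !evD !evM !emb_aG // L_aG //.
by split=> //; ring.
Qed.

Lemma sec_fixed u : secU u -> forall g w, Zpd v g ->
  ev (aG g w) (u 1 0) = ev w (u 1 0) /\
  ev (aG g w) (u 0 0 - u 1 0 * L) = ev w (u 0 0 - u 1 0 * L).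
Proof.
move/secUP => h g w hg; have [e0 e1] := h g hg w; split=> //.
by rewrite !evB !evM L_aG // -e0 e1; ring.
Qed.

Lemma orb_ev u x w i : Defs.Zp v x -> ev w (orb u x i 0) = ev (aT x w) (u i 0).
Proof. by move=> hx; rewrite mxE ev_actt. Qed.

Lemma umod0 : umod 0.
Proof.
exists 0, 0; apply: cV2P; apply: ev_inj => w; rewrite ?umk0 ?umk1 mxE ?evD ?evM !ev_emb0 ?ev0 //.
by rewrite mul0r addr0.
Qed.

Lemma umod_lin (a : B 0) u u' : umod u -> umod u' -> umod (emb a *: u + u').
Proof.
move=> [x [y ->]] [x' [y' ->]]; exists (a * x + x'), (a * y + y').
by apply: cV2P; apply: ev_inj => w; rewrite !mxE /= !evD !evM ?evD ?evM !ev_emb //; ring.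
Qed.

Lemma orb_umk (a b : B 0) x : Defs.Zp v x ->
  orb (umk (emb a) (emb b)) x = umk (emb (embc 0 x * (b0 * b + 0) + a)) (emb b).
Proof.
move=> hx; have z (d : B 0) w : ev (aT x w) (emb d) = ev w (emb d) by apply: emb_T0 => //; exact: Zp_le1.
apply: cV2P; apply: ev_inj => w; rewrite orb_ev // ?umk0 ?umk1 ?z //.
by rewrite !evD !evM !z L_aT // !ev_emb ev_emb0 ev_embc; ring.
Qed.

Lemma umod_stable x u : Defs.Zp v x -> umod u -> umod (orb u x).
Proof. by move=> hx [a [b ->]]; rewrite orb_umk //; exists (embc 0 x * (b0 * b + 0) + a), b. Qed.

(** The orbit is affine in x, so the difference quotient is equal to the derivative and any
    neighbourhood will do. *)
Lemma umod_deriv u : umod u ->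
  is_deriv0 v p cst nb (orb u) ((emb b0 *: delta_mx 0 1) *m u).
Proof.
move=> [a [b ->]] m; exists 0%N => x hx x0 _ i j; rewrite ord1 {j}.
suff -> : cst x^-1 *: (orb (umk (emb a) (emb b)) x - orb (umk (emb a) (emb b)) 0) -
  (emb b0 *: delta_mx 0 1) *m umk (emb a) (emb b) = 0.
  by rewrite mxE; apply/nbP => w; rewrite ev0 av0 ltW.
rewrite !orb_umk //; last exact: zeroZp.
apply: cV2P; apply: ev_inj => w; rewrite !mxE sum2 !mxE /= !(mul0r, mulr0, mulr1, addr0, add0r).
  rewrite evB evM evB !evD !evM !ev_emb !ev_embc !emb_mul ev_cst ev0.
  by rewrite mul0r !add0r; field.
by rewrite subrr mulr0 subr0.
Qed.

Definition ubasis (i : 'I_2) : 'cV[E]_2 :=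
  if i == 0 then umk (emb (embc 0 1)) (emb (embc 0 0)) else umk (emb (embc 0 0)) (emb (embc 0 1)).

Lemma ubasis_umod i : umod (ubasis i).
Proof. by rewrite /ubasis; case: ifP => _; eexists; eexists; reflexivity. Qed.

Lemma ubasis_sum (a : 'I_2 -> E) : \sum_i a i *: ubasis i = umk (a 0) (a 1).
Proof.
rewrite sum2 /ubasis /=; apply: cV2P; apply: ev_inj => w; rewrite !mxE /= !evD !evM ?evD ?evM !ev_embc; ring.
Qed.

Lemma umk_inj x y x' y' : umk x y = umk x' y' -> x = x' /\ y = y'.
Proof.
move=> e; have e1 : y = y' by rewrite -(umk1 x y) e umk1.
split=> //; have := congr1 (fun M : 'cV[E]_2 => M 0 0) e; rewrite !umk0 e1 => e0.
by apply: (addIr (y' * L)).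
Qed.

Lemma sec_umk u : secU u -> exists x y, [/\ Bc x, Bc y & u = umk x y].
Proof.
move=> hu; exists (u 0 0 - u 1 0 * L), (u 1 0).
have h := sec_fixed hu; split; try by apply: fixed_Bc => g w hg; have [] := h g w hg.
by apply: cV2P; rewrite ?umk0 ?umk1 // subrK.
Qed.

Lemma umod_tensor : (forall x y : B 0, (forall w, ev w (emb x) = ev w (emb y)) -> x = y) ->
  exists k (g : 'I_k -> 'cV[E]_2) (f : 'I_k -> 'cV[E]_2 -> B 0),
    [/\ (forall i, umod (g i)),
        (forall i a w w', umod w -> umod w' ->
           f i (emb a *: w + w') = a * f i w + f i w'),
        (forall w, umod w -> w = \sum_i emb (f i w) *: g i),
        (forall w, secU w -> exists a : 'I_k -> E,
           (forall i, Bc (a i)) /\ w = \sum_i a i *: g i) &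
        (forall a : 'I_k -> E, (forall i, Bc (a i)) ->
           \sum_i a i *: g i = 0 ->
           forall j, \sum_i a i * emb (f j (g i)) = 0)].
Proof.
move=> emb_inj; have /choice[F hF] : forall u, exists ab : B 0 * B 0, umod u -> u = umk (emb ab.1) (emb ab.2).
  move=> u; case: (pselect (umod u)) => [[a [b e]]|n]; first by exists (a, b).
  by exists (0, 0).
exists 2%N, ubasis, (fun i u => if i == 0 then (F u).1 else (F u).2).
have fE u a b : u = umk (emb a) (emb b) -> (F u).1 = a /\ (F u).2 = b.
  move=> e; have e' := hF u (ex_intro _ a (ex_intro _ b e)).
  by have [e1 e2] := umk_inj (etrans (esym e') e); split; apply: emb_inj => w; rewrite ?e1 ?e2.
split.
- exact: ubasis_umod.
- move=> i a w w' hw hw'.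
  have e : emb a *: w + w' = umk (emb (a * (F w).1 + (F w').1)) (emb (a * (F w).2 + (F w').2)).
    rewrite {1}(hF w hw) {1}(hF w' hw').
    by apply: cV2P; apply: ev_inj => t; rewrite !mxE /= !evD !evM ?evD ?evM !ev_emb; ring.
  by have [-> ->] := fE _ _ _ e; case: ifP.
- by move=> w hw; rewrite ubasis_sum /=; exact: hF.
- move=> w hw; have [x [y [hx hy ->]]] := sec_umk hw.
  by exists (fun i => if i == 0 then x else y); split=> [i|]; [case: ifP|rewrite ubasis_sum].
- move=> a _; rewrite ubasis_sum => e j.
  have e0 : umk 0 0 = 0 by apply: cV2P; rewrite ?umk0 ?umk1 mxE ?mul0r ?addr0.
  by rewrite -e0 in e; have [e1 e2] := umk_inj e; rewrite sum2 e1 e2 !mul0r addr0.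
Qed.

(** Restricting an expansion on p^k Z_p to p^(k+2) Z_p multiplies the n-th coefficient by p^(2n), so
    truncation at degree h leaves an error |p|^(2h) M. This outweighs the factor |p|^h lost in
    [la_level]. *)
Lemma la_poly u : locally_analytic v p cst nb (fun x : 'rV[C]_1 => orb u (x 0 0)) ->
  exists k (M : R), 0 < M /\ forall r w h, exists2 P : {poly C}, (size P <= h)%N &
    forall i : nat, v (ev (aT (p ^ k * i)%:R w) (u r 0) - P.[i%:R]) <= q ^+ (2 * h) * M.
Proof.
move=> hla; have z0 : Zpd v (0 : 'rV[C]_1) by move=> i; rewrite mxE; exact: zeroZp.
have [k [cf [H1 H2]]] := hla 0 z0.
pose Cn r w n := p%:R ^+ (k * n) * ev w (cf (fun=> n) r 0).
have [N0 hN0] := H1 0%N.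
have big n r w : (N0 <= n)%N -> v (Cn r w n) <= 1.
  move=> nN; have := hN0 (fun=> n); rewrite big_ord1 => /(_ nN r 0).
  by rewrite mxE => /nbP/(_ w); rewrite evM ev_cst.
have [M M0 hM] : exists2 M : R, 0 < M & forall r w n, v (Cn r w n) <= M.
  have [M M0 hM] : exists2 M : R, 0 < M & forall r w n, (n < N0)%N -> v (Cn r w n) <= M.
    elim: N0 {hN0 big} => [|n [M M0 hM]]; first by exists 1.
    have [k0 hk0] := ev_bd (cf (fun=> n) 0 0); have [k1 hk1] := ev_bd (cf (fun=> n) 1 0).
    exists (Num.max M (Num.max (q ^+ k0)^-1 (q ^+ k1)^-1)); first by rewrite lt_max M0.
    move=> r w i; rewrite ltnS leq_eqVlt => /orP[/eqP ->|/hM h]; last first.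
      by apply: le_trans (h r w) _; rewrite le_max lexx.
    rewrite le_max; apply/orP; right; apply: le_trans (_ : v (ev w (cf (fun=> n) r 0)) <= _).
      by rewrite avM ler_piMl ?av_ge0 // avX exprn_ile1 ?q_ge0 ?q_le1.
    by rewrite le_max; move: r; apply: ord2P; rewrite ?hk0 ?hk1 ?orbT.
  exists (Num.max M 1) => [|r w n]; first by rewrite lt_max M0.
  rewrite le_max; case: (ltnP n N0) => [/hM -> //|/big ->]; by rewrite orbT.
exists (k + 2)%N, M; split=> // r w h.
exists (\poly_(n < h) (Cn r w n * p%:R ^+ (2 * n))); first exact: size_poly.
move=> i; pose y : 'rV[C]_1 := const_mx (p ^ 2 * i)%:R.
have zy : Zpd v y by move=> j; rewrite mxE; exact: natZp.
have qM : 0 < q ^+ (2 * h) * M by rewrite mulr_gt0.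
have [m hm] := q_arch qM; have [N hN] := H2 y zy m.
have hN' := leq_maxr N h; set N' := maxn N h in hN'.
have argE : (0 + p%:R ^+ k *: y : 'rV[C]_1) 0 0 = (p ^ (k + 2) * i)%:R.
  by rewrite !mxE add0r -natrX -natrM mulnA -expnD.
have := hN N' (leq_maxl N h) r 0; rewrite argE mxBE summxE => /nbP/(_ w); rewrite evB orb_ev; last exact: natZp.
have -> : ev w (\sum_(f : {ffun 'I_1 -> 'I_N'}) (cst (\prod_l (p%:R ^+ k * y 0 l) ^+ f l) *: cf (fun l : 'I_1 => f l)) r 0) =
    \sum_(n < N') Cn r w n * p%:R ^+ (2 * n) * i%:R ^+ n.
  rewrite sum_ffun1 (big_morph (ev w) (evD w) (ev0 w)); apply: eq_bigr => n _.
  rewrite mxE evM ev_cst big_ord1 ffunE mxE.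
  have -> : (fun l : 'I_1 => nat_of_ord ([ffun=> n] l : 'I_N')) = fun=> nat_of_ord n by apply/funext => j; rewrite ffunE.
  rewrite /Cn exprMn -exprM natrM natrX exprMn -exprM; ring.
move=> h1; apply: avBtrans (le_trans h1 (ltW hm)) _.
rewrite horner_poly (big_ord_widen _ (fun n => Cn r w n * p%:R ^+ (2 * n) * i%:R ^+ n) hN') [X in _ - X]big_mkcond -sumrB.
apply: av_sum_le => [|n _]; first exact: ltW.
case: ltnP => hn; first by rewrite subrr av0 ltW.
rewrite subr0 2!avM [v (p%:R ^+ _)]avX [v (i%:R ^+ _)]avX; apply: le_trans (_ : v (Cn r w n) * q ^+ (2 * n) <= _).
  rewrite ler_piMr ?mulr_ge0 ?av_ge0 ?exprn_ge0 ?q_ge0 // exprn_ile1 ?av_ge0 ?av_nat //.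
rewrite mulrC; apply: ler_pM; rewrite ?av_ge0 ?exprn_ge0 ?q_ge0 //.
by apply: q_anti; rewrite leq_mul2l hn orbT.
Qed.

Lemma umod_la u : secU u ->
  locally_analytic v p cst nb (fun x : 'rV[C]_1 => orb u (x 0 0)) <->
  exists m, (0 <= m)%N /\ exists k (b : 'I_k -> B m) (w : 'I_k -> 'cV[E]_2),
    (forall i, umod (w i)) /\ u = \sum_i emb (b i) *: w i.
Proof.
move=> hu; have hfix := sec_fixed hu; split.
  move=> /la_poly[k [M [M0 hM]]]; exists k; split=> //.
  have [a1 a1E] : exists a : B k, u 1 0 = emb a.
    by apply: (la_B (M := M)); [move=> g w hg; have [] := hfix g w hg| |move=> w h _; exact: hM].
  have [a0 a0E] : exists a : B k, u 0 0 - u 1 0 * L = emb a.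
    apply: (la_B (M := M)); [by move=> g w hg; have [] := hfix g w hg|by []|move=> w h h2].
    have [P sP hP] := hM 0 w h.
    pose e := ev w (emb a1); pose z := ev w L; pose b := ev w (emb b0).
    (* Since u_1 is already known to be of level k, the term u_1 L is affine in i along the orbit;
       to subtract it, affine polynomials must be allowed, whence the condition 2 <= h. *)
    exists (P - (e * z)%:P - (e * b * p%:R ^+ k) *: 'X).
      apply: leq_trans (size_polyD _ _) _; rewrite size_polyN geq_max; apply/andP; split; last first.
        by apply: leq_trans (size_scale_leq _ _) _; rewrite size_polyX.
      apply: leq_trans (size_polyD _ _) _; rewrite size_polyN geq_max sP.
      by apply: leq_trans (size_polyC_leq1 _) _; exact: ltnW.
    move=> i; have zi : Defs.Zp v ((p ^ k * i)%:R : C) by exact: natZp.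
    rewrite evB evM L_aT // a1E emb_T0 //; last first.
      by rewrite natrM avM natrX avX ler_piMr ?exprn_ge0 ?q_ge0 ?av_nat.
    rewrite !hornerE -/e -/z -/b natrM natrX.
    have -> : ev (aT (p%:R ^+ k * i%:R) w) (u 0 0) - e * (z + p%:R ^+ k * i%:R * b) -
       (P.[i%:R] - e * z - e * b * p%:R ^+ k * i%:R) = ev (aT (p%:R ^+ k * i%:R) w) (u 0 0) - P.[i%:R] by ring.
    by have := hP i; rewrite natrM natrX.
  exists 2%N, (fun i => if i == 0 then a0 else a1), ubasis; split; first exact: ubasis_umod.
  rewrite (ubasis_sum (fun i => emb (if i == 0 then a0 else a1))) /= -a0E -a1E.
  by apply: cV2P; rewrite ?umk0 ?umk1 // subrK.
move=> [m [_ [k [b [us [hus uE]]]]]].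
have /choice[f hf] : forall i, exists xy : B 0 * B 0, us i = umk (emb xy.1) (emb xy.2).
  by move=> i; have [x [y e]] := hus i; exists (x, y).
pose F0 : E := \sum_i emb (b i) * emb (f i).1; pose F1 : E := \sum_i emb (b i) * emb (f i).2.
have {}uE : u = umk F0 F1.
  rewrite uE; apply: cV2P; rewrite summxE ?umk0 ?umk1 /F0 /F1 ?mulr_suml -?big_split; apply: eq_bigr => i _.
    by rewrite mxE hf umk0 mulrDr mulrA.
  by rewrite mxE hf umk1.
have Fc (d : 'I_k -> B 0) x y w : Defs.Zp v x -> Defs.Zp v y -> v (x - y) <= q ^+ m ->
   ev (aT x w) (\sum_i emb (b i) * emb (d i)) = ev (aT y w) (\sum_i emb (b i) * emb (d i)).
  move=> hx hy xy; rewrite !(big_morph (ev _) (evD _) (ev0 _)); apply: eq_bigr => i _.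
  rewrite !evM (@emb_aT x y m (b i) w hx hy xy); congr (_ * _); apply: emb_aT => //.
  by apply: le_trans xy _; exact: (q_anti K (leq0n m)).
(* On x0 + p^m Z_p the coefficients of level m are constant and L is affine, so two terms of the
   power series suffice. *)
move=> x0 hx0; exists m.
pose c1 : 'cV[E]_2 := \col_i (if i == 0 then emb b0 * actt (x0 0 0) F1 else 0).
pose cf (i : 'I_1 -> nat) : 'cV[E]_2 := if i 0 == 0%N then orb u (x0 0 0) else if i 0 == 1%N then c1 else 0.
exists cf; split=> [m'|x hx m'].
  exists 2%N => i; rewrite big_ord1 => hi r s; rewrite /cf.
  case: (i 0) hi => [|[|n]] //= _; rewrite !mxE mulr0; apply/nbP => w.
  by rewrite ev0 av0 ltW.
exists 2%N => N' N2 r s; rewrite sum_ffun1.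
case: N' N2 => [|[|N']] // _; rewrite 2!big_ord_recl [X in _ + (_ + X)]big1 ?addr0 => [|i _]; last first.
  have -> : cf (fun l : 'I_1 => nat_of_ord ([ffun=> lift ord0 (lift ord0 i)] l : 'I_N'.+2)) = 0.
    by rewrite /cf ffunE.
  by rewrite scaler0.
have -> : cf (fun l : 'I_1 => nat_of_ord ([ffun=> ord0] l : 'I_N'.+2)) = orb u (x0 0 0) by rewrite /cf ffunE.
have -> : cf (fun l : 'I_1 => nat_of_ord ([ffun=> lift ord0 ord0] l : 'I_N'.+2)) = c1 by rewrite /cf ffunE.
rewrite !big_ord1 !ffunE; apply/nbP => w.
have -> : (x0 + p%:R ^+ m *: x) 0 0 = x0 0 0 + p%:R ^+ m * x 0 0 by rewrite !mxE.
have hz0 : Defs.Zp v (x0 0 0) := hx0 0; have hx1 : Defs.Zp v (x 0 0) := hx 0.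
move: (x0 0 0) (x 0 0) hz0 hx1 @c1 @cf => z0 z hz0 hz c1 cf.
have hy : Defs.Zp v (z0 + p%:R ^+ m * z).
  by apply: ZpD => //; apply: ZpM => //; rewrite -natrX; exact: natZp.
have yx : v (z0 + p%:R ^+ m * z - z0) <= q ^+ m.
  by rewrite addrAC subrr add0r avM avX ler_piMr ?exprn_ge0 ?q_ge0 //; exact: Zp_le1.
suff -> : orb u (z0 + p%:R ^+ m * z) - (cst ((p%:R ^+ m * z) ^+ (ord0 : 'I_N'.+2)) *: orb u z0 +
   cst ((p%:R ^+ m * z) ^+ (lift ord0 ord0 : 'I_N'.+2)) *: c1) = 0.
  by rewrite mxE ev0 av0 ltW.
have e0 : (p%:R ^+ m * z) ^+ (ord0 : 'I_N'.+2) = 1 by [].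
have e1 : (p%:R ^+ m * z) ^+ (lift ord0 ord0 : 'I_N'.+2) = p%:R ^+ m * z by [].
have zE (a : E) (A : 'cV[E]_2) i : (a *: A) i 0 = a * A i 0 by rewrite mxE.
have c10 : c1 0 0 = emb b0 * actt z0 F1 by rewrite mxE.
have c11 : c1 1 0 = 0 by rewrite mxE.
rewrite e0 e1; apply: cV2P; apply: ev_inj => w'; rewrite [in RHS]mxE ev0 mxBE evB mxDE evD !zE !evM !ev_cst !orb_ev // uE.
  rewrite c10 umk0 !evD !evM !L_aT // ev_actt // (Fc _ _ _ _ hy hz0 yx) (Fc _ _ _ _ hy hz0 yx); ring.
by rewrite c11 umk1 ev0 (Fc _ _ _ _ hy hz0 yx) mulr0 addr0 mul1r subrr.
Qed.
Lemma uder_coef (t : 'I_2 -> E) (e : E) : cst 0 = 0 -> cst 1 = 1 ->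
  e *: delta_mx 0 1 = \sum_l' t l' *: map_mx cst (uder C l l') -> e = t l.
Proof.
move=> c0 c1 /(congr1 (fun M : 'M[E]_2 => M 0 1)); rewrite summxE (bigD1 l) //= big1 => [|i il].
  by rewrite !mxE !eqxx /= !mulr1 c1 mulr1 addr0.
by rewrite !mxE (negPf il) mul0r c0 mulr0.
Qed.
End Unipotent.

Lemma finite_etale_id (A : comNzRingType) : finite_etale (@idfun A).
Proof.
exists 1%N, (fun=> 1), (fun=> id); split=> [i|b|g hg]; first by [].
  by rewrite big_ord1 mulr1.
exists (g 1); split=> [b|x hx]; last by rewrite hx big_ord1 !mulr1.
by rewrite big_ord1 mulr1 mulrC -(alinearZ hg) mulr1.
Qed.

(** * The value of the geometric Sen map *)

Section SenMap.
Variable K : cpdata.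
Local Notation R := (cpR K).
Local Notation p := (cpp K).
Local Notation p_pr := (cpp_pr K).
Local Notation C := (cpC K).
Local Notation v := (cpv K).
Local Notation q := (v p%:R).
Local Notation zeta := (cpz K).
Local Notation A := (tate v).
Variables w0 c : C.
Hypotheses (w01 : v w0 < 1) (c0 : c != 0) (c1 : v c < 1).
Local Notation T1 := (kumT w0 2).
Local Notation T2 := (kumT w0 3).
Local Notation T := (kumT c 1).
Local Notation s := [:: T1; T2; T].
Local Notation Om := (pt s).
Local Notation E := (OU p_pr T1 T2 T (@idfun A)).
Local Notation tA := (torA p_pr T (@idfun A)).
Local Notation cst := (OUcst p_pr T1 T2 T (@idfun A)).

Let us : units s := units_s w01 c1.
Let emb n (a : tA n) : E := torA_emb T1 T2 a.
Let aG (g : 'rV[C]_2) (w : Om) : Om := gact (gG g) w.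
Let aT (x : C) (w : Om) : Om := gact (gT x) w.
Let eemb := @ev_emb K w0 c w01 c1.

Lemma gact_gT0 (w : Om) : gact (gT 0) w = w.
Proof.
apply: ptE => // i n; rewrite gact_r; last exact/zvec_gT/zeroZp.
rewrite -[RHS]mul1r; congr (_ * _); have -> : (gT (0 : C))`_i = 0 by case: i => [|[|[|i]]] //=; rewrite nth_nil.
exact: (zpow_nat K n 0).
Qed.

Let emb_aG g n (a : tA n) (w : Om) : Zpd v g -> ev (aG g w) (emb a) = ev w (emb a).
Proof.
move=> hg; rewrite !eemb; apply: (@pev_ext K [:: T]) => // -[|//] _ /=.
by rewrite asboolT; [rewrite (zpow_nat K n 0) mul1r|exact: zvec_gG].
Qed.

Let emb_aT x y n (a : tA n) (w : Om) : Defs.Zp v x -> Defs.Zp v y -> v (x - y) <= q ^+ n ->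
  ev (aT x w) (emb a) = ev (aT y w) (emb a).
Proof.
move=> hx hy xy; rewrite !eemb; apply: (@pev_ext K [:: T]) => // -[|//] _ /=.
rewrite !asboolT; [|exact: zvec_gT|exact: zvec_gT]; congr (_ * _).
by apply: zpowE => //; apply: avBtrans xy _; exact: zresP.
Qed.

Let embc n (a : C) : tA n := kscal [:: T] n a.
Let ev_embc n a w : ev w (emb (embc n a)) = a.
Proof. by rewrite eemb pev_scal. Qed.

Let zrot_gG (j : 'I_2) (w : Om) : zrot j 1 w = aG (delta_mx 0 j) w.
Proof.
have hz : Zpd v (delta_mx 0 j : 'rV[C]_2) by move=> i; rewrite mxE; exact: natZp.
apply: ptE => // i n; rewrite gact_r; last exact: zvec_gG.
congr (_ * _); have -> : (gG (delta_mx 0 j : 'rV[C]_2))`_i = (i == j)%N%:R.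
  by move: j {hz}; apply: ord2P; case: i => [|[|[|i]]] //=; rewrite ?mxE ?nth_nil.
by rewrite zpow_nat; case: ifP.
Qed.

Let fixed_toric (x : E) : (forall g w, Zpd v g -> ev (aG g w) x = ev w x) -> toric (fun w => ev w x).
Proof.
move=> h; have hz (j : 'I_2) : Zpd v (delta_mx 0 j : 'rV[C]_2) by move=> i; rewrite mxE; exact: natZp.
have key (j : 'I_2) w : ev (zrot j 1 w) x = ev w x by rewrite zrot_gG h.
exact: (lev_fixed w01 c0 c1 (ev_lev w01 c1 x) (key 0) (key 1)).
Qed.

Let fixed_Ator (x : E) : (forall g w, Zpd v g -> ev (aG g w) x = ev w x) -> Ator x.
Proof. by move=> h; apply: (toric_Ator w01 c1); exact: fixed_toric. Qed.

(** Transfers [la_level] from the toric tower to the product along a section of the projection. *)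
Let la_emb (x : E) k (M : R) : (forall g w, Zpd v g -> ev (aG g w) x = ev w x) -> 0 < M ->
  (forall w h, (2 <= h)%N -> exists2 P : {poly C}, (size P <= h)%N &
     forall i : nat, v (ev (aT (p ^ k * i)%:R w) x - P.[i%:R]) <= q ^+ (2 * h) * M) ->
  exists a : tA k, x = emb a.
Proof.
move=> /fixed_toric tx M0 hP; have [F cF FE] := toric_desc c1 tx; have [sec hs] := toric_sec w0 c.
have [|a ha] := la_level c0 c1 (k := k) cF M0.
  move=> u h h2; have [P sP PE] := hP (sec u) h h2; exists P => // i.
  have [ez er] := sec_coord (hs u).
  have -> : F (iter i (kgam k) u) = ev (aT (p ^ k * i)%:R (sec u)) x; last exact: PE.
  rewrite FE; apply: (cl_lev_ext cF) => [|[|//] n _].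
    by rewrite -[RHS]/(pz (sec u)) ez; elim: i.
  rewrite -[RHS]/(prt (aT (p ^ k * i)%:R (sec u)) 2 n) gact_r; last exact/zvec_gT/natZp.
  rewrite -[(gT _)`_2]/((p ^ k * i)%:R) zpow_nat er exprM.
  by rewrite (iter_mul (x := fun u : pt [:: T] => prt u 0 n) (z := zeta n ^+ (p ^ k))).
exists a; apply: (ev_inj w01 c1) => w; rewrite FE ha; exact/esym/eemb.
Qed.

Variable l : 'I_2.

Lemma sen_prim_ex : exists L : E, forall w, ev w L = sen_prim l w.
Proof. by apply: (ev_ex w01 c1); apply: sen_prim_lev => //; exact: ltn_ord. Qed.

Lemma sen_b_ex : exists b0 : tA 0, forall w, ev w (emb b0) = sen_b l w.
Proof.
have [b hb] := @kumT_inv K w0 w01 (2 + l) isT.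
pose B : A := tconst v (w0 * (2 + l)%:R / c ^+ (2 + l)) * T * (tconst v c * tvar v) ^+ (1 + l) * b.
exists (str (kummer p_pr [:: T]) 0 B) => w; rewrite eemb pev_str.
have z1 : v (pz w) <= 1 := pz_le1 w; rewrite -[pz (ptl _)]/(pz w).
have hX (f : A) n : tev (pz w) (f ^+ n) = tev (pz w) f ^+ n.
  elim: n => [|n IH]; first by rewrite tev_const.
  by rewrite !exprS tevM // IH.
have l3 : (l < size s)%N := ltnW (ltn_ord l).
have e : prt w l 0 * tev (pz w) b = 1.
  rewrite prt0 //; have -> : s`_l = kumT w0 (2 + l) by move: l; apply: ord2P.
  by rewrite -tevM // hb tev_const.
have h2 : prt w l 0 != 0 by rewrite -(av_gt0 v) (prt_unit w _ us).
have hb' : tev (pz w) b = (prt w l 0)^-1 by apply: (mulfI h2); rewrite e mulfV.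
rewrite /B !tevM // hb' ?hX ?tevM ?tev_const ?tev_var ?tev_kumT // expr1 /sen_b prt20.
have h1 : c ^+ (2 + l) != 0 by exact: expf_neq0.
by move: (c ^+ (2 + l)) h1 => e' h1; field; rewrite h1 h2.
Qed.

(** The axiom on Higgs fields, for the l-th unipotent representation over X' = X, isolates theta_l
    as the upper right entry of the Higgs matrix. *)
Lemma sen_map_value (theta : 'rV[E]_2) : geometric_sen_map zeta theta ->
  forall w, ev w (theta 0 l) = sen_b l w.
Proof.
move=> hth w; have [L LE] := sen_prim_ex; have [b0 b0E] := sen_b_ex.
pose vD := @evD K w0 c w01 c1; pose vB := @evB K w0 c w01 c1; pose vM := @evM K w0 c w01 c1.
pose v0 := @ev0 K w0 c w01 c1; pose vI := @ev_inj K w0 c w01 c1; pose vC := @ev_cst K w0 c w01 c1.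
pose vG (g : 'rV[C]_2) (x : E) (w : Om) (hg : Zpd v g) : ev w (actG zeta g x) = ev (aG g w) x := ev_actG w01 c1 x w hg.
pose vT (a : C) (x : E) (w : Om) (ha : Defs.Zp v a) : ev w (actGamma zeta a x) = ev (aT a w) x := ev_actGamma w01 c1 x w ha.
pose vN := @ev_nbhs K w0 c w01 c1.
pose vE n (a x y : tA n) (w : Om) : ev w (emb (a * x + y)) = ev w (emb a) * ev w (emb x) + ev w (emb y) := ev_embP w01 c1 a x y w.
pose vE0 n (w : Om) : ev w (emb (0 : tA n)) = 0 := ev_emb0 w01 c1 n w.
have vb (x : E) : exists k, forall w, v (ev w x) <= (q ^+ k)^-1 := cev_bounded us x.
have L_aG g w' : Zpd v g -> ev (aG g w') L = ev w' L - g 0 l.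
  move=> hg; rewrite !LE (sen_prim_gact w01 c0 c1 (ltn_ord l) w' (zvec_gG hg)) /= mul0r addr0.
  by congr (_ - _); move: l; apply: ord2P.
have L_aT x w' : Defs.Zp v x -> ev (aT x w') L = ev w' L + x * ev w' (emb b0).
  move=> hx; rewrite !LE b0E (sen_prim_gact w01 c0 c1 (ltn_ord l) w' (zvec_gT hx)) /=.
  by congr (_ + _); rewrite [_`_l](_ : _ = 0) ?subr0 //; move: l; apply: ord2P.
have hd : decompletion zeta (urep l) 0 (umod emb L : set 'cV[E]_2).
  split.
  - by move=> u hu g hg; exact: (umod_sec vD vM vI vC vG emb_aG L_aG hu hg).
  - exact: (umod0 vD vM v0 vI vE0 L).
  - by move=> a u u'; exact: (umod_lin vD vM vI vE a).
  - by move=> x u hx hu; exact: (umod_stable vD vM vI vT vE vE0 ev_embc emb_aT gact_gT0 L_aT hx hu).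
  - have [k [g [f hgf]]] := umod_tensor vD vB vM vI vC vG vE ev_embc L_aG fixed_Ator (@emb_inj K w0 c w01 c1 0).
    by exists k, g, f; exact: hgf.
  - move=> u hu.
    exact: (umod_la vD vB vM v0 vI vb vC vG vT vN ev_embc emb_aT gact_gT0 L_aG L_aT la_emb hu).
have hh : is_higgs zeta (umod emb L : set 'cV[E]_2) (emb b0 *: delta_mx 0 1).
  move=> u hu; exact: (umod_deriv vD vB vM v0 vI vC vT vN vE vE0 ev_embc emb_aT gact_gT0 L_aT hu).
have e := gs_higgs hth (urep_la v p l) (urep_drho v p l) (finite_etale_id A) hd hh.
have k0 : cst 0 = 0 by apply: vI => w'; rewrite vC v0.
have k1 : cst 1 = 1 by apply: vI => w'; rewrite vC; exact: (esym (ev_monoid w01 c1 w').1).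
have := uder_coef k0 k1 e => e2; rewrite -b0E e2.
exact/esym/(ev_cbc w01 c1).
Qed.
End SenMap.

Section Conclusion.
Variable K : cpdata.
Local Notation C := (cpC K).
Local Notation v := (cpv K).
Local Notation zeta := (cpz K).
Local Notation p_pr := (cpp_pr K).
Local Notation A := (tate v).
Variables w0 c : C.
Hypotheses (w01 : v w0 < 1) (c0 : c != 0) (c1 : v c < 1).
Local Notation T1 := (kumT w0 2).
Local Notation T2 := (kumT w0 3).
Local Notation T := (kumT c 1).

(** The geometric point is C itself with some choice of roots above t = 0; both components of theta
    vanish there, so 1 is not attained. *)
Lemma sen_map_not_surj (theta : 'rV[OX p_pr T1 T2 T]_2) :
  geometric_sen_map zeta theta -> ~ surjective_at theta 0.
Proof.
move=> hth hs; have us := units_s w01 c1.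
have z0 : v (0 : C) <= 1 by rewrite av0 ler01.
have [w wz] := pt_ex [:: T1; T2; T] z0.
pose y0 : OX p_pr T1 T2 T -> C := @cev K [:: T1; T2; T] w.
pose y : {rmorphism OX p_pr T1 T2 T -> C} := HB.pack y0
  (GRing.isZmodMorphism.Build _ _ y0 (cev_zmod us w)) (GRing.isMonoidMorphism.Build _ _ y0 (cev_monoid us w)).
have yE x : y x = ev w x by [].
have gp : geometric_point 0 v y.
  split.
  - by have [_ h _] := cphC K.
  - by move=> a; rewrite yE ev_cst.
  - by move=> x /(cplusP us) h; exact: h.
  - have e0 : ev w (OUcst p_pr T1 T2 T idfun 0) = 0 := ev_cst w01 c1 0 w.
    exact: etrans (etrans (cev_cst us (tvar v) w) (etrans (tev_var (pz_le1 w)) wz)) (esym e0).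
have [l hl] := hs C v y gp 1.
have h0 (i : 'I_2) : y (theta 0 i) = 0.
  by rewrite yE (sen_map_value w01 c0 c1 i hth) /sen_b wz mulr0 exprS !mul0r mulr0 mul0r.
move: hl; rewrite big1 => [/eqP|i _]; last by rewrite h0 mulr0.
by rewrite eq_sym oner_eq0.
Qed.
End Conclusion.

(* T1 = 1 + varpi u and T2 = 1 + varpi u' are the coordinates
   of T^2 on Y, pulled back to X = Spa C_p<t> along u |-> t^2, u' |-> t^3, and
   t |-> 1 + c t identifies X with the rational subset |T - 1| <= |c| of T^1. *)
Theorem theorem3p9 (R : realType) (p : nat) (p_pr : prime p)
    (C : closedFieldType) (v : absval R C) (hC : is_Cp p v)
    (zeta : nat -> C)
    (zeta_prim : forall n, (p ^ n).-primitive_root (zeta n))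
    (zeta_compat : forall n, zeta n.+1 ^+ p = zeta n)
    (varpi : C) (varpi_gt0 : 0 < v varpi) (varpi_lt1 : v varpi < 1) :
  let t := tvar v in
  let T1 := 1 + tconst v varpi * t ^+ 2 in
  let T2 := 1 + tconst v varpi * t ^+ 3 in
  [/\ profinite_etale_torsor p_pr zeta T1 T2,
      affinoid_perfectoid p_pr T1 T2 &
      forall c : C, 0 < v c -> v c < 1 ->
      forall theta : 'rV[OX p_pr T1 T2 (1 + tconst v c * t)]_2,
        geometric_sen_map zeta theta -> ~ surjective_at theta 0].
Proof.
move=> t T1 T2; pose K := CpData p_pr hC zeta_prim zeta_compat.
have w0 : varpi != 0 by rewrite -(av_gt0 v).
split.
- have [b1 h1] := @kumT_inv K varpi varpi_lt1 2 isT.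
  have [b2 h2] := @kumT_inv K varpi varpi_lt1 3 isT.
  apply: (@kummer_torsor K T1 T2 b1 b2 h1 h2).
  apply: (@units_kumT K varpi varpi_lt1 2 _ [:: T2]) => //.
  exact: (@units_kumT K varpi varpi_lt1 3 [::] [::]).
- exact: (@cusp_perfectoid K varpi w0 varpi_lt1).
- move=> c c0 c1 theta; apply: (@sen_map_not_surj K varpi c) => //.
  by rewrite -(av_gt0 v).
Qed.
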